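(* Let $\omega_1,\omega_2$ be nonzero real numbers, which may be equal. Consider the holomorphic system $$\dot x=i\omega_1x+y+f,\quad \dot y=i\omega_1y+g,\quad \dot z=i\omega_2z+h,$$ where $f,g,h$ are holomorphic near $0\in\mathbb{C}^3$ and vanish to order at least $2$. Then: 1) The system has no $y$-invariant holomorphic center manifold at the origin. 2) If $\omega_2/\omega_1\notin\mathbb{N}$, it has a unique $x$-invariant holomorphic center manifold at the origin, containing an isochronous center family of period $2\pi/|\omega_1|$. 3) If $\omega_1/\omega_2\notin\mathbb{N}$, it has a unique $z$-invariant holomorphic center manifold at the origin, containing an isochronous center family of period $2\pi/|\omega_2|$. 4) If $\omega_1=\omega_2$, it has a unique $(x,z)$-invariant holomorphic center manifold at the origin, containing an isochronous center family of period $2\pi/|\omega_1|$. 5) Suppose $\omega_2/\omega_1=k\in\mathbb{N}\setminus\{1\}$. Apply $k-2$ reduction steps to the Briot–Bouquet system in the $x$-direction, and let $\bar r_x$ be the second component of the resulting constant vector. If $\bar r_x=0$, there are infinitely many $x$-invariant holomorphic center manifolds at the origin, each containing an isochronous center family of period $2\pi/|\omega_1|$. If $\bar r_x\neq0$, there is none. 6) Suppose $\omega_1/\omega_2=k\in\mathbb{N}\setminus\{1\}$. Apply $k-2$ reduction steps to the Briot–Bouquet system in the $z$-direction, and let $\bar r_z$ be the second component of the resulting constant vector. If $\bar r_z=0$, there are infinitely many $z$-invariant holomorphic center manifolds at the origin, each containing an isochronous center family of period $2\pi/|\omega_2|$. If $\bar r_z\neq0$, there is none.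
   Context: A (two-dimensional) Briot–Bouquet system is a system $x\,w'(x)=x\,a+Mw+F(x,w)$ for $w=(u,v)$. Here $a\in\mathbb{C}^2$ is called its constant vector, $M$ is a complex $2\times2$ matrix called its linear matrix, and $F$ is holomorphic near $0\in\mathbb{C}^3$ with $F(0)=0$ and $DF(0)=0$. Reduction step: take such a system and a vector $c\in\mathbb{C}^2$ with $(I-M)c=a$. The substitution $w=x(\tilde w+c)$ transforms the system into the Briot–Bouquet system $x\tilde w'=x\tilde a+(M-I)\tilde w+\tilde F(x,\tilde w)$. Here $\tilde a=F_2(1,c)$, where $F_2$ is the homogeneous quadratic part of $F$, and $\tilde F(x,\tilde w)=x^{-1}F(x,x(\tilde w+c))-x\tilde a$. If $1$ is not an eigenvalue of $M$, then $c=(I-M)^{-1}a$ is unique and this is called the reduction step. ''Applying $k$ reduction steps'' means iterating it $k$ times; zero steps leaves the system unchanged. For a system $\dot x=P$, $\dot y=Q$, $\dot z=R$: - The Briot–Bouquet system in the $x$-direction is $x u'=\frac{Q(x,xu,xv)}{P(x,xu,xv)}-u$, $x v'=\frac{R(x,xu,xv)}{P(x,xu,xv)}-v$, with $u=y/x$, $v=z/x$. - The Briot–Bouquet system in the $z$-direction is $z u'=\frac{P(zu,zv,z)}{R(zu,zv,z)}-u$, $z v'=\frac{Q(zu,zv,z)}{R(zu,zv,z)}-v$, with $u=x/z$, $v=y/z$. Their right-hand sides are holomorphic near the origin and vanish there. An $x$-invariant (resp. $y$-, $z$-invariant) holomorphic center manifold at the origin is a germ at $0$ of a one-dimensional complex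 submanifold of $\mathbb{C}^3$ through $0$ that is invariant under the system and tangent at $0$ to the $x$-axis (resp. $y$-, $z$-axis). An $(x,z)$-invariant one is such a germ of a two-dimensional complex invariant submanifold tangent at $0$ to the $(x,z)$-plane. Such a manifold $S$ contains an isochronous center family of period $T$ if every real-time trajectory of the system starting at a point of $S\setminus\{0\}$ sufficiently close to $0$ is periodic of period $T$. $\mathbb{N}=\{1,2,3,\dots\}$. *)

(* Defs.v *)
From Stdlib Require Import Reals Lra ClassicalEpsilon.
Open Scope R_scope.

Record Cplx := mkC { Re : R; Im : R }.
Definition C0 : Cplx := mkC 0 0.
Definition C1 : Cplx := mkC 1 0.
Definition Ci : Cplx := mkC 0 1.
Definition RtoC (r : R) : Cplx := mkC r 0.
Definition Cadd (z w : Cplx) : Cplx := mkC (Re z + Re w) (Im z + Im w).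
Definition Copp (z : Cplx) : Cplx := mkC (- Re z) (- Im z).
Definition Csub (z w : Cplx) : Cplx := Cadd z (Copp w).
Definition Cmul (z w : Cplx) : Cplx :=
  mkC (Re z * Re w - Im z * Im w) (Re z * Im w + Im z * Re w).
(* multiplicative inverse (the value at 0 is irrelevant) *)
Definition Cinv (z : Cplx) : Cplx :=
  mkC (Re z / (Re z ^ 2 + Im z ^ 2)) (- Im z / (Re z ^ 2 + Im z ^ 2)).
Definition Cdiv (z w : Cplx) : Cplx := Cmul z (Cinv w).
Definition Cnorm (z : Cplx) : R := sqrt (Re z ^ 2 + Im z ^ 2).

(* Cplx^3 (points (x,y,z), or (x,u,v) for Briot--Bouquet systems)         *)
Record C3 := mk3 { p0 : Cplx; p1 : Cplx; p2 : Cplx }.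
Definition comp (i : nat) (p : C3) : Cplx :=
  match i with 0%nat => p0 p | 1%nat => p1 p | _ => p2 p end.
Definition O3 : C3 := mk3 C0 C0 C0.
Definition add3 (p q : C3) : C3 := mk3 (Cadd (p0 p) (p0 q)) (Cadd (p1 p) (p1 q)) (Cadd (p2 p) (p2 q)).
Definition sub3 (p q : C3) : C3 := mk3 (Csub (p0 p) (p0 q)) (Csub (p1 p) (p1 q)) (Csub (p2 p) (p2 q)).
Definition scal3 (a : Cplx) (p : C3) : C3 := mk3 (Cmul a (p0 p)) (Cmul a (p1 p)) (Cmul a (p2 p)).
Definition e3 (i : nat) : C3 :=
  match i with 0%nat => mk3 C1 C0 C0 | 1%nat => mk3 C0 C1 C0 | _ => mk3 C0 C0 C1 end.
Definition n3 (p : C3) : R :=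
  sqrt (Re (p0 p) ^ 2 + Im (p0 p) ^ 2 + Re (p1 p) ^ 2 + Im (p1 p) ^ 2
        + Re (p2 p) ^ 2 + Im (p2 p) ^ 2).

Definition ccont (f : C3 -> Cplx) (p : C3) : Prop :=
  forall eps, 0 < eps -> exists d, 0 < d /\
    forall q, n3 (sub3 q p) < d -> Cnorm (Csub (f q) (f p)) < eps.

Definition has_pd (i : nat) (f : C3 -> Cplx) (p : C3) (L : Cplx) : Prop :=
  forall eps, 0 < eps -> exists d, 0 < d /\
    forall h : Cplx, Cnorm h < d ->
      Cnorm (Csub (Csub (f (add3 p (scal3 h (e3 i)))) (f p)) (Cmul L h))
        <= eps * Cnorm h.

(* the partial derivative (chosen; it is unique whenever it exists) *)
Definition pd (i : nat) (f : C3 -> Cplx) (p : C3) : Cplx :=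
  epsilon (inhabits C0) (fun L => has_pd i f p L).

(* f is holomorphic on the ball of radius r about 0:
   continuous with complex partial derivatives (Osgood's definition) *)
Definition holo_ball (r : R) (f : C3 -> Cplx) : Prop :=
  forall p, n3 p < r ->
    ccont f p /\ forall i, (i < 3)%nat -> exists L, has_pd i f p L.

Definition holo_near0 (f : C3 -> Cplx) : Prop := exists r, 0 < r /\ holo_ball r f.

Definition order_ge2 (f : C3 -> Cplx) : Prop :=
  f O3 = C0 /\ forall i, (i < 3)%nat -> pd i f O3 = C0.

Definition is_sol (X : C3 -> C3) (a b : R) (phi : R -> C3) : Prop :=
  forall t, a < t < b -> forall i, (i < 3)%nat ->
    derivable_pt_lim (fun s => Re (comp i (phi s))) t (Re (comp i (X (phi t)))) /\
    derivable_pt_lim (fun s => Im (comp i (phi s))) t (Im (comp i (X (phi t)))).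

Definition is_global_sol (X : C3 -> C3) (phi : R -> C3) : Prop :=
  forall t, forall i, (i < 3)%nat ->
    derivable_pt_lim (fun s => Re (comp i (phi s))) t (Re (comp i (X (phi t)))) /\
    derivable_pt_lim (fun s => Im (comp i (phi s))) t (Im (comp i (X (phi t)))).

(* Germs of complex submanifolds at 0 (represented by sets S)          *)
Definition germ_eq (S1 S2 : C3 -> Prop) : Prop :=
  exists r, 0 < r /\ forall q, n3 q < r -> (S1 q <-> S2 q).

Definition d0 (phi : C3 -> Cplx) (v : C3) : Cplx :=
  Cadd (Cmul (pd 0 phi O3) (p0 v))
       (Cadd (Cmul (pd 1 phi O3) (p1 v)) (Cmul (pd 2 phi O3) (p2 v))).

Definition submfd1_tangent (t : nat) (S : C3 -> Prop) : Prop :=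
  exists r phi1 phi2, 0 < r /\ holo_ball r phi1 /\ holo_ball r phi2 /\
    phi1 O3 = C0 /\ phi2 O3 = C0 /\
    (* rank of the 2x3 Jacobian at 0 is 2: some 2x2 minor is nonzero *)
    (exists j k, (j < 3)%nat /\ (k < 3)%nat /\
       Csub (Cmul (pd j phi1 O3) (pd k phi2 O3)) (Cmul (pd k phi1 O3) (pd j phi2 O3)) <> C0) /\
    (forall v, (d0 phi1 v = C0 /\ d0 phi2 v = C0) <-> exists lam, v = scal3 lam (e3 t)) /\
    (forall q, n3 q < r -> (S q <-> phi1 q = C0 /\ phi2 q = C0)).

Definition submfd2_xz (S : C3 -> Prop) : Prop :=
  exists r phi, 0 < r /\ holo_ball r phi /\ phi O3 = C0 /\
    (exists j, (j < 3)%nat /\ pd j phi O3 <> C0) /\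
    (forall v, d0 phi v = C0 <->
       exists lam mu, v = add3 (scal3 lam (e3 0)) (scal3 mu (e3 2))) /\
    (forall q, n3 q < r -> (S q <-> phi q = C0)).

Definition invariant (X : C3 -> C3) (S : C3 -> Prop) : Prop :=
  exists r, 0 < r /\ forall q, n3 q < r -> S q ->
    forall eps phi, 0 < eps -> is_sol X (- eps) eps phi -> phi 0 = q ->
      exists eps', 0 < eps' /\ forall t, - eps' < t < eps' -> S (phi t).

Definition isochronous (X : C3 -> C3) (S : C3 -> Prop) (T : R) : Prop :=
  exists delta, 0 < delta /\ forall q, S q -> 0 < n3 q < delta ->
    (exists phi, is_global_sol X phi /\ phi 0 = q) /\
    (forall phi, is_global_sol X phi -> phi 0 = q ->
       (forall t, phi (t + T) = phi t) /\ (forall t, 0 < t < T -> phi t <> q)).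

Definition cm_axis (t : nat) (X : C3 -> C3) (S : C3 -> Prop) : Prop :=
  submfd1_tangent t S /\ invariant X S.
Definition cm_xz (X : C3 -> C3) (S : C3 -> Prop) : Prop :=
  submfd2_xz S /\ invariant X S.

(* Briot--Bouquet systems  x w' = x a + M w + F(x,w),  points (x,u,v)   *)
Record BB := mkBB {
  bb_a1 : Cplx; bb_a2 : Cplx;
  bb_m11 : Cplx; bb_m12 : Cplx; bb_m21 : Cplx; bb_m22 : Cplx;
  bb_F1 : C3 -> Cplx; bb_F2 : C3 -> Cplx
}.

Definition clim0 (H : Cplx -> Cplx) (L : Cplx) : Prop :=
  forall eps, 0 < eps -> exists d, 0 < d /\
    forall s, 0 < Cnorm s < d -> Cnorm (Csub (H s) L) < eps.

(* holomorphic extension across {x = 0} (removable singularity) *)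
Definition remov (H : C3 -> Cplx) (p : C3) : Cplx :=
  if excluded_middle_informative (p0 p = C0)
  then epsilon (inhabits C0) (fun L => clim0 (fun s => H (mk3 s (p1 p) (p2 p))) L)
  else H p.

Definition quad (F : C3 -> Cplx) (v : C3) : Cplx :=
  Cmul (RtoC (1/2))
   (Cadd (Cadd
     (Cadd (Cmul (pd 0 (pd 0 F) O3) (Cmul (p0 v) (p0 v)))
      (Cadd (Cmul (pd 0 (pd 1 F) O3) (Cmul (p0 v) (p1 v)))
            (Cmul (pd 0 (pd 2 F) O3) (Cmul (p0 v) (p2 v)))))
     (Cadd (Cmul (pd 1 (pd 0 F) O3) (Cmul (p1 v) (p0 v)))
      (Cadd (Cmul (pd 1 (pd 1 F) O3) (Cmul (p1 v) (p1 v)))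
            (Cmul (pd 1 (pd 2 F) O3) (Cmul (p1 v) (p2 v))))))
     (Cadd (Cmul (pd 2 (pd 0 F) O3) (Cmul (p2 v) (p0 v)))
      (Cadd (Cmul (pd 2 (pd 1 F) O3) (Cmul (p2 v) (p1 v)))
            (Cmul (pd 2 (pd 2 F) O3) (Cmul (p2 v) (p2 v)))))).

(* the reduction step, with c = (I - M)^{-1} a (Cramer's rule) *)
Definition reduce (s : BB) : BB :=
  let det := Csub (Cmul (Csub C1 (bb_m11 s)) (Csub C1 (bb_m22 s)))
                  (Cmul (bb_m12 s) (bb_m21 s)) in
  let c1 := Cdiv (Cadd (Cmul (Csub C1 (bb_m22 s)) (bb_a1 s)) (Cmul (bb_m12 s) (bb_a2 s))) det in
  let c2 := Cdiv (Cadd (Cmul (bb_m21 s) (bb_a1 s)) (Cmul (Csub C1 (bb_m11 s)) (bb_a2 s))) det in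
  let v1 := mk3 C1 c1 c2 in
  let at1 := quad (bb_F1 s) v1 in
  let at2 := quad (bb_F2 s) v1 in
  let sub (p : C3) : C3 :=
      mk3 (p0 p) (Cmul (p0 p) (Cadd (p1 p) c1)) (Cmul (p0 p) (Cadd (p2 p) c2)) in
  mkBB at1 at2
       (Csub (bb_m11 s) C1) (bb_m12 s) (bb_m21 s) (Csub (bb_m22 s) C1)
       (remov (fun p => Csub (Cdiv (bb_F1 s (sub p)) (p0 p)) (Cmul (p0 p) at1)))
       (remov (fun p => Csub (Cdiv (bb_F2 s (sub p)) (p0 p)) (Cmul (p0 p) at2))).

(* decomposition of a right-hand side G = (G1,G2), G(0) = 0, as x a + M w + F *)
Definition bb_of_rhs (G1 G2 : C3 -> Cplx) : BB :=
  let a1 := pd 0 G1 O3 in let a2 := pd 0 G2 O3 in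
  let m11 := pd 1 G1 O3 in let m12 := pd 2 G1 O3 in
  let m21 := pd 1 G2 O3 in let m22 := pd 2 G2 O3 in
  mkBB a1 a2 m11 m12 m21 m22
    (fun p => Csub (G1 p) (Cadd (Cmul (p0 p) a1) (Cadd (Cmul m11 (p1 p)) (Cmul m12 (p2 p)))))
    (fun p => Csub (G2 p) (Cadd (Cmul (p0 p) a2) (Cadd (Cmul m21 (p1 p)) (Cmul m22 (p2 p))))).

(* Briot--Bouquet system in the x-direction of  x' = P, y' = Q, z' = R ;
   p = (x,u,v), u = y/x, v = z/x *)
Definition bb_x (P Q Rf : C3 -> Cplx) : BB :=
  let blow (p : C3) := mk3 (p0 p) (Cmul (p0 p) (p1 p)) (Cmul (p0 p) (p2 p)) in
  bb_of_rhs
    (remov (fun p => Csub (Cdiv (Q (blow p)) (P (blow p))) (p1 p)))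
    (remov (fun p => Csub (Cdiv (Rf (blow p)) (P (blow p))) (p2 p))).

(* Briot--Bouquet system in the z-direction; p = (z,u,v), u = x/z, v = y/z *)
Definition bb_z (P Q Rf : C3 -> Cplx) : BB :=
  let blow (p : C3) := mk3 (Cmul (p0 p) (p1 p)) (Cmul (p0 p) (p2 p)) (p0 p) in
  bb_of_rhs
    (remov (fun p => Csub (Cdiv (P (blow p)) (Rf (blow p))) (p1 p)))
    (remov (fun p => Csub (Cdiv (Q (blow p)) (Rf (blow p))) (p2 p))).

Definition Psys (w1 : R) (f : C3 -> Cplx) (p : C3) : Cplx :=
  Cadd (Cadd (Cmul (Cmul Ci (RtoC w1)) (p0 p)) (p1 p)) (f p).
Definition Qsys (w1 : R) (g : C3 -> Cplx) (p : C3) : Cplx :=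
  Cadd (Cmul (Cmul Ci (RtoC w1)) (p1 p)) (g p).
Definition Rsys (w2 : R) (h : C3 -> Cplx) (p : C3) : Cplx :=
  Cadd (Cmul (Cmul Ci (RtoC w2)) (p2 p)) (h p).
Definition Xsys (w1 w2 : R) (f g h : C3 -> Cplx) (p : C3) : C3 :=
  mk3 (Psys w1 f p) (Qsys w1 g p) (Rsys w2 h p).

Definition ratio_in_N (a b : R) : Prop := exists n : nat, (1 <= n)%nat /\ a = INR n * b.

Definition infinitely_many (Pr : (C3 -> Prop) -> Prop) : Prop :=
  exists Sf : nat -> (C3 -> Prop),
    (forall n, Pr (Sf n)) /\ (forall m n, m <> n -> ~ germ_eq (Sf m) (Sf n)).

(* Main.v *)
(** A center manifold tangent to the [x]-axis is a graph [y = x u(x)], [z = x v(x)], and its invariance says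
    exactly that [(u,v)] solves the Briot-Bouquet system in the [x]-direction.  A reduction step matches the
    solutions with those of the reduced system and lowers the linear matrix by the identity.  Without resonance one
    can thus pass to [M - N I] with [N] large, where [x w' + N w = ...] is a contraction after integration along
    rays, so that the solution exists and is unique.  At a resonance the last step before the eigenvalue is crossed
    has either no admissible first-order coefficient [c] or infinitely many, according to the second component of
    the constant vector, and each [c] leads to a nonresonant system.

    Periods come from solving [i w E Gam = X o Gam], with [E] the Euler operator and [Gam] tangent to [(x,0,z)]:
    it maps the orbits [exp(i w t) p] to orbits of [X].  On an invariant curve this linearises the scalar equation
    [x' = P(c(x))].  When [w1 = w2] the image of [Gam] is itself the [(x,z)]-manifold; conversely the restriction of
    [X] to any [(x,z)]-manifold yields another such [Gam], and [Gam] is unique.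

    The [z]-direction is the [x]-direction after a cyclic permutation of the coordinates.  A manifold tangent to
    the [y]-axis is excluded by comparing first-order terms: the [y] in the first equation is not tangential. *)

From Coquelicot Require Import Rcomplements Hierarchy Continuity Derive RInt RInt_analysis AutoDerive.
From Stdlib Require Import Reals Lra Lia ClassicalEpsilon FunctionalExtensionality Classical.
Require Import Defs.
Open Scope R_scope.

(** No power series occurs. Osgood's definition gives control of slices only, so the estimates are
    drawn from circle means of difference quotients, and new functions are shown holomorphic through
    a Cauchy condition on their quotients that survives integration and pointwise limits.

    One operator then solves all the equations: K g(p), the integral over [0,1] of t^(e-m) g(tp),
    inverts E + (e+1-m) on functions that are O(|p|^m), with norm at most 6/(e+1). For e = m = 0 it
    yields local solutions of differential equations, for m = 0 and e large the nonresonant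
    Briot-Bouquet systems. Linearisation leads to E - 1, which kills linear functions; there e = 0
    and m = 2, the linear part of Gam being prescribed. As e is then fixed, smallness must come from
    elsewhere: quadratic terms are small on small balls, and the nilpotent entry is shrunk by
    rescaling y.

    In the z-direction the resonant matrix is a Jordan block. Its nonzero off-diagonal entry makes
    the first equation for c solvable whatever its constant term, and leaves the first component of
    c free. *)

Notation "x +c y" := (Cadd x y) (at level 50, left associativity).
Notation "x -c y" := (Csub x y) (at level 50, left associativity).
Notation "x *c y" := (Cmul x y) (at level 40, left associativity).
Notation "x /c y" := (Cdiv x y) (at level 40, left associativity).
Notation "p +v q" := (add3 p q) (at level 50, left associativity).
Notation "p -v q" := (sub3 p q) (at level 50, left associativity).
Notation "a *v p" := (scal3 a p) (at level 40, left associativity).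

(** * Complex numbers: field structure and modulus *)

Lemma Cplx_eq (z w : Cplx) : Re z = Re w -> Im z = Im w -> z = w.
Proof. destruct z, w; simpl; intros -> ->; reflexivity. Qed.

Lemma Cplx_norm2_neq0 (z : Cplx) : z <> C0 -> Re z ^ 2 + Im z ^ 2 <> 0.
Proof.
  intros Hz H; apply Hz; apply Cplx_eq; simpl; nra.
Qed.

Lemma Cplx_field_theory : field_theory C0 C1 Cadd Cmul Csub Copp Cdiv Cinv eq.
Proof.
  constructor.
  - constructor; intros; apply Cplx_eq; unfold Csub; simpl; ring.
  - intros H; injection H; lra.
  - intros; reflexivity.
  - intros z Hz; pose proof (Cplx_norm2_neq0 z Hz).
    apply Cplx_eq; simpl; field; intros E; apply H; simpl; lra.
Qed.
Add Field Cplx_field : Cplx_field_theory.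

Lemma C1_neq_C0 : C1 <> C0.
Proof. intros H; injection H; lra. Qed.

Lemma Cnorm_ge0 (z : Cplx) : 0 <= Cnorm z.
Proof. apply sqrt_pos. Qed.

Lemma Cnorm_sqr (z : Cplx) : Cnorm z ^ 2 = Re z ^ 2 + Im z ^ 2.
Proof. unfold Cnorm; rewrite pow2_sqrt; [reflexivity|nra]. Qed.

Lemma Cnorm_C0 : Cnorm C0 = 0.
Proof. unfold Cnorm; simpl; replace (0 * (0 * 1) + 0 * (0 * 1)) with 0 by ring; apply sqrt_0. Qed.

Lemma Cnorm_eq0 (z : Cplx) : Cnorm z = 0 -> z = C0.
Proof.
  intros H; pose proof (Cnorm_sqr z) as H1; rewrite H in H1.
  apply Cplx_eq; simpl; nra.
Qed.

Lemma Cnorm_gt0 (z : Cplx) : z <> C0 -> 0 < Cnorm z.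
Proof.
  intros Hz; destruct (Cnorm_ge0 z) as [H|H]; auto.
  exfalso; apply Hz, Cnorm_eq0; auto.
Qed.

Lemma Cnorm_neq0 (z : Cplx) : 0 < Cnorm z -> z <> C0.
Proof. intros H ->; rewrite Cnorm_C0 in H; lra. Qed.

Lemma Cnorm_mul (z w : Cplx) : Cnorm (z *c w) = Cnorm z * Cnorm w.
Proof.
  unfold Cnorm; rewrite <- sqrt_mult by nra; f_equal; simpl; ring.
Qed.

Lemma Cnorm_le (z : Cplx) (a : R) : 0 <= a -> Re z ^ 2 + Im z ^ 2 <= a ^ 2 -> Cnorm z <= a.
Proof.
  intros Ha H; unfold Cnorm; rewrite <- (sqrt_pow2 a Ha); apply sqrt_le_1_alt; exact H.
Qed.

Lemma Re_le_Cnorm (z : Cplx) : Rabs (Re z) <= Cnorm z.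
Proof. unfold Cnorm; rewrite <- (sqrt_Rsqr_abs (Re z)); apply sqrt_le_1_alt; unfold Rsqr; nra. Qed.

Lemma Im_le_Cnorm (z : Cplx) : Rabs (Im z) <= Cnorm z.
Proof. unfold Cnorm; rewrite <- (sqrt_Rsqr_abs (Im z)); apply sqrt_le_1_alt; unfold Rsqr; nra. Qed.

Lemma Cnorm_le_Re_Im (z : Cplx) : Cnorm z <= Rabs (Re z) + Rabs (Im z).
Proof.
  pose proof (Rabs_pos (Re z)); pose proof (Rabs_pos (Im z)).
  apply Cnorm_le; [lra|].
  rewrite <- (pow2_abs (Re z)), <- (pow2_abs (Im z)); nra.
Qed.

Lemma Cnorm_add (z w : Cplx) : Cnorm (z +c w) <= Cnorm z + Cnorm w.
Proof.
  pose proof (Cnorm_ge0 z); pose proof (Cnorm_ge0 w).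
  pose proof (Cnorm_sqr z); pose proof (Cnorm_sqr w).
  apply Cnorm_le; [lra|]; simpl Re; simpl Im.
  (* Cauchy-Schwarz: the squares of the two sides differ by [(Re z * Im w - Im z * Re w) ^ 2]. *)
  assert (Re z * Re w + Im z * Im w <= Cnorm z * Cnorm w).
  { apply Rsqr_incr_0_var; [|nra]; unfold Rsqr.
    replace (Cnorm z * Cnorm w * (Cnorm z * Cnorm w)) with (Cnorm z ^ 2 * Cnorm w ^ 2) by ring.
    rewrite H1, H2. pose proof (pow2_ge_0 (Re z * Im w - Im z * Re w)). nra. }
  nra.
Qed.

Lemma Cnorm_opp (z : Cplx) : Cnorm (Copp z) = Cnorm z.
Proof. unfold Cnorm; simpl; f_equal; ring. Qed.

Lemma Cnorm_sub (z w : Cplx) : Cnorm (z -c w) <= Cnorm z + Cnorm w.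
Proof. unfold Csub; rewrite <- (Cnorm_opp w); apply Cnorm_add. Qed.

Lemma Cnorm_sub_sym (z w : Cplx) : Cnorm (z -c w) = Cnorm (w -c z).
Proof. rewrite <- Cnorm_opp; f_equal; ring. Qed.

Lemma Cnorm_sub_tri (a b c : Cplx) : Cnorm (a -c c) <= Cnorm (a -c b) + Cnorm (b -c c).
Proof. replace (a -c c) with ((a -c b) +c (b -c c)) by ring; apply Cnorm_add. Qed.

Lemma Cnorm_le_sub (a b : Cplx) : Cnorm a <= Cnorm b + Cnorm (a -c b).
Proof. replace a with (b +c (a -c b)) at 1 by ring; apply Cnorm_add. Qed.

Lemma Cnorm_C1 : Cnorm C1 = 1.
Proof. unfold Cnorm; simpl; replace (1 * (1 * 1) + 0 * (0 * 1)) with 1 by ring; apply sqrt_1. Qed.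

Lemma Cnorm_RtoC (r : R) : Cnorm (RtoC r) = Rabs r.
Proof.
  unfold Cnorm; simpl; replace (r * (r * 1) + 0 * (0 * 1)) with (Rsqr r) by (unfold Rsqr; ring).
  apply sqrt_Rsqr_abs.
Qed.

Lemma Cnorm_Ci : Cnorm Ci = 1.
Proof. unfold Cnorm; simpl; replace (0 * (0 * 1) + 1 * (1 * 1)) with 1 by ring; apply sqrt_1. Qed.

Lemma Cnorm_inv (z : Cplx) : z <> C0 -> Cnorm (Cinv z) = / Cnorm z.
Proof.
  intros Hz; pose proof (Cnorm_gt0 z Hz).
  apply (Rmult_eq_reg_l (Cnorm z)); [|lra].
  rewrite Rinv_r, <- Cnorm_mul by lra.
  replace (z *c Cinv z) with C1 by (field; exact Hz); apply Cnorm_C1.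
Qed.

Lemma Cnorm_div (z w : Cplx) : w <> C0 -> Cnorm (z /c w) = Cnorm z / Cnorm w.
Proof. intros; unfold Cdiv; rewrite Cnorm_mul, Cnorm_inv; auto. Qed.

Lemma Cmul_integral (z w : Cplx) : z *c w = C0 -> z = C0 \/ w = C0.
Proof.
  intros H; destruct (excluded_middle_informative (z = C0)) as [|Hz]; [left; auto|right].
  replace w with ((z *c w) /c z) by (field; exact Hz); rewrite H; field; exact Hz.
Qed.

Lemma Cmul_neq0 (z w : Cplx) : z <> C0 -> w <> C0 -> z *c w <> C0.
Proof. intros Hz Hw H; destruct (Cmul_integral _ _ H); auto. Qed.

Lemma Csub_eq0 (z w : Cplx) : z -c w = C0 -> z = w.
Proof. intros H; replace z with ((z -c w) +c w) by ring; rewrite H; ring. Qed.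

Lemma RtoC_add (a b : R) : RtoC (a + b) = RtoC a +c RtoC b.
Proof. apply Cplx_eq; simpl; ring. Qed.
Lemma RtoC_sub (a b : R) : RtoC (a - b) = RtoC a -c RtoC b.
Proof. apply Cplx_eq; simpl; ring. Qed.
Lemma RtoC_mul (a b : R) : RtoC (a * b) = RtoC a *c RtoC b.
Proof. apply Cplx_eq; simpl; ring. Qed.
Lemma RtoC_inv (a : R) : a <> 0 -> RtoC (/ a) = Cinv (RtoC a).
Proof. intros; apply Cplx_eq; simpl; field; auto. Qed.
Lemma RtoC_neq0 (a : R) : a <> 0 -> RtoC a <> C0.
Proof. intros H E; apply H; injection E; auto. Qed.

(** * The Hermitian norm on [C3] *)

Lemma C3_eq (p q : C3) : p0 p = p0 q -> p1 p = p1 q -> p2 p = p2 q -> p = q.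
Proof. destruct p, q; simpl; intros -> -> ->; reflexivity. Qed.

Lemma n3_ge0 (p : C3) : 0 <= n3 p.
Proof. apply sqrt_pos. Qed.

Lemma n3_sqr (p : C3) : n3 p ^ 2 = Cnorm (p0 p) ^ 2 + Cnorm (p1 p) ^ 2 + Cnorm (p2 p) ^ 2.
Proof. rewrite !Cnorm_sqr; unfold n3; rewrite pow2_sqrt; [ring|nra]. Qed.

Lemma n3_le (p : C3) (a : R) :
  0 <= a -> Cnorm (p0 p) ^ 2 + Cnorm (p1 p) ^ 2 + Cnorm (p2 p) ^ 2 <= a ^ 2 -> n3 p <= a.
Proof. intros Ha H; rewrite <- n3_sqr in H; pose proof (n3_ge0 p); nra. Qed.

Lemma Cnorm_comp_le (i : nat) (p : C3) : Cnorm (comp i p) <= n3 p.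
Proof.
  pose proof (n3_sqr p); pose proof (n3_ge0 p).
  pose proof (Cnorm_ge0 (p0 p)); pose proof (Cnorm_ge0 (p1 p)); pose proof (Cnorm_ge0 (p2 p)).
  destruct i as [|[|i]]; simpl; nra.
Qed.

Lemma Cnorm_p0 (p : C3) : Cnorm (p0 p) <= n3 p.
Proof. exact (Cnorm_comp_le 0 p). Qed.
Lemma Cnorm_p1 (p : C3) : Cnorm (p1 p) <= n3 p.
Proof. exact (Cnorm_comp_le 1 p). Qed.
Lemma Cnorm_p2 (p : C3) : Cnorm (p2 p) <= n3 p.
Proof. exact (Cnorm_comp_le 2 p). Qed.

Lemma n3_le_sum (p : C3) : n3 p <= Cnorm (p0 p) + Cnorm (p1 p) + Cnorm (p2 p).
Proof.
  pose proof (Cnorm_ge0 (p0 p)); pose proof (Cnorm_ge0 (p1 p)); pose proof (Cnorm_ge0 (p2 p)).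
  apply n3_le; nra.
Qed.

Lemma n3_add (p q : C3) : n3 (p +v q) <= n3 p + n3 q.
Proof.
  pose proof (n3_sqr p); pose proof (n3_sqr q); pose proof (n3_ge0 p); pose proof (n3_ge0 q).
  apply n3_le; [lra|]; simpl p0; simpl p1; simpl p2.
  pose proof (Cnorm_add (p0 p) (p0 q)); pose proof (Cnorm_add (p1 p) (p1 q)); pose proof (Cnorm_add (p2 p) (p2 q)).
  pose proof (Cnorm_ge0 (p0 p +c p0 q)); pose proof (Cnorm_ge0 (p1 p +c p1 q)); pose proof (Cnorm_ge0 (p2 p +c p2 q)).
  set (a0 := Cnorm (p0 p)) in *; set (a1 := Cnorm (p1 p)) in *; set (a2 := Cnorm (p2 p)) in *.
  set (b0 := Cnorm (p0 q)) in *; set (b1 := Cnorm (p1 q)) in *; set (b2 := Cnorm (p2 q)) in *.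
  (* Cauchy-Schwarz by Lagrange's identity, whose three squares are handed to [nra]. *)
  assert (a0 * b0 + a1 * b1 + a2 * b2 <= n3 p * n3 q).
  { apply Rsqr_incr_0_var; [|nra]; unfold Rsqr.
    replace (n3 p * n3 q * (n3 p * n3 q)) with (n3 p ^ 2 * n3 q ^ 2) by ring.
    rewrite H, H0.
    pose proof (pow2_ge_0 (a0 * b1 - a1 * b0)); pose proof (pow2_ge_0 (a0 * b2 - a2 * b0));
    pose proof (pow2_ge_0 (a1 * b2 - a2 * b1)). nra. }
  assert (forall u s, 0 <= u -> u <= s -> u ^ 2 <= s ^ 2) as Hsq by (intros; nra).
  pose proof (Hsq _ _ H6 H3); pose proof (Hsq _ _ H7 H4); pose proof (Hsq _ _ H8 H5).
  nra.
Qed.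

Lemma n3_scal (a : Cplx) (p : C3) : n3 (a *v p) = Cnorm a * n3 p.
Proof.
  pose proof (Cnorm_ge0 a); pose proof (n3_ge0 p); pose proof (n3_ge0 (a *v p)).
  apply Rsqr_inj; [assumption|nra|]; unfold Rsqr.
  replace (n3 (a *v p) * n3 (a *v p)) with (n3 (a *v p) ^ 2) by ring.
  replace (Cnorm a * n3 p * (Cnorm a * n3 p)) with (Cnorm a ^ 2 * n3 p ^ 2) by ring.
  rewrite !n3_sqr; simpl p0; simpl p1; simpl p2; rewrite !Cnorm_mul; ring.
Qed.

Lemma n3_sub_sym (p q : C3) : n3 (p -v q) = n3 (q -v p).
Proof.
  replace (p -v q) with (Copp C1 *v (q -v p)) by (apply C3_eq; simpl; ring).
  rewrite n3_scal, Cnorm_opp, Cnorm_C1; ring.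
Qed.

Lemma n3_sub_tri (p q s : C3) : n3 (p -v s) <= n3 (p -v q) + n3 (q -v s).
Proof. replace (p -v s) with ((p -v q) +v (q -v s)) by (apply C3_eq; simpl; ring); apply n3_add. Qed.

Lemma n3_le_sub (p q : C3) : n3 p <= n3 q + n3 (p -v q).
Proof. replace p with (q +v (p -v q)) at 1 by (apply C3_eq; simpl; ring); apply n3_add. Qed.

Lemma n3_sub (p q : C3) : n3 (p -v q) <= n3 p + n3 q.
Proof.
  replace (p -v q) with (p +v (Copp C1 *v q)) by (apply C3_eq; simpl; ring).
  eapply Rle_trans; [apply n3_add|]; rewrite n3_scal, Cnorm_opp, Cnorm_C1; lra.
Qed.

Lemma n3_O3 : n3 O3 = 0.
Proof. apply Rle_antisym; [|apply n3_ge0]; apply n3_le; simpl; rewrite ?Cnorm_C0; lra. Qed.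

Lemma n3_eq0 (p : C3) : n3 p = 0 -> p = O3.
Proof.
  intros H; pose proof (Cnorm_p0 p); pose proof (Cnorm_p1 p); pose proof (Cnorm_p2 p).
  pose proof (Cnorm_ge0 (p0 p)); pose proof (Cnorm_ge0 (p1 p)); pose proof (Cnorm_ge0 (p2 p)).
  apply C3_eq; apply Cnorm_eq0; lra.
Qed.

Lemma n3_e3 (i : nat) : n3 (e3 i) = 1.
Proof.
  assert (n3 (e3 i) ^ 2 = 1) as H.
  { rewrite n3_sqr; destruct i as [|[|i]]; simpl p0; simpl p1; simpl p2;
    rewrite Cnorm_C0, Cnorm_C1; ring. }
  pose proof (n3_ge0 (e3 i)); nra.
Qed.

Lemma n3_scal_e3 (h : Cplx) (i : nat) : n3 (h *v e3 i) = Cnorm h.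
Proof. rewrite n3_scal, n3_e3; ring. Qed.

Lemma n3_axis0 (x : Cplx) : n3 (mk3 x C0 C0) = Cnorm x.
Proof.
  replace (mk3 x C0 C0) with (x *v e3 0) by (apply C3_eq; simpl; ring); apply n3_scal_e3.
Qed.

(** * Complex-valued functions of a real variable *)

Definition rder (g : R -> Cplx) (t : R) (v : Cplx) : Prop :=
  derivable_pt_lim (fun s => Re (g s)) t (Re v) /\ derivable_pt_lim (fun s => Im (g s)) t (Im v).

(** Multiplying by [h] admits [h = 0]; in a chain rule the inner increment may vanish. *)
Lemma derivable_pt_lim_eps (f : R -> R) (t v : R) :
  derivable_pt_lim f t v <->
  forall eps, 0 < eps -> exists d, 0 < d /\ forall h, Rabs h < d -> Rabs (f (t + h) - f t - v * h) <= eps * Rabs h.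
Proof.
  split.
  - intros H eps Heps; destruct (H eps Heps) as [[d Hd] H1]; exists d; split; auto.
    intros h Hh; destruct (Req_dec h 0) as [->|Hn].
    + rewrite Rplus_0_r; replace (f t - f t - v * 0) with 0 by ring; rewrite Rabs_R0; lra.
    + specialize (H1 h Hn Hh).
      replace (f (t + h) - f t - v * h) with (((f (t + h) - f t) / h - v) * h) by (field; auto).
      rewrite Rabs_mult; pose proof (Rabs_pos h); nra.
  - intros H eps Heps; destruct (H (eps / 2)) as [d [Hd H1]]; [lra|].
    exists (mkposreal d Hd); intros h Hn Hh; simpl in Hh; specialize (H1 h Hh).
    replace ((f (t + h) - f t) / h - v) with ((f (t + h) - f t - v * h) / h) by (field; auto).
    unfold Rdiv; rewrite Rabs_mult, Rabs_inv.
    pose proof (Rabs_pos_lt h Hn).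
    apply Rle_lt_trans with (eps / 2 * Rabs h * / Rabs h).
    + apply Rmult_le_compat_r; [left; apply Rinv_0_lt_compat|]; auto.
    + field_simplify; lra.
Qed.

Lemma rder_eps (g : R -> Cplx) (t : R) (v : Cplx) :
  rder g t v <->
  forall eps, 0 < eps -> exists d, 0 < d /\
    forall h, Rabs h < d -> Cnorm (g (t + h) -c g t -c v *c RtoC h) <= eps * Rabs h.
Proof.
  unfold rder; rewrite !derivable_pt_lim_eps; split.
  - intros [H1 H2] eps Heps.
    destruct (H1 (eps / 2)) as [d1 [Hd1 K1]]; [lra|].
    destruct (H2 (eps / 2)) as [d2 [Hd2 K2]]; [lra|].
    exists (Rmin d1 d2); split; [apply Rmin_glb_lt; auto|].
    intros h Hh; specialize (K1 h); specialize (K2 h).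
    pose proof (Rmin_l d1 d2); pose proof (Rmin_r d1 d2).
    eapply Rle_trans; [apply Cnorm_le_Re_Im|].
    simpl Re; simpl Im.
    match goal with |- Rabs ?a + Rabs ?b <= _ =>
      replace a with (Re (g (t + h)) - Re (g t) - Re v * h) by (simpl; ring);
      replace b with (Im (g (t + h)) - Im (g t) - Im v * h) by (simpl; ring) end.
    assert (Rabs h < d1) by lra; assert (Rabs h < d2) by lra. intuition lra.
  - intros H; split; intros eps Heps; destruct (H eps Heps) as [d [Hd K]]; exists d; split; auto;
    intros h Hh; eapply Rle_trans; [|apply (K h Hh)| |apply (K h Hh)].
    + eapply Rle_trans; [|apply Re_le_Cnorm]; apply Req_le; f_equal; simpl; ring.
    + eapply Rle_trans; [|apply Im_le_Cnorm]; apply Req_le; f_equal; simpl; ring.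
Qed.

Definition rcont (f : R -> Cplx) (t : R) : Prop :=
  continuous (fun s => Re (f s)) t /\ continuous (fun s => Im (f s)) t.

Lemma continuous_eps (f : R -> R) (t : R) :
  continuous f t <-> forall eps, 0 < eps -> exists d, 0 < d /\ forall s, Rabs (s - t) < d -> Rabs (f s - f t) < eps.
Proof.
  split.
  - intros H eps Heps.
    apply continuity_pt_filterlim in H.
    destruct (H eps Heps) as [d [Hd K]]; exists d; split; auto.
    intros s Hs; destruct (Req_dec s t) as [->|Hn].
    + replace (f t - f t) with 0 by ring; rewrite Rabs_R0; auto.
    + apply (K s); split; auto; split; [exact I|auto].
  - intros H; apply continuity_pt_filterlim; intros eps Heps.
    destruct (H eps Heps) as [d [Hd K]]; exists d; split; auto.
    intros s [_ Hs]; apply K; exact Hs.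
Qed.

Lemma rcont_eps (f : R -> Cplx) (t : R) :
  rcont f t <-> forall eps, 0 < eps -> exists d, 0 < d /\ forall s, Rabs (s - t) < d -> Cnorm (f s -c f t) < eps.
Proof.
  unfold rcont; rewrite !continuous_eps; split.
  - intros [H1 H2] eps Heps.
    destruct (H1 (eps / 2)) as [d1 [Hd1 K1]]; [lra|].
    destruct (H2 (eps / 2)) as [d2 [Hd2 K2]]; [lra|].
    exists (Rmin d1 d2); split; [apply Rmin_glb_lt; auto|].
    intros s Hs; specialize (K1 s); specialize (K2 s).
    pose proof (Rmin_l d1 d2); pose proof (Rmin_r d1 d2).
    eapply Rle_lt_trans; [apply Cnorm_le_Re_Im|]; simpl.
    unfold Rminus in *; intuition lra.
  - intros H; split; intros eps Heps; destruct (H eps Heps) as [d [Hd K]]; exists d; split; auto;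
    intros s Hs; specialize (K s Hs);
    [eapply Rle_lt_trans; [|exact K]; eapply Rle_trans; [|apply Re_le_Cnorm]
    |eapply Rle_lt_trans; [|exact K]; eapply Rle_trans; [|apply Im_le_Cnorm]];
    apply Req_le; f_equal; simpl; ring.
Qed.

Lemma rder_rcont (g : R -> Cplx) (t : R) (v : Cplx) : rder g t v -> rcont g t.
Proof.
  intros [H1 H2]; split; apply (ex_derive_continuous (V := R_NormedModule));
  [exists (Re v)|exists (Im v)]; apply is_derive_Reals; auto.
Qed.

Lemma rder_const (c : Cplx) (t : R) : rder (fun _ => c) t C0.
Proof. split; apply derivable_pt_lim_const. Qed.

Lemma rder_add (f g : R -> Cplx) (t : R) (u v : Cplx) :
  rder f t u -> rder g t v -> rder (fun s => f s +c g s) t (u +c v).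
Proof.
  intros [H1 H2] [H3 H4]; split; simpl;
  [exact (derivable_pt_lim_plus _ _ _ _ _ H1 H3)|exact (derivable_pt_lim_plus _ _ _ _ _ H2 H4)].
Qed.

Lemma rder_mul (f g : R -> Cplx) (t : R) (u v : Cplx) :
  rder f t u -> rder g t v -> rder (fun s => f s *c g s) t (u *c g t +c f t *c v).
Proof.
  intros [H1 H2] [H3 H4]; split; simpl.
  - pose proof (derivable_pt_lim_minus _ _ _ _ _ (derivable_pt_lim_mult _ _ _ _ _ H1 H3)
      (derivable_pt_lim_mult _ _ _ _ _ H2 H4)) as K.
    match goal with |- derivable_pt_lim _ _ ?a => replace a with
      (Re u * Re (g t) + Re (f t) * Re v - (Im u * Im (g t) + Im (f t) * Im v)) by ring end; exact K.
  - pose proof (derivable_pt_lim_plus _ _ _ _ _ (derivable_pt_lim_mult _ _ _ _ _ H1 H4)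
      (derivable_pt_lim_mult _ _ _ _ _ H2 H3)) as K.
    match goal with |- derivable_pt_lim _ _ ?a => replace a with
      (Re u * Im (g t) + Re (f t) * Im v + (Im u * Re (g t) + Im (f t) * Re v)) by ring end; exact K.
Qed.

Lemma rder_RtoC (f : R -> R) (t v : R) : derivable_pt_lim f t v -> rder (fun s => RtoC (f s)) t (RtoC v).
Proof. intros H; split; simpl; [exact H|apply derivable_pt_lim_const]. Qed.

Lemma rder_scal (f : R -> Cplx) (c : Cplx) (t : R) (u : Cplx) :
  rder f t u -> rder (fun s => c *c f s) t (c *c u).
Proof.
  intros H; pose proof (rder_mul _ _ _ _ _ (rder_const c t) H) as K.
  replace (c *c u) with (C0 *c f t +c c *c u) by ring; exact K.
Qed.

Lemma rder_ext_loc (f g : R -> Cplx) (t d : R) (u : Cplx) :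
  0 < d -> (forall s, Rabs (s - t) < d -> f s = g s) -> rder f t u -> rder g t u.
Proof.
  intros Hd E H; rewrite rder_eps in H |- *; intros eps Heps.
  destruct (H eps Heps) as [d' [Hd' K]]; exists (Rmin d d'); split; [apply Rmin_glb_lt; auto|].
  intros h Hh; pose proof (Rmin_l d d'); pose proof (Rmin_r d d').
  rewrite <- !E; [apply K; lra| |].
  - replace (t - t) with 0 by ring; rewrite Rabs_R0; auto.
  - replace (t + h - t) with h by ring; lra.
Qed.

Lemma rder_unique (g : R -> Cplx) (t : R) (u v : Cplx) : rder g t u -> rder g t v -> u = v.
Proof.
  intros [H1 H2] [H3 H4]; apply Cplx_eq;
  [exact (uniqueness_limite _ _ _ _ H1 H3)|exact (uniqueness_limite _ _ _ _ H2 H4)].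
Qed.

Lemma rcont_const (c : Cplx) (t : R) : rcont (fun _ => c) t.
Proof. split; apply continuous_const. Qed.

Lemma rcont_sub (f g : R -> Cplx) (t : R) : rcont f t -> rcont g t -> rcont (fun s => f s -c g s) t.
Proof.
  intros [H1 H2] [H3 H4]; split; simpl; apply (continuous_plus (V := R_NormedModule)); auto;
  apply (continuous_opp (V := R_NormedModule)); auto.
Qed.

Lemma rcont_mul (f g : R -> Cplx) (t : R) : rcont f t -> rcont g t -> rcont (fun s => f s *c g s) t.
Proof.
  intros [H1 H2] [H3 H4]; split; simpl.
  - apply (continuous_minus (V := R_NormedModule)); apply (continuous_mult (K := R_AbsRing)); auto.
  - apply (continuous_plus (V := R_NormedModule)); apply (continuous_mult (K := R_AbsRing)); auto.
Qed.

Lemma rcont_ext_loc (f g : R -> Cplx) (t d : R) :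
  0 < d -> (forall s, Rabs (s - t) < d -> f s = g s) -> rcont f t -> rcont g t.
Proof.
  intros Hd E H; rewrite rcont_eps in H |- *; intros eps Heps.
  destruct (H eps Heps) as [d' [Hd' K]]; exists (Rmin d d'); split; [apply Rmin_glb_lt; auto|].
  intros s Hs; pose proof (Rmin_l d d'); pose proof (Rmin_r d d').
  rewrite <- !E; [apply K; lra| |lra].
  replace (t - t) with 0 by ring; rewrite Rabs_R0; auto.
Qed.

(** A mean value inequality with a variable majorant: [B - f] and [B + f] both have a nonnegative
    derivative. The sign [s] in the proof treats the two together. *)
Lemma real_increment_le (f df B dB : R -> R) (a b : R) :
  a <= b ->
  (forall t, a <= t <= b -> derivable_pt_lim f t (df t)) ->
  (forall t, a <= t <= b -> derivable_pt_lim B t (dB t)) ->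
  (forall t, a <= t <= b -> Rabs (df t) <= dB t) ->
  Rabs (f b - f a) <= B b - B a.
Proof.
  intros Hab Hf HB Hle.
  assert (Hmin : Rmin a b = a) by (apply Rmin_left; auto).
  assert (Hmax : Rmax a b = b) by (apply Rmax_right; auto).
  assert (forall s, s = 1 \/ s = -1 -> s * (f b - f a) <= B b - B a) as K.
  { intros s Hs.
    destruct (MVT_gen (fun t => B t - s * f t) a b (fun t => dB t - s * df t)) as [c [Hc E]].
    - rewrite Hmin, Hmax; intros t Ht; apply is_derive_Reals.
      apply derivable_pt_lim_minus; [apply HB; lra|].
      apply (derivable_pt_lim_scal f s t (df t)); apply Hf; lra.
    - rewrite Hmin, Hmax; intros t Ht; apply derivable_continuous_pt.
      exists (dB t - s * df t); apply derivable_pt_lim_minus; [apply HB; lra|].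
      apply (derivable_pt_lim_scal f s t (df t)); apply Hf; lra.
    - rewrite Hmin, Hmax in Hc; specialize (Hle c Hc).
      assert (0 <= dB c - s * df c).
      { pose proof (Rle_abs (df c)); pose proof (Rle_abs (- df c)); rewrite Rabs_Ropp in *.
        destruct Hs as [-> | ->]; lra. }
      nra. }
  pose proof (K 1 (or_introl eq_refl)); pose proof (K (-1) (or_intror eq_refl)).
  apply Rabs_le; lra.
Qed.

(** The factor 2 comes from bounding real and imaginary parts separately. It returns in [CInt_bound]
    and explains many of the constants below. *)
Lemma rder_increment_le (g v : R -> Cplx) (B dB : R -> R) (a b : R) :
  a <= b ->
  (forall t, a <= t <= b -> rder g t (v t)) ->
  (forall t, a <= t <= b -> derivable_pt_lim B t (dB t)) ->
  (forall t, a <= t <= b -> Cnorm (v t) <= dB t) ->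
  Cnorm (g b -c g a) <= 2 * (B b - B a).
Proof.
  intros Hab Hg HB Hle.
  pose proof (real_increment_le (fun t => Re (g t)) (fun t => Re (v t)) B dB a b Hab
    (fun t Ht => proj1 (Hg t Ht)) HB
    (fun t Ht => Rle_trans _ _ _ (Re_le_Cnorm _) (Hle t Ht))) as H1.
  pose proof (real_increment_le (fun t => Im (g t)) (fun t => Im (v t)) B dB a b Hab
    (fun t Ht => proj2 (Hg t Ht)) HB
    (fun t Ht => Rle_trans _ _ _ (Im_le_Cnorm _) (Hle t Ht))) as H2.
  eapply Rle_trans; [apply Cnorm_le_Re_Im|]; simpl; unfold Rminus in *; lra.
Qed.

Lemma rder_increment_const (g v : R -> Cplx) (K a b : R) :
  a <= b ->
  (forall t, a <= t <= b -> rder g t (v t)) ->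
  (forall t, a <= t <= b -> Cnorm (v t) <= K) ->
  Cnorm (g b -c g a) <= 2 * (K * (b - a)).
Proof.
  intros Hab Hg Hle.
  replace (K * (b - a)) with (K * b - K * a) by ring.
  apply (rder_increment_le g v (fun t => K * t) (fun _ => K) a b); auto.
  intros t _; apply is_derive_Reals; auto_derive; [auto|ring].
Qed.

(** * Integrals of complex-valued functions over an interval *)

Definition CInt (f : R -> Cplx) (a b : R) : Cplx :=
  mkC (RInt (fun t => Re (f t)) a b) (RInt (fun t => Im (f t)) a b).

Definition rcont_on (f : R -> Cplx) (a b : R) : Prop := forall t, a <= t <= b -> rcont f t.

Lemma rcont_on_ex (f : R -> Cplx) (a b : R) : a <= b -> rcont_on f a b ->
  ex_RInt (fun t => Re (f t)) a b /\ ex_RInt (fun t => Im (f t)) a b.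
Proof.
  intros Hab H; split; apply (ex_RInt_continuous (V := R_CompleteNormedModule));
  rewrite Rmin_left, Rmax_right by auto; intros t Ht; apply H; auto.
Qed.

Lemma CInt_ext (f g : R -> Cplx) (a b : R) : a <= b ->
  (forall t, a < t < b -> f t = g t) -> CInt f a b = CInt g a b.
Proof.
  intros Hab E; unfold CInt; f_equal; apply (RInt_ext (V := R_CompleteNormedModule));
  rewrite Rmin_left, Rmax_right by auto; intros t Ht; rewrite E; auto.
Qed.

Lemma CInt_sub (f g : R -> Cplx) (a b : R) : a <= b -> rcont_on f a b -> rcont_on g a b ->
  CInt (fun t => f t -c g t) a b = CInt f a b -c CInt g a b.
Proof.
  intros Hab Hf Hg; destruct (rcont_on_ex f a b Hab Hf) as [F1 F2]; destruct (rcont_on_ex g a b Hab Hg) as [G1 G2].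
  apply Cplx_eq; simpl; [exact (RInt_minus _ _ a b F1 G1)|exact (RInt_minus _ _ a b F2 G2)].
Qed.

Lemma CInt_scal (f : R -> Cplx) (c : Cplx) (a b : R) : a <= b -> rcont_on f a b ->
  CInt (fun t => c *c f t) a b = c *c CInt f a b.
Proof.
  intros Hab Hf; destruct (rcont_on_ex f a b Hab Hf) as [F1 F2].
  assert (forall u r, ex_RInt u a b -> r * RInt u a b = RInt (fun t => r * u t) a b) as E
    by (intros u r Hu; symmetry; exact (RInt_scal (V := R_CompleteNormedModule) u a b r Hu)).
  apply Cplx_eq; simpl; rewrite !E by assumption.
  - exact (RInt_minus _ _ a b (ex_RInt_scal _ _ _ (Re c) F1) (ex_RInt_scal _ _ _ (Im c) F2)).
  - exact (RInt_plus _ _ a b (ex_RInt_scal _ _ _ (Re c) F2) (ex_RInt_scal _ _ _ (Im c) F1)).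
Qed.

Lemma CInt_Chasles (f : R -> Cplx) (a b c : R) : a <= b <= c -> rcont_on f a c ->
  CInt f a b +c CInt f b c = CInt f a c.
Proof.
  intros Hab Hf.
  destruct (rcont_on_ex f a b) as [F1 F2]; [lra|intros t Ht; apply Hf; lra|].
  destruct (rcont_on_ex f b c) as [F3 F4]; [lra|intros t Ht; apply Hf; lra|].
  apply Cplx_eq; simpl; [exact (RInt_Chasles _ a b c F1 F3)|exact (RInt_Chasles _ a b c F2 F4)].
Qed.

Lemma CInt_bound (f : R -> Cplx) (a b K : R) : a <= b -> rcont_on f a b ->
  (forall t, a <= t <= b -> Cnorm (f t) <= K) -> Cnorm (CInt f a b) <= 2 * (K * (b - a)).
Proof.
  intros Hab Hf HK; destruct (rcont_on_ex f a b Hab Hf) as [F1 F2].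
  eapply Rle_trans; [apply Cnorm_le_Re_Im|]; simpl.
  assert (Rabs (RInt (fun t => Re (f t)) a b) <= (b - a) * K).
  { apply abs_RInt_le_const; auto; intros t Ht; eapply Rle_trans; [apply Re_le_Cnorm|auto]. }
  assert (Rabs (RInt (fun t => Im (f t)) a b) <= (b - a) * K).
  { apply abs_RInt_le_const; auto; intros t Ht; eapply Rle_trans; [apply Im_le_Cnorm|auto]. }
  lra.
Qed.

Lemma CInt_FTC (g v : R -> Cplx) (a b : R) : a <= b ->
  (forall t, a <= t <= b -> rder g t (v t)) -> rcont_on v a b -> CInt v a b = g b -c g a.
Proof.
  intros Hab Hg Hv; apply Cplx_eq; simpl; apply is_RInt_unique.
  - apply (is_RInt_derive (V := R_CompleteNormedModule) (fun t => Re (g t)));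
    rewrite Rmin_left, Rmax_right by auto; intros t Ht; [apply is_derive_Reals; apply Hg; auto|apply Hv; auto].
  - apply (is_RInt_derive (V := R_CompleteNormedModule) (fun t => Im (g t)));
    rewrite Rmin_left, Rmax_right by auto; intros t Ht; [apply is_derive_Reals; apply Hg; auto|apply Hv; auto].
Qed.

Lemma CInt_const (c : Cplx) (a b : R) : CInt (fun _ => c) a b = RtoC (b - a) *c c.
Proof. unfold CInt; rewrite !RInt_const; apply Cplx_eq; simpl; unfold scal; simpl; unfold mult; simpl; ring. Qed.

(** * Complex differentiability in one variable *)

Definition cder (f : Cplx -> Cplx) (z L : Cplx) : Prop :=
  forall eps, 0 < eps -> exists d, 0 < d /\
    forall h, Cnorm h < d -> Cnorm (f (z +c h) -c f z -c L *c h) <= eps * Cnorm h.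

Definition ccont1 (f : Cplx -> Cplx) (z : Cplx) : Prop :=
  forall eps, 0 < eps -> exists d, 0 < d /\ forall w, Cnorm (w -c z) < d -> Cnorm (f w -c f z) < eps.

Lemma cder_ccont1 (f : Cplx -> Cplx) (z L : Cplx) : cder f z L -> ccont1 f z.
Proof.
  intros H eps Heps; destruct (H 1) as [d [Hd K]]; [lra|].
  pose proof (Cnorm_ge0 L).
  set (e := eps / (2 + Cnorm L)).
  assert (0 < e) by (apply Rdiv_lt_0_compat; lra).
  exists (Rmin d e); split; [apply Rmin_glb_lt; auto|].
  intros w Hw; pose proof (Rmin_l d e); pose proof (Rmin_r d e).
  specialize (K (w -c z)); replace (z +c (w -c z)) with w in K by ring.
  pose proof (Cnorm_add (f w -c f z -c L *c (w -c z)) (L *c (w -c z))) as T.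
  replace (f w -c f z -c L *c (w -c z) +c L *c (w -c z)) with (f w -c f z) in T by ring.
  rewrite Cnorm_mul in T. pose proof (Cnorm_ge0 (w -c z)).
  assert (e * (2 + Cnorm L) = eps) by (unfold e; field; lra).
  specialize (K ltac:(lra)).
  nra.
Qed.

Lemma cder_unique (f : Cplx -> Cplx) (z L L' : Cplx) : cder f z L -> cder f z L' -> L = L'.
Proof.
  intros H H'; apply Csub_eq0, Cnorm_eq0.
  destruct (Req_dec (Cnorm (L -c L')) 0) as [|Hn]; auto; exfalso.
  pose proof (Cnorm_ge0 (L -c L')).
  destruct (H (Cnorm (L -c L') / 4)) as [d [Hd K]]; [lra|].
  destruct (H' (Cnorm (L -c L') / 4)) as [d' [Hd' K']]; [lra|].
  set (e := Rmin d d' / 2).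
  assert (0 < Rmin d d') by (apply Rmin_glb_lt; auto).
  pose proof (Rmin_l d d'); pose proof (Rmin_r d d').
  assert (Cnorm (RtoC e) = e) as Ee by (rewrite Cnorm_RtoC; apply Rabs_pos_eq; unfold e; lra).
  specialize (K (RtoC e)); specialize (K' (RtoC e)); rewrite Ee in *.
  specialize (K ltac:(unfold e; lra)); specialize (K' ltac:(unfold e; lra)).
  pose proof (Cnorm_sub (f (z +c RtoC e) -c f z -c L' *c RtoC e) (f (z +c RtoC e) -c f z -c L *c RtoC e)) as T.
  match type of T with Cnorm ?a <= _ => replace a with ((L -c L') *c RtoC e) in T by ring end.
  rewrite Cnorm_mul, Ee in T. assert (0 < e) by (unfold e; lra). nra.
Qed.

Lemma cder_ext_loc (f g : Cplx -> Cplx) (z L : Cplx) (d : R) :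
  0 < d -> (forall w, Cnorm (w -c z) < d -> f w = g w) -> cder f z L -> cder g z L.
Proof.
  intros Hd E H eps Heps.
  destruct (H eps Heps) as [d' [Hd' K]]; exists (Rmin d d'); split; [apply Rmin_glb_lt; auto|].
  intros h Hh; pose proof (Rmin_l d d'); pose proof (Rmin_r d d').
  rewrite <- !E; [apply K; lra| |].
  - replace (z -c z) with C0 by ring; rewrite Cnorm_C0; auto.
  - replace (z +c h -c z) with h by ring; lra.
Qed.

Lemma rder_comp (f : Cplx -> Cplx) (g : R -> Cplx) (t : R) (L v : Cplx) :
  cder f (g t) L -> rder g t v -> rder (fun s => f (g s)) t (L *c v).
Proof.
  rewrite !rder_eps; intros Hf Hg eps Heps.
  pose proof (Cnorm_ge0 L); pose proof (Cnorm_ge0 v).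
  (* [e1] pays for the error of [f] on an inner increment of size at most [(1 + Cnorm v) * Rabs h],
     [e2] for the error of [g] multiplied by [L]; the bound [e2 <= 1] is what gives that size. *)
  set (e1 := eps / (2 * (2 + Cnorm v))).
  assert (0 < e1) by (apply Rdiv_lt_0_compat; lra).
  assert (e1 * (2 * (2 + Cnorm v)) = eps) by (unfold e1; field; lra).
  destruct (Hf e1 H1) as [d1 [Hd1 K1]].
  set (e2 := Rmin 1 (eps / (2 * (1 + Cnorm L)))).
  assert (0 < eps / (2 * (1 + Cnorm L))) by (apply Rdiv_lt_0_compat; lra).
  assert (eps / (2 * (1 + Cnorm L)) * (2 * (1 + Cnorm L)) = eps) by (field; lra).
  assert (0 < e2) by (apply Rmin_glb_lt; lra).
  pose proof (Rmin_l 1 (eps / (2 * (1 + Cnorm L)))); pose proof (Rmin_r 1 (eps / (2 * (1 + Cnorm L)))).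
  fold e2 in H6, H7.
  destruct (Hg e2 H5) as [d2 [Hd2 K2]].
  set (d3 := d1 / (2 + Cnorm v)).
  assert (0 < d3) by (apply Rdiv_lt_0_compat; lra).
  assert (d3 * (2 + Cnorm v) = d1) by (unfold d3; field; lra).
  exists (Rmin d2 d3); split; [apply Rmin_glb_lt; auto|].
  intros h Hh; pose proof (Rmin_l d2 d3); pose proof (Rmin_r d2 d3).
  specialize (K2 h ltac:(lra)).
  set (k := g (t + h) -c g t) in *.
  pose proof (Rabs_pos h).
  assert (Cnorm k <= (1 + Cnorm v) * Rabs h) as Hk.
  { pose proof (Cnorm_le_sub k (v *c RtoC h)) as T; rewrite Cnorm_mul, Cnorm_RtoC in T. nra. }
  assert (Cnorm k < d1) as Hk1 by nra.
  specialize (K1 k Hk1).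
  replace (g t +c k) with (g (t + h)) in K1 by (unfold k; ring).
  match goal with |- Cnorm ?a <= _ => replace a with
    ((f (g (t + h)) -c f (g t) -c L *c k) +c L *c (k -c v *c RtoC h)) by (unfold k; ring) end.
  eapply Rle_trans; [apply Cnorm_add|]; rewrite Cnorm_mul.
  assert (e1 * Cnorm k <= eps / 2 * Rabs h) by nra.
  assert (Cnorm L * Cnorm (k -c v *c RtoC h) <= eps / 2 * Rabs h).
  { apply Rle_trans with (Cnorm L * (e2 * Rabs h)); [apply Rmult_le_compat_l; auto|].
    assert (Cnorm L * e2 <= eps / 2) by nra. nra. }
  lra.
Qed.

Lemma rcont_comp (f : Cplx -> Cplx) (g : R -> Cplx) (t : R) :
  ccont1 f (g t) -> rcont g t -> rcont (fun s => f (g s)) t.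
Proof.
  rewrite !rcont_eps; intros Hf Hg eps Heps.
  destruct (Hf eps Heps) as [d1 [Hd1 K1]]; destruct (Hg d1 Hd1) as [d2 [Hd2 K2]].
  exists d2; split; auto.
Qed.

Definition dq (f : Cplx -> Cplx) (z h : Cplx) : Cplx := (f (z +c h) -c f z) /c h.

Lemma Un_cv_eps (u : nat -> R) (l : R) : Un_cv u l <->
  forall eps, 0 < eps -> exists N, forall n, (N <= n)%nat -> Rabs (u n - l) < eps.
Proof.
  split; intros H eps Heps; destruct (H eps Heps) as [N K]; exists N; intros n Hn; apply K; auto.
Qed.

(** Completeness with its rate: the limit inherits the modulus [b] of the Cauchy sequence. *)
Lemma Cplx_complete (u : nat -> Cplx) (b : nat -> R) :
  (forall n m, (n <= m)%nat -> Cnorm (u n -c u m) <= b n) ->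
  (forall eps, 0 < eps -> exists N, forall n, (N <= n)%nat -> b n < eps) ->
  exists l, forall n, Cnorm (u n -c l) <= b n.
Proof.
  intros Hu Hb.
  assert (forall pr : Cplx -> R, (forall z w, Rabs (pr z - pr w) <= Cnorm (z -c w)) ->
            exists l, Un_cv (fun n => pr (u n)) l) as K.
  { intros pr Hpr.
    destruct (R_complete (fun n => pr (u n))) as [l Hl]; [|exists l; auto].
    intros eps Heps; destruct (Hb eps Heps) as [N HN]; exists N; intros n m Hn Hm.
    unfold Rdist; eapply Rle_lt_trans; [apply Hpr|].
    destruct (Nat.le_ge_cases n m).
    - eapply Rle_lt_trans; [apply Hu; auto|apply HN; lia].
    - rewrite Cnorm_sub_sym; eapply Rle_lt_trans; [apply Hu; auto|apply HN; lia]. }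
  destruct (K Re) as [lr Hr].
  { intros z w; eapply Rle_trans; [|apply Re_le_Cnorm]; apply Req_le; f_equal. }
  destruct (K Im) as [li Hi].
  { intros z w; eapply Rle_trans; [|apply Im_le_Cnorm]; apply Req_le; f_equal. }
  exists (mkC lr li); intros n; apply le_epsilon; intros eps Heps.
  rewrite Un_cv_eps in Hr, Hi.
  destruct (Hr (eps / 2)) as [N1 K1]; [lra|]; destruct (Hi (eps / 2)) as [N2 K2]; [lra|].
  set (m := Nat.max n (Nat.max N1 N2)).
  eapply Rle_trans; [apply (Cnorm_sub_tri _ (u m))|].
  apply Rplus_le_compat; [apply Hu; lia|].
  eapply Rle_trans; [apply Cnorm_le_Re_Im|]; simpl.
  specialize (K1 m ltac:(lia)); specialize (K2 m ltac:(lia)); unfold Rminus in *; lra.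
Qed.

Lemma inv_INR_small (C eps : R) : 0 < eps -> exists N, forall n, (N <= n)%nat -> C / (INR n + 1) < eps.
Proof.
  intros Heps; destruct (INR_unbounded (Rabs C / eps)) as [N HN]; exists N; intros n Hn.
  apply le_INR in Hn; pose proof (pos_INR n).
  apply (Rmult_lt_reg_r (INR n + 1)); [lra|].
  unfold Rdiv at 1; rewrite Rmult_assoc, Rinv_l, Rmult_1_r by lra.
  assert (Rabs C < eps * INR N).
  { apply (Rmult_lt_reg_r (/ eps)); [apply Rinv_0_lt_compat; auto|].
    replace (eps * INR N * / eps) with (INR N) by (field; lra); auto. }
  pose proof (Rle_abs C); nra.
Qed.

(** A criterion for differentiability that needs no candidate for the derivative. Such a Cauchy
    condition passes through integrals and pointwise limits, and this is how [mixed_derivative],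
    [Hol_limit] and [Kc_Hol] obtain their derivatives. *)
Lemma dq_cauchy_cder (f : Cplx -> Cplx) (z : Cplx) (K d : R) : 0 < d ->
  (forall h h', 0 < Cnorm h < d -> 0 < Cnorm h' < d ->
     Cnorm (dq f z h -c dq f z h') <= K * (Cnorm h + Cnorm h')) ->
  exists L, cder f z L.
Proof.
  intros Hd H.
  (* Read off from the hypothesis at [h = h']. *)
  assert (0 <= K) as HK.
  { assert (Cnorm (RtoC (d / 2)) = d / 2) as E by (rewrite Cnorm_RtoC; apply Rabs_pos_eq; lra).
    specialize (H (RtoC (d / 2)) (RtoC (d / 2))); rewrite E in H.
    pose proof (Cnorm_ge0 (dq f z (RtoC (d / 2)) -c dq f z (RtoC (d / 2)))).
    assert (0 <= K * (d / 2 + d / 2)) by (eapply Rle_trans; [apply H0|apply H; lra]). nra. }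
  (* Real increments inside the punctured disc that tend to 0; the derivative is the limit of their
     quotients. *)
  set (e := fun n : nat => d / 2 / (INR n + 1)).
  assert (forall n, 0 < e n < d) as He.
  { intros n; unfold e; pose proof (pos_INR n); split; [apply Rdiv_lt_0_compat; lra|].
    apply (Rmult_lt_reg_r (INR n + 1)); [lra|].
    unfold Rdiv at 1; rewrite Rmult_assoc, Rinv_l, Rmult_1_r by lra. nra. }
  assert (forall n, Cnorm (RtoC (e n)) = e n) as Ee.
  { intros n; rewrite Cnorm_RtoC; apply Rabs_pos_eq; specialize (He n); lra. }
  destruct (Cplx_complete (fun n => dq f z (RtoC (e n))) (fun n => 2 * K * e n)) as [L HL].
  - intros n m Hnm; eapply Rle_trans; [apply H; rewrite Ee; apply He|]; rewrite !Ee.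
    assert (e m <= e n); [|nra].
    apply le_INR in Hnm; pose proof (pos_INR n); unfold e, Rdiv; apply Rmult_le_compat_l; [lra|].
    apply Rinv_le_contravar; lra.
  - intros eps Heps; destruct (inv_INR_small (2 * K * (d / 2)) eps Heps) as [N HN]; exists N.
    intros n Hn; specialize (HN n Hn); unfold e, Rdiv in *; nra.
  - assert (forall h, 0 < Cnorm h < d -> Cnorm (dq f z h -c L) <= K * Cnorm h) as HL'.
    { intros h Hh; apply le_epsilon; intros eps Heps.
      destruct (inv_INR_small (3 * K * (d / 2)) eps Heps) as [N HN].
      specialize (HN N (le_n N)).
      eapply Rle_trans; [apply (Cnorm_sub_tri _ (dq f z (RtoC (e N))))|].
      pose proof (H h (RtoC (e N)) Hh ltac:(rewrite Ee; apply He)) as T; rewrite Ee in T.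
      specialize (HL N); cbv beta in HL.
      assert (3 * K * e N < eps) by (unfold e, Rdiv in *; nra). nra. }
    exists L; intros eps Heps.
    assert (0 < eps / (K + 1)) by (apply Rdiv_lt_0_compat; lra).
    assert (eps / (K + 1) * (K + 1) = eps) by (field; lra).
    exists (Rmin d (eps / (K + 1))); split; [apply Rmin_glb_lt; auto|].
    intros h Hh; pose proof (Rmin_l d (eps / (K + 1))); pose proof (Rmin_r d (eps / (K + 1))).
    destruct (excluded_middle_informative (h = C0)) as [->|Hn].
    + replace (f (z +c C0) -c f z -c L *c C0) with C0;
        [rewrite Cnorm_C0; lra|replace (z +c C0) with z by ring; ring].
    + pose proof (Cnorm_gt0 h Hn).
      specialize (HL' h ltac:(lra)).
      replace (f (z +c h) -c f z -c L *c h) with ((dq f z h -c L) *c h) by (unfold dq; field; auto).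
      rewrite Cnorm_mul; apply Rmult_le_compat_r; [apply Cnorm_ge0|]. nra.
Qed.

Lemma cder_comp (f g : Cplx -> Cplx) (z L M : Cplx) :
  cder f (g z) L -> cder g z M -> cder (fun w => f (g w)) z (L *c M).
Proof.
  intros Hf Hg eps Heps.
  pose proof (Cnorm_ge0 L) as HL; pose proof (Cnorm_ge0 M) as HM.
  set (e1 := eps / (2 * (2 + Cnorm M))).
  assert (0 < e1) by (apply Rdiv_lt_0_compat; lra).
  assert (e1 * (2 * (2 + Cnorm M)) = eps) by (unfold e1; field; lra).
  destruct (Hf e1) as [d1 [Hd1 K1]]; auto.
  set (e0 := eps / (2 * (1 + Cnorm L))).
  assert (0 < e0) by (apply Rdiv_lt_0_compat; lra).
  assert (e0 * (2 * (1 + Cnorm L)) = eps) by (unfold e0; field; lra).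
  set (e2 := Rmin 1 e0).
  assert (0 < e2) by (apply Rmin_glb_lt; lra).
  assert (e2 <= 1) by apply Rmin_l; assert (e2 <= e0) by apply Rmin_r.
  destruct (Hg e2) as [d2 [Hd2 K2]]; auto.
  set (d3 := d1 / (2 + Cnorm M)).
  assert (0 < d3) by (apply Rdiv_lt_0_compat; lra).
  assert (d3 * (2 + Cnorm M) = d1) by (unfold d3; field; lra).
  exists (Rmin d2 d3); split; [apply Rmin_glb_lt; auto|].
  intros h Hh; pose proof (Rmin_l d2 d3); pose proof (Rmin_r d2 d3).
  specialize (K2 h ltac:(lra)).
  set (k := g (z +c h) -c g z) in *.
  pose proof (Cnorm_ge0 h).
  assert (Cnorm k <= (1 + Cnorm M) * Cnorm h) as Hk.
  { pose proof (Cnorm_le_sub k (M *c h)) as T; rewrite Cnorm_mul in T. nra. }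
  assert (Cnorm k < d1) as Hk1 by nra.
  specialize (K1 k Hk1).
  replace (g z +c k) with (g (z +c h)) in K1 by (unfold k; ring).
  match goal with |- Cnorm ?a <= _ => replace a with
    ((f (g (z +c h)) -c f (g z) -c L *c k) +c L *c (k -c M *c h)) by (unfold k; ring) end.
  eapply Rle_trans; [apply Cnorm_add|]; rewrite Cnorm_mul.
  assert (e1 * Cnorm k <= eps / 2 * Cnorm h) by nra.
  assert (Cnorm L * Cnorm (k -c M *c h) <= eps / 2 * Cnorm h).
  { apply Rle_trans with (Cnorm L * (e2 * Cnorm h)); [apply Rmult_le_compat_l; auto|].
    assert (Cnorm L * e2 <= eps / 2) by nra. nra. }
  lra.
Qed.

(** * The exponential map *)

Definition cexp (w : Cplx) : Cplx := mkC (exp (Re w) * cos (Im w)) (exp (Re w) * sin (Im w)).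

Lemma cexp_add (z w : Cplx) : cexp (z +c w) = cexp z *c cexp w.
Proof.
  apply Cplx_eq; unfold cexp; simpl; rewrite exp_plus, ?cos_plus, ?sin_plus; ring.
Qed.

Lemma Cnorm_cexp (w : Cplx) : Cnorm (cexp w) = exp (Re w).
Proof.
  pose proof (exp_pos (Re w)).
  apply Rsqr_inj; [apply Cnorm_ge0|lra|]; unfold Rsqr.
  replace (Cnorm (cexp w) * Cnorm (cexp w)) with (Cnorm (cexp w) ^ 2) by ring.
  rewrite Cnorm_sqr; simpl. pose proof (sin2_cos2 (Im w)); unfold Rsqr in *. nra.
Qed.

Lemma cexp_neq0 (w : Cplx) : cexp w <> C0.
Proof. apply Cnorm_neq0; rewrite Cnorm_cexp; apply exp_pos. Qed.

(** The real derivatives of [exp], [cos] and [sin] at 0 are combined; [cexp_add] then carries the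
    result to every point. *)
Lemma cder_cexp0 : cder cexp C0 C1.
Proof.
  intros eps Heps.
  set (e := Rmin 1 (eps / 9)).
  assert (0 < e) by (apply Rmin_glb_lt; lra).
  assert (e <= 1) by apply Rmin_l; assert (e <= eps / 9) by apply Rmin_r.
  clearbody e.
  pose proof (derivable_pt_lim_exp 0) as HE; rewrite exp_0 in HE.
  pose proof (derivable_pt_lim_cos 0) as HC; rewrite sin_0 in HC.
  pose proof (derivable_pt_lim_sin 0) as HS; rewrite cos_0 in HS.
  rewrite derivable_pt_lim_eps in HE, HC, HS.
  destruct (HE e) as [d1 [Hd1 K1]]; auto; destruct (HC e) as [d2 [Hd2 K2]]; auto;
  destruct (HS e) as [d3 [Hd3 K3]]; auto.
  exists (Rmin e (Rmin d1 (Rmin d2 d3))); split; [repeat apply Rmin_glb_lt; auto|].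
  intros [x y] Hh.
  pose proof (Rmin_l e (Rmin d1 (Rmin d2 d3))); pose proof (Rmin_r e (Rmin d1 (Rmin d2 d3))).
  pose proof (Rmin_l d1 (Rmin d2 d3)); pose proof (Rmin_r d1 (Rmin d2 d3)).
  pose proof (Rmin_l d2 d3); pose proof (Rmin_r d2 d3).
  pose proof (Re_le_Cnorm (mkC x y)) as Hx; pose proof (Im_le_Cnorm (mkC x y)) as Hy; simpl in Hx, Hy.
  set (N := Cnorm (mkC x y)) in *.
  specialize (K1 x ltac:(lra)); specialize (K2 y ltac:(lra)); specialize (K3 y ltac:(lra)).
  rewrite ?Rplus_0_l, ?exp_0, ?cos_0, ?sin_0 in *.
  eapply Rle_trans; [apply Cnorm_le_Re_Im|]; simpl; rewrite ?Rplus_0_l, ?exp_0, ?cos_0, ?sin_0.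
  (* Three remainders, each at most [e * N]. The goal is regrouped so that every term contains a
     remainder or is a product of two small factors. *)
  set (a := exp x - 1 - x) in *. set (b := cos y - 1) in *. set (c := sin y - y) in *.
  match type of K1 with Rabs ?u <= _ => replace u with a in K1 by (unfold a; ring) end.
  match type of K2 with Rabs ?u <= _ => replace u with b in K2 by (unfold b; ring) end.
  match type of K3 with Rabs ?u <= _ => replace u with c in K3 by (unfold c; ring) end.
  match goal with |- Rabs ?u + Rabs ?v <= _ =>
    replace u with (a + (a + 1 + x) * b) by (unfold a, b; ring);
    replace v with ((a + x) * (c + y) + c) by (unfold a, c; ring) end.
  pose proof (Rabs_pos x); pose proof (Rabs_pos y).
  assert (Rabs (a + 1 + x) <= 3).
  { pose proof (Rabs_triang (a + 1) x); pose proof (Rabs_triang a 1); rewrite Rabs_R1 in *. nra. }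
  assert (Rabs (a + x) <= 2 * N) by (pose proof (Rabs_triang a x); nra).
  assert (Rabs (c + y) <= 2 * N) by (pose proof (Rabs_triang c y); nra).
  pose proof (Rabs_triang a ((a + 1 + x) * b)) as T1; pose proof (Rabs_triang ((a + x) * (c + y)) c) as T2.
  rewrite Rabs_mult in T1, T2.
  pose proof (Rabs_pos (a + x)); pose proof (Rabs_pos (c + y)); pose proof (Rabs_pos (a + 1 + x)); pose proof (Rabs_pos b).
  assert (Rabs (a + 1 + x) * Rabs b <= 3 * (e * N)) by (apply Rmult_le_compat; nra).
  assert (Rabs (a + x) * Rabs (c + y) <= (2 * N) * (2 * e)) by (apply Rmult_le_compat; nra).
  nra.
Qed.

Lemma cder_cexp (w : Cplx) : cder cexp w (cexp w).
Proof.
  intros eps Heps; pose proof (Cnorm_gt0 _ (cexp_neq0 w)).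
  destruct (cder_cexp0 (eps / Cnorm (cexp w))) as [d [Hd K]]; [apply Rdiv_lt_0_compat; auto|].
  exists d; split; auto; intros h Hh; specialize (K h Hh).
  rewrite cexp_add.
  replace (C0 +c h) with h in K by ring.
  replace (cexp C0) with C1 in K by (apply Cplx_eq; simpl; rewrite exp_0, ?cos_0, ?sin_0; ring).
  replace (cexp w *c cexp h -c cexp w -c cexp w *c h) with (cexp w *c (cexp h -c C1 -c C1 *c h)) by ring.
  rewrite Cnorm_mul.
  apply Rle_trans with (Cnorm (cexp w) * (eps / Cnorm (cexp w) * Cnorm h)); [apply Rmult_le_compat_l; lra|].
  apply Req_le; field; lra.
Qed.

(** * Goursat's theorem on rectangles *)

(** Bisection in abstract form. [P n a c] speaks of the rectangle with lower left corner [(a, c)]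
    and sides [A / 2 ^ n], [B / 2 ^ n]; a property inherited from the four quarters that fails on
    the whole fails on a nested sequence, whose common point is [(s, t)]. *)
Lemma nested_quadrants (P : nat -> R -> R -> Prop) (A B a0 c0 : R) : 0 <= A -> 0 <= B ->
  (forall n a c, P (S n) a c -> P (S n) (a + A / 2 ^ S n) c -> P (S n) a (c + B / 2 ^ S n) ->
     P (S n) (a + A / 2 ^ S n) (c + B / 2 ^ S n) -> P n a c) ->
  ~ P 0%nat a0 c0 ->
  exists s t, forall n, exists a c, ~ P n a c /\ a <= s <= a + A / 2 ^ n /\ c <= t <= c + B / 2 ^ n.
Proof.
  intros HA HB Hstep H0.
  (* Selects a quarter on which [P] fails. The fourth quarter is the default, since [P] cannot hold
     on all four. *)
  set (step := fun (n : nat) (x : R * R) =>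
    let a := fst x in let c := snd x in
    let a' := a + A / 2 ^ S n in let c' := c + B / 2 ^ S n in
    if excluded_middle_informative (P (S n) a c) then
      if excluded_middle_informative (P (S n) a' c) then
        if excluded_middle_informative (P (S n) a c') then (a', c') else (a, c')
      else (a', c)
    else (a, c)).
  set (x := fix x (n : nat) : R * R := match n with O => (a0, c0) | S m => step m (x m) end).
  assert (Hx : forall n, ~ P n (fst (x n)) (snd (x n))).
  { induction n; [exact H0|]; simpl x; unfold step.
    destruct (x n) as [a c]; simpl fst in *; simpl snd in *.
    repeat destruct excluded_middle_informative; simpl fst; simpl snd; auto.
  }
  assert (Hhalf : forall D n, D / 2 ^ n = 2 * (D / 2 ^ S n)).
  { intros D n; simpl; field; apply pow_nonzero; lra. }
  assert (Hpos : forall D n, 0 <= D -> 0 <= D / 2 ^ n).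
  { intros D n HD; apply Rmult_le_pos; auto; left; apply Rinv_0_lt_compat, pow_lt; lra. }
  assert (Hs : forall n, fst (x n) <= fst (x (S n)) /\ fst (x (S n)) + A / 2 ^ S n <= fst (x n) + A / 2 ^ n /\
     snd (x n) <= snd (x (S n)) /\ snd (x (S n)) + B / 2 ^ S n <= snd (x n) + B / 2 ^ n).
  { intros n; pose proof (Hhalf A n); pose proof (Hhalf B n).
    pose proof (Hpos A (S n) HA); pose proof (Hpos B (S n) HB).
    change (x (S n)) with (step n (x n)); unfold step; destruct (x n) as [a c]; cbv beta zeta; unfold fst, snd;
    repeat destruct excluded_middle_informative; lra. }
  assert (Hlub : forall (u : nat -> R) D, 0 <= D ->
     (forall n, u n <= u (S n) /\ u (S n) + D / 2 ^ S n <= u n + D / 2 ^ n) ->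
     exists s, forall n, u n <= s <= u n + D / 2 ^ n).
  { intros u D HD Hu.
    assert (Hmono : forall n k, u n <= u (n + k)%nat /\ u (n + k)%nat + D / 2 ^ (n + k) <= u n + D / 2 ^ n).
    { intros n k; induction k; [rewrite Nat.add_0_r; lra|].
      rewrite Nat.add_succ_r; specialize (Hu (n + k)%nat); lra. }
    assert (Hub : forall n m, u m <= u n + D / 2 ^ n).
    { intros n m; destruct (Nat.le_ge_cases n m) as [H|H].
      - replace m with (n + (m - n))%nat by lia. pose proof (Hmono n (m - n)%nat).
        pose proof (Hpos D (n + (m - n))%nat HD); lra.
      - replace n with (m + (n - m))%nat by lia. pose proof (Hmono m (n - m)%nat).
        pose proof (Hpos D (m + (n - m))%nat HD); lra. }
    destruct (completeness (fun y => exists n, y = u n)) as [s [Hs1 Hs2]].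
    - exists (u 0%nat + D / 2 ^ 0); intros y [n ->]; apply Hub.
    - exists (u 0%nat); exists 0%nat; auto.
    - exists s; intros n; split; [apply Hs1; exists n; auto|].
      apply Hs2; intros y [m ->]; apply Hub. }
  destruct (Hlub (fun n => fst (x n)) A HA) as [s Es]; [intros n; split; apply (Hs n)|].
  destruct (Hlub (fun n => snd (x n)) B HB) as [t Et]; [intros n; split; apply (Hs n)|].
  exists s, t; intros n; exists (fst (x n)), (snd (x n)); auto.
Qed.

(** The integral of G dz along the boundary of the rectangle, counterclockwise: bottom minus top,
    plus i times right minus left. *)
Definition Qrect (G : Cplx -> Cplx) (a b c d : R) : Cplx :=
  (CInt (fun s => G (mkC s c)) a b -c CInt (fun s => G (mkC s d)) a b)
  +c Ci *c (CInt (fun t => G (mkC b t)) c d -c CInt (fun t => G (mkC a t)) c d).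

Definition in_rect (a b c d : R) (w : Cplx) : Prop := a <= Re w <= b /\ c <= Im w <= d.

Lemma rder_horizontal (c s : R) : rder (fun s => mkC s c) s C1.
Proof. split; simpl; [apply derivable_pt_lim_id|apply derivable_pt_lim_const]. Qed.

Lemma rder_vertical (a t : R) : rder (fun t => mkC a t) t Ci.
Proof. split; simpl; [apply derivable_pt_lim_const|apply derivable_pt_lim_id]. Qed.

Lemma rcont_edges (G : Cplx -> Cplx) (a b c d : R) :
  (forall w, in_rect a b c d w -> ccont1 G w) ->
  (forall y, c <= y <= d -> rcont_on (fun s => G (mkC s y)) a b) /\
  (forall x, a <= x <= b -> rcont_on (fun t => G (mkC x t)) c d).
Proof.
  intros HG; split; intros y Hy x Hx; apply (rcont_comp G).
  - apply HG; split; simpl; auto.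
  - apply (rder_rcont _ _ C1), rder_horizontal.
  - apply HG; split; simpl; auto.
  - apply (rder_rcont _ _ Ci), rder_vertical.
Qed.

Lemma Qrect_split (G : Cplx -> Cplx) (a b c d m n : R) : a <= m <= b -> c <= n <= d ->
  (forall w, in_rect a b c d w -> ccont1 G w) ->
  Qrect G a b c d = (Qrect G a m c n +c Qrect G m b c n) +c (Qrect G a m n d +c Qrect G m b n d).
Proof.
  intros Hm Hn HG; destruct (rcont_edges G a b c d HG) as [H1 H2]; unfold Qrect.
  rewrite <- (CInt_Chasles (fun s => G (mkC s c)) a m b), <- (CInt_Chasles (fun s => G (mkC s d)) a m b),
    <- (CInt_Chasles (fun t => G (mkC a t)) c n d), <- (CInt_Chasles (fun t => G (mkC b t)) c n d);
    try apply H1; try apply H2; try lra.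
  ring.
Qed.

Lemma Qrect_primitive (G F : Cplx -> Cplx) (a b c d : R) : a <= b -> c <= d ->
  (forall w, cder F w (G w)) -> (forall w, ccont1 G w) -> Qrect G a b c d = C0.
Proof.
  intros Hab Hcd HF HG; destruct (rcont_edges G a b c d (fun w _ => HG w)) as [H1 H2]; unfold Qrect.
  assert (E1 : forall y, c <= y <= d -> CInt (fun s => G (mkC s y)) a b = F (mkC b y) -c F (mkC a y)).
  { intros y Hy; apply (CInt_FTC (fun s => F (mkC s y))); auto.
    intros t Ht; replace (G (mkC t y)) with (G (mkC t y) *c C1) by ring.
    apply (rder_comp F (fun s => mkC s y)); [apply HF|apply rder_horizontal]. }
  assert (E2 : forall x, a <= x <= b -> Ci *c CInt (fun t => G (mkC x t)) c d = F (mkC x d) -c F (mkC x c)).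
  { intros x Hx; rewrite <- CInt_scal by auto.
    apply (CInt_FTC (fun t => F (mkC x t))); auto.
    - intros t Ht; replace (Ci *c G (mkC x t)) with (G (mkC x t) *c Ci) by ring.
      apply (rder_comp F (fun t => mkC x t)); [apply HF|apply rder_vertical].
    - intros t Ht; apply rcont_mul; [apply rcont_const|apply H2; auto]. }
  match goal with |- ?u -c ?v +c Ci *c (?w -c ?z) = _ =>
    replace (u -c v +c Ci *c (w -c z)) with (u -c v +c (Ci *c w -c Ci *c z)) by ring end.
  rewrite !E1, !E2 by lra; ring.
Qed.

Lemma Qrect_sub (G H : Cplx -> Cplx) (a b c d : R) : a <= b -> c <= d ->
  (forall w, in_rect a b c d w -> ccont1 G w) -> (forall w, in_rect a b c d w -> ccont1 H w) ->
  Qrect (fun w => G w -c H w) a b c d = Qrect G a b c d -c Qrect H a b c d.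
Proof.
  intros Hab Hcd HG HH; destruct (rcont_edges G a b c d HG) as [G1 G2]; destruct (rcont_edges H a b c d HH) as [H1 H2].
  unfold Qrect.
  rewrite (CInt_sub (fun s => G (mkC s c)) (fun s => H (mkC s c))), (CInt_sub (fun s => G (mkC s d)) (fun s => H (mkC s d))),
    (CInt_sub (fun s => G (mkC a s)) (fun s => H (mkC a s))), (CInt_sub (fun s => G (mkC b s)) (fun s => H (mkC b s)));
    try apply G1; try apply G2; try apply H1; try apply H2; try lra.
  ring.
Qed.

Lemma ccont1_sub (f g : Cplx -> Cplx) (z : Cplx) : ccont1 f z -> ccont1 g z -> ccont1 (fun w => f w -c g w) z.
Proof.
  intros Hf Hg eps Heps.
  destruct (Hf (eps / 2)) as [d1 [Hd1 K1]]; [lra|]; destruct (Hg (eps / 2)) as [d2 [Hd2 K2]]; [lra|].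
  exists (Rmin d1 d2); split; [apply Rmin_glb_lt; auto|].
  intros w Hw; pose proof (Rmin_l d1 d2); pose proof (Rmin_r d1 d2).
  specialize (K1 w ltac:(lra)); specialize (K2 w ltac:(lra)).
  replace (f w -c g w -c (f z -c g z)) with ((f w -c f z) -c (g w -c g z)) by ring.
  pose proof (Cnorm_sub (f w -c f z) (g w -c g z)); lra.
Qed.

Lemma cder_affine_primitive (A B w : Cplx) :
  cder (fun w => A *c w +c RtoC (/ 2) *c B *c w *c w) w (A +c B *c w).
Proof.
  intros eps Heps; pose proof (Cnorm_ge0 B).
  exists (eps / (1 + Cnorm B)); split; [apply Rdiv_lt_0_compat; lra|].
  intros h Hh.
  assert (eps / (1 + Cnorm B) * (1 + Cnorm B) = eps) by (field; lra).
  match goal with |- Cnorm ?a <= _ => replace a with (RtoC (/ 2) *c B *c h *c h) end.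
  - rewrite !Cnorm_mul, Cnorm_RtoC, Rabs_pos_eq by lra. pose proof (Cnorm_ge0 h).
    assert (Cnorm B * Cnorm h <= eps) by nra. nra.
  - assert (RtoC (/ 2) +c RtoC (/ 2) = C1) as E by (apply Cplx_eq; simpl; field).
    transitivity (RtoC (/ 2) *c B *c h *c h +c (RtoC (/ 2) +c RtoC (/ 2) -c C1) *c B *c w *c h); [rewrite E|]; ring.
Qed.

Lemma ccont1_affine (A B w : Cplx) : ccont1 (fun w => A +c B *c w) w.
Proof.
  apply (cder_ccont1 _ _ B); intros eps Heps; exists 1; split; [lra|]; intros h _.
  replace (A +c B *c (w +c h) -c (A +c B *c w) -c B *c h) with C0 by ring.
  rewrite Cnorm_C0; pose proof (Cnorm_ge0 h); nra.
Qed.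

Lemma Qrect_bound (G : Cplx -> Cplx) (a b c d K : R) : a <= b -> c <= d -> 0 <= K ->
  (forall w, in_rect a b c d w -> ccont1 G w) -> (forall w, in_rect a b c d w -> Cnorm (G w) <= K) ->
  Cnorm (Qrect G a b c d) <= 4 * (K * ((b - a) + (d - c))).
Proof.
  intros Hab Hcd HK HG HB; destruct (rcont_edges G a b c d HG) as [G1 G2]; unfold Qrect.
  eapply Rle_trans; [apply Cnorm_add|]; rewrite Cnorm_mul, Cnorm_Ci.
  eapply Rle_trans; [apply Rplus_le_compat; [apply Cnorm_sub|apply Rmult_le_compat_l; [lra|apply Cnorm_sub]]|].
  assert (forall y, c <= y <= d -> Cnorm (CInt (fun s => G (mkC s y)) a b) <= 2 * (K * (b - a))).
  { intros y Hy; apply CInt_bound; auto; intros t Ht; apply HB; split; auto. }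
  assert (forall x, a <= x <= b -> Cnorm (CInt (fun t => G (mkC x t)) c d) <= 2 * (K * (d - c))).
  { intros x Hx; apply CInt_bound; auto; intros t Ht; apply HB; split; auto. }
  pose proof (H c ltac:(lra)); pose proof (H d ltac:(lra)); pose proof (H0 a ltac:(lra)); pose proof (H0 b ltac:(lra)).
  lra.
Qed.

(** Goursat's bisection: a rectangle whose boundary integral is too large contains ever smaller ones
    with the same defect, which the affine approximation at their common point excludes. *)
Lemma goursat (G : Cplx -> Cplx) (a0 b0 c0 d0 : R) : a0 <= b0 -> c0 <= d0 ->
  (forall w, in_rect a0 b0 c0 d0 w -> exists L, cder G w L) -> Qrect G a0 b0 c0 d0 = C0.
Proof.
  intros Hab Hcd HG.
  assert (HGc : forall w, in_rect a0 b0 c0 d0 w -> ccont1 G w).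
  { intros w Hw; destruct (HG w Hw) as [L HL]; exact (cder_ccont1 _ _ _ HL). }
  set (A := b0 - a0); set (B := d0 - c0).
  assert (Hpos : forall D n, 0 <= D -> 0 <= D / 2 ^ n <= D).
  { intros D n HD; assert (1 <= 2 ^ n) by (apply pow_R1_Rle; lra).
    assert (0 < / 2 ^ n) by (apply Rinv_0_lt_compat; lra).
    assert (/ 2 ^ n <= 1) by (rewrite <- Rinv_1; apply Rinv_le_contravar; lra).
    unfold Rdiv; nra. }
  assert (Hhalf : forall D n, D / 2 ^ n = 2 * (D / 2 ^ S n)).
  { intros D n; simpl; field; apply pow_nonzero; lra. }
  assert (HA : 0 <= A) by (unfold A; lra); assert (HB : 0 <= B) by (unfold B; lra).
  apply Cnorm_eq0; apply Rle_antisym; [|apply Cnorm_ge0].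
  apply le_epsilon; intros eta Heta; rewrite Rplus_0_l.
  set (S0 := A + B).
  destruct (Req_dec S0 0) as [HS|HS].
  { unfold S0 in HS; assert (a0 = b0) by (unfold A, B in *; lra); assert (c0 = d0) by (unfold A, B in *; lra); subst b0 d0.
    unfold Qrect; match goal with |- Cnorm ?a <= _ => replace a with C0 by ring end.
    rewrite Cnorm_C0; lra. }
  assert (HS0 : 0 < S0) by (unfold S0 in *; lra).
  (* The bound obtained at the end, [4 * eps * S0 ^ 2], is then [eta]. *)
  set (eps := eta / (4 * S0 ^ 2)).
  assert (Heps : 0 < eps) by (apply Rdiv_lt_0_compat; nra).
  (* The bound is quadratic in the side lengths, so that the bounds on four quarters add up to the
     bound on the whole. The premises keep the rectangle inside the original one. *)
  set (P := fun (n : nat) (a c : R) => a0 <= a -> a + A / 2 ^ n <= b0 -> c0 <= c -> c + B / 2 ^ n <= d0 ->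
     Cnorm (Qrect G a (a + A / 2 ^ n) c (c + B / 2 ^ n)) <= 4 * eps * (A / 2 ^ n + B / 2 ^ n) ^ 2).
  assert (HP : P 0%nat a0 c0).
  { apply NNPP; intros HN.
    destruct (nested_quadrants P A B a0 c0 HA HB) as [s [t Hst]]; auto.
    - intros n a c H1 H2 H3 H4 Ha1 Ha2 Hc1 Hc2.
      unfold P in *; rewrite (Hhalf A n), (Hhalf B n) in *.
      pose proof (Hpos A (S n) HA); pose proof (Hpos B (S n) HB).
      set (u := A / 2 ^ S n) in *; set (v := B / 2 ^ S n) in *.
      rewrite (Qrect_split G a (a + 2 * u) c (c + 2 * v) (a + u) (c + v)); try lra.
      + specialize (H1 ltac:(lra) ltac:(lra) ltac:(lra) ltac:(lra)).
        specialize (H2 ltac:(lra) ltac:(lra) ltac:(lra) ltac:(lra)).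
        specialize (H3 ltac:(lra) ltac:(lra) ltac:(lra) ltac:(lra)).
        specialize (H4 ltac:(lra) ltac:(lra) ltac:(lra) ltac:(lra)).
        replace (a + u + u) with (a + 2 * u) in * by ring. replace (c + v + v) with (c + 2 * v) in * by ring.
        eapply Rle_trans; [apply Cnorm_add|].
        eapply Rle_trans; [apply Rplus_le_compat; apply Cnorm_add|].
        nra.
      + intros w [Hw1 Hw2]; apply HGc; split; lra.
    - assert (Hrest : forall n a c, ~ P n a c -> a0 <= a /\ a + A / 2 ^ n <= b0 /\ c0 <= c /\ c + B / 2 ^ n <= d0 /\
         4 * eps * (A / 2 ^ n + B / 2 ^ n) ^ 2 < Cnorm (Qrect G a (a + A / 2 ^ n) c (c + B / 2 ^ n))).
      { intros n a c H; unfold P in H; repeat split; apply Rnot_lt_le || apply Rnot_le_lt; intros H'; apply H; intros; lra. }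
      assert (Hin : in_rect a0 b0 c0 d0 (mkC s t)).
      { destruct (Hst 0%nat) as [a [c [H1 [H2 H3]]]]; apply Hrest in H1; split; simpl Re; simpl Im; lra. }
      destruct (HG _ Hin) as [L HL].
      destruct (HL eps Heps) as [d [Hd K]].
      assert (exists n, S0 / 2 ^ n < d) as [n Hn].
      { destruct (pow_lt_1_zero (/ 2) ltac:(rewrite Rabs_pos_eq; lra) (d / S0)) as [n Hn]; [apply Rdiv_lt_0_compat; lra|].
        exists n; specialize (Hn n (le_n n)); rewrite Rabs_pos_eq in Hn by (apply pow_le; lra).
        rewrite pow_inv in Hn; unfold Rdiv in *.
        apply (Rmult_lt_compat_l S0) in Hn; [|lra].
        replace (S0 * (d * / S0)) with d in Hn by (field; lra); exact Hn. }
      destruct (Hst n) as [a [c [H1 [H2 H3]]]]; apply Hrest in H1.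
      destruct H1 as [Ha1 [Ha2 [Hc1 [Hc2 H1]]]].
      pose proof (Hpos A n HA); pose proof (Hpos B n HB).
      assert (S0 / 2 ^ n = A / 2 ^ n + B / 2 ^ n) as ES by (unfold S0, Rdiv; ring).
      set (u := A / 2 ^ n) in *; set (v := B / 2 ^ n) in *.
      apply (Rlt_not_le _ _ H1).
      set (w0 := mkC s t) in *.
      (* The affine part has a primitive and contributes nothing to the boundary integral; the rest
         is at most [eps] times the size of the rectangle. *)
      set (Aff := fun w => (G w0 -c L *c w0) +c L *c w).
      assert (Qrect Aff a (a + u) c (c + v) = C0) as EQ.
      { apply (Qrect_primitive Aff (fun w => (G w0 -c L *c w0) *c w +c RtoC (/ 2) *c L *c w *c w)); try lra.
        - intros w; apply cder_affine_primitive.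
        - intros w; apply ccont1_affine. }
      assert (forall w, in_rect a (a + u) c (c + v) w -> in_rect a0 b0 c0 d0 w) as Hsub
        by (intros w [Hw1 Hw2]; split; lra).
      replace (Qrect G a (a + u) c (c + v)) with (Qrect (fun w => G w -c Aff w) a (a + u) c (c + v)).
      2:{ rewrite Qrect_sub, EQ; try lra; [ring| |]; intros w Hw; [apply HGc; auto|apply ccont1_affine]. }
      eapply Rle_trans; [apply (Qrect_bound _ _ _ _ _ (eps * (u + v))); try lra; try nra|].
      + intros w Hw; apply ccont1_sub; [apply HGc; auto|apply ccont1_affine].
      + intros w [Hw1 Hw2].
        assert (Cnorm (w -c w0) <= u + v).
        { eapply Rle_trans; [apply Cnorm_le_Re_Im|]; simpl; apply Rplus_le_compat; apply Rabs_le; lra. }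
        specialize (K (w -c w0) ltac:(lra)).
        replace (w0 +c (w -c w0)) with w in K by ring.
        unfold Aff; replace (G w -c (G w0 -c L *c w0 +c L *c w)) with (G w -c G w0 -c L *c (w -c w0)) by ring.
        eapply Rle_trans; [exact K|]; nra.
      + nra. }
  unfold P in HP; simpl in HP; unfold Rdiv in HP; rewrite !Rinv_1, !Rmult_1_r in HP.
  replace (a0 + A) with b0 in HP by (unfold A; ring); replace (c0 + B) with d0 in HP by (unfold B; ring).
  eapply Rle_trans; [apply HP; lra|].
  fold S0; unfold eps; apply Req_le; field; lra.
Qed.

(** * Rules for complex derivatives *)

Lemma cder_const (c z : Cplx) : cder (fun _ => c) z C0.
Proof.
  intros eps Heps; exists 1; split; [lra|]; intros h _.
  replace (c -c c -c C0 *c h) with C0 by ring; rewrite Cnorm_C0; pose proof (Cnorm_ge0 h); nra.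
Qed.

Lemma cder_id (z : Cplx) : cder (fun w => w) z C1.
Proof.
  intros eps Heps; exists 1; split; [lra|]; intros h _.
  replace (z +c h -c z -c C1 *c h) with C0 by ring; rewrite Cnorm_C0; pose proof (Cnorm_ge0 h); nra.
Qed.

Lemma cder_add (f g : Cplx -> Cplx) (z L M : Cplx) :
  cder f z L -> cder g z M -> cder (fun w => f w +c g w) z (L +c M).
Proof.
  intros Hf Hg eps Heps.
  destruct (Hf (eps / 2)) as [d1 [Hd1 K1]]; [lra|]; destruct (Hg (eps / 2)) as [d2 [Hd2 K2]]; [lra|].
  exists (Rmin d1 d2); split; [apply Rmin_glb_lt; auto|].
  intros h Hh; pose proof (Rmin_l d1 d2); pose proof (Rmin_r d1 d2).
  specialize (K1 h ltac:(lra)); specialize (K2 h ltac:(lra)).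
  replace (f (z +c h) +c g (z +c h) -c (f z +c g z) -c (L +c M) *c h) with
    ((f (z +c h) -c f z -c L *c h) +c (g (z +c h) -c g z -c M *c h)) by ring.
  eapply Rle_trans; [apply Cnorm_add|]; lra.
Qed.

Lemma cder_mul (f g : Cplx -> Cplx) (z L M : Cplx) :
  cder f z L -> cder g z M -> cder (fun w => f w *c g w) z (L *c g z +c f z *c M).
Proof.
  intros Hf Hg eps Heps.
  pose proof (Cnorm_ge0 L) as HL; pose proof (Cnorm_ge0 (f z)) as Hfz; pose proof (Cnorm_ge0 (g z)) as Hgz.
  set (S := 3 * (1 + Cnorm L + Cnorm (f z) + Cnorm (g z))).
  assert (0 < eps / S) by (apply Rdiv_lt_0_compat; unfold S; lra).
  assert (eps / S * S = eps) by (field; unfold S; lra).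
  destruct (Hf (eps / S)) as [d1 [Hd1 K1]]; auto; destruct (Hg (eps / S)) as [d2 [Hd2 K2]]; auto.
  destruct (cder_ccont1 _ _ _ Hg (Rmin 1 (eps / S))) as [d3 [Hd3 K3]]; [apply Rmin_glb_lt; lra|].
  pose proof (Rmin_l 1 (eps / S)); pose proof (Rmin_r 1 (eps / S)).
  exists (Rmin d1 (Rmin d2 d3)); split; [repeat apply Rmin_glb_lt; auto|].
  intros h Hh; pose proof (Rmin_l d1 (Rmin d2 d3)); pose proof (Rmin_r d1 (Rmin d2 d3)).
  pose proof (Rmin_l d2 d3); pose proof (Rmin_r d2 d3).
  specialize (K1 h ltac:(lra)); specialize (K2 h ltac:(lra)); specialize (K3 (z +c h)).
  replace (z +c h -c z) with h in K3 by ring; specialize (K3 ltac:(lra)).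
  match goal with |- Cnorm ?a <= _ => replace a with
    ((f (z +c h) -c f z -c L *c h) *c g (z +c h) +c (L *c h *c (g (z +c h) -c g z) +c f z *c (g (z +c h) -c g z -c M *c h)))
    by ring end.
  eapply Rle_trans; [apply Cnorm_add|]; eapply Rle_trans; [apply Rplus_le_compat_l, Cnorm_add|].
  rewrite !Cnorm_mul.
  pose proof (Cnorm_ge0 h).
  assert (Cnorm (g (z +c h)) <= 1 + Cnorm (g z)) by (pose proof (Cnorm_le_sub (g (z +c h)) (g z)); lra).
  pose proof (Cnorm_ge0 (g (z +c h))).
  set (e := eps / S) in *; set (N := Cnorm h) in *.
  assert (0 <= e * N) by nra.
  assert (Cnorm (f (z +c h) -c f z -c L *c h) * Cnorm (g (z +c h)) <= e * N * (1 + Cnorm (g z))).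
  { apply Rmult_le_compat; auto; apply Cnorm_ge0. }
  assert (Cnorm L * N * Cnorm (g (z +c h) -c g z) <= Cnorm L * N * e) by (apply Rmult_le_compat_l; [nra|lra]).
  assert (Cnorm (f z) * Cnorm (g (z +c h) -c g z -c M *c h) <= Cnorm (f z) * (e * N)) by (apply Rmult_le_compat_l; auto).
  assert (e * N * S = eps * N) by (rewrite <- H0; ring).
  unfold S in *. nra.
Qed.

Lemma cder_inv (z : Cplx) : z <> C0 -> cder Cinv z (Copp (Cinv (z *c z))).
Proof.
  intros Hz eps Heps; pose proof (Cnorm_gt0 z Hz) as Nz.
  set (N := Cnorm z) in *.
  assert (0 < eps * (N ^ 3 / 2)) by (apply Rmult_lt_0_compat; auto; assert (0 < N ^ 3) by (apply pow_lt; auto); lra).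
  exists (Rmin (N / 2) (eps * (N ^ 3 / 2))); split; [apply Rmin_glb_lt; lra|].
  intros h Hh; pose proof (Rmin_l (N / 2) (eps * (N ^ 3 / 2))); pose proof (Rmin_r (N / 2) (eps * (N ^ 3 / 2))).
  assert (N / 2 <= Cnorm (z +c h)) as Hw.
  { pose proof (Cnorm_le_sub z (z +c h)) as T; replace (z -c (z +c h)) with (Copp h) in T by ring; rewrite Cnorm_opp in T; fold N in T; lra. }
  assert (z +c h <> C0) as Hne by (apply Cnorm_neq0; lra).
  replace (Cinv (z +c h) -c Cinv z -c Copp (Cinv (z *c z)) *c h) with ((h *c h) /c (z *c z *c (z +c h)))
    by (field; auto).
  rewrite Cnorm_div by (repeat apply Cmul_neq0; auto).
  rewrite !Cnorm_mul; fold N.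
  pose proof (Cnorm_ge0 h).
  apply (Rmult_le_reg_r (N * N * Cnorm (z +c h))); [repeat apply Rmult_lt_0_compat; lra|].
  unfold Rdiv; rewrite Rmult_assoc, Rinv_l, Rmult_1_r by (apply Rgt_not_eq; repeat apply Rmult_lt_0_compat; lra).
  assert (eps * (N ^ 3 / 2) <= eps * (N * N * Cnorm (z +c h))).
  { apply Rmult_le_compat_l; [lra|]. simpl. nra. }
  nra.
Qed.

(** * Mean values over circles *)

Definition cis (t : R) : Cplx := cexp (mkC 0 t).

Lemma Cnorm_cis (t : R) : Cnorm (cis t) = 1.
Proof. unfold cis; rewrite Cnorm_cexp; simpl; apply exp_0. Qed.

Lemma cexp_polar (s t : R) : cexp (mkC s t) = RtoC (exp s) *c cis t.
Proof. apply Cplx_eq; unfold cis, cexp; simpl; rewrite exp_0; ring. Qed.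

Lemma Cnorm_circle (r t : R) : 0 <= r -> Cnorm (RtoC r *c cis t) = r.
Proof. intros; rewrite Cnorm_mul, Cnorm_cis, Cnorm_RtoC, Rabs_pos_eq; lra. Qed.

Lemma rder_cis (t : R) : rder cis t (Ci *c cis t).
Proof.
  unfold cis. replace (Ci *c cexp (mkC 0 t)) with (cexp (mkC 0 t) *c Ci) by ring.
  apply (rder_comp cexp (fun t => mkC 0 t)); [apply cder_cexp|apply rder_vertical].
Qed.

Lemma rcont_circle (r t : R) : rcont (fun t => RtoC r *c cis t) t.
Proof. apply rcont_mul; [apply rcont_const|]; apply (rder_rcont _ _ _ (rder_cis t)). Qed.

(** Under [cexp] the annulus between two circles is the image of a rectangle of height 2 pi whose
    horizontal sides cancel by periodicity. Goursat thus makes the mean independent of the radius,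
    and continuity at the centre gives its value. At the centre continuity is enough, so that the
    result applies to difference quotients. *)
Lemma circle_mean (f : Cplx -> Cplx) (r : R) (rho : R) :
  (forall z, Cnorm z < r -> ccont1 f z) ->
  (forall z, 0 < Cnorm z < r -> exists L, cder f z L) ->
  0 < rho < r ->
  CInt (fun t => f (RtoC rho *c cis t)) 0 (2 * PI) = RtoC (2 * PI) *c f C0.
Proof.
  intros Hc Hd Hrho.
  pose proof PI_RGT_0 as HPI.
  assert (Hcirc : forall a, 0 < a < r -> rcont_on (fun t => f (RtoC a *c cis t)) 0 (2 * PI)).
  { intros a Ha t _; apply (rcont_comp f); [apply Hc; rewrite Cnorm_circle; lra|apply rcont_circle]. }
  assert (Hconst : forall a, 0 < a <= rho ->
    CInt (fun t => f (RtoC a *c cis t)) 0 (2 * PI) = CInt (fun t => f (RtoC rho *c cis t)) 0 (2 * PI)).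
  { intros a Ha.
    assert (ln a <= ln rho) as Hln by (apply ln_le; lra).
    pose proof (goursat (fun w => f (cexp w)) (ln a) (ln rho) 0 (2 * PI) Hln ltac:(lra)) as HQ.
    assert (Qrect (fun w => f (cexp w)) (ln a) (ln rho) 0 (2 * PI) = C0) as E.
    { apply HQ; intros w [Hw1 Hw2].
      assert (0 < Cnorm (cexp w) < r) as Hn.
      { rewrite Cnorm_cexp; split; [apply exp_pos|].
        apply Rle_lt_trans with (exp (ln rho)); [|rewrite exp_ln; lra].
        destruct Hw1 as [_ [Hw1|Hw1]]; [left; apply exp_increasing; auto|rewrite Hw1; lra]. }
      destruct (Hd _ Hn) as [L HL]; exists (L *c cexp w); apply (cder_comp f cexp); [exact HL|apply cder_cexp]. }
    unfold Qrect in E.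
    assert (forall s, cexp (mkC s (2 * PI)) = cexp (mkC s 0)) as Hper
      by (intros s; unfold cexp; simpl; rewrite cos_2PI, sin_2PI, cos_0, sin_0; reflexivity).
    assert (CInt (fun s => f (cexp (mkC s (2 * PI)))) (ln a) (ln rho) = CInt (fun s => f (cexp (mkC s 0))) (ln a) (ln rho)) as E1
      by (apply CInt_ext; auto; intros s _; rewrite Hper; reflexivity).
    rewrite E1 in E.
    assert (forall b, 0 < b -> (fun t => f (cexp (mkC (ln b) t))) = (fun t => f (RtoC b *c cis t))) as E2.
    { intros b Hb; apply functional_extensionality; intros t; rewrite cexp_polar, exp_ln; auto. }
    rewrite !E2 in E by lra.
    match type of E with ?x -c ?x +c Ci *c (?u -c ?v) = _ => assert (Ci *c (u -c v) = C0) as E3 by (rewrite <- E; ring) end.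
    apply Cmul_integral in E3; destruct E3 as [E3|E3]; [injection E3; lra|].
    symmetry; apply Csub_eq0; exact E3. }
  apply Csub_eq0, Cnorm_eq0, Rle_antisym; [|apply Cnorm_ge0].
  apply le_epsilon; intros eps Heps; rewrite Rplus_0_l.
  destruct (Hc C0 ltac:(rewrite Cnorm_C0; lra) (eps / (4 * PI))) as [d [Hdp K]]; [apply Rdiv_lt_0_compat; lra|].
  set (a := Rmin rho (d / 2)).
  assert (0 < a) by (apply Rmin_glb_lt; lra).
  assert (a <= rho) by apply Rmin_l; assert (a <= d / 2) by apply Rmin_r.
  rewrite <- (Hconst a) by lra.
  replace (RtoC (2 * PI) *c f C0) with (CInt (fun _ => f C0) 0 (2 * PI)) by (rewrite CInt_const; f_equal; f_equal; ring).
  rewrite <- (CInt_sub (fun t => f (RtoC a *c cis t))); [|lra|apply Hcirc; lra|intros t _; apply rcont_const].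
  eapply Rle_trans; [apply (CInt_bound _ _ _ (eps / (4 * PI)))|].
  - lra.
  - intros t Ht; apply rcont_sub; [apply Hcirc; [lra|auto]|apply rcont_const].
  - intros t Ht; left; apply K; replace (RtoC a *c cis t -c C0) with (RtoC a *c cis t) by ring; rewrite Cnorm_circle; lra.
  - apply Req_le; field; lra.
Qed.

Lemma cder_shift (f : Cplx -> Cplx) (a z L : Cplx) : cder f (a +c z) L -> cder (fun w => f (a +c w)) z L.
Proof.
  intros H eps Heps; destruct (H eps Heps) as [d [Hd K]]; exists d; split; auto; intros h Hh.
  replace (a +c (z +c h)) with (a +c z +c h) by ring; auto.
Qed.

Definition hol1 (f : Cplx -> Cplx) (z0 : Cplx) (r : R) : Prop :=
  forall z, Cnorm (z -c z0) < r -> exists L, cder f z L.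

Lemma rcont_dq_circle (f : Cplx -> Cplx) (z : Cplx) (r rho : R) :
  hol1 f z r -> 0 < rho < r -> rcont_on (fun t => dq f z (RtoC rho *c cis t)) 0 (2 * PI).
Proof.
  intros Hf Hrho t _.
  set (w := RtoC rho *c cis t).
  assert (Cnorm w = rho) as Ew by (apply Cnorm_circle; lra).
  assert (w <> C0) as Hw by (apply Cnorm_neq0; lra).
  apply (rcont_comp (dq f z) (fun t => RtoC rho *c cis t)); [|apply rcont_circle]; fold w.
  destruct (Hf (z +c w)) as [L HL].
  { replace (z +c w -c z) with w by ring; lra. }
  apply (cder_ccont1 _ _ ((L +c C0) *c Cinv w +c (f (z +c w) -c f z) *c (Copp (Cinv (w *c w))))).
  apply (cder_mul (fun h => f (z +c h) +c Copp (f z)) Cinv); [|apply cder_inv; auto].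
  apply cder_add; [apply cder_shift; auto|apply cder_const].
Qed.

(** The difference quotient, completed by [L] at 0, is continuous there and differentiable
    elsewhere, so [circle_mean] applies. This plays the part of Cauchy's formula: the derivative is
    a mean of difference quotients. *)
Lemma cder_circle (f : Cplx -> Cplx) (z L : Cplx) (r rho : R) :
  hol1 f z r -> cder f z L -> 0 < rho < r ->
  RtoC (2 * PI) *c L = CInt (fun t => dq f z (RtoC rho *c cis t)) 0 (2 * PI).
Proof.
  intros Hf HL Hrho.
  set (g := fun h => if excluded_middle_informative (h = C0) then L else dq f z h).
  assert (g C0 = L) as Eg by (unfold g; destruct excluded_middle_informative; congruence).
  assert (forall h, h <> C0 -> g h = dq f z h) as Eg' by (intros h Hh; unfold g; destruct excluded_middle_informative; congruence).
  assert (forall h, 0 < Cnorm h < r -> exists M, cder g h M) as Hg.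
  { intros h Hh; assert (h <> C0) as Hh0 by (apply Cnorm_neq0; lra).
    destruct (Hf (z +c h)) as [M HM]; [replace (z +c h -c z) with h by ring; lra|].
    exists ((M +c C0) *c Cinv h +c (f (z +c h) -c f z) *c (Copp (Cinv (h *c h)))).
    apply (cder_ext_loc (dq f z) g h _ (Cnorm h)); [lra| |].
    - intros w Hw; symmetry; apply Eg'; intros ->.
      replace (C0 -c h) with (Copp h) in Hw by ring; rewrite Cnorm_opp in Hw; lra.
    - apply (cder_mul (fun h => f (z +c h) +c Copp (f z)) Cinv); [|apply cder_inv; auto].
      apply cder_add; [apply cder_shift; auto|apply cder_const]. }
  rewrite <- Eg, <- (circle_mean g r rho); auto.
  - apply CInt_ext; [pose proof PI_RGT_0; lra|]; intros t _; apply Eg', Cnorm_neq0; rewrite Cnorm_circle; lra.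
  - intros h Hh; destruct (excluded_middle_informative (h = C0)) as [->|Hn].
    + intros eps Heps; destruct (HL (eps / 2)) as [d [Hd K]]; [lra|].
      exists d; split; auto; intros w Hw; rewrite Eg.
      replace (w -c C0) with w in Hw by ring.
      destruct (excluded_middle_informative (w = C0)) as [->|Hw0].
      * rewrite Eg; replace (L -c L) with C0 by ring; rewrite Cnorm_C0; auto.
      * rewrite (Eg' w Hw0); specialize (K w Hw); pose proof (Cnorm_gt0 w Hw0).
        apply (Rmult_lt_reg_r (Cnorm w)); auto; rewrite <- Cnorm_mul.
        replace ((dq f z w -c L) *c w) with (f (z +c w) -c f z -c L *c w) by (unfold dq; field; auto).
        nra.
    + pose proof (Cnorm_gt0 h Hn); destruct (Hg h) as [M HM]; [lra|]; exact (cder_ccont1 _ _ _ HM).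
Qed.

(** * Cauchy estimates, Taylor expansion and removable singularities in one variable *)

Lemma Rmult_le_cancel_2PI (a b : R) : a * (2 * PI) <= b * (2 * PI) -> a <= b.
Proof. intros; apply (Rmult_le_reg_r (2 * PI)); auto; pose proof PI_RGT_0; lra. Qed.

(** On the circle of radius [r / 2] the quotients are at most [4 * M / r]; the last factor 2 is that
    of [CInt_bound]. *)
Lemma cder_bound (f : Cplx -> Cplx) (z L : Cplx) (r M : R) :
  0 < r -> hol1 f z r -> (forall w, Cnorm (w -c z) < r -> Cnorm (f w) <= M) -> cder f z L ->
  Cnorm L <= 8 * M / r.
Proof.
  intros Hr Hf HM HL; pose proof PI_RGT_0 as HPI.
  pose proof (cder_circle f z L r (r / 2) Hf HL ltac:(lra)) as E.
  apply (f_equal Cnorm) in E; rewrite Cnorm_mul, Cnorm_RtoC, Rabs_pos_eq in E by lra.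
  apply Rmult_le_cancel_2PI; rewrite Rmult_comm, E.
  eapply Rle_trans; [apply (CInt_bound _ _ _ (4 * M / r))|].
  - lra.
  - apply (rcont_dq_circle f z r); [auto|lra].
  - intros t _; set (w := RtoC (r / 2) *c cis t).
    assert (Cnorm w = r / 2) as Ew by (apply Cnorm_circle; lra).
    unfold dq; rewrite Cnorm_div by (apply Cnorm_neq0; lra); rewrite Ew.
    assert (Cnorm (f (z +c w)) <= M) by (apply HM; replace (z +c w -c z) with w by ring; lra).
    assert (Cnorm (f z) <= M) by (apply HM; replace (z -c z) with C0 by ring; rewrite Cnorm_C0; lra).
    pose proof (Cnorm_sub (f (z +c w)) (f z)).
    apply (Rmult_le_reg_r (r / 2)); [lra|].
    replace (4 * M / r * (r / 2)) with (2 * M) by (field; lra).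
    unfold Rdiv at 1; rewrite Rmult_assoc, Rinv_l, Rmult_1_r by lra. lra.
  - apply Req_le; field; lra.
Qed.

Lemma rder_segment (f : Cplx -> Cplx) (a b L : Cplx) (t : R) :
  cder f (a +c RtoC t *c (b -c a)) L -> rder (fun t => f (a +c RtoC t *c (b -c a))) t (L *c (b -c a)).
Proof.
  intros H; apply (rder_comp f (fun t => a +c RtoC t *c (b -c a))); auto.
  assert (rder RtoC t C1) as H1 by (apply (rder_RtoC id t 1), derivable_pt_lim_id).
  pose proof (rder_add _ _ _ _ _ (rder_const a t) (rder_mul _ _ _ _ _ H1 (rder_const (b -c a) t))) as K.
  cbv beta in K; replace (C0 +c (C1 *c (b -c a) +c RtoC t *c C0)) with (b -c a) in K by ring; exact K.
Qed.

Lemma segment_in_disc (a b z0 : Cplx) (r t : R) : 0 <= t <= 1 ->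
  Cnorm (a -c z0) < r -> Cnorm (b -c z0) < r -> Cnorm (a +c RtoC t *c (b -c a) -c z0) < r.
Proof.
  intros Ht Ha Hb.
  replace (a +c RtoC t *c (b -c a) -c z0) with (RtoC (1 - t) *c (a -c z0) +c RtoC t *c (b -c z0))
    by (rewrite RtoC_sub; replace (RtoC 1) with C1 by reflexivity; ring).
  eapply Rle_lt_trans; [apply Cnorm_add|]; rewrite !Cnorm_mul, !Cnorm_RtoC, !Rabs_pos_eq by lra.
  destruct (Req_dec t 0) as [->|]; [lra|]; nra.
Qed.

Lemma hol1_increment (f : Cplx -> Cplx) (a b z0 : Cplx) (r K : R) :
  (forall z, Cnorm (z -c z0) < r -> exists L, cder f z L /\ Cnorm L <= K) ->
  Cnorm (a -c z0) < r -> Cnorm (b -c z0) < r -> Cnorm (f b -c f a) <= 2 * (K * Cnorm (b -c a)).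
Proof.
  intros Hf Ha Hb.
  set (df := fun z => epsilon (inhabits C0) (fun L => cder f z L /\ Cnorm L <= K)).
  assert (forall z, Cnorm (z -c z0) < r -> cder f z (df z) /\ Cnorm (df z) <= K) as Hdf
    by (intros z Hz; exact (epsilon_spec (inhabits C0) _ (Hf z Hz))).
  pose proof (rder_increment_const (fun t => f (a +c RtoC t *c (b -c a)))
    (fun t => df (a +c RtoC t *c (b -c a)) *c (b -c a)) (K * Cnorm (b -c a)) 0 1 ltac:(lra)) as H.
  cbv beta in H; replace (a +c RtoC 1 *c (b -c a)) with b in H by (replace (RtoC 1) with C1 by reflexivity; ring).
  replace (a +c RtoC 0 *c (b -c a)) with a in H by (replace (RtoC 0) with C0 by reflexivity; ring).
  replace (2 * (K * Cnorm (b -c a))) with (2 * (K * Cnorm (b -c a) * (1 - 0))) by ring.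
  apply H.
  - intros t Ht; apply rder_segment, Hdf, segment_in_disc; auto.
  - intros t Ht; rewrite Cnorm_mul; apply Rmult_le_compat_r; [apply Cnorm_ge0|]; apply Hdf, segment_in_disc; auto.
Qed.

Lemma hol1_sub_disc (f : Cplx -> Cplx) (z0 z : Cplx) (r r' : R) :
  hol1 f z0 r -> Cnorm (z -c z0) + r' <= r -> hol1 f z r'.
Proof.
  intros H Hr w Hw; apply H; pose proof (Cnorm_sub_tri w z z0); lra.
Qed.

Lemma bound_sub_disc (f : Cplx -> Cplx) (z0 z : Cplx) (r r' M : R) :
  (forall w, Cnorm (w -c z0) < r -> Cnorm (f w) <= M) -> Cnorm (z -c z0) + r' <= r ->
  forall w, Cnorm (w -c z) < r' -> Cnorm (f w) <= M.
Proof. intros H Hr w Hw; apply H; pose proof (Cnorm_sub_tri w z z0); lra. Qed.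

Lemma hol1_lipschitz (f : Cplx -> Cplx) (z0 a b : Cplx) (r M : R) :
  0 < r -> hol1 f z0 r -> (forall w, Cnorm (w -c z0) < r -> Cnorm (f w) <= M) ->
  Cnorm (a -c z0) < r / 2 -> Cnorm (b -c z0) < r / 2 -> Cnorm (f b -c f a) <= 32 * M / r * Cnorm (b -c a).
Proof.
  intros Hr Hf HM Ha Hb.
  replace (32 * M / r * Cnorm (b -c a)) with (2 * (16 * M / r * Cnorm (b -c a))) by (field; lra).
  apply (hol1_increment f a b z0 (r / 2)); auto.
  intros z Hz; destruct (Hf z) as [L HL]; [lra|]; exists L; split; auto.
  replace (16 * M / r) with (8 * M / (r / 2)) by (field; lra).
  apply (cder_bound f z L (r / 2) M); auto; [lra| |].
  - apply (hol1_sub_disc f z0 z r); auto; lra.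
  - apply (bound_sub_disc f z0 z r); auto; lra.
Qed.

(** Both derivatives are means over circles of the same radius [r / 8], and the difference of the
    quotients is made of two increments of [f] controlled by [hol1_lipschitz]. Second derivatives do
    not enter. *)
Lemma cder_lipschitz (f : Cplx -> Cplx) (z0 a b La Lb : Cplx) (r M : R) :
  0 < r -> hol1 f z0 r -> (forall w, Cnorm (w -c z0) < r -> Cnorm (f w) <= M) ->
  Cnorm (a -c z0) < r / 4 -> Cnorm (b -c z0) < r / 4 -> cder f a La -> cder f b Lb ->
  Cnorm (Lb -c La) <= 1024 * M / r ^ 2 * Cnorm (b -c a).
Proof.
  intros Hr Hf HM Ha Hb HLa HLb; pose proof PI_RGT_0 as HPI.
  assert (Hfa : hol1 f a (r / 4)) by (apply (hol1_sub_disc f z0 a r); auto; lra).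
  assert (Hfb : hol1 f b (r / 4)) by (apply (hol1_sub_disc f z0 b r); auto; lra).
  pose proof (cder_circle f a La (r / 4) (r / 8) Hfa HLa ltac:(lra)) as Ea.
  pose proof (cder_circle f b Lb (r / 4) (r / 8) Hfb HLb ltac:(lra)) as Eb.
  pose proof (rcont_dq_circle f a (r / 4) (r / 8) Hfa ltac:(lra)) as Ca.
  pose proof (rcont_dq_circle f b (r / 4) (r / 8) Hfb ltac:(lra)) as Cb.
  assert (RtoC (2 * PI) *c (Lb -c La) =
    CInt (fun t => dq f b (RtoC (r / 8) *c cis t) -c dq f a (RtoC (r / 8) *c cis t)) 0 (2 * PI)) as E
    by (rewrite CInt_sub; auto; [rewrite <- Ea, <- Eb; ring|lra]).
  apply (f_equal Cnorm) in E; rewrite Cnorm_mul, Cnorm_RtoC, Rabs_pos_eq in E by lra.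
  apply Rmult_le_cancel_2PI; rewrite Rmult_comm, E.
  eapply Rle_trans; [apply (CInt_bound _ _ _ (512 * M / r ^ 2 * Cnorm (b -c a)))|].
  - lra.
  - intros t Ht; apply rcont_sub; auto.
  - intros t _; set (w := RtoC (r / 8) *c cis t).
    assert (Cnorm w = r / 8) as Ew by (apply Cnorm_circle; lra).
    assert (w <> C0) by (apply Cnorm_neq0; lra).
    replace (dq f b w -c dq f a w) with (((f (b +c w) -c f (a +c w)) -c (f b -c f a)) /c w) by (unfold dq; field; auto).
    rewrite Cnorm_div by auto; rewrite Ew.
    assert (forall c, Cnorm (c -c z0) < r / 4 -> Cnorm (c +c w -c z0) < r / 2) as Hcw.
    { intros c Hc; replace (c +c w -c z0) with ((c -c z0) +c w) by ring; pose proof (Cnorm_add (c -c z0) w); lra. }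
    pose proof (hol1_lipschitz f z0 (a +c w) (b +c w) r M Hr Hf HM (Hcw a Ha) (Hcw b Hb)) as L1.
    pose proof (hol1_lipschitz f z0 a b r M Hr Hf HM ltac:(lra) ltac:(lra)) as L2.
    replace (b +c w -c (a +c w)) with (b -c a) in L1 by ring.
    pose proof (Cnorm_sub (f (b +c w) -c f (a +c w)) (f b -c f a)).
    apply (Rmult_le_reg_r (r / 8)); [lra|].
    replace (512 * M / r ^ 2 * Cnorm (b -c a) * (r / 8)) with (2 * (32 * M / r * Cnorm (b -c a))) by (field; lra).
    unfold Rdiv at 1; rewrite Rmult_assoc, Rinv_l, Rmult_1_r by lra. lra.
  - apply Req_le; field; lra.
Qed.

(** Along the segment the derivative of the remainder is [(f' - L) h], and [cder_lipschitz] bounds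
    [f' - L] by a multiple of the modulus of [h]. *)
Lemma hol1_taylor (f : Cplx -> Cplx) (z0 L h : Cplx) (r M : R) :
  0 < r -> hol1 f z0 r -> (forall w, Cnorm (w -c z0) < r -> Cnorm (f w) <= M) -> cder f z0 L ->
  Cnorm h < r / 4 -> Cnorm (f (z0 +c h) -c f z0 -c L *c h) <= 2048 * M / r ^ 2 * Cnorm h ^ 2.
Proof.
  intros Hr Hf HM HL Hh.
  assert (Cnorm (z0 -c z0) < r / 4) as H0 by (replace (z0 -c z0) with C0 by ring; rewrite Cnorm_C0; lra).
  destruct (Req_dec (Cnorm h) 0) as [E|E].
  { apply Cnorm_eq0 in E; subst h; replace (z0 +c C0) with z0 by ring.
    replace (f z0 -c f z0 -c L *c C0) with C0 by ring; rewrite Cnorm_C0; lra. }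
  set (K := 1024 * M / r ^ 2 * Cnorm h).
  assert (0 <= M) as HM0 by (eapply Rle_trans; [apply Cnorm_ge0|apply (HM z0)]; lra).
  pose proof (Cnorm_ge0 h).
  assert (0 <= 1024 * M / r ^ 2) by (apply Rmult_le_pos; [lra|left; apply Rinv_0_lt_compat; nra]).
  set (r' := Rmin (r / 4) (2 * Cnorm h)).
  assert (forall t, 0 <= t <= 1 -> Cnorm (RtoC t *c h) <= Cnorm h) as Hth.
  { intros t Ht; rewrite Cnorm_mul, Cnorm_RtoC, Rabs_pos_eq by lra; nra. }
  assert (forall t, 0 <= t <= 1 -> exists L', cder f (z0 +c RtoC t *c h) L' /\ Cnorm (L' -c L) <= K) as HD.
  { intros t Ht; specialize (Hth t Ht).
    destruct (Hf (z0 +c RtoC t *c h)) as [L' HL']; [replace (z0 +c RtoC t *c h -c z0) with (RtoC t *c h) by ring; lra|].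
    exists L'; split; auto.
    eapply Rle_trans; [apply (cder_lipschitz f z0 z0 (z0 +c RtoC t *c h) L L' r M); auto;
      replace (z0 +c RtoC t *c h -c z0) with (RtoC t *c h) by ring; lra|].
    replace (z0 +c RtoC t *c h -c z0) with (RtoC t *c h) by ring.
    unfold K; apply Rmult_le_compat_l; auto. }
  set (df := fun t => epsilon (inhabits C0) (fun L' => cder f (z0 +c RtoC t *c h) L' /\ Cnorm (L' -c L) <= K)).
  assert (forall t, 0 <= t <= 1 -> cder f (z0 +c RtoC t *c h) (df t) /\ Cnorm (df t -c L) <= K) as Hdf
    by (intros t Ht; exact (epsilon_spec (inhabits C0) _ (HD t Ht))).
  pose proof (rder_increment_const (fun t => f (z0 +c RtoC t *c h) +c Copp L *c (RtoC t *c h))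
    (fun t => df t *c h +c Copp L *c (C1 *c h +c RtoC t *c C0)) (K * Cnorm h) 0 1 ltac:(lra)) as HI.
  assert (Cnorm (f (z0 +c h) -c f z0 -c L *c h) <= 2 * (K * Cnorm h * (1 - 0))) as HJ.
  { replace (f (z0 +c h) -c f z0 -c L *c h) with
      (f (z0 +c RtoC 1 *c h) +c Copp L *c (RtoC 1 *c h) -c (f (z0 +c RtoC 0 *c h) +c Copp L *c (RtoC 0 *c h))).
    - apply HI.
      + intros t Ht; apply rder_add.
        * pose proof (rder_segment f z0 (z0 +c h) (df t) t) as Hs.
          replace (z0 +c h -c z0) with h in Hs by ring; apply Hs, Hdf; auto.
        * apply rder_scal, (rder_mul RtoC (fun _ => h)); [|apply rder_const].
          apply (rder_RtoC id t 1), derivable_pt_lim_id.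
      + intros t Ht; replace (df t *c h +c Copp L *c (C1 *c h +c RtoC t *c C0)) with ((df t -c L) *c h) by ring.
        rewrite Cnorm_mul; apply Rmult_le_compat_r; auto; apply Hdf; auto.
    - replace (RtoC 1) with C1 by reflexivity; replace (RtoC 0) with C0 by reflexivity.
      replace (C1 *c h) with h by ring. replace (z0 +c C0 *c h) with z0 by ring. ring. }
  eapply Rle_trans; [exact HJ|]; unfold K; apply Req_le; field; lra.
Qed.

(** The constant depends on [f] only through [M] and [r]. The estimate is therefore uniform over
    families of functions, in the form asked for by [dq_cauchy_cder]. *)
Lemma hol1_dq_cauchy (f : Cplx -> Cplx) (z0 h h' : Cplx) (r M : R) :
  0 < r -> hol1 f z0 r -> (forall w, Cnorm (w -c z0) < r -> Cnorm (f w) <= M) ->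
  0 < Cnorm h < r / 4 -> 0 < Cnorm h' < r / 4 ->
  Cnorm (dq f z0 h -c dq f z0 h') <= 2048 * M / r ^ 2 * (Cnorm h + Cnorm h').
Proof.
  intros Hr Hf HM Hh Hh'.
  destruct (Hf z0) as [L HL]; [replace (z0 -c z0) with C0 by ring; rewrite Cnorm_C0; lra|].
  assert (forall k, 0 < Cnorm k < r / 4 -> Cnorm (dq f z0 k -c L) <= 2048 * M / r ^ 2 * Cnorm k) as H.
  { intros k Hk; assert (k <> C0) as Hk0 by (apply Cnorm_neq0; lra).
    apply (Rmult_le_reg_r (Cnorm k)); [lra|]; rewrite <- Cnorm_mul.
    replace ((dq f z0 k -c L) *c k) with (f (z0 +c k) -c f z0 -c L *c k) by (unfold dq; field; auto).
    eapply Rle_trans; [apply (hol1_taylor f z0 L k r M); auto; lra|]; apply Req_le; ring. }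
  eapply Rle_trans; [apply (Cnorm_sub_tri _ L)|].
  rewrite (Cnorm_sub_sym L); pose proof (H h Hh); pose proof (H h' Hh'); lra.
Qed.

(** [D b] is a circle mean in [a] of quotients that are holomorphic in [b] with uniform bounds;
    hence the quotients of [D] satisfy a Cauchy condition. The statement serves both the second
    derivative in one variable and the mixed partial derivatives. *)
Lemma mixed_derivative (F : Cplx -> Cplx -> Cplx) (D : Cplx -> Cplx) (r M : R) :
  0 < r ->
  (forall b, Cnorm b < r -> hol1 (fun a => F a b) C0 r) ->
  (forall a, Cnorm a < r -> hol1 (F a) C0 r) ->
  (forall a b, Cnorm a < r -> Cnorm b < r -> Cnorm (F a b) <= M) ->
  (forall b, Cnorm b < r -> cder (fun a => F a b) C0 (D b)) ->
  exists L, cder D C0 L.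
Proof.
  intros Hr H1 H2 HM HD; pose proof PI_RGT_0 as HPI.
  set (w := fun t => RtoC (r / 2) *c cis t).
  assert (Hw : forall t, Cnorm (w t) = r / 2) by (intros; apply Cnorm_circle; lra).
  assert (Hw0 : forall t, w t <> C0) by (intros t; apply Cnorm_neq0; rewrite Hw; lra).
  assert (Hcont : forall b, Cnorm b < r -> rcont_on (fun t => dq (fun a => F a b) C0 (w t)) 0 (2 * PI)).
  { intros b Hb; apply (rcont_dq_circle _ _ r); [apply H1; auto|lra]. }
  assert (Hint : forall b, Cnorm b < r -> RtoC (2 * PI) *c D b = CInt (fun t => dq (fun a => F a b) C0 (w t)) 0 (2 * PI)).
  { intros b Hb; apply (cder_circle _ _ _ r); [apply H1; auto|apply HD; auto|lra]. }
  assert (HC0 : Cnorm C0 < r) by (rewrite Cnorm_C0; lra).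
  set (G := fun h t => Cinv h *c (dq (fun a => F a h) C0 (w t) -c dq (fun a => F a C0) C0 (w t))).
  assert (HG : forall h, Cnorm h < r -> rcont_on (G h) 0 (2 * PI)).
  { intros h Hh t Ht; apply rcont_mul; [apply rcont_const|apply rcont_sub; apply Hcont; auto]. }
  assert (Hdq : forall h, 0 < Cnorm h < r -> RtoC (2 * PI) *c dq D C0 h = CInt (G h) 0 (2 * PI)).
  { intros h Hh; assert (h <> C0) by (apply Cnorm_neq0; lra).
    unfold G; rewrite (CInt_scal (fun t => dq (fun a => F a h) C0 (w t) -c dq (fun a => F a C0) C0 (w t)));
      [|lra|intros t Ht; apply rcont_sub; apply Hcont; auto; lra].
    rewrite CInt_sub; [|lra|apply Hcont; lra|apply Hcont; auto].
    rewrite <- !Hint by (auto; lra). unfold dq; replace (C0 +c h) with h by ring; field; auto. }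
  set (K := 2048 * M / r ^ 2).
  apply (dq_cauchy_cder D C0 (2 * (4 * K / r)) (r / 4)); [lra|].
  intros h h' Hh Hh'.
  apply Rmult_le_cancel_2PI.
  assert (RtoC (2 * PI) *c (dq D C0 h -c dq D C0 h') = CInt (fun t => G h t -c G h' t) 0 (2 * PI)) as E.
  { rewrite CInt_sub; [|lra|apply HG; lra|apply HG; lra]; rewrite <- !Hdq by lra; ring. }
  apply (f_equal Cnorm) in E; rewrite Cnorm_mul, Cnorm_RtoC, Rabs_pos_eq in E by lra.
  rewrite Rmult_comm, E.
  eapply Rle_trans; [apply (CInt_bound _ _ _ (4 * K / r * (Cnorm h + Cnorm h')))|].
  - lra.
  - intros t Ht; apply rcont_sub; apply HG; auto; lra.
  - intros t _.
    assert (h <> C0) by (apply Cnorm_neq0; lra); assert (h' <> C0) by (apply Cnorm_neq0; lra).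
    (* Difference quotients in [a] and in [b] commute, so the estimate in [b] can be used at
       [a = w t] and at [a = 0]. *)
    replace (G h t -c G h' t) with (((dq (F (w t)) C0 h -c dq (F (w t)) C0 h') -c (dq (F C0) C0 h -c dq (F C0) C0 h')) /c w t).
    2:{ unfold G, dq; replace (C0 +c h) with h by ring; replace (C0 +c h') with h' by ring; replace (C0 +c w t) with (w t) by ring.
        field; repeat split; auto. }
    rewrite Cnorm_div, Hw by auto.
    assert (forall a, Cnorm a < r -> Cnorm (dq (F a) C0 h -c dq (F a) C0 h') <= K * (Cnorm h + Cnorm h')) as HK.
    { intros a Ha; apply hol1_dq_cauchy; auto; intros b Hb; apply HM; auto; replace (b -c C0) with b in Hb by ring; auto. }
    pose proof (HK (w t) ltac:(rewrite Hw; lra)); pose proof (HK C0 HC0).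
    match goal with |- Cnorm (?u -c ?v) / _ <= _ => pose proof (Cnorm_sub u v) end.
    apply (Rmult_le_reg_r (r / 2)); [lra|].
    replace (4 * K / r * (Cnorm h + Cnorm h') * (r / 2)) with (2 * (K * (Cnorm h + Cnorm h'))) by (field; lra).
    unfold Rdiv at 1; rewrite Rmult_assoc, Rinv_l, Rmult_1_r by lra. lra.
  - apply Req_le; ring.
Qed.

(** This is [mixed_derivative] for [f (z0 + a + b)], whose derivative in [a] at 0 is
    [df (z0 + b)]. *)
Lemma hol1_derivative (f df : Cplx -> Cplx) (z0 : Cplx) (r : R) :
  0 < r -> (forall z, Cnorm (z -c z0) < r -> cder f z (df z)) -> exists L, cder df z0 L.
Proof.
  intros Hr Hf.
  assert (Hc : ccont1 f z0) by (apply (cder_ccont1 _ _ (df z0)), Hf; replace (z0 -c z0) with C0 by ring; rewrite Cnorm_C0; lra).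
  destruct (Hc 1) as [d [Hd K]]; [lra|].
  set (r' := Rmin r d / 2).
  assert (0 < Rmin r d) by (apply Rmin_glb_lt; auto).
  pose proof (Rmin_l r d); pose proof (Rmin_r r d).
  assert (forall a b, Cnorm a < r' -> Cnorm b < r' -> Cnorm (z0 +c a +c b -c z0) < Rmin r d) as Hab.
  { intros a b Ha Hb; replace (z0 +c a +c b -c z0) with (a +c b) by ring; pose proof (Cnorm_add a b); unfold r' in *; lra. }
  destruct (mixed_derivative (fun a b => f (z0 +c a +c b)) (fun b => df (z0 +c b)) r' (1 + Cnorm (f z0))) as [L HL].
  - unfold r'; lra.
  - intros b Hb a Ha; replace (a -c C0) with a in Ha by ring; exists (df (z0 +c a +c b)).
    pose proof (cder_shift f (z0 +c b) a (df (z0 +c a +c b))) as HS.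
    replace (z0 +c b +c a) with (z0 +c a +c b) in HS by ring.
    specialize (HS (Hf _ (Rlt_le_trans _ _ _ (Hab a b Ha Hb) (Rmin_l r d)))).
    replace (fun a0 : Cplx => f (z0 +c a0 +c b)) with (fun w => f (z0 +c b +c w)); auto.
    apply functional_extensionality; intros w; f_equal; ring.
  - intros a Ha b Hb; replace (b -c C0) with b in Hb by ring; exists (df (z0 +c a +c b)).
    apply (cder_shift f (z0 +c a)), Hf; specialize (Hab a b Ha Hb); lra.
  - intros a b Ha Hb; specialize (K (z0 +c a +c b)); specialize (Hab a b Ha Hb).
    pose proof (Cnorm_le_sub (f (z0 +c a +c b)) (f z0)); specialize (K ltac:(lra)); lra.
  - intros b Hb.
    pose proof (cder_shift f (z0 +c b) C0 (df (z0 +c b))) as HS.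
    replace (z0 +c b +c C0) with (z0 +c b) in HS by ring.
    replace (fun a : Cplx => f (z0 +c a +c b)) with (fun w => f (z0 +c b +c w)).
    + apply HS, Hf; replace (z0 +c b -c z0) with b by ring; unfold r' in Hb; lra.
    + apply functional_extensionality; intros w; f_equal; ring.
  - exists L; intros eps Heps; destruct (HL eps Heps) as [d' [Hd' K']]; exists d'; split; auto.
    intros h Hh; specialize (K' h Hh); replace (C0 +c h) with h in K' by ring.
    replace (z0 +c C0) with z0 in K' by ring; exact K'.
Qed.

(** After subtraction of the quadratic polynomial the derivative along the segment is [o(h)] times
    [h], by the differentiability of [df] at [z0]. *)
Lemma taylor2 (f df : Cplx -> Cplx) (z0 B : Cplx) (r : R) :
  0 < r -> (forall z, Cnorm (z -c z0) < r -> cder f z (df z)) -> cder df z0 B ->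
  forall eps, 0 < eps -> exists d, 0 < d /\ forall h, Cnorm h < d ->
    Cnorm (f (z0 +c h) -c f z0 -c df z0 *c h -c RtoC (1 / 2) *c B *c (h *c h)) <= eps * Cnorm h ^ 2.
Proof.
  intros Hr Hf HB eps Heps.
  destruct (HB (eps / 2)) as [d [Hd K]]; [lra|].
  exists (Rmin r d); split; [apply Rmin_glb_lt; auto|]; intros h Hh.
  pose proof (Rmin_l r d); pose proof (Rmin_r r d); pose proof (Cnorm_ge0 h).
  assert (forall t, 0 <= t <= 1 -> Cnorm (RtoC t *c h) <= Cnorm h) as Hth.
  { intros t Ht; rewrite Cnorm_mul, Cnorm_RtoC, Rabs_pos_eq by lra; nra. }
  pose proof (rder_increment_const
    (fun t => f (z0 +c RtoC t *c h) +c (Copp (df z0) *c (RtoC t *c h) +c Copp (RtoC (1 / 2) *c B *c (h *c h)) *c (RtoC t *c RtoC t)))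
    (fun t => df (z0 +c RtoC t *c h) *c h +c (Copp (df z0) *c (C1 *c h +c RtoC t *c C0) +c Copp (RtoC (1 / 2) *c B *c (h *c h)) *c (C1 *c RtoC t +c RtoC t *c C1)))
    (eps / 2 * Cnorm h ^ 2) 0 1 ltac:(lra)) as HI.
  assert (HId : forall t, rder RtoC t C1) by (intros t; apply (rder_RtoC id t 1), derivable_pt_lim_id).
  replace (eps * Cnorm h ^ 2) with (2 * (eps / 2 * Cnorm h ^ 2 * (1 - 0))) by field.
  replace (f (z0 +c h) -c f z0 -c df z0 *c h -c RtoC (1 / 2) *c B *c (h *c h)) with
   (f (z0 +c RtoC 1 *c h) +c (Copp (df z0) *c (RtoC 1 *c h) +c Copp (RtoC (1 / 2) *c B *c (h *c h)) *c (RtoC 1 *c RtoC 1)) -c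
   (f (z0 +c RtoC 0 *c h) +c (Copp (df z0) *c (RtoC 0 *c h) +c Copp (RtoC (1 / 2) *c B *c (h *c h)) *c (RtoC 0 *c RtoC 0)))).
  2:{ replace (RtoC 1) with C1 by reflexivity; replace (RtoC 0) with C0 by reflexivity.
      replace (C1 *c h) with h by ring. replace (z0 +c C0 *c h) with z0 by ring. ring. }
  apply HI.
  - intros t Ht; apply rder_add.
    + pose proof (rder_segment f z0 (z0 +c h) (df (z0 +c RtoC t *c h)) t) as Hs.
      replace (z0 +c h -c z0) with h in Hs by ring; apply Hs, Hf.
      replace (z0 +c RtoC t *c h -c z0) with (RtoC t *c h) by ring; specialize (Hth t Ht); lra.
    + apply rder_add; apply rder_scal; [apply (rder_mul RtoC (fun _ => h)); [auto|apply rder_const]|apply rder_mul; auto].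
  - intros t Ht; specialize (Hth t Ht); specialize (K (RtoC t *c h) ltac:(lra)).
    match goal with |- Cnorm ?a <= _ => replace a with ((df (z0 +c RtoC t *c h) -c df z0 -c B *c (RtoC t *c h)) *c h) end.
    + rewrite Cnorm_mul; replace (eps / 2 * Cnorm h ^ 2) with (eps / 2 * Cnorm h * Cnorm h) by ring.
      apply Rmult_le_compat_r; auto; nra.
    + replace (RtoC (1 / 2) *c B *c (h *c h)) with (RtoC (1 / 2) *c (B *c (h *c h))) by ring.
      replace (Copp (RtoC (1 / 2) *c (B *c (h *c h))) *c (C1 *c RtoC t +c RtoC t *c C1)) with
        (Copp (B *c (h *c h)) *c RtoC t *c (RtoC (1 / 2) +c RtoC (1 / 2))) by ring.
      replace (RtoC (1 / 2) +c RtoC (1 / 2)) with C1 by (apply Cplx_eq; simpl; field). ring.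
Qed.

Lemma hol1_choose (f : Cplx -> Cplx) (z0 : Cplx) (r : R) :
  hol1 f z0 r -> exists df, forall z, Cnorm (z -c z0) < r -> cder f z (df z).
Proof.
  intros H; exists (fun z => epsilon (inhabits C0) (fun L => cder f z L)).
  intros z Hz; exact (epsilon_spec (inhabits C0) _ (H z Hz)).
Qed.

(** The function [z f(z)] is differentiable at 0 with derivative [f C0], hence holomorphic near 0.
    Dividing its second-order expansion by [z] differentiates [f] at 0. *)
Lemma removable (f : Cplx -> Cplx) (r M : R) : 0 < r ->
  (forall z, 0 < Cnorm z < r -> exists L, cder f z L) -> clim0 f (f C0) -> exists L, cder f C0 L.
Proof.
  intros Hr Hf Hl.
  set (g := fun z => z *c f z).
  assert (Hg0 : cder g C0 (f C0)).
  { intros eps Heps; destruct (Hl eps Heps) as [d [Hd K]]; exists d; split; auto.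
    intros h Hh; unfold g; replace (C0 +c h) with h by ring.
    destruct (excluded_middle_informative (h = C0)) as [->|Hn].
    - replace (C0 *c f C0 -c C0 *c f C0 -c f C0 *c C0) with C0 by ring; rewrite Cnorm_C0; lra.
    - pose proof (Cnorm_gt0 h Hn); specialize (K h ltac:(lra)).
      replace (h *c f h -c C0 *c f C0 -c f C0 *c h) with ((f h -c f C0) *c h) by ring.
      rewrite Cnorm_mul; apply Rmult_le_compat_r; lra. }
  assert (Hg : hol1 g C0 r).
  { intros z Hz; replace (z -c C0) with z in Hz by ring.
    destruct (excluded_middle_informative (z = C0)) as [->|Hn]; [exists (f C0); auto|].
    pose proof (Cnorm_gt0 z Hn); destruct (Hf z ltac:(lra)) as [L HL].
    exists (C1 *c f z +c z *c L); apply (cder_mul (fun z => z) f); auto; apply cder_id. }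
  destruct (hol1_choose g C0 r Hg) as [dg Hdg].
  destruct (hol1_derivative g dg C0 r Hr Hdg) as [B HB].
  assert (dg C0 = f C0) as E.
  { apply (cder_unique g C0); auto; apply Hdg; replace (C0 -c C0) with C0 by ring; rewrite Cnorm_C0; auto. }
  exists (RtoC (1 / 2) *c B); intros eps Heps.
  destruct (taylor2 g dg C0 B r Hr Hdg HB eps Heps) as [d [Hd K]].
  exists d; split; auto; intros h Hh; specialize (K h Hh).
  destruct (excluded_middle_informative (h = C0)) as [->|Hn].
  - replace (C0 +c C0) with C0 by ring; replace (f C0 -c f C0 -c RtoC (1 / 2) *c B *c C0) with C0 by ring; rewrite Cnorm_C0; lra.
  - pose proof (Cnorm_gt0 h Hn).
    apply (Rmult_le_reg_r (Cnorm h)); auto; rewrite <- Cnorm_mul.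
    eapply Rle_trans; [|eapply Rle_trans; [exact K|apply Req_le; ring]].
    apply Req_le; f_equal; rewrite E; unfold g; replace (C0 +c h) with h by ring; ring.
Qed.

(** * Holomorphic functions of three variables *)

Definition dot (l h : C3) : Cplx := p0 l *c p0 h +c (p1 l *c p1 h +c p2 l *c p2 h).
Definition grad (f : C3 -> Cplx) (p : C3) : C3 := mk3 (pd 0 f p) (pd 1 f p) (pd 2 f p).

(** Total complex differentiability, which composes, whereas the mere existence of partial
    derivatives does not. *)
Definition tdiff (f : C3 -> Cplx) (p l : C3) : Prop :=
  forall eps, 0 < eps -> exists d, 0 < d /\
    forall h, n3 h < d -> Cnorm (f (p +v h) -c f p -c dot l h) <= eps * n3 h.

Lemma Cnorm_dot (l h : C3) : Cnorm (dot l h) <= 3 * n3 l * n3 h.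
Proof.
  unfold dot; eapply Rle_trans; [apply Cnorm_add|]; eapply Rle_trans; [apply Rplus_le_compat_l, Cnorm_add|].
  rewrite !Cnorm_mul.
  pose proof (n3_ge0 l); pose proof (n3_ge0 h).
  pose proof (Rmult_le_compat _ _ _ _ (Cnorm_ge0 _) (Cnorm_ge0 _) (Cnorm_p0 l) (Cnorm_p0 h)).
  pose proof (Rmult_le_compat _ _ _ _ (Cnorm_ge0 _) (Cnorm_ge0 _) (Cnorm_p1 l) (Cnorm_p1 h)).
  pose proof (Rmult_le_compat _ _ _ _ (Cnorm_ge0 _) (Cnorm_ge0 _) (Cnorm_p2 l) (Cnorm_p2 h)).
  lra.
Qed.

Lemma dot_e3 (l : C3) (i : nat) (h : Cplx) : dot l (h *v e3 i) = comp i l *c h.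
Proof. destruct i as [|[|i]]; unfold dot; simpl; ring. Qed.

Lemma dot_sub (l h k : C3) : dot l (h -v k) = dot l h -c dot l k.
Proof. unfold dot; simpl; ring. Qed.

Lemma dot_O3 (l : C3) : dot l O3 = C0.
Proof. unfold dot; simpl; ring. Qed.

Lemma tdiff_has_pd (f : C3 -> Cplx) (p l : C3) (i : nat) : tdiff f p l -> has_pd i f p (comp i l).
Proof.
  intros H eps Heps; destruct (H eps Heps) as [d [Hd K]]; exists d; split; auto.
  intros h Hh; specialize (K (h *v e3 i)); rewrite n3_scal_e3, dot_e3 in K; auto.
Qed.

Lemma has_pd_cder (i : nat) (f : C3 -> Cplx) (p : C3) (z L : Cplx) :
  has_pd i f (p +v z *v e3 i) L <-> cder (fun z => f (p +v z *v e3 i)) z L.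
Proof.
  assert (forall h, p +v (z +c h) *v e3 i = (p +v z *v e3 i) +v h *v e3 i) as E
    by (intros h; apply C3_eq; simpl; ring).
  split; intros H eps Heps; destruct (H eps Heps) as [d [Hd K]]; exists d; split; auto;
  intros h Hh; specialize (K h Hh); rewrite E in *; auto.
Qed.

Lemma add3_C0_e3 (p : C3) (i : nat) : p +v C0 *v e3 i = p.
Proof. apply C3_eq; simpl; ring. Qed.

Lemma has_pd_cder0 (i : nat) (f : C3 -> Cplx) (p : C3) (L : Cplx) :
  has_pd i f p L <-> cder (fun z => f (p +v z *v e3 i)) C0 L.
Proof. rewrite <- has_pd_cder, add3_C0_e3; reflexivity. Qed.

Lemma has_pd_unique (i : nat) (f : C3 -> Cplx) (p : C3) (L L' : Cplx) :
  has_pd i f p L -> has_pd i f p L' -> L = L'.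
Proof. rewrite !has_pd_cder0; apply cder_unique. Qed.

Lemma has_pd_pd (i : nat) (f : C3 -> Cplx) (p : C3) :
  (exists L, has_pd i f p L) -> has_pd i f p (pd i f p).
Proof. apply epsilon_spec. Qed.

Lemma pd_eq (i : nat) (f : C3 -> Cplx) (p : C3) (L : Cplx) : has_pd i f p L -> pd i f p = L.
Proof. intros H; apply (has_pd_unique i f p); auto; apply has_pd_pd; exists L; auto. Qed.

Lemma tdiff_grad_eq (f : C3 -> Cplx) (p l : C3) : tdiff f p l -> grad f p = l.
Proof.
  intros H; apply C3_eq; simpl; apply pd_eq;
  [apply (tdiff_has_pd f p l 0)|apply (tdiff_has_pd f p l 1)|apply (tdiff_has_pd f p l 2)]; auto.
Qed.

Lemma tdiff_ext_loc (f g : C3 -> Cplx) (p l : C3) (d : R) :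
  0 < d -> (forall q, n3 (q -v p) < d -> f q = g q) -> tdiff f p l -> tdiff g p l.
Proof.
  intros Hd E H eps Heps.
  destruct (H eps Heps) as [d' [Hd' K]]; exists (Rmin d d'); split; [apply Rmin_glb_lt; auto|].
  intros h Hh; pose proof (Rmin_l d d'); pose proof (Rmin_r d d').
  rewrite <- !E; [apply K; lra| |].
  - replace (p -v p) with O3 by (apply C3_eq; simpl; ring); rewrite n3_O3; auto.
  - replace (p +v h -v p) with h by (apply C3_eq; simpl; ring); lra.
Qed.

(** The common core of the three chain rules below: [k] is the inner increment, [m] its linear part,
    and [N] the size of the increment of the parameter. *)
Lemma tdiff_estimate (f : C3 -> Cplx) (P l : C3) (A : R) : tdiff f P l -> 0 <= A ->
  forall eps, 0 < eps -> exists e d, 0 < e /\ 0 < d /\ forall k m N, 0 <= N < d ->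
    n3 (k -v m) <= e * N -> n3 m <= A * N -> Cnorm (f (P +v k) -c f P -c dot l m) <= eps * N.
Proof.
  intros Hf HA eps Heps; pose proof (n3_ge0 l) as Hl.
  destruct (Hf (eps / (2 * (1 + A)))) as [d [Hd K]]; [apply Rdiv_lt_0_compat; lra|].
  set (e0 := eps / (2 * (1 + 3 * n3 l))).
  assert (0 < e0) by (apply Rdiv_lt_0_compat; lra).
  assert (e0 * (2 * (1 + 3 * n3 l)) = eps) by (unfold e0; field; lra).
  set (e1 := eps / (2 * (1 + A))) in *.
  assert (e1 * (2 * (1 + A)) = eps) by (unfold e1; field; lra).
  assert (0 < e1) by (apply Rdiv_lt_0_compat; lra).
  exists (Rmin 1 e0), (d / (1 + A)); split; [apply Rmin_glb_lt; lra|]; split; [apply Rdiv_lt_0_compat; lra|].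
  intros k m N HN Hkm Hm.
  pose proof (Rmin_l 1 e0); pose proof (Rmin_r 1 e0).
  assert (d / (1 + A) * (1 + A) = d) by (field; lra).
  assert (n3 (k -v m) <= N) by nra. assert (n3 (k -v m) <= e0 * N) by nra.
  assert (n3 k <= (1 + A) * N) by (pose proof (n3_le_sub k m); lra).
  assert (n3 k < d) as Hk by nra.
  specialize (K k Hk).
  replace (f (P +v k) -c f P -c dot l m) with ((f (P +v k) -c f P -c dot l k) +c dot l (k -v m))
    by (rewrite dot_sub; ring).
  eapply Rle_trans; [apply Cnorm_add|].
  pose proof (Cnorm_dot l (k -v m)). pose proof (n3_ge0 (k -v m)).
  assert (e1 * n3 k <= eps / 2 * N) by nra.
  assert (3 * n3 l * n3 (k -v m) <= eps / 2 * N).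
  { apply Rle_trans with (3 * n3 l * (e0 * N)); [apply Rmult_le_compat_l; lra|].
    assert (3 * n3 l * e0 <= eps / 2) by nra. nra. }
  lra.
Qed.

(** The row vector [l] times the matrix with rows [m0], [m1], [m2]: the gradient of a composite. *)
Definition scomb (l m0 m1 m2 : C3) : C3 := p0 l *v m0 +v (p1 l *v m1 +v p2 l *v m2).

Lemma tdiff_comp (f : C3 -> Cplx) (W : C3 -> C3) (p l m0 m1 m2 : C3) :
  tdiff f (W p) l -> tdiff (fun q => p0 (W q)) p m0 -> tdiff (fun q => p1 (W q)) p m1 ->
  tdiff (fun q => p2 (W q)) p m2 -> tdiff (fun q => f (W q)) p (scomb l m0 m1 m2).
Proof.
  intros Hf H0 H1 H2 eps Heps.
  pose proof (n3_ge0 m0); pose proof (n3_ge0 m1); pose proof (n3_ge0 m2).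
  destruct (tdiff_estimate f (W p) l (3 * (n3 m0 + n3 m1 + n3 m2)) Hf ltac:(lra) eps Heps) as [e [d [He [Hd K]]]].
  destruct (H0 (e / 3)) as [d0 [Hd0 K0]]; [lra|]; destruct (H1 (e / 3)) as [d1 [Hd1 K1]]; [lra|];
  destruct (H2 (e / 3)) as [d2 [Hd2 K2]]; [lra|].
  exists (Rmin d (Rmin d0 (Rmin d1 d2))); split; [repeat apply Rmin_glb_lt; auto|].
  intros h Hh.
  pose proof (Rmin_l d (Rmin d0 (Rmin d1 d2))); pose proof (Rmin_r d (Rmin d0 (Rmin d1 d2))).
  pose proof (Rmin_l d0 (Rmin d1 d2)); pose proof (Rmin_r d0 (Rmin d1 d2)).
  pose proof (Rmin_l d1 d2); pose proof (Rmin_r d1 d2).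
  specialize (K0 h ltac:(lra)); specialize (K1 h ltac:(lra)); specialize (K2 h ltac:(lra)).
  pose proof (n3_ge0 h).
  set (k := W (p +v h) -v W p); set (m := mk3 (dot m0 h) (dot m1 h) (dot m2 h)).
  replace (W (p +v h)) with (W p +v k) by (unfold k; apply C3_eq; simpl; ring).
  replace (dot (scomb l m0 m1 m2) h) with (dot l m) by (unfold dot, scomb, m; simpl; unfold dot; ring).
  apply K; [lra| |].
  - eapply Rle_trans; [apply n3_le_sum|]; unfold k, m; simpl p0; simpl p1; simpl p2; lra.
  - eapply Rle_trans; [apply n3_le_sum|]; unfold m; simpl p0; simpl p1; simpl p2.
    pose proof (Cnorm_dot m0 h); pose proof (Cnorm_dot m1 h); pose proof (Cnorm_dot m2 h); lra.
Qed.

Lemma tdiff_comp_rder (f : C3 -> Cplx) (g : R -> C3) (t : R) (l v : C3) :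
  tdiff f (g t) l -> rder (fun s => p0 (g s)) t (p0 v) -> rder (fun s => p1 (g s)) t (p1 v) ->
  rder (fun s => p2 (g s)) t (p2 v) -> rder (fun s => f (g s)) t (dot l v).
Proof.
  rewrite !rder_eps; intros Hf H0 H1 H2 eps Heps.
  pose proof (n3_ge0 v).
  destruct (tdiff_estimate f (g t) l (n3 v) Hf ltac:(lra) eps Heps) as [e [d [He [Hd K]]]].
  destruct (H0 (e / 3)) as [d0 [Hd0 K0]]; [lra|]; destruct (H1 (e / 3)) as [d1 [Hd1 K1]]; [lra|];
  destruct (H2 (e / 3)) as [d2 [Hd2 K2]]; [lra|].
  exists (Rmin d (Rmin d0 (Rmin d1 d2))); split; [repeat apply Rmin_glb_lt; auto|].
  intros h Hh.
  pose proof (Rmin_l d (Rmin d0 (Rmin d1 d2))); pose proof (Rmin_r d (Rmin d0 (Rmin d1 d2))).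
  pose proof (Rmin_l d0 (Rmin d1 d2)); pose proof (Rmin_r d0 (Rmin d1 d2)).
  pose proof (Rmin_l d1 d2); pose proof (Rmin_r d1 d2).
  specialize (K0 h ltac:(lra)); specialize (K1 h ltac:(lra)); specialize (K2 h ltac:(lra)).
  pose proof (Rabs_pos h).
  set (k := g (t + h) -v g t); set (m := RtoC h *v v).
  replace (g (t + h)) with (g t +v k) by (unfold k; apply C3_eq; simpl; ring).
  replace (dot l v *c RtoC h) with (dot l m) by (unfold dot, m; simpl; ring).
  apply K; [lra| |].
  - eapply Rle_trans; [apply n3_le_sum|]; unfold k, m; simpl p0; simpl p1; simpl p2.
    replace (RtoC h *c p0 v) with (p0 v *c RtoC h) by ring; replace (RtoC h *c p1 v) with (p1 v *c RtoC h) by ring;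
    replace (RtoC h *c p2 v) with (p2 v *c RtoC h) by ring; lra.
  - unfold m; rewrite n3_scal, Cnorm_RtoC; lra.
Qed.

Lemma tdiff_comp_cder (f : C3 -> Cplx) (g : Cplx -> C3) (z : Cplx) (l v : C3) :
  tdiff f (g z) l -> cder (fun s => p0 (g s)) z (p0 v) -> cder (fun s => p1 (g s)) z (p1 v) ->
  cder (fun s => p2 (g s)) z (p2 v) -> cder (fun s => f (g s)) z (dot l v).
Proof.
  intros Hf H0 H1 H2 eps Heps.
  pose proof (n3_ge0 v).
  destruct (tdiff_estimate f (g z) l (n3 v) Hf ltac:(lra) eps Heps) as [e [d [He [Hd K]]]].
  destruct (H0 (e / 3)) as [d0 [Hd0 K0]]; [lra|]; destruct (H1 (e / 3)) as [d1 [Hd1 K1]]; [lra|];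
  destruct (H2 (e / 3)) as [d2 [Hd2 K2]]; [lra|].
  exists (Rmin d (Rmin d0 (Rmin d1 d2))); split; [repeat apply Rmin_glb_lt; auto|].
  intros h Hh.
  pose proof (Rmin_l d (Rmin d0 (Rmin d1 d2))); pose proof (Rmin_r d (Rmin d0 (Rmin d1 d2))).
  pose proof (Rmin_l d0 (Rmin d1 d2)); pose proof (Rmin_r d0 (Rmin d1 d2)).
  pose proof (Rmin_l d1 d2); pose proof (Rmin_r d1 d2).
  specialize (K0 h ltac:(lra)); specialize (K1 h ltac:(lra)); specialize (K2 h ltac:(lra)).
  pose proof (Cnorm_ge0 h).
  set (k := g (z +c h) -v g z); set (m := h *v v).
  replace (g (z +c h)) with (g z +v k) by (unfold k; apply C3_eq; simpl; ring).
  replace (dot l v *c h) with (dot l m) by (unfold dot, m; simpl; ring).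
  apply K; [lra| |].
  - eapply Rle_trans; [apply n3_le_sum|]; unfold k, m; simpl p0; simpl p1; simpl p2.
    replace (h *c p0 v) with (p0 v *c h) by ring; replace (h *c p1 v) with (p1 v *c h) by ring;
    replace (h *c p2 v) with (p2 v *c h) by ring; lra.
  - unfold m; rewrite n3_scal; lra.
Qed.

Lemma tdiff_of_exact (f : C3 -> Cplx) (p l : C3) :
  (forall h, f (p +v h) = f p +c dot l h) -> tdiff f p l.
Proof.
  intros H eps Heps; exists 1; split; [lra|]; intros h _; rewrite H.
  replace (f p +c dot l h -c f p -c dot l h) with C0 by ring; rewrite Cnorm_C0; pose proof (n3_ge0 h); nra.
Qed.

Lemma tdiff_const (c : Cplx) (p : C3) : tdiff (fun _ => c) p O3.
Proof. apply tdiff_of_exact; intros h; unfold dot; simpl; ring. Qed.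

Lemma tdiff_p0 (p : C3) : tdiff p0 p (e3 0).
Proof. apply tdiff_of_exact; intros h; unfold dot; simpl; ring. Qed.
Lemma tdiff_p1 (p : C3) : tdiff p1 p (e3 1).
Proof. apply tdiff_of_exact; intros h; unfold dot; simpl; ring. Qed.
Lemma tdiff_p2 (p : C3) : tdiff p2 p (e3 2).
Proof. apply tdiff_of_exact; intros h; unfold dot; simpl; ring. Qed.

(** This rule and the next ones are instances of [tdiff_comp], with dummy coordinates filling up
    [C3]. *)
Lemma tdiff_add (f g : C3 -> Cplx) (p l m : C3) :
  tdiff f p l -> tdiff g p m -> tdiff (fun q => f q +c g q) p (l +v m).
Proof.
  intros Hf Hg.
  pose proof (tdiff_comp (fun q => p0 q +c p1 q) (fun q => mk3 (f q) (g q) C0) p (mk3 C1 C1 C0) l m O3) as K.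
  replace (l +v m) with (scomb (mk3 C1 C1 C0) l m O3) by (apply C3_eq; unfold scomb; simpl; ring).
  apply K; auto; [|exact (tdiff_const C0 p)].
  apply tdiff_of_exact; intros h; unfold dot; simpl; ring.
Qed.

Lemma tdiff_mul (f g : C3 -> Cplx) (p l m : C3) :
  tdiff f p l -> tdiff g p m -> tdiff (fun q => f q *c g q) p (g p *v l +v f p *v m).
Proof.
  intros Hf Hg.
  pose proof (tdiff_comp (fun q => p0 q *c p1 q) (fun q => mk3 (f q) (g q) C0) p (mk3 (g p) (f p) C0) l m O3) as K.
  replace (g p *v l +v f p *v m) with (scomb (mk3 (g p) (f p) C0) l m O3) by (apply C3_eq; unfold scomb; simpl; ring).
  apply K; auto; [|exact (tdiff_const C0 p)].
  intros eps Heps; exists eps; split; auto; intros h Hh.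
  match goal with |- Cnorm ?a <= _ => replace a with (p0 h *c p1 h) by (unfold dot; simpl; ring) end.
  rewrite Cnorm_mul; pose proof (Cnorm_p0 h); pose proof (Cnorm_p1 h).
  apply Rmult_le_compat; auto; try apply Cnorm_ge0; lra.
Qed.

Lemma tdiff_cder (u : Cplx -> Cplx) (f : C3 -> Cplx) (p l : C3) (L : Cplx) :
  cder u (f p) L -> tdiff f p l -> tdiff (fun q => u (f q)) p (L *v l).
Proof.
  intros Hu Hf.
  pose proof (tdiff_comp (fun q => u (p0 q)) (fun q => mk3 (f q) C0 C0) p (mk3 L C0 C0) l O3 O3) as K.
  replace (L *v l) with (scomb (mk3 L C0 C0) l O3 O3) by (apply C3_eq; unfold scomb; simpl; ring).
  apply K; auto; try exact (tdiff_const C0 p).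
  intros eps Heps; destruct (Hu eps Heps) as [d [Hd H]]; exists d; split; auto; intros h Hh.
  pose proof (Cnorm_p0 h); specialize (H (p0 h) ltac:(lra)); simpl.
  replace (dot (mk3 L C0 C0) h) with (L *c p0 h) by (unfold dot; simpl; ring).
  eapply Rle_trans; [exact H|]; apply Rmult_le_compat_l; lra.
Qed.

Lemma tdiff_opp (f : C3 -> Cplx) (p l : C3) : tdiff f p l -> tdiff (fun q => Copp (f q)) p (Copp C1 *v l).
Proof.
  intros H; apply (tdiff_cder Copp f p l (Copp C1)); auto.
  intros eps Heps; exists 1; split; [lra|]; intros h _.
  replace (Copp (f p +c h) -c Copp (f p) -c Copp C1 *c h) with C0 by ring; rewrite Cnorm_C0; pose proof (Cnorm_ge0 h); nra.
Qed.

Lemma tdiff_ccont (f : C3 -> Cplx) (p l : C3) : tdiff f p l -> ccont f p.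
Proof.
  intros H eps Heps; destruct (H 1) as [d [Hd K]]; [lra|].
  pose proof (n3_ge0 l).
  set (e := eps / (2 + 3 * n3 l)).
  assert (0 < e) by (apply Rdiv_lt_0_compat; lra).
  assert (e * (2 + 3 * n3 l) = eps) by (unfold e; field; lra).
  exists (Rmin d e); split; [apply Rmin_glb_lt; auto|].
  intros q Hq; pose proof (Rmin_l d e); pose proof (Rmin_r d e).
  specialize (K (q -v p)); replace (p +v (q -v p)) with q in K by (apply C3_eq; simpl; ring).
  specialize (K ltac:(lra)).
  pose proof (Cnorm_le_sub (f q -c f p) (dot l (q -v p))); pose proof (Cnorm_dot l (q -v p)).
  pose proof (n3_ge0 (q -v p)). nra.
Qed.

(** Separately holomorphic bounded functions (Osgood): all estimates come from the one-variable slices. *)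
Definition sepB (f : C3 -> Cplx) (p : C3) (r M : R) : Prop :=
  forall q, n3 (q -v p) < r -> (forall i, (i < 3)%nat -> exists L, has_pd i f q L) /\ Cnorm (f q) <= M.

Lemma sepB_sub (f : C3 -> Cplx) (p q : C3) (r r' M : R) : sepB f p r M -> n3 (q -v p) + r' <= r -> sepB f q r' M.
Proof. intros H Hr s Hs; apply H; pose proof (n3_sub_tri s q p); lra. Qed.

Lemma sepB_slice (f : C3 -> Cplx) (p : C3) (r M : R) (i : nat) : sepB f p r M -> (i < 3)%nat ->
  hol1 (fun z => f (p +v z *v e3 i)) C0 r /\
  (forall z, Cnorm (z -c C0) < r -> Cnorm (f (p +v z *v e3 i)) <= M).
Proof.
  intros H Hi; split; intros z Hz; replace (z -c C0) with z in Hz by ring;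
  (assert (n3 (p +v z *v e3 i -v p) < r) as Hq by
    (replace (p +v z *v e3 i -v p) with (z *v e3 i) by (apply C3_eq; simpl; ring); rewrite n3_scal_e3; auto));
  destruct (H _ Hq) as [H1 H2]; auto.
  destruct (H1 i Hi) as [L HL]; exists L; apply has_pd_cder; auto.
Qed.

Lemma n3_self (p : C3) : n3 (p -v p) = 0.
Proof. replace (p -v p) with O3 by (apply C3_eq; simpl; ring); apply n3_O3. Qed.

Lemma Cnorm_self (z : Cplx) : Cnorm (z -c z) = 0.
Proof. replace (z -c z) with C0 by ring; apply Cnorm_C0. Qed.

Lemma sepB_pd (f : C3 -> Cplx) (p : C3) (r M : R) (i : nat) : 0 < r -> sepB f p r M -> (i < 3)%nat ->
  cder (fun z => f (p +v z *v e3 i)) C0 (pd i f p).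
Proof.
  intros Hr H Hi; apply has_pd_cder0, has_pd_pd, H; auto; rewrite n3_self; auto.
Qed.

Lemma n3_partial1 (h : C3) : n3 (mk3 (p0 h) C0 C0) <= n3 h.
Proof.
  pose proof (n3_sqr h); apply n3_le; [apply n3_ge0|]; rewrite H; simpl p0; simpl p1; simpl p2; rewrite Cnorm_C0.
  pose proof (pow2_ge_0 (Cnorm (p1 h))); pose proof (pow2_ge_0 (Cnorm (p2 h))); lra.
Qed.

Lemma n3_partial2 (h : C3) : n3 (mk3 (p0 h) (p1 h) C0) <= n3 h.
Proof.
  pose proof (n3_sqr h); apply n3_le; [apply n3_ge0|]; rewrite H; simpl p0; simpl p1; simpl p2; rewrite Cnorm_C0.
  pose proof (pow2_ge_0 (Cnorm (p2 h))); lra.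
Qed.

Lemma M_nonneg (f : C3 -> Cplx) (p : C3) (r M : R) : 0 < r -> sepB f p r M -> 0 <= M.
Proof.
  intros Hr H; destruct (H p) as [_ H1]; [rewrite n3_self; auto|]; pose proof (Cnorm_ge0 (f p)); lra.
Qed.

Lemma sepB_step_lipschitz (f : C3 -> Cplx) (c : C3) (h : Cplx) (r M : R) (i : nat) :
  0 < r -> sepB f c r M -> (i < 3)%nat -> Cnorm h < r / 2 ->
  Cnorm (f (c +v h *v e3 i) -c f c) <= 32 * M / r * Cnorm h.
Proof.
  intros Hr H Hi Hh; destruct (sepB_slice f c r M i H Hi) as [H1 H2].
  pose proof (hol1_lipschitz _ C0 C0 h r M Hr H1 H2) as K; cbv beta in K.
  rewrite add3_C0_e3, Cnorm_self in K; replace (h -c C0) with h in K by ring; apply K; lra.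
Qed.

(** The path from [a] to [b] follows the axes through [a1] and [a2]; each of the three legs costs
    [32 * M / (r / 2)]. *)
Lemma sepB_lipschitz (f : C3 -> Cplx) (p a b : C3) (r M : R) : 0 < r -> sepB f p r M ->
  n3 (a -v p) < r / 8 -> n3 (b -v p) < r / 8 -> Cnorm (f b -c f a) <= 192 * M / r * n3 (b -v a).
Proof.
  intros Hr H Ha Hb.
  pose proof (M_nonneg f p r M Hr H) as HM.
  set (h := b -v a).
  assert (n3 h < r / 4) as Hh by (pose proof (n3_sub_tri b p a); rewrite (n3_sub_sym p a) in *; unfold h; lra).
  set (a1 := a +v mk3 (p0 h) C0 C0); set (a2 := a +v mk3 (p0 h) (p1 h) C0).
  assert (forall c, n3 (c -v a) <= n3 h -> sepB f c (r / 2) M) as Hc.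
  { intros c Hc; apply (sepB_sub f p c r); auto; pose proof (n3_sub_tri c a p); lra. }
  assert (0 <= 32 * M / (r / 2)) as HK by (apply Rmult_le_pos; [lra|left; apply Rinv_0_lt_compat; lra]).
  pose proof (Cnorm_p0 h); pose proof (Cnorm_p1 h); pose proof (Cnorm_p2 h).
  assert (Cnorm (f a1 -c f a) <= 32 * M / (r / 2) * n3 h) as S0.
  { replace a1 with (a +v p0 h *v e3 0) by (unfold a1; apply C3_eq; simpl; ring).
    eapply Rle_trans; [apply (sepB_step_lipschitz f a (p0 h) (r / 2) M 0); auto; try lra|apply Rmult_le_compat_l; auto].
    apply Hc; rewrite n3_self; apply n3_ge0. }
  assert (Cnorm (f a2 -c f a1) <= 32 * M / (r / 2) * n3 h) as S1.
  { replace a2 with (a1 +v p1 h *v e3 1) by (unfold a1, a2; apply C3_eq; simpl; ring).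
    eapply Rle_trans; [apply (sepB_step_lipschitz f a1 (p1 h) (r / 2) M 1); auto; try lra|apply Rmult_le_compat_l; auto].
    apply Hc; unfold a1; replace (a +v mk3 (p0 h) C0 C0 -v a) with (mk3 (p0 h) C0 C0) by (apply C3_eq; simpl; ring); apply n3_partial1. }
  assert (Cnorm (f b -c f a2) <= 32 * M / (r / 2) * n3 h) as S2.
  { replace b with (a2 +v p2 h *v e3 2) by (unfold a2, h; apply C3_eq; simpl; ring).
    eapply Rle_trans; [apply (sepB_step_lipschitz f a2 (p2 h) (r / 2) M 2); auto; try lra|apply Rmult_le_compat_l; auto].
    apply Hc; unfold a2; replace (a +v mk3 (p0 h) (p1 h) C0 -v a) with (mk3 (p0 h) (p1 h) C0) by (apply C3_eq; simpl; ring); apply n3_partial2. }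
  replace (192 * M / r * n3 h) with (3 * (32 * M / (r / 2) * n3 h)) by (field; lra).
  pose proof (Cnorm_sub_tri (f b) (f a2) (f a)); pose proof (Cnorm_sub_tri (f a2) (f a1) (f a)); lra.
Qed.

(** The argument of [cder_lipschitz], with circles in direction [i] around two arbitrary points. It
    makes the partial derivatives continuous, from a bound on [f] alone. *)
Lemma sepB_pd_lipschitz (f : C3 -> Cplx) (p a b : C3) (r M : R) (i : nat) : 0 < r -> sepB f p r M -> (i < 3)%nat ->
  n3 (a -v p) < r / 16 -> n3 (b -v p) < r / 16 ->
  Cnorm (pd i f b -c pd i f a) <= 24576 * M / r ^ 2 * n3 (b -v a).
Proof.
  intros Hr H Hi Ha Hb; pose proof PI_RGT_0 as HPI.
  assert (Sa : sepB f a (r / 16) M) by (apply (sepB_sub f p a r); auto; lra).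
  assert (Sb : sepB f b (r / 16) M) by (apply (sepB_sub f p b r); auto; lra).
  destruct (sepB_slice f a (r / 16) M i Sa Hi) as [A1 _]; destruct (sepB_slice f b (r / 16) M i Sb Hi) as [B1 _].
  pose proof (cder_circle _ _ _ _ (r / 32) A1 (sepB_pd f a (r / 16) M i ltac:(lra) Sa Hi) ltac:(lra)) as Ea.
  pose proof (cder_circle _ _ _ _ (r / 32) B1 (sepB_pd f b (r / 16) M i ltac:(lra) Sb Hi) ltac:(lra)) as Eb.
  pose proof (rcont_dq_circle _ _ _ (r / 32) A1 ltac:(lra)) as Ca.
  pose proof (rcont_dq_circle _ _ _ (r / 32) B1 ltac:(lra)) as Cb.
  assert (RtoC (2 * PI) *c (pd i f b -c pd i f a) =
    CInt (fun t => dq (fun z => f (b +v z *v e3 i)) C0 (RtoC (r / 32) *c cis t)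
      -c dq (fun z => f (a +v z *v e3 i)) C0 (RtoC (r / 32) *c cis t)) 0 (2 * PI)) as E
    by (rewrite CInt_sub; auto; [rewrite <- Ea, <- Eb; ring|lra]).
  apply (f_equal Cnorm) in E; rewrite Cnorm_mul, Cnorm_RtoC, Rabs_pos_eq in E by lra.
  apply Rmult_le_cancel_2PI; rewrite Rmult_comm, E.
  eapply Rle_trans; [apply (CInt_bound _ _ _ (12288 * M / r ^ 2 * n3 (b -v a)))|].
  - lra.
  - intros t Ht; apply rcont_sub; auto.
  - intros t _; set (w := RtoC (r / 32) *c cis t).
    assert (Cnorm w = r / 32) as Ew by (apply Cnorm_circle; lra).
    assert (w <> C0) by (apply Cnorm_neq0; lra).
    unfold dq; rewrite !add3_C0_e3; replace (C0 +c w) with w by ring.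
    match goal with |- Cnorm (?x /c w -c ?y /c w) <= _ => replace (x /c w -c y /c w) with
      (((f (b +v w *v e3 i) -c f (a +v w *v e3 i)) -c (f b -c f a)) /c w) by (field; auto) end.
    rewrite Cnorm_div by auto; rewrite Ew.
    assert (forall c, n3 (c -v p) < r / 16 -> n3 (c +v w *v e3 i -v p) < r / 8) as Hcw.
    { intros c Hc; replace (c +v w *v e3 i -v p) with ((c -v p) +v w *v e3 i) by (apply C3_eq; simpl; ring).
      pose proof (n3_add (c -v p) (w *v e3 i)); rewrite n3_scal_e3 in *; lra. }
    pose proof (sepB_lipschitz f p _ _ r M Hr H (Hcw a Ha) (Hcw b Hb)) as L1.
    pose proof (sepB_lipschitz f p a b r M Hr H ltac:(lra) ltac:(lra)) as L2.
    replace (b +v w *v e3 i -v (a +v w *v e3 i)) with (b -v a) in L1 by (apply C3_eq; simpl; ring).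
    match goal with |- Cnorm (?u -c ?v) / _ <= _ => pose proof (Cnorm_sub u v) end.
    apply (Rmult_le_reg_r (r / 32)); [lra|].
    replace (12288 * M / r ^ 2 * n3 (b -v a) * (r / 32)) with (2 * (192 * M / r * n3 (b -v a))) by (field; lra).
    unfold Rdiv at 1; rewrite Rmult_assoc, Rinv_l, Rmult_1_r by lra. lra.
  - apply Req_le; field; lra.
Qed.

(** [mixed_derivative] with [a] in direction [i] and [b] in direction [j]; the case [i = j] is
    included. *)
Lemma sepB_pd_pd (f : C3 -> Cplx) (p : C3) (r M : R) (i j : nat) : 0 < r -> sepB f p r M -> (i < 3)%nat -> (j < 3)%nat ->
  exists L, has_pd j (pd i f) p L.
Proof.
  intros Hr H Hi Hj.
  assert (forall a b, Cnorm a < r / 2 -> Cnorm b < r / 2 -> n3 (p +v b *v e3 j +v a *v e3 i -v p) < r) as Hab.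
  { intros a b Ha Hb; replace (p +v b *v e3 j +v a *v e3 i -v p) with (b *v e3 j +v a *v e3 i) by (apply C3_eq; simpl; ring).
    pose proof (n3_add (b *v e3 j) (a *v e3 i)); rewrite !n3_scal_e3 in *; lra. }
  destruct (mixed_derivative (fun a b => f (p +v b *v e3 j +v a *v e3 i)) (fun b => pd i f (p +v b *v e3 j)) (r / 2) M) as [L HL].
  - lra.
  - intros b Hb a Ha; replace (a -c C0) with a in Ha by ring.
    destruct (H _ (Hab a b Ha Hb)) as [H1 _]; destruct (H1 i Hi) as [L HL]; exists L; apply has_pd_cder; auto.
  - intros a Ha b Hb; replace (b -c C0) with b in Hb by ring.
    destruct (H _ (Hab a b Ha Hb)) as [H1 _]; destruct (H1 j Hj) as [L HL]; exists L.
    assert (forall b, p +v b *v e3 j +v a *v e3 i = p +v a *v e3 i +v b *v e3 j) as E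
      by (intros; apply C3_eq; simpl; ring).
    rewrite E in HL; apply has_pd_cder in HL.
    replace (fun b => f (p +v b *v e3 j +v a *v e3 i)) with (fun z => f (p +v a *v e3 i +v z *v e3 j)); auto.
    apply functional_extensionality; intros; rewrite E; auto.
  - intros a b Ha Hb; apply H; auto.
  - intros b Hb; apply has_pd_cder0, has_pd_pd, H; auto.
    replace (p +v b *v e3 j -v p) with (b *v e3 j) by (apply C3_eq; simpl; ring); rewrite n3_scal_e3; lra.
  - exists L; apply has_pd_cder0; auto.
Qed.

Lemma sepB_step_taylor (f : C3 -> Cplx) (c : C3) (h : Cplx) (r M : R) (i : nat) :
  0 < r -> sepB f c r M -> (i < 3)%nat -> Cnorm h < r / 4 ->
  Cnorm (f (c +v h *v e3 i) -c f c -c pd i f c *c h) <= 2048 * M / r ^ 2 * Cnorm h ^ 2.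
Proof.
  intros Hr H Hi Hh; destruct (sepB_slice f c r M i H Hi) as [H1 H2].
  pose proof (hol1_taylor _ C0 _ h r M Hr H1 H2 (sepB_pd f c r M i Hr H Hi) Hh) as K; cbv beta in K.
  rewrite add3_C0_e3 in K; replace (C0 +c h) with h in K by ring; exact K.
Qed.

(** Expansion along the axes one coordinate at a time; the partial derivatives at the intermediate
    points are then moved back to [p] by [sepB_pd_lipschitz]. *)
Lemma sepB_taylor (f : C3 -> Cplx) (p h : C3) (r M : R) : 0 < r -> sepB f p r M -> n3 h < r / 16 ->
  Cnorm (f (p +v h) -c f p -c dot (grad f p) h) <= 100000 * M / r ^ 2 * n3 h ^ 2.
Proof.
  intros Hr H Hh.
  pose proof (M_nonneg f p r M Hr H) as HM; pose proof (n3_ge0 h) as Hh0.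
  set (q1 := p +v mk3 (p0 h) C0 C0); set (q2 := p +v mk3 (p0 h) (p1 h) C0).
  assert (E1 : q1 -v p = mk3 (p0 h) C0 C0) by (unfold q1; apply C3_eq; simpl; ring).
  assert (E2 : q2 -v p = mk3 (p0 h) (p1 h) C0) by (unfold q2; apply C3_eq; simpl; ring).
  assert (N1 : n3 (q1 -v p) <= n3 h) by (rewrite E1; apply n3_partial1).
  assert (N2 : n3 (q2 -v p) <= n3 h) by (rewrite E2; apply n3_partial2).
  assert (Hr2 : 0 < / r ^ 2) by (apply Rinv_0_lt_compat; nra).
  set (T := 2048 * M / (r / 2) ^ 2 * n3 h ^ 2).
  assert (HTT : forall i c, (i < 3)%nat -> n3 (c -v p) <= n3 h ->
     Cnorm (f (c +v comp i h *v e3 i) -c f c -c pd i f c *c comp i h) <= T).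
  { intros i c Hi Hc; pose proof (Cnorm_comp_le i h); pose proof (Cnorm_ge0 (comp i h)).
    eapply Rle_trans; [apply (sepB_step_taylor f c (comp i h) (r / 2) M i); auto; try lra|].
    - apply (sepB_sub f p c r); auto; lra.
    - unfold T; apply Rmult_le_compat_l; [|nra].
      unfold Rdiv; apply Rmult_le_pos; [lra|left; apply Rinv_0_lt_compat; nra]. }
  set (D := 24576 * M / r ^ 2 * n3 h ^ 2).
  assert (HDD : forall i c, (i < 3)%nat -> n3 (c -v p) <= n3 h -> Cnorm ((pd i f c -c pd i f p) *c comp i h) <= D).
  { intros i c Hi Hc; rewrite Cnorm_mul; pose proof (Cnorm_comp_le i h); pose proof (Cnorm_ge0 (comp i h)).
    pose proof (sepB_pd_lipschitz f p p c r M i Hr H Hi ltac:(rewrite n3_self; lra) ltac:(lra)) as HL.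
    assert (0 <= 24576 * M / r ^ 2) by (unfold Rdiv; apply Rmult_le_pos; lra).
    unfold D; replace (24576 * M / r ^ 2 * n3 h ^ 2) with ((24576 * M / r ^ 2 * n3 h) * n3 h) by ring.
    apply Rmult_le_compat; auto; [apply Cnorm_ge0|]. eapply Rle_trans; [exact HL|]; apply Rmult_le_compat_l; auto. }
  pose proof (HTT 0%nat p ltac:(lia) ltac:(rewrite n3_self; auto)) as T0.
  pose proof (HTT 1%nat q1 ltac:(lia) N1) as T1; pose proof (HTT 2%nat q2 ltac:(lia) N2) as T2.
  pose proof (HDD 1%nat q1 ltac:(lia) N1) as D1; pose proof (HDD 2%nat q2 ltac:(lia) N2) as D2.
  simpl comp in *.
  replace (p +v p0 h *v e3 0) with q1 in T0 by (unfold q1; apply C3_eq; simpl; ring).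
  replace (q1 +v p1 h *v e3 1) with q2 in T1 by (unfold q1, q2; apply C3_eq; simpl; ring).
  replace (q2 +v p2 h *v e3 2) with (p +v h) in T2 by (unfold q2; apply C3_eq; simpl; ring).
  replace (f (p +v h) -c f p -c dot (grad f p) h) with
    ((f (p +v h) -c f q2 -c pd 2 f q2 *c p2 h) +c ((f q2 -c f q1 -c pd 1 f q1 *c p1 h) +c ((f q1 -c f p -c pd 0 f p *c p0 h)
     +c ((pd 1 f q1 -c pd 1 f p) *c p1 h +c (pd 2 f q2 -c pd 2 f p) *c p2 h)))) by (unfold dot, grad; simpl; ring).
  eapply Rle_trans; [apply Cnorm_add|]; eapply Rle_trans; [apply Rplus_le_compat_l, Cnorm_add|];
  eapply Rle_trans; [apply Rplus_le_compat_l, Rplus_le_compat_l, Cnorm_add|];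
  eapply Rle_trans; [apply Rplus_le_compat_l, Rplus_le_compat_l, Rplus_le_compat_l, Cnorm_add|].
  (* Three Taylor remainders and two displacements of partial derivatives; together they give the
     factor 73728, rounded up in the statement. *)
  apply Rle_trans with (3 * T + 2 * D); [lra|].
  replace (3 * T + 2 * D) with (73728 * (M * / r ^ 2 * n3 h ^ 2)) by (unfold T, D; field; lra).
  replace (100000 * M / r ^ 2 * n3 h ^ 2) with (100000 * (M * / r ^ 2 * n3 h ^ 2)) by (field; lra).
  assert (0 <= M * / r ^ 2 * n3 h ^ 2) by (apply Rmult_le_pos; [apply Rmult_le_pos; lra|nra]). lra.
Qed.

Lemma sepB_tdiff (f : C3 -> Cplx) (p : C3) (r M : R) : 0 < r -> sepB f p r M -> tdiff f p (grad f p).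
Proof.
  intros Hr H eps Heps.
  pose proof (M_nonneg f p r M Hr H) as HM.
  assert (0 <= 100000 * M / r ^ 2) as HK by (unfold Rdiv; apply Rmult_le_pos; [lra|left; apply Rinv_0_lt_compat; nra]).
  set (K := 100000 * M / r ^ 2) in *.
  assert (0 < eps / (1 + K)) by (apply Rdiv_lt_0_compat; lra).
  assert (eps / (1 + K) * (1 + K) = eps) by (field; lra).
  exists (Rmin (r / 16) (eps / (1 + K))); split; [apply Rmin_glb_lt; lra|].
  intros h Hh; pose proof (Rmin_l (r / 16) (eps / (1 + K))); pose proof (Rmin_r (r / 16) (eps / (1 + K))).
  pose proof (n3_ge0 h).
  eapply Rle_trans; [apply (sepB_taylor f p h r M); auto; lra|]; fold K.
  replace (K * n3 h ^ 2) with (K * n3 h * n3 h) by ring. apply Rmult_le_compat_r; nra.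
Qed.

Lemma sepB_pd_ccont (f : C3 -> Cplx) (p : C3) (r M : R) (i : nat) : 0 < r -> sepB f p r M -> (i < 3)%nat -> ccont (pd i f) p.
Proof.
  intros Hr H Hi eps Heps.
  pose proof (M_nonneg f p r M Hr H) as HM.
  assert (0 <= 24576 * M / r ^ 2) as HK by (unfold Rdiv; apply Rmult_le_pos; [lra|left; apply Rinv_0_lt_compat; nra]).
  set (K := 24576 * M / r ^ 2) in *.
  assert (0 < eps / (1 + K)) by (apply Rdiv_lt_0_compat; lra).
  assert (eps / (1 + K) * (1 + K) = eps) by (field; lra).
  exists (Rmin (r / 16) (eps / (1 + K))); split; [apply Rmin_glb_lt; lra|].
  intros q Hq; pose proof (Rmin_l (r / 16) (eps / (1 + K))); pose proof (Rmin_r (r / 16) (eps / (1 + K))).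
  pose proof (n3_ge0 (q -v p)).
  eapply Rle_lt_trans; [apply (sepB_pd_lipschitz f p p q r M i); auto; [rewrite n3_self|]; lra|]; fold K. nra.
Qed.

(** * Holomorphic functions on balls and vanishing to order two *)

Definition Hol (r : R) (f : C3 -> Cplx) : Prop := forall p, n3 p < r -> tdiff f p (grad f p).

Lemma Hol_intro (r : R) (f : C3 -> Cplx) : (forall p, n3 p < r -> exists l, tdiff f p l) -> Hol r f.
Proof. intros H p Hp; destruct (H p Hp) as [l Hl]; rewrite (tdiff_grad_eq f p l Hl); auto. Qed.

Lemma comp_grad (i : nat) (f : C3 -> Cplx) (p : C3) : (i < 3)%nat -> comp i (grad f p) = pd i f p.
Proof. destruct i as [|[|[|i]]]; intros; try reflexivity; lia. Qed.

Lemma Hol_has_pd (r : R) (f : C3 -> Cplx) (p : C3) (i : nat) : Hol r f -> n3 p < r -> (i < 3)%nat -> has_pd i f p (pd i f p).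
Proof. intros H Hp Hi; rewrite <- comp_grad by auto; apply tdiff_has_pd, H; auto. Qed.

Lemma Hol_sub (r r' : R) (f : C3 -> Cplx) : r' <= r -> Hol r f -> Hol r' f.
Proof. intros Hr H p Hp; apply H; lra. Qed.

(** Continuity is used as a source of a local bound; from there [sepB] carries the estimates. *)
Lemma holo_ball_sepB (r : R) (f : C3 -> Cplx) (p : C3) : holo_ball r f -> n3 p < r ->
  exists d M, 0 < d /\ sepB f p d M.
Proof.
  intros H Hp; destruct (H p Hp) as [Hc _]; destruct (Hc 1) as [d [Hd K]]; [lra|].
  exists (Rmin d (r - n3 p)), (1 + Cnorm (f p)); split; [apply Rmin_glb_lt; lra|].
  intros q Hq; pose proof (Rmin_l d (r - n3 p)); pose proof (Rmin_r d (r - n3 p)); split.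
  - apply H; pose proof (n3_le_sub q p); lra.
  - pose proof (Cnorm_le_sub (f q) (f p)); specialize (K q ltac:(lra)); lra.
Qed.

Lemma holo_ball_Hol (r : R) (f : C3 -> Cplx) : holo_ball r f <-> Hol r f.
Proof.
  split.
  - intros H p Hp; destruct (holo_ball_sepB r f p H Hp) as [d [M [Hd HS]]]; apply (sepB_tdiff f p d M); auto.
  - intros H p Hp; split; [apply (tdiff_ccont f p (grad f p)), H; auto|].
    intros i Hi; exists (pd i f p); apply (Hol_has_pd r); auto.
Qed.

Lemma Hol_sepB (r : R) (f : C3 -> Cplx) (p : C3) : Hol r f -> n3 p < r -> exists d M, 0 < d /\ sepB f p d M.
Proof. rewrite <- holo_ball_Hol; apply holo_ball_sepB. Qed.

(** Osgood's lemma with a bound in place of continuity. Functions defined by integrals, limits or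
    removable singularities are shown holomorphic in this way. *)
Lemma Hol_of_sep (r M : R) (f : C3 -> Cplx) :
  (forall p, n3 p < r -> (forall i, (i < 3)%nat -> exists L, has_pd i f p L) /\ Cnorm (f p) <= M) -> Hol r f.
Proof.
  intros H p Hp; apply (sepB_tdiff f p (r - n3 p) M); [lra|].
  intros q Hq; apply H; pose proof (n3_le_sub q p); lra.
Qed.

Lemma Hol_bounded_sepB (r M : R) (f : C3 -> Cplx) (p : C3) (d : R) :
  Hol r f -> (forall q, n3 q < r -> Cnorm (f q) <= M) -> n3 p + d <= r -> sepB f p d M.
Proof.
  intros H HM Hd q Hq; assert (n3 q < r) by (pose proof (n3_le_sub q p); lra); split; auto.
  intros i Hi; exists (pd i f q); apply (Hol_has_pd r); auto.
Qed.

Lemma Hol_pd (r : R) (f : C3 -> Cplx) (i : nat) : (i < 3)%nat -> Hol r f -> Hol r (pd i f).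
Proof.
  intros Hi H; apply holo_ball_Hol; intros p Hp; destruct (Hol_sepB r f p H Hp) as [d [M [Hd HS]]].
  split; [apply (sepB_pd_ccont f p d M); auto|intros j Hj; apply (sepB_pd_pd f p d M); auto].
Qed.

Lemma n3_segment (p q : C3) (t r : R) : 0 <= t <= 1 -> n3 p < r -> n3 q < r -> n3 (q +v RtoC t *v (p -v q)) < r.
Proof.
  intros Ht Hp Hq.
  replace (q +v RtoC t *v (p -v q)) with (RtoC (1 - t) *v q +v RtoC t *v p)
    by (rewrite RtoC_sub; replace (RtoC 1) with C1 by reflexivity; apply C3_eq; simpl; ring).
  eapply Rle_lt_trans; [apply n3_add|]; rewrite !n3_scal, !Cnorm_RtoC, !Rabs_pos_eq by lra.
  destruct (Req_dec t 0) as [->|]; [lra|]; nra.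
Qed.

Lemma rder_affine (a b : Cplx) (t : R) : rder (fun t => a +c RtoC t *c b) t b.
Proof.
  assert (rder RtoC t C1) as H1 by (apply (rder_RtoC id t 1), derivable_pt_lim_id).
  pose proof (rder_add _ _ _ _ _ (rder_const a t) (rder_mul _ _ _ _ _ H1 (rder_const b t))) as K.
  cbv beta in K; replace (C0 +c (C1 *c b +c RtoC t *c C0)) with b in K by ring; exact K.
Qed.

Lemma Hol_increment (f : C3 -> Cplx) (p q : C3) (r A : R) : Hol r f -> n3 p < r -> n3 q < r ->
  (forall t, 0 <= t <= 1 -> n3 (grad f (q +v RtoC t *v (p -v q))) <= A) ->
  Cnorm (f p -c f q) <= 6 * A * n3 (p -v q).
Proof.
  intros Hf Hp Hq HA.
  pose proof (rder_increment_const (fun t => f (q +v RtoC t *v (p -v q)))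
    (fun t => dot (grad f (q +v RtoC t *v (p -v q))) (p -v q)) (3 * A * n3 (p -v q)) 0 1 ltac:(lra)) as H.
  cbv beta in H.
  replace (q +v RtoC 1 *v (p -v q)) with p in H by (replace (RtoC 1) with C1 by reflexivity; apply C3_eq; simpl; ring).
  replace (q +v RtoC 0 *v (p -v q)) with q in H by (replace (RtoC 0) with C0 by reflexivity; apply C3_eq; simpl; ring).
  replace (6 * A * n3 (p -v q)) with (2 * (3 * A * n3 (p -v q) * (1 - 0))) by ring.
  apply H; intros t Ht.
  - apply (tdiff_comp_rder f (fun t => q +v RtoC t *v (p -v q))); [apply Hf, n3_segment; auto| | |]; apply rder_affine.
  - eapply Rle_trans; [apply Cnorm_dot|]; apply Rmult_le_compat_r; [apply n3_ge0|]; specialize (HA t Ht); lra.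
Qed.

Lemma order2_grad (f : C3 -> Cplx) (r : R) : 0 < r -> Hol r f -> order_ge2 f ->
  exists d C, 0 < d <= r /\ 0 <= C /\ forall p, n3 p < d -> n3 (grad f p) <= C * n3 p.
Proof.
  intros Hr Hf [_ H0].
  destruct (Hol_sepB r f O3 Hf ltac:(rewrite n3_O3; auto)) as [d [M [Hd HS]]].
  pose proof (M_nonneg f O3 d M Hd HS) as HM.
  set (K := 24576 * M / d ^ 2).
  assert (0 <= K) as HK by (unfold K, Rdiv; apply Rmult_le_pos; [lra|left; apply Rinv_0_lt_compat; nra]).
  exists (Rmin r (d / 16)), (3 * K); repeat split; [apply Rmin_glb_lt; lra|apply Rmin_l|lra|].
  intros p Hp; pose proof (Rmin_l r (d / 16)); pose proof (Rmin_r r (d / 16)).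
  assert (forall i, (i < 3)%nat -> Cnorm (pd i f p) <= K * n3 p) as HP.
  { intros i Hi.
    pose proof (sepB_pd_lipschitz f O3 O3 p d M i Hd HS Hi ltac:(rewrite n3_self; lra)) as HL.
    replace (p -v O3) with p in HL by (apply C3_eq; simpl; ring).
    rewrite (H0 i Hi) in HL; replace (pd i f p -c C0) with (pd i f p) in HL by ring; apply HL; lra. }
  eapply Rle_trans; [apply n3_le_sum|]; simpl.
  pose proof (HP 0%nat ltac:(lia)); pose proof (HP 1%nat ltac:(lia)); pose proof (HP 2%nat ltac:(lia)); lra.
Qed.

(** The Lipschitz constant is proportional to the radius [b]. This makes nonlinear terms
    contractions on small balls. *)
Lemma order2_lipschitz (f : C3 -> Cplx) (r : R) : 0 < r -> Hol r f -> order_ge2 f ->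
  exists d C, 0 < d <= r /\ 0 <= C /\ forall b, b <= d -> forall p q, n3 p < b -> n3 q < b ->
    Cnorm (f p -c f q) <= C * b * n3 (p -v q).
Proof.
  intros Hr Hf H2; destruct (order2_grad f r Hr Hf H2) as [d [C [Hd [HC K]]]].
  exists d, (6 * C); repeat split; try lra.
  intros b Hb p q Hp Hq.
  replace (6 * C * b * n3 (p -v q)) with (6 * (C * b) * n3 (p -v q)) by ring.
  apply (Hol_increment f p q r); auto; try lra.
  intros t Ht; pose proof (n3_segment p q t b Ht Hp Hq).
  eapply Rle_trans; [apply K; lra|]; apply Rmult_le_compat_l; lra.
Qed.

Lemma order2_square (f : C3 -> Cplx) (r : R) : 0 < r -> Hol r f -> order_ge2 f ->
  exists d C, 0 < d <= r /\ 0 <= C /\ forall p, n3 p < d -> Cnorm (f p) <= C * n3 p ^ 2.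
Proof.
  intros Hr Hf H2; destruct (order2_lipschitz f r Hr Hf H2) as [d [C [Hd [HC K]]]].
  exists (d / 2), (2 * C); repeat split; try lra.
  intros p Hp; destruct H2 as [H0 _].
  destruct (Req_dec (n3 p) 0) as [E|E].
  - rewrite (n3_eq0 p E), H0, Cnorm_C0, n3_O3; lra.
  - pose proof (n3_ge0 p); specialize (K (2 * n3 p) ltac:(lra) p O3 ltac:(lra) ltac:(rewrite n3_O3; lra)).
    rewrite H0 in K; replace (f p -c C0) with (f p) in K by ring.
    replace (p -v O3) with p in K by (apply C3_eq; simpl; ring). nra.
Qed.

(** Links [quad], a combination of second partial derivatives at 0, with the limit of f(sv)/s^2. It
    gives the limit at [t = 0] of the integrand of [Kc] and the constant vector of the reduced
    system. *)
Lemma quad_limit (f : C3 -> Cplx) (r : R) (v : C3) : 0 < r -> Hol r f -> order_ge2 f ->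
  forall eps, 0 < eps -> exists d, 0 < d /\ forall s, Cnorm s < d ->
    Cnorm (f (s *v v) -c s *c s *c quad f v) <= eps * Cnorm s ^ 2.
Proof.
  intros Hr Hf [H0 H1] eps Heps.
  set (r' := r / (1 + n3 v)).
  pose proof (n3_ge0 v) as Hv.
  assert (0 < r') by (apply Rdiv_lt_0_compat; lra).
  assert (r' * (1 + n3 v) = r) by (unfold r'; field; lra).
  assert (Hin : forall s, Cnorm s < r' -> n3 (s *v v) < r).
  { intros s Hs; rewrite n3_scal; pose proof (Cnorm_ge0 s); nra. }
  assert (Hlin : forall (a s : Cplx), cder (fun s => s *c a) s a).
  { intros a s; pose proof (cder_mul _ _ _ _ _ (cder_id s) (cder_const a s)) as K; cbv beta in K.
    replace (C1 *c a +c s *c C0) with a in K by ring; exact K. }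
  assert (Hcurve : forall g s l, tdiff g (s *v v) l -> cder (fun s => g (s *v v)) s (dot l v)).
  { intros g s l Hg; apply (tdiff_comp_cder g (fun s => s *v v)); auto; apply Hlin. }
  set (df := fun s => dot (grad f (s *v v)) v).
  assert (Hdf : forall s, Cnorm (s -c C0) < r' -> cder (fun s => f (s *v v)) s (df s)).
  { intros s Hs; replace (s -c C0) with s in Hs by ring; apply Hcurve, Hf, Hin; auto. }
  (* The second derivative of [s -> f (s v)] at 0, by the chain rule applied to each partial
     derivative. *)
  set (B := dot (grad (pd 0 f) O3) v *c p0 v +c (dot (grad (pd 1 f) O3) v *c p1 v +c dot (grad (pd 2 f) O3) v *c p2 v)).
  assert (EO : C0 *v v = O3) by (apply C3_eq; simpl; ring).
  assert (HB : cder df C0 B).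
  { assert (forall i, (i < 3)%nat -> forall c, cder (fun s => pd i f (s *v v) *c c) C0 (dot (grad (pd i f) O3) v *c c)) as HP.
    { intros i Hi c. assert (tdiff (pd i f) (C0 *v v) (grad (pd i f) O3)) as HT.
      { rewrite EO; apply (Hol_pd r f i Hi Hf); rewrite n3_O3; auto. }
      pose proof (cder_mul _ _ _ _ _ (Hcurve _ _ _ HT) (cder_const c C0)) as K; cbv beta in K.
      match type of K with cder _ _ (?a +c ?b *c C0) => replace (a +c b *c C0) with a in K by ring end; exact K. }
    unfold B; apply (cder_add _ (fun s => pd 1 f (s *v v) *c p1 v +c pd 2 f (s *v v) *c p2 v)); [apply (HP 0%nat); lia|].
    apply cder_add; [apply (HP 1%nat); lia|apply (HP 2%nat); lia]. }
  destruct (taylor2 _ df C0 B r' H Hdf HB eps Heps) as [d [Hd K]].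
  exists d; split; auto; intros s Hs; specialize (K s Hs); cbv beta in K.
  replace (C0 +c s) with s in K by ring.
  replace (s *c s *c quad f v) with (f (C0 *v v) +c df C0 *c s +c RtoC (1 / 2) *c B *c (s *c s)).
  - replace (f (s *v v) -c (f (C0 *v v) +c df C0 *c s +c RtoC (1 / 2) *c B *c (s *c s))) with
      (f (s *v v) -c f (C0 *v v) -c df C0 *c s -c RtoC (1 / 2) *c B *c (s *c s)) by ring; exact K.
  - unfold df; rewrite EO, H0; unfold grad; rewrite !H1 by lia.
    unfold B, quad, dot, grad; simpl p0; simpl p1; simpl p2; ring.
Qed.

(** Pointwise convergence suffices under a uniform bound: the estimate of [hol1_dq_cauchy] is the
    same for all [fn n], so it passes to the limit. *)
Lemma Hol_limit (r M : R) (fn : nat -> C3 -> Cplx) (f : C3 -> Cplx) :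
  (forall n, Hol r (fn n)) -> (forall n p, n3 p < r -> Cnorm (fn n p) <= M) ->
  (forall p, n3 p < r -> forall eps, 0 < eps -> exists N, forall n, (N <= n)%nat -> Cnorm (fn n p -c f p) < eps) ->
  Hol r f.
Proof.
  intros Hn HM Hl.
  apply (Hol_of_sep r M); intros p Hp; split.
  - intros i Hi.
    set (d := r - n3 p).
    assert (0 < d) as Hd by (unfold d; lra).
    destruct (dq_cauchy_cder (fun z => f (p +v z *v e3 i)) C0 (2048 * M / d ^ 2) (d / 4)) as [L HL];
      [lra| |exists L; apply has_pd_cder0; auto].
    intros h h' Hh Hh'; apply le_epsilon; intros eps Heps.
    assert (forall z, Cnorm z < d -> n3 (p +v z *v e3 i) < r) as Hz.
    { intros z Hz; pose proof (n3_add p (z *v e3 i)); rewrite n3_scal_e3 in *; unfold d in *; lra. }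
    assert (forall k, 0 < Cnorm k < d / 4 -> exists N, forall n, (N <= n)%nat ->
       Cnorm (dq (fun z => f (p +v z *v e3 i)) C0 k -c dq (fun z => fn n (p +v z *v e3 i)) C0 k) < eps / 2) as Hk.
    { intros k Hk.
      assert (k <> C0) by (apply Cnorm_neq0; lra).
      destruct (Hl _ (Hz k ltac:(lra)) (eps / 4 * Cnorm k)) as [N1 K1]; [nra|].
      destruct (Hl _ (Hz C0 ltac:(rewrite Cnorm_C0; lra)) (eps / 4 * Cnorm k)) as [N2 K2]; [nra|].
      exists (Nat.max N1 N2); intros n Hn'; specialize (K1 n ltac:(lia)); specialize (K2 n ltac:(lia)).
      unfold dq; replace (C0 +c k) with k by ring.
      match goal with |- Cnorm (?a /c k -c ?b /c k) < _ => replace (a /c k -c b /c k) with ((a -c b) /c k) by (field; auto) end.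
      rewrite Cnorm_div by auto.
      apply (Rmult_lt_reg_r (Cnorm k)); [lra|]; unfold Rdiv at 1; rewrite Rmult_assoc, Rinv_l, Rmult_1_r by lra.
      match goal with |- Cnorm (?a -c ?b -c (?c -c ?e)) < _ =>
        replace (a -c b -c (c -c e)) with ((e -c b) -c (c -c a)) by ring; pose proof (Cnorm_sub (e -c b) (c -c a)) end.
      nra. }
    destruct (Hk h Hh) as [N1 K1]; destruct (Hk h' Hh') as [N2 K2].
    set (n := Nat.max N1 N2); specialize (K1 n ltac:(lia)); specialize (K2 n ltac:(lia)).
    assert (sepB (fn n) p d M) as HS by (apply (Hol_bounded_sepB r); auto; unfold d; lra).
    destruct (sepB_slice (fn n) p d M i HS Hi) as [S1 S2].
    pose proof (hol1_dq_cauchy _ C0 h h' d M Hd S1 S2 Hh Hh') as K3.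
    match goal with |- Cnorm (?a -c ?b) <= _ => match type of K3 with Cnorm (?a' -c ?b') <= _ =>
      replace (a -c b) with ((a' -c b') +c ((a -c a') -c (b -c b'))) by ring;
      pose proof (Cnorm_add (a' -c b') ((a -c a') -c (b -c b'))); pose proof (Cnorm_sub (a -c a') (b -c b')) end end.
    lra.
  - apply le_epsilon; intros eps Heps; destruct (Hl p Hp eps Heps) as [N HN]; specialize (HN N (le_n N)).
    pose proof (Cnorm_le_sub (f p) (fn N p)); rewrite (Cnorm_sub_sym (f p)) in *; specialize (HM N p Hp); lra.
Qed.

(** * Fixed points in spaces of holomorphic maps *)

Definition HolV (r : R) (W : C3 -> C3) : Prop :=
  Hol r (fun p => p0 (W p)) /\ Hol r (fun p => p1 (W p)) /\ Hol r (fun p => p2 (W p)).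

Definition wle (r c : R) (m : nat) (W : C3 -> C3) : Prop := forall p, n3 p < r -> n3 (W p) <= c * n3 p ^ m.

(** An operator of norm [kappa] for the weight [|p|^m]. Instead of linearity, the estimate is
    required for differences; this covers the identity, used to invert maps, and [Kop]. *)
Record good_op (K : (C3 -> C3) -> C3 -> C3) (r kappa : R) (m : nat) : Prop := {
  good_hol : forall g c, HolV r g -> wle r c m g -> HolV r (K g) /\ wle r (kappa * c) m (K g);
  good_sub : forall g g' c c', HolV r g -> HolV r g' -> wle r c m g -> wle r c m g' ->
    wle r c' m (fun p => g p -v g' p) -> wle r (kappa * c') m (fun p => K g p -v K g' p) }.

Lemma n3_complete (u : nat -> C3) (c : R) : 0 <= c ->
  (forall n, n3 (u (S n) -v u n) <= c * (1 / 2) ^ n) ->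
  exists l, forall n, n3 (u n -v l) <= 6 * c * (1 / 2) ^ n.
Proof.
  intros Hc Hu.
  assert (forall n k, n3 (u n -v u (n + k)%nat) <= 2 * c * (1 / 2) ^ n * (1 - (1 / 2) ^ k)) as H.
  { intros n k; induction k.
    - rewrite Nat.add_0_r, n3_self; simpl; lra.
    - rewrite Nat.add_succ_r; pose proof (n3_sub_tri (u n) (u (n + k)%nat) (u (S (n + k)))).
      specialize (Hu (n + k)%nat); rewrite n3_sub_sym in Hu; rewrite pow_add in Hu; simpl pow; lra. }
  assert (forall n, 0 < (1 / 2) ^ n) as Hpos by (intros; apply pow_lt; lra).
  assert (forall n m, (n <= m)%nat -> n3 (u n -v u m) <= 2 * c * (1 / 2) ^ n) as H'.
  { intros n m Hnm; replace m with (n + (m - n))%nat by lia; eapply Rle_trans; [apply H|].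
    pose proof (Hpos n); pose proof (Hpos (m - n)%nat).
    assert (0 <= c * (1 / 2) ^ n) by (apply Rmult_le_pos; lra). nra. }
  assert (forall eps, 0 < eps -> exists N, forall n, (N <= n)%nat -> 2 * c * (1 / 2) ^ n < eps) as Hsmall.
  { intros eps Heps; destruct (pow_lt_1_zero (1 / 2) ltac:(rewrite Rabs_pos_eq; lra) (eps / (2 * c + 1))) as [N HN];
      [apply Rdiv_lt_0_compat; lra|].
    exists N; intros n Hn; specialize (HN n Hn); rewrite Rabs_pos_eq in HN by (left; apply Hpos).
    assert (eps / (2 * c + 1) * (2 * c + 1) = eps) by (field; lra). pose proof (Hpos n); nra. }
  assert (forall i, exists l, forall n, Cnorm (comp i (u n) -c l) <= 2 * c * (1 / 2) ^ n) as Hi.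
  { intros i; apply Cplx_complete; auto.
    intros n m Hnm; eapply Rle_trans; [|apply (H' n m Hnm)].
    replace (comp i (u n) -c comp i (u m)) with (comp i (u n -v u m)) by (destruct i as [|[|i]]; reflexivity).
    apply Cnorm_comp_le. }
  destruct (Hi 0%nat) as [l0 K0]; destruct (Hi 1%nat) as [l1 K1]; destruct (Hi 2%nat) as [l2 K2].
  exists (mk3 l0 l1 l2); intros n; eapply Rle_trans; [apply n3_le_sum|].
  specialize (K0 n); specialize (K1 n); specialize (K2 n); simpl in *; lra.
Qed.

(** Picard iteration from 0 in a weighted ball of radius [delta]: [kappa * L <= 1 / 2] is
    contraction and the last inequality is invariance of the ball. Limits are pointwise, so
    completeness of a function space is replaced by [Hol_limit]. *)
Theorem holomorphic_fixed_point (K : (C3 -> C3) -> C3 -> C3) (G : C3 -> C3 -> C3) (r kappa L c0 delta : R) (m : nat) :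
  0 < r -> 0 <= kappa -> 0 <= L -> 0 <= c0 -> 0 <= delta -> good_op K r kappa m ->
  (forall w, HolV r w -> wle r delta m w -> HolV r (fun p => G p (w p))) ->
  (forall p w w', n3 p < r -> n3 w <= delta * n3 p ^ m -> n3 w' <= delta * n3 p ^ m ->
     n3 (G p w -v G p w') <= L * n3 (w -v w')) ->
  (forall p, n3 p < r -> n3 (G p O3) <= c0 * n3 p ^ m) ->
  kappa * L <= 1 / 2 -> kappa * (c0 + L * delta) <= delta ->
  exists w, HolV r w /\ wle r delta m w /\ forall p, n3 p < r -> w p = K (fun q => G q (w q)) p.
Proof.
  intros Hr Hkappa HL Hc0 Hdelta HK HGh HGl HG0 HkL Hkd.
  set (w := fix w (n : nat) : C3 -> C3 := match n with O => fun _ => O3 | S k => K (fun q => G q (w k q)) end).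
  assert (Hpm : forall p, 0 <= n3 p ^ m) by (intros; apply pow_le, n3_ge0).
  assert (Hbound : forall u, HolV r u -> wle r delta m u -> wle r (c0 + L * delta) m (fun p => G p (u p))).
  { intros u Hu Hb p Hp.
    pose proof (HGl p (u p) O3 Hp (Hb p Hp)) as H1; rewrite n3_O3 in H1.
    specialize (H1 ltac:(apply Rmult_le_pos; auto)).
    replace (u p -v O3) with (u p) in H1 by (apply C3_eq; simpl; ring).
    pose proof (n3_le_sub (G p (u p)) (G p O3)); specialize (HG0 p Hp); specialize (Hb p Hp).
    assert (L * n3 (u p) <= L * (delta * n3 p ^ m)) by (apply Rmult_le_compat_l; auto). lra. }
  assert (Hw : forall n, HolV r (w n) /\ wle r delta m (w n)).
  { induction n as [|n [IH1 IH2]].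
    - split; [|intros p Hp; simpl; rewrite n3_O3; apply Rmult_le_pos; auto].
      repeat split; apply Hol_intro; intros p Hp; exists O3; exact (tdiff_const C0 p).
    - destruct (good_hol _ _ _ _ HK _ _ (HGh _ IH1 IH2) (Hbound _ IH1 IH2)) as [H1 H2]; split; auto.
      intros p Hp; eapply Rle_trans; [apply H2; auto|]; apply Rmult_le_compat_r; auto. }
  assert (Hdiff : forall n, wle r (delta * (1 / 2) ^ n) m (fun p => w (S n) p -v w n p)).
  { induction n as [|n IH].
    - intros p Hp; replace (w 0%nat p) with O3 by reflexivity.
      replace (w 1%nat p -v O3) with (w 1%nat p) by (apply C3_eq; simpl; ring).
      rewrite pow_O, Rmult_1_r; apply Hw; auto.
    - destruct (Hw n) as [A1 A2]; destruct (Hw (S n)) as [B1 B2].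
      assert (wle r (L * (delta * (1 / 2) ^ n)) m (fun p => G p (w (S n) p) -v G p (w n p))) as Hg.
      { intros p Hp; eapply Rle_trans; [apply HGl; auto|]; rewrite Rmult_assoc; apply Rmult_le_compat_l; auto. }
      pose proof (good_sub _ _ _ _ HK _ _ _ _ (HGh _ B1 B2) (HGh _ A1 A2) (Hbound _ B1 B2) (Hbound _ A1 A2) Hg) as H.
      intros p Hp; eapply Rle_trans; [exact (H p Hp)|]; apply Rmult_le_compat_r; auto.
      assert (0 <= delta * (1 / 2) ^ n) by (apply Rmult_le_pos; [lra|apply pow_le; lra]).
      simpl pow; nra. }
  (* The pointwise limit, chosen together with its rate of convergence. *)
  set (W := fun p => epsilon (inhabits O3) (fun l => forall n, n3 (w n p -v l) <= 6 * (delta * n3 p ^ m) * (1 / 2) ^ n)).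
  assert (HW : forall p, n3 p < r -> forall n, n3 (w n p -v W p) <= 6 * (delta * n3 p ^ m) * (1 / 2) ^ n).
  { intros p Hp; apply (epsilon_spec (inhabits O3) (fun l => forall n, n3 (w n p -v l) <= 6 * (delta * n3 p ^ m) * (1 / 2) ^ n)).
    apply n3_complete; [apply Rmult_le_pos; auto|]; intros n; pose proof (Hdiff n p Hp); lra. }
  assert (Hlim : forall p, n3 p < r -> forall C eps, 0 < eps -> exists N, forall n, (N <= n)%nat -> C * (6 * (delta * n3 p ^ m) * (1 / 2) ^ n) < eps).
  { intros p Hp C eps Heps; set (B := Rabs C * (6 * (delta * n3 p ^ m))).
    assert (0 <= B) by (apply Rmult_le_pos; [apply Rabs_pos|]; apply Rmult_le_pos; [lra|apply Rmult_le_pos; auto]).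
    destruct (pow_lt_1_zero (1 / 2) ltac:(rewrite Rabs_pos_eq; lra) (eps / (B + 1))) as [N HN]; [apply Rdiv_lt_0_compat; lra|].
    assert (eps / (B + 1) * (B + 1) = eps) by (field; lra).
    exists N; intros n Hn; specialize (HN n Hn). assert (0 < (1 / 2) ^ n) by (apply pow_lt; lra).
    rewrite Rabs_pos_eq in HN by lra.
    apply Rle_lt_trans with (B * (1 / 2) ^ n); [|nra].
    unfold B; rewrite <- !Rmult_assoc; apply Rmult_le_compat_r; [lra|]; apply Rmult_le_compat_r; auto.
    apply Rmult_le_compat_r; auto. apply Rmult_le_compat_r; [lra|apply Rle_abs]. }
  assert (HWb : wle r delta m W).
  { intros p Hp; apply le_epsilon; intros eps Heps; destruct (Hlim p Hp 1 eps Heps) as [N HN].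
    specialize (HN N (le_n N)); pose proof (HW p Hp N); destruct (Hw N) as [_ Hb]; specialize (Hb p Hp).
    pose proof (n3_le_sub (W p) (w N p)); rewrite (n3_sub_sym (W p)) in *; lra. }
  assert (HWh : HolV r W).
  { assert (forall i : nat, (forall n, Hol r (fun p => comp i (w n p))) -> Hol r (fun p => comp i (W p))) as Hi.
    { intros i Hi; apply (Hol_limit r (delta * r ^ m) (fun n p => comp i (w n p))); auto.
      - intros n p Hp; eapply Rle_trans; [apply Cnorm_comp_le|]; eapply Rle_trans; [apply Hw; auto|].
        apply Rmult_le_compat_l; auto; apply pow_incr; split; [apply n3_ge0|lra].
      - intros p Hp eps Heps; destruct (Hlim p Hp 1 eps Heps) as [N HN]; exists N; intros n Hn; specialize (HN n Hn).
        specialize (HW p Hp n).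
        replace (comp i (w n p) -c comp i (W p)) with (comp i (w n p -v W p)) by (destruct i as [|[|i]]; reflexivity).
        pose proof (Cnorm_comp_le i (w n p -v W p)); lra. }
    split; [apply (Hi 0%nat); intros n; apply (Hw n)|split; [apply (Hi 1%nat)|apply (Hi 2%nat)]; intros n; apply (Hw n)]. }
  exists W; repeat split; try apply HWh; auto.
  intros p Hp.
  assert (n3 (W p -v K (fun q => G q (W q)) p) = 0) as E.
  { apply Rle_antisym; [|apply n3_ge0]; apply le_epsilon; intros eps Heps; rewrite Rplus_0_l.
    destruct (Hlim p Hp (1 + kappa * L) eps Heps) as [N HN]; specialize (HN N (le_n N)).
    destruct (Hw N) as [A1 A2].
    assert (wle r (L * (6 * delta * (1 / 2) ^ N)) m (fun p => G p (w N p) -v G p (W p))) as Hg.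
    { intros q Hq; eapply Rle_trans; [apply HGl; auto|]; pose proof (HW q Hq N).
      rewrite Rmult_assoc; apply Rmult_le_compat_l; auto; lra. }
    pose proof (good_sub _ _ _ _ HK _ _ _ _ (HGh _ A1 A2) (HGh _ HWh HWb) (Hbound _ A1 A2) (Hbound _ HWh HWb) Hg p Hp) as H.
    cbv beta in H; replace (K (fun q => G q (w N q)) p) with (w (S N) p) in H by reflexivity.
    pose proof (n3_sub_tri (W p) (w (S N) p) (K (fun q => G q (W q)) p)).
    rewrite (n3_sub_sym (W p) (w (S N) p)) in *.
    pose proof (HW p Hp (S N)) as HS; simpl pow in HS.
    assert (0 <= 6 * (delta * n3 p ^ m) * (1 / 2) ^ N) by (apply Rmult_le_pos; [apply Rmult_le_pos; [lra|apply Rmult_le_pos; auto]|apply pow_le; lra]).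
    replace (kappa * (L * (6 * delta * (1 / 2) ^ N)) * n3 p ^ m) with (kappa * L * (6 * (delta * n3 p ^ m) * (1 / 2) ^ N)) in H by ring.
    lra. }
  apply n3_eq0 in E; apply C3_eq; apply Csub_eq0; [exact (f_equal p0 E)|exact (f_equal p1 E)|exact (f_equal p2 E)].
Qed.

(** * Composition, algebra and inversion of holomorphic maps *)

Lemma order2_intro (f : C3 -> Cplx) : f O3 = C0 -> tdiff f O3 O3 -> order_ge2 f.
Proof.
  intros H0 H; split; auto; intros i Hi; apply pd_eq.
  replace C0 with (comp i O3) by (destruct i as [|[|i]]; reflexivity); apply tdiff_has_pd; auto.
Qed.

Lemma order2_tdiff (f : C3 -> Cplx) (r : R) : 0 < r -> Hol r f -> order_ge2 f -> tdiff f O3 O3.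
Proof.
  intros Hr Hf [_ H]; replace O3 with (grad f O3) at 2.
  - apply Hf; rewrite n3_O3; auto.
  - unfold grad; rewrite !H by lia; reflexivity.
Qed.

Lemma order2_of_square (f : C3 -> Cplx) (d C : R) : 0 < d -> (forall p, n3 p < d -> Cnorm (f p) <= C * n3 p ^ 2) -> order_ge2 f.
Proof.
  intros Hd H.
  assert (f O3 = C0) as H0.
  { apply Cnorm_eq0, Rle_antisym; [|apply Cnorm_ge0]; specialize (H O3); rewrite n3_O3 in H.
    eapply Rle_trans; [apply H; auto|simpl; lra]. }
  apply order2_intro; auto.
  intros eps Heps; pose proof (Rabs_pos C).
  assert (0 < eps / (1 + Rabs C)) by (apply Rdiv_lt_0_compat; lra).
  assert (eps / (1 + Rabs C) * (1 + Rabs C) = eps) by (field; lra).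
  exists (Rmin d (eps / (1 + Rabs C))); split; [apply Rmin_glb_lt; auto|].
  intros h Hh; pose proof (Rmin_l d (eps / (1 + Rabs C))); pose proof (Rmin_r d (eps / (1 + Rabs C))).
  replace (O3 +v h) with h by (apply C3_eq; simpl; ring); rewrite H0.
  replace (f h -c C0 -c dot O3 h) with (f h) by (unfold dot; simpl; ring).
  eapply Rle_trans; [apply H; lra|]; pose proof (n3_ge0 h); pose proof (Rle_abs C).
  assert (C * n3 h <= eps) by nra. nra.
Qed.

Lemma Hol_comp (r R0 : R) (f : C3 -> Cplx) (W : C3 -> C3) :
  Hol R0 f -> HolV r W -> (forall p, n3 p < r -> n3 (W p) < R0) -> Hol r (fun p => f (W p)).
Proof.
  intros Hf [H0 [H1 H2]] HW; apply Hol_intro; intros p Hp.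
  eexists; apply (tdiff_comp f W); [apply Hf, HW; auto|apply H0; auto|apply H1; auto|apply H2; auto].
Qed.

Lemma HolV_comp (r R0 : R) (F W : C3 -> C3) :
  HolV R0 F -> HolV r W -> (forall p, n3 p < r -> n3 (W p) < R0) -> HolV r (fun p => F (W p)).
Proof.
  intros [F0 [F1 F2]] HW HB; repeat split;
  [apply (Hol_comp r R0 (fun p => p0 (F p)))|apply (Hol_comp r R0 (fun p => p1 (F p)))|apply (Hol_comp r R0 (fun p => p2 (F p)))]; auto.
Qed.

Lemma Hol_add (r : R) (f g : C3 -> Cplx) : Hol r f -> Hol r g -> Hol r (fun p => f p +c g p).
Proof. intros Hf Hg; apply Hol_intro; intros p Hp; eexists; apply tdiff_add; [apply Hf|apply Hg]; auto. Qed.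

Lemma Hol_mul (r : R) (f g : C3 -> Cplx) : Hol r f -> Hol r g -> Hol r (fun p => f p *c g p).
Proof. intros Hf Hg; apply Hol_intro; intros p Hp; eexists; apply tdiff_mul; [apply Hf|apply Hg]; auto. Qed.

Lemma Hol_opp (r : R) (f : C3 -> Cplx) : Hol r f -> Hol r (fun p => Copp (f p)).
Proof. intros Hf; apply Hol_intro; intros p Hp; eexists; apply tdiff_opp; apply Hf; auto. Qed.

Lemma Hol_csub (r : R) (f g : C3 -> Cplx) : Hol r f -> Hol r g -> Hol r (fun p => f p -c g p).
Proof. intros Hf Hg; unfold Csub; apply Hol_add; auto; apply Hol_opp; auto. Qed.

Lemma Hol_const (r : R) (c : Cplx) : Hol r (fun _ => c).
Proof. apply Hol_intro; intros p Hp; eexists; apply tdiff_const. Qed.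

Lemma Hol_p0 (r : R) : Hol r p0.
Proof. apply Hol_intro; intros p Hp; eexists; apply tdiff_p0. Qed.
Lemma Hol_p1 (r : R) : Hol r p1.
Proof. apply Hol_intro; intros p Hp; eexists; apply tdiff_p1. Qed.
Lemma Hol_p2 (r : R) : Hol r p2.
Proof. apply Hol_intro; intros p Hp; eexists; apply tdiff_p2. Qed.

Lemma good_op_id (r : R) (m : nat) : good_op (fun g => g) r 1 m.
Proof.
  constructor.
  - intros g c H1 H2; split; auto; intros p Hp; rewrite Rmult_1_l; auto.
  - intros g g' c c' _ _ _ _ H p Hp; rewrite Rmult_1_l; auto.
Qed.

Definition order2V (N : C3 -> C3) : Prop :=
  order_ge2 (fun p => p0 (N p)) /\ order_ge2 (fun p => p1 (N p)) /\ order_ge2 (fun p => p2 (N p)).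

Lemma order2V_lipschitz (N : C3 -> C3) (r : R) : 0 < r -> HolV r N -> order2V N ->
  exists d C, 0 < d <= r /\ 0 <= C /\ forall b, b <= d -> forall p q, n3 p < b -> n3 q < b ->
    n3 (N p -v N q) <= C * b * n3 (p -v q).
Proof.
  intros Hr [H0 [H1 H2]] [O0 [O1 O2]].
  destruct (order2_lipschitz _ r Hr H0 O0) as [d0 [A0 [Hd0 [HA0 K0]]]].
  destruct (order2_lipschitz _ r Hr H1 O1) as [d1 [A1 [Hd1 [HA1 K1]]]].
  destruct (order2_lipschitz _ r Hr H2 O2) as [d2 [A2 [Hd2 [HA2 K2]]]].
  exists (Rmin d0 (Rmin d1 d2)), (A0 + A1 + A2).
  pose proof (Rmin_l d0 (Rmin d1 d2)); pose proof (Rmin_r d0 (Rmin d1 d2)).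
  pose proof (Rmin_l d1 d2); pose proof (Rmin_r d1 d2).
  repeat split; try lra.
  - repeat apply Rmin_glb_lt; lra.
  - intros b Hb p q Hp Hq; eapply Rle_trans; [apply n3_le_sum|]; simpl p0; simpl p1; simpl p2.
    pose proof (K0 b ltac:(lra) p q Hp Hq); pose proof (K1 b ltac:(lra) p q Hp Hq); pose proof (K2 b ltac:(lra) p q Hp Hq).
    lra.
Qed.

Lemma order2V_O3 (N : C3 -> C3) : order2V N -> N O3 = O3.
Proof. intros [[H0 _] [[H1 _] [H2 _]]]; apply C3_eq; auto. Qed.

Lemma n3_eq (p q : C3) : n3 (p -v q) = 0 -> p = q.
Proof. intros H; apply n3_eq0 in H; apply C3_eq; apply Csub_eq0; [exact (f_equal p0 H)|exact (f_equal p1 H)|exact (f_equal p2 H)]. Qed.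

(** The inverse of [id + N] solves Psi(q) = q - N(Psi(q)), a fixed point problem with the identity
    as operator and weight 0. Both composites are needed later: one produces parameters for given
    points, the other shows them unique. *)
Theorem inverse_near_identity (N : C3 -> C3) (r : R) : 0 < r -> HolV r N -> order2V N ->
  exists rho Psi, 0 < rho /\ 2 * rho <= r /\ HolV rho Psi /\
    (forall q, n3 q < rho -> n3 (Psi q) <= 2 * n3 q /\ Psi q +v N (Psi q) = q) /\
    (forall p, n3 p < rho -> n3 (p +v N p) < rho -> Psi (p +v N p) = p) /\
    tdiff (fun q => p0 (Psi q)) O3 (e3 0) /\ tdiff (fun q => p1 (Psi q)) O3 (e3 1) /\ tdiff (fun q => p2 (Psi q)) O3 (e3 2).
Proof.
  intros Hr HN H2.
  destruct (order2V_lipschitz N r Hr HN H2) as [d [C [Hd [HC K]]]].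
  pose proof (order2V_O3 N H2) as HN0.
  (* On the ball of radius [b] the map [N] is Lipschitz with constant 1/2. *)
  set (b := Rmin (d / 2) (1 / (2 * (C + 1)))).
  assert (0 < b) as Hb by (apply Rmin_glb_lt; [lra|apply Rdiv_lt_0_compat; lra]).
  assert (b <= d / 2) as Hbd by apply Rmin_l.
  assert (b <= 1 / (2 * (C + 1))) as HbC by apply Rmin_r.
  assert (C * b <= 1 / 2) as HCb.
  { apply Rle_trans with ((C + 1) * (1 / (2 * (C + 1)))); [apply Rmult_le_compat; lra|apply Req_le; field; lra]. }
  assert (Hlip : forall p q, n3 p < b -> n3 q < b -> n3 (N p -v N q) <= 1 / 2 * n3 (p -v q)).
  { intros p q Hp Hq; eapply Rle_trans; [apply (K b); auto; lra|]; apply Rmult_le_compat_r; [apply n3_ge0|lra]. }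
  set (delta := b / 2); set (rho := b / 4).
  destruct (holomorphic_fixed_point (fun g => g) (fun q w => q -v N w) rho 1 (1 / 2) rho delta 0) as [Psi [HP [HPb HPeq]]];
    try (unfold rho, delta; lra).
  - apply good_op_id.
  - intros w Hw Hwb.
    assert (HolV rho (fun p => N (w p))) as [A0 [A1 A2]].
    { apply (HolV_comp rho r); auto; intros p Hp; specialize (Hwb p Hp); simpl in Hwb; unfold delta in *; lra. }
    repeat split; simpl; apply Hol_csub; auto; [apply Hol_p0|apply Hol_p1|apply Hol_p2].
  - intros p w w' Hp Hw Hw'; simpl in Hw, Hw'.
    replace (p -v N w -v (p -v N w')) with (N w' -v N w) by (apply C3_eq; simpl; ring).
    rewrite n3_sub_sym; apply Hlip; unfold delta in *; lra.
  - intros p Hp; rewrite HN0; simpl; replace (p -v O3) with p by (apply C3_eq; simpl; ring); lra.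
  - assert (Hin : forall q, n3 q < rho -> n3 (Psi q) < b).
    { intros q Hq; specialize (HPb q Hq); simpl in HPb; unfold delta in HPb; lra. }
    assert (Hsmall : forall q, n3 q < rho -> n3 (Psi q) <= 2 * n3 q).
    { intros q Hq; pose proof (Hlip (Psi q) O3 (Hin q Hq) ltac:(rewrite n3_O3; lra)) as H.
      rewrite HN0 in H; replace (N (Psi q) -v O3) with (N (Psi q)) in H by (apply C3_eq; simpl; ring).
      replace (Psi q -v O3) with (Psi q) in H by (apply C3_eq; simpl; ring).
      pose proof (n3_sub q (N (Psi q))) as T; rewrite <- HPeq in T by auto; lra. }
    assert (HPsi0 : Psi O3 = O3).
    { apply n3_eq0, Rle_antisym; [|apply n3_ge0]; eapply Rle_trans; [apply Hsmall|]; rewrite n3_O3; unfold rho; lra. }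
    assert (Hrho : 0 < rho) by (unfold rho; lra).
    (* Psi differs from the identity by [N] after Psi, whose differential at 0 vanishes. *)
    assert (Hder : forall (pr : C3 -> Cplx) l, tdiff pr O3 l -> (forall p q, pr (p -v q) = pr p -c pr q) ->
       Hol r (fun p => pr (N p)) -> order_ge2 (fun p => pr (N p)) -> tdiff (fun q => pr (Psi q)) O3 l).
    { intros pr l Hpr Hsub HprN Hpr2.
      destruct HP as [B0 [B1 B2]].
      assert (tdiff (fun q => pr (N (Psi q))) O3 O3) as HT.
      { assert (tdiff (fun p => pr (N p)) (Psi O3) O3) as HN2 by (rewrite HPsi0; exact (order2_tdiff _ r Hr HprN Hpr2)).
        assert (n3 O3 < rho) as HO by (rewrite n3_O3; auto).
        pose proof (tdiff_comp _ Psi O3 O3 _ _ _ HN2 (B0 O3 HO) (B1 O3 HO) (B2 O3 HO)) as HT.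
        match type of HT with tdiff _ _ ?a => replace a with O3 in HT by (apply C3_eq; unfold scomb; simpl; ring) end; exact HT. }
      apply (tdiff_ext_loc (fun q => pr q +c Copp (pr (N (Psi q)))) _ O3 l rho Hrho).
      - intros q Hq; replace (q -v O3) with q in Hq by (apply C3_eq; simpl; ring).
        rewrite (HPeq q Hq) at 2; rewrite Hsub; reflexivity.
      - replace l with (l +v Copp C1 *v O3) by (apply C3_eq; simpl; ring).
        apply tdiff_add; auto; apply tdiff_opp; auto. }
    exists rho, Psi; repeat split; try apply HP; auto.
    + unfold rho; lra.
    + rewrite (HPeq q H) at 1; apply C3_eq; simpl; ring.
    + intros p Hp Hq; apply n3_eq.
      pose proof (HPeq _ Hq) as E; set (q := p +v N p) in *.
      pose proof (Hlip (Psi q) p (Hin q Hq) ltac:(unfold rho in Hp; lra)) as HL.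
      assert (n3 (Psi q -v p) = n3 (N (Psi q) -v N p)) as E2.
      { rewrite n3_sub_sym; f_equal; rewrite E at 1; unfold q at 1; apply C3_eq; simpl; ring. }
      pose proof (n3_ge0 (Psi q -v p)); lra.
    + apply (Hder p0); [apply tdiff_p0|reflexivity|apply HN|apply H2].
    + apply (Hder p1); [apply tdiff_p1|reflexivity|apply HN|apply H2].
    + apply (Hder p2); [apply tdiff_p2|reflexivity|apply HN|apply H2].
Qed.

(** * Inverting the Euler operator along rays *)

(** Integrating [t ^ e] gains the factor [1 / (e + 1)], which makes the operator below a contraction
    for large [e]. *)
Lemma CInt_bound_pow (f : R -> Cplx) (C : R) (e : nat) : rcont_on f 0 1 ->
  (forall t, 0 < t < 1 -> Cnorm (f t) <= C * t ^ e) -> Cnorm (CInt f 0 1) <= 2 * C / (INR e + 1).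
Proof.
  intros Hf HC; destruct (rcont_on_ex f 0 1 ltac:(lra) Hf) as [F1 F2].
  pose proof (pos_INR e) as He.
  assert (is_RInt (fun t => C * t ^ e) 0 1 (C / (INR e + 1))) as HI.
  { replace (C / (INR e + 1)) with (minus (C / (INR e + 1) * 1 ^ S e) (C / (INR e + 1) * 0 ^ S e)).
    - apply (is_RInt_derive (V := R_CompleteNormedModule) (fun t => C / (INR e + 1) * t ^ S e)).
      + intros t _; auto_derive; auto.
        replace (match e with 0%nat => 1 | S _ => INR e + 1 end) with (INR e + 1) by (destruct e; simpl; ring).
        field; lra.
      + intros t _; apply (ex_derive_continuous (V := R_NormedModule)); auto_derive; auto.
    - unfold minus, plus, opp; simpl; rewrite pow1; field; lra. }
  assert (forall u : R -> R, ex_RInt u 0 1 -> (forall t, 0 < t < 1 -> Rabs (u t) <= C * t ^ e) -> Rabs (RInt u 0 1) <= C / (INR e + 1)) as HB.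
  { intros u Hu Hub; rewrite <- (is_RInt_unique _ _ _ _ HI).
    assert (ex_RInt (fun t => C * t ^ e) 0 1) as HE by (eexists; exact HI).
    apply Rabs_le; split.
    - assert (RInt (fun t => - (C * t ^ e)) 0 1 = - RInt (fun t => C * t ^ e) 0 1) as EO
        by exact (RInt_opp (V := R_CompleteNormedModule) _ 0 1 HE).
      rewrite <- EO.
      apply RInt_le; [lra|apply (ex_RInt_opp (V := R_NormedModule)); auto|auto|].
      intros t Ht; specialize (Hub t Ht); pose proof (Rle_abs (- u t)); rewrite Rabs_Ropp in *; lra.
    - apply RInt_le; auto; [lra|]; intros t Ht; specialize (Hub t Ht); pose proof (Rle_abs (u t)); lra. }
  eapply Rle_trans; [apply Cnorm_le_Re_Im|]; simpl.
  pose proof (HB _ F1 (fun t Ht => Rle_trans _ _ _ (Re_le_Cnorm _) (HC t Ht))).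
  pose proof (HB _ F2 (fun t Ht => Rle_trans _ _ _ (Im_le_Cnorm _) (HC t Ht))).
  replace (2 * C / (INR e + 1)) with (C / (INR e + 1) + C / (INR e + 1)) by (field; lra); lra.
Qed.

Definition rlim0 (F : R -> Cplx) (L : Cplx) : Prop :=
  forall eps, 0 < eps -> exists d, 0 < d /\ forall t, 0 < Rabs t < d -> Cnorm (F t -c L) < eps.

(** The integrand t^(e-m) g(tp). The power is written as a quotient because e - m is negative in the
    case e = 0, m = 2. *)
Definition kfun (e m : nat) (g : C3 -> Cplx) (p : C3) (t : R) : Cplx := RtoC (t ^ e / t ^ m) *c g (RtoC t *v p).
(** [kfun] extended to [t = 0] by its limit. *)
Definition kint (e m : nat) (g : C3 -> Cplx) (p : C3) (t : R) : Cplx :=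
  if Req_dec_T t 0 then epsilon (inhabits C0) (rlim0 (kfun e m g p)) else kfun e m g p t.
Definition Kc (e m : nat) (g : C3 -> Cplx) (p : C3) : Cplx := CInt (kint e m g p) 0 1.
Definition Kop (e m : nat) (W : C3 -> C3) (p : C3) : C3 :=
  mk3 (Kc e m (fun q => p0 (W q)) p) (Kc e m (fun q => p1 (W q)) p) (Kc e m (fun q => p2 (W q)) p).

Lemma kint_neq0 (e m : nat) (g : C3 -> Cplx) (p : C3) (t : R) : t <> 0 -> kint e m g p t = kfun e m g p t.
Proof. intros H; unfold kint; destruct Req_dec_T; [contradiction|reflexivity]. Qed.

Lemma rder_ray (g : C3 -> Cplx) (p : C3) (t : R) (l : C3) :
  tdiff g (RtoC t *v p) l -> rder (fun t => g (RtoC t *v p)) t (dot l p).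
Proof.
  intros H; apply (tdiff_comp_rder g (fun t => RtoC t *v p)); auto; simpl;
  [pose proof (rder_affine C0 (p0 p) t) as K|pose proof (rder_affine C0 (p1 p) t) as K|pose proof (rder_affine C0 (p2 p) t) as K];
  (eapply rder_ext_loc; [exact Rlt_0_1| |exact K]; intros s _; simpl; ring).
Qed.

Lemma rcont_RtoC (f : R -> R) (t : R) : continuous f t -> rcont (fun s => RtoC (f s)) t.
Proof. intros H; split; simpl; [exact H|apply continuous_const]. Qed.

Lemma continuous_pow (n : nat) (t : R) : continuous (fun s : R => s ^ n) t.
Proof. apply (ex_derive_continuous (V := R_NormedModule)); auto_derive; auto. Qed.

(** For [m = 2] the growth condition makes [g] vanish to order two, and g(tp)/t^2 tends to
    [quad g p]. The factor [0 ^ e] is 1 for [e = 0] and 0 otherwise. *)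
Lemma kfun_limit (e m : nat) (g : C3 -> Cplx) (p : C3) (r c : R) : m = 0%nat \/ m = 2%nat -> 0 < r -> Hol r g ->
  (forall q, n3 q < r -> Cnorm (g q) <= c * n3 q ^ m) -> exists L, rlim0 (kfun e m g p) L.
Proof.
  intros Hm Hr Hg Hc.
  assert (Hprod : forall (F : R -> Cplx) L, rlim0 F L -> rlim0 (fun t => RtoC (t ^ e) *c F t) (RtoC (0 ^ e) *c L)).
  { intros F L HF.
    set (F' := fun t => if Req_dec_T t 0 then L else F t).
    assert (rcont F' 0) as HF'.
    { apply rcont_eps; intros eps Heps; destruct (HF eps Heps) as [d [Hd K]]; exists d; split; auto.
      intros s Hs; unfold F' at 2; destruct (Req_dec_T 0 0) as [_|]; [|lra].
      unfold F'; destruct (Req_dec_T s 0) as [_|Hn]; [rewrite Cnorm_self; auto|].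
      apply K; replace (s - 0) with s in Hs by ring; split; auto; apply Rabs_pos_lt; auto. }
    pose proof (rcont_mul _ _ _ (rcont_RtoC _ _ (continuous_pow e 0)) HF') as HC.
    rewrite rcont_eps in HC; intros eps Heps; destruct (HC eps Heps) as [d [Hd K]]; exists d; split; auto.
    intros t Ht; specialize (K t); replace (t - 0) with t in K by ring; specialize (K ltac:(lra)).
    unfold F' in K; destruct (Req_dec_T 0 0) as [_|]; [|lra]; destruct (Req_dec_T t 0) as [E|_]; auto.
    rewrite E, Rabs_R0 in Ht; lra. }
  destruct Hm as [-> | ->].
  - exists (RtoC (0 ^ e) *c g O3).
    assert (rlim0 (fun t => g (RtoC t *v p)) (g O3)) as H0.
    { assert (rcont (fun t => g (RtoC t *v p)) 0) as HC.
      { eapply rder_rcont, rder_ray, Hg; rewrite n3_scal, Cnorm_RtoC, Rabs_R0; lra. }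
      rewrite rcont_eps in HC; intros eps Heps; destruct (HC eps Heps) as [d [Hd K]]; exists d; split; auto.
      intros t Ht; specialize (K t); replace (t - 0) with t in K by ring.
      replace (RtoC 0 *v p) with O3 in K by (apply C3_eq; simpl; replace (RtoC 0) with C0 by reflexivity; ring).
      apply K; lra. }
    intros eps Heps; destruct (Hprod _ _ H0 eps Heps) as [d [Hd K]]; exists d; split; auto; intros t Ht.
    unfold kfun; simpl pow at 2; unfold Rdiv; rewrite Rinv_1, Rmult_1_r; auto.
  - exists (RtoC (0 ^ e) *c quad g p).
    assert (rlim0 (fun t => RtoC (/ t ^ 2) *c g (RtoC t *v p)) (quad g p)) as H0.
    { intros eps Heps.
      destruct (quad_limit g r p Hr Hg (order2_of_square g r c Hr Hc) (eps / 2)) as [d [Hd K]]; [lra|].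
      exists d; split; auto; intros t Ht; specialize (K (RtoC t)); rewrite Cnorm_RtoC in K; specialize (K ltac:(lra)).
      assert (t <> 0) as Hn by (intros ->; rewrite Rabs_R0 in Ht; lra).
      assert (0 < t ^ 2) by (simpl; nra).
      replace (RtoC (/ t ^ 2) *c g (RtoC t *v p) -c quad g p) with
        (RtoC (/ t ^ 2) *c (g (RtoC t *v p) -c RtoC t *c RtoC t *c quad g p)).
      - rewrite Cnorm_mul, Cnorm_RtoC, Rabs_pos_eq by (left; apply Rinv_0_lt_compat; auto).
        rewrite pow2_abs in K.
        apply Rle_lt_trans with (/ t ^ 2 * (eps / 2 * t ^ 2)); [apply Rmult_le_compat_l; auto; left; apply Rinv_0_lt_compat; auto|].
        replace (/ t ^ 2 * (eps / 2 * t ^ 2)) with (eps / 2) by (field; auto); lra.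
      - rewrite RtoC_inv by lra; replace (RtoC (t ^ 2)) with (RtoC t *c RtoC t) by (rewrite <- RtoC_mul; f_equal; ring).
        field; apply RtoC_neq0; auto. }
    intros eps Heps; destruct (Hprod _ _ H0 eps Heps) as [d [Hd K]]; exists d; split; auto; intros t Ht.
    specialize (K t Ht); unfold kfun.
    replace (RtoC (t ^ e / t ^ 2)) with (RtoC (t ^ e) *c RtoC (/ t ^ 2)) by (rewrite <- RtoC_mul; reflexivity).
    match goal with |- Cnorm (?a -c ?b) < _ => match type of K with Cnorm (?a' -c _) < _ => replace a with a' by ring end end; auto.
Qed.

Lemma kint_rcont (e m : nat) (g : C3 -> Cplx) (p : C3) (r c t : R) : m = 0%nat \/ m = 2%nat -> Hol r g ->
  (forall q, n3 q < r -> Cnorm (g q) <= c * n3 q ^ m) -> n3 (RtoC t *v p) < r -> rcont (kint e m g p) t.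
Proof.
  intros Hm Hg Hc Ht.
  assert (0 < r) as Hr by (pose proof (n3_ge0 (RtoC t *v p)); lra).
  destruct (Req_dec_T t 0) as [->|Hn].
  - pose proof (epsilon_spec (inhabits C0) _ (kfun_limit e m g p r c Hm Hr Hg Hc)) as HL.
    apply rcont_eps; intros eps Heps; destruct (HL eps Heps) as [d [Hd K]]; exists d; split; auto.
    intros s Hs; unfold kint; destruct (Req_dec_T 0 0) as [_|]; [|lra].
    destruct (Req_dec_T s 0) as [_|Hs0]; [rewrite Cnorm_self; auto|].
    apply K; replace (s - 0) with s in Hs by ring; split; auto; apply Rabs_pos_lt; auto.
  - apply (rcont_ext_loc (kfun e m g p) _ t (Rabs t)); [apply Rabs_pos_lt; auto| |].
    + intros s Hs; symmetry; apply kint_neq0; intros ->.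
      replace (0 - t) with (- t) in Hs by ring; rewrite Rabs_Ropp in Hs; lra.
    + apply rcont_mul.
      * apply rcont_RtoC, (ex_derive_continuous (V := R_NormedModule)); auto_derive; apply pow_nonzero; auto.
      * eapply rder_rcont, rder_ray, Hg; auto.
Qed.

Lemma n3_ray (p : C3) (t r : R) : 0 <= t <= 1 -> n3 p < r -> n3 (RtoC t *v p) < r.
Proof. intros Ht Hp; rewrite n3_scal, Cnorm_RtoC, Rabs_pos_eq by lra; pose proof (n3_ge0 p); nra. Qed.

Lemma kint_rcont_on (e m : nat) (g : C3 -> Cplx) (p : C3) (r c : R) : m = 0%nat \/ m = 2%nat -> Hol r g ->
  (forall q, n3 q < r -> Cnorm (g q) <= c * n3 q ^ m) -> n3 p < r -> rcont_on (kint e m g p) 0 1.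
Proof. intros Hm Hg Hc Hp t Ht; apply (kint_rcont e m g p r c); auto; apply n3_ray; auto. Qed.

Lemma Kc_bound (e m : nat) (g : C3 -> Cplx) (r c : R) (p : C3) : m = 0%nat \/ m = 2%nat -> Hol r g ->
  (forall q, n3 q < r -> Cnorm (g q) <= c * n3 q ^ m) -> n3 p < r ->
  Cnorm (Kc e m g p) <= 2 * (c * n3 p ^ m) / (INR e + 1).
Proof.
  intros Hm Hg Hc Hp; apply CInt_bound_pow; [apply (kint_rcont_on e m g p r c); auto|].
  intros t Ht; rewrite kint_neq0 by lra; unfold kfun.
  assert (0 < t ^ e) by (apply pow_lt; lra); assert (0 < t ^ m) by (apply pow_lt; lra).
  assert (0 < t ^ e / t ^ m) by (apply Rdiv_lt_0_compat; auto).
  rewrite Cnorm_mul, Cnorm_RtoC, Rabs_pos_eq by lra.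
  pose proof (Hc _ (n3_ray p t r ltac:(lra) Hp)) as K.
  rewrite n3_scal, Cnorm_RtoC, Rabs_pos_eq, Rpow_mult_distr in K by lra.
  apply Rle_trans with (t ^ e / t ^ m * (c * (t ^ m * n3 p ^ m))); [apply Rmult_le_compat_l; lra|].
  apply Req_le; field; lra.
Qed.

Lemma Kc_sub (e m : nat) (g g' : C3 -> Cplx) (r c c' : R) (p : C3) : m = 0%nat \/ m = 2%nat -> Hol r g -> Hol r g' ->
  (forall q, n3 q < r -> Cnorm (g q) <= c * n3 q ^ m) -> (forall q, n3 q < r -> Cnorm (g' q) <= c * n3 q ^ m) ->
  n3 p < r -> Kc e m (fun q => g q -c g' q) p = Kc e m g p -c Kc e m g' p.
Proof.
  intros Hm Hg Hg' Hc Hc' Hp; unfold Kc.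
  rewrite <- CInt_sub; [|lra|apply (kint_rcont_on e m g p r c); auto|apply (kint_rcont_on e m g' p r c); auto].
  apply CInt_ext; [lra|]; intros t Ht; rewrite !kint_neq0 by lra; unfold kfun; ring.
Qed.

(** Difference quotients of the integral are integrals of difference quotients of [g] at [t p].
    Since [t p] is at least as far from the boundary as [p], the estimate of [hol1_dq_cauchy] holds
    with the same [d] for all [t]. *)
Lemma Kc_Hol (e m : nat) (g : C3 -> Cplx) (r c : R) : m = 0%nat \/ m = 2%nat -> 0 <= c -> Hol r g ->
  (forall q, n3 q < r -> Cnorm (g q) <= c * n3 q ^ m) -> Hol r (Kc e m g).
Proof.
  intros Hm Hc0 Hg Hc; pose proof (pos_INR e) as He.
  apply (Hol_of_sep r (2 * (c * r ^ m) / (INR e + 1))); intros p Hp; split.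
  2:{ eapply Rle_trans; [apply (Kc_bound e m g r c); auto|].
      unfold Rdiv; apply Rmult_le_compat_r; [left; apply Rinv_0_lt_compat; lra|].
      apply Rmult_le_compat_l; [lra|]; apply Rmult_le_compat_l; [lra|]; apply pow_incr; split; [apply n3_ge0|lra]. }
  intros i Hi; set (d := r - n3 p); assert (0 < d) as Hd by (unfold d; lra).
  set (M := c * r ^ m).
  assert (HM : forall q, n3 q < r -> Cnorm (g q) <= M).
  { intros q Hq; eapply Rle_trans; [apply Hc; auto|]; apply Rmult_le_compat_l; [lra|]; apply pow_incr; split; [apply n3_ge0|lra]. }
  assert (HM0 : 0 <= M) by (eapply Rle_trans; [apply Cnorm_ge0|apply (HM p); auto]).
  set (K := 2048 * M / d ^ 2).
  assert (HK : 0 <= K) by (unfold K, Rdiv; apply Rmult_le_pos; [lra|left; apply Rinv_0_lt_compat; nra]).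
  assert (Hz : forall z, Cnorm z < d -> n3 (p +v z *v e3 i) < r).
  { intros z Hz; pose proof (n3_add p (z *v e3 i)); rewrite n3_scal_e3 in *; unfold d in *; lra. }
  destruct (dq_cauchy_cder (fun z => Kc e m g (p +v z *v e3 i)) C0 (2 * K / (INR e + 1)) (d / 4)) as [L HL];
    [lra| |exists L; apply has_pd_cder0; auto].
  intros h h' Hh Hh'.
  set (D := fun k t => Cinv k *c (kint e m g (p +v k *v e3 i) t -c kint e m g p t)).
  assert (HDc : forall k, Cnorm k < d -> rcont_on (D k) 0 1).
  { intros k Hk t Ht; apply rcont_mul; [apply rcont_const|]; apply rcont_sub; apply (kint_rcont_on e m g _ r c); auto. }
  assert (HD : forall k, Cnorm k < d -> dq (fun z => Kc e m g (p +v z *v e3 i)) C0 k = CInt (D k) 0 1).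
  { intros k Hk; unfold D; rewrite (CInt_scal (fun t => kint e m g (p +v k *v e3 i) t -c kint e m g p t)), CInt_sub; try lra;
      try (apply (kint_rcont_on e m g _ r c); auto).
    - unfold dq, Kc; rewrite add3_C0_e3; replace (C0 +c k) with k by ring; unfold Cdiv; ring.
    - intros t Ht; apply rcont_sub; apply (kint_rcont_on e m g _ r c); auto. }
  rewrite !HD by lra; rewrite <- CInt_sub; [|lra|apply HDc; lra|apply HDc; lra].
  replace (2 * K / (INR e + 1) * (Cnorm h + Cnorm h')) with (2 * (K * (Cnorm h + Cnorm h')) / (INR e + 1)) by (field; lra).
  apply CInt_bound_pow.
  { intros t Ht; apply rcont_sub; apply HDc; auto; lra. }
  intros t Ht; unfold D; rewrite !kint_neq0 by lra; unfold kfun.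
  assert (h <> C0) by (apply Cnorm_neq0; lra); assert (h' <> C0) by (apply Cnorm_neq0; lra).
  assert (RtoC t <> C0) by (apply RtoC_neq0; lra).
  set (q := RtoC t *v p).
  assert (Eq : forall z, RtoC t *v (p +v z *v e3 i) = q +v (RtoC t *c z) *v e3 i)
    by (intros z; unfold q; apply C3_eq; simpl; ring).
  rewrite !Eq; set (G := fun z => g (q +v z *v e3 i)).
  replace (g q) with (G C0) by (unfold G; rewrite add3_C0_e3; reflexivity).
  match goal with |- Cnorm ?a <= _ => replace a with
    (RtoC (t ^ e / t ^ m) *c RtoC t *c (dq G C0 (RtoC t *c h) -c dq G C0 (RtoC t *c h'))) end.
  2:{ unfold dq; replace (C0 +c RtoC t *c h) with (RtoC t *c h) by ring; replace (C0 +c RtoC t *c h') with (RtoC t *c h') by ring.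
      unfold G; field; repeat split; auto. }
  assert (n3 q + d <= r) as Hqd.
  { unfold q, d; rewrite n3_scal, Cnorm_RtoC, Rabs_pos_eq by lra; pose proof (n3_ge0 p); nra. }
  assert (sepB g q d M) as HS by (apply (Hol_bounded_sepB r); auto).
  destruct (sepB_slice g q d M i HS Hi) as [S1 S2].
  assert (Nt : forall k, Cnorm (RtoC t *c k) = t * Cnorm k) by (intros k; rewrite Cnorm_mul, Cnorm_RtoC, Rabs_pos_eq; lra).
  pose proof (hol1_dq_cauchy G C0 (RtoC t *c h) (RtoC t *c h') d M Hd S1 S2) as HQ; rewrite !Nt in HQ.
  specialize (HQ ltac:(split; [apply Rmult_lt_0_compat; lra|nra]) ltac:(split; [apply Rmult_lt_0_compat; lra|nra])).
  fold K in HQ.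
  assert (0 < t ^ e) by (apply pow_lt; lra); assert (0 < t ^ m) by (apply pow_lt; lra).
  assert (0 < t ^ e / t ^ m) by (apply Rdiv_lt_0_compat; auto).
  rewrite !Cnorm_mul, !Cnorm_RtoC, (Rabs_pos_eq t), (Rabs_pos_eq (t ^ e / t ^ m)) by lra.
  apply Rle_trans with (t ^ e / t ^ m * t * (K * (t * Cnorm h + t * Cnorm h'))); [apply Rmult_le_compat_l; [nra|auto]|].
  (* An increment [h] of [p] is an increment [t h] of [t p]: the quotient yields one factor [t] and
     the Cauchy estimate another, leaving [t ^ 2 / t ^ m], which is at most 1 for both values of
     [m]. *)
  replace (t ^ e / t ^ m * t * (K * (t * Cnorm h + t * Cnorm h'))) with ((K * (Cnorm h + Cnorm h')) * t ^ e * (t ^ 2 / t ^ m)) by (field; lra).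
  rewrite <- (Rmult_1_r (K * (Cnorm h + Cnorm h') * t ^ e)) at 2.
  apply Rmult_le_compat_l; [apply Rmult_le_pos; [apply Rmult_le_pos; lra|lra]|].
  destruct Hm as [-> | ->].
  - simpl; unfold Rdiv; rewrite Rinv_1; nra.
  - apply Req_le; field; lra.
Qed.

(** The substitution t -> st turns the primitive [J s] of the integrand into s^(e+1-m) times the
    value of [Kc] at [s p]. Differentiating both forms at [s = 1] gives the equation. *)
Lemma Kc_euler (e m : nat) (g : C3 -> Cplx) (r c : R) (p : C3) : m = 0%nat \/ m = 2%nat -> 0 <= c -> Hol r g ->
  (forall q, n3 q < r -> Cnorm (g q) <= c * n3 q ^ m) -> n3 p < r ->
  dot (grad (Kc e m g) p) p +c RtoC (INR e + 1 - INR m) *c Kc e m g p = g p.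
Proof.
  intros Hm Hc0 Hg Hc Hp.
  set (k := kint e m g p).
  set (J := fun s => mkC (RInt (fun t => Re (k t)) 0 s) (RInt (fun t => Im (k t)) 0 s)).
  (* A number [b > 1] such that [t p] stays in the ball for [|t| <= b], so that the derivative at
     [s = 1] is two-sided. *)
  set (b := (1 + r / (n3 p + (r - n3 p) / 2)) / 2).
  pose proof (n3_ge0 p) as Hp0.
  assert (1 < r / (n3 p + (r - n3 p) / 2)) as Hb1.
  { apply (Rmult_lt_reg_r (n3 p + (r - n3 p) / 2)); [lra|]; unfold Rdiv at 2; rewrite Rmult_assoc, Rinv_l by lra; lra. }
  assert (1 < b) as Hb by (unfold b; lra).
  assert (forall t, -b <= t <= b -> n3 (RtoC t *v p) < r) as Hin.
  { intros t Ht; rewrite n3_scal, Cnorm_RtoC.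
    assert (Rabs t <= b) by (apply Rabs_le; lra).
    assert (b <= r / (n3 p + (r - n3 p) / 2)) by (unfold b; lra).
    assert (r / (n3 p + (r - n3 p) / 2) * (n3 p + (r - n3 p) / 2) = r) by (field; lra).
    assert (Rabs t * n3 p <= r / (n3 p + (r - n3 p) / 2) * n3 p) by (apply Rmult_le_compat_r; lra). nra. }
  assert (Hk : forall t, -b <= t <= b -> rcont k t) by (intros t Ht; apply (kint_rcont e m g p r c); auto).
  assert (HJ : rder J 1 (g p)).
  { assert (k 1 = g p) as E1.
    { unfold k; rewrite kint_neq0 by lra; unfold kfun; rewrite !pow1.
      replace (RtoC (1 / 1)) with C1 by (unfold Rdiv; rewrite Rinv_1, Rmult_1_r; reflexivity).
      replace (RtoC 1 *v p) with p by (apply C3_eq; simpl; replace (RtoC 1) with C1 by reflexivity; ring); ring. }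
    rewrite <- E1; assert (forall (pr : Cplx -> R), (forall t, -b <= t <= b -> continuous (fun t => pr (k t)) t) ->
      derivable_pt_lim (fun s => RInt (fun t => pr (k t)) 0 s) 1 (pr (k 1))) as HR.
    { intros pr Hpr; apply is_derive_Reals.
      apply (is_derive_RInt (V := R_NormedModule) (fun t => pr (k t)) _ 0 1); [|apply Hpr; lra].
      exists (mkposreal (b - 1) ltac:(lra)); intros s Hs; unfold ball in Hs; simpl in Hs; unfold AbsRing_ball, abs, minus, plus, opp in Hs; simpl in Hs.
      apply (RInt_correct (V := R_CompleteNormedModule)), (ex_RInt_continuous (V := R_CompleteNormedModule)).
      intros t Ht; apply Hpr; apply Rabs_lt_between in Hs.
      unfold Rmin, Rmax in Ht; destruct Rle_dec; lra. }
    split; [apply (HR Re)|apply (HR Im)]; intros t Ht; apply (Hk t Ht). }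
  assert (Hscale : forall s, 0 < s < b -> J s = RtoC (s ^ S e / s ^ m) *c Kc e m g (RtoC s *v p)).
  { intros s Hs.
    assert (J s = CInt (fun t => RtoC s *c k (s * t)) 0 1) as EJ.
    { assert (forall u : R -> R, (forall t, -b <= t <= b -> continuous u t) -> RInt (fun t => s * u (s * t)) 0 1 = RInt u 0 s) as HR.
      { intros u Hu.
        pose proof (RInt_comp_lin (V := R_CompleteNormedModule) u s 0 0 1) as HL.
        replace (s * 0 + 0) with 0 in HL by ring; replace (s * 1 + 0) with s in HL by ring.
        rewrite <- HL.
        - apply (RInt_ext (V := R_CompleteNormedModule)); intros t _; rewrite Rplus_0_r; reflexivity.
        - apply (ex_RInt_continuous (V := R_CompleteNormedModule)); intros t Ht; apply Hu.
          rewrite Rmin_left, Rmax_right in Ht by lra; lra. }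
      unfold J, CInt; apply Cplx_eq; simpl.
      - rewrite <- (HR (fun t => Re (k t))) by (intros t Ht; apply (Hk t Ht)).
        apply (RInt_ext (V := R_CompleteNormedModule)); intros t _; simpl; ring.
      - rewrite <- (HR (fun t => Im (k t))) by (intros t Ht; apply (Hk t Ht)).
        apply (RInt_ext (V := R_CompleteNormedModule)); intros t _; simpl; ring. }
    rewrite EJ; unfold Kc; rewrite <- CInt_scal; [|lra|apply (kint_rcont_on e m g _ r c); auto; apply Hin; lra].
    apply CInt_ext; [lra|]; intros t Ht.
    unfold k; rewrite !kint_neq0 by nra; unfold kfun.
    replace (RtoC t *v (RtoC s *v p)) with (RtoC (s * t) *v p) by (rewrite RtoC_mul; apply C3_eq; simpl; ring).
    replace (RtoC s *c (RtoC ((s * t) ^ e / (s * t) ^ m) *c g (RtoC (s * t) *v p))) with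
      (RtoC (s * ((s * t) ^ e / (s * t) ^ m)) *c g (RtoC (s * t) *v p)) by (rewrite RtoC_mul; ring).
    replace (RtoC (s ^ S e / s ^ m) *c (RtoC (t ^ e / t ^ m) *c g (RtoC (s * t) *v p))) with
      (RtoC (s ^ S e / s ^ m * (t ^ e / t ^ m)) *c g (RtoC (s * t) *v p)) by (rewrite RtoC_mul; ring).
    do 2 f_equal; rewrite !Rpow_mult_distr; simpl; field; split; apply pow_nonzero; lra. }
  set (l := grad (Kc e m g) p).
  assert (E1p : RtoC 1 *v p = p) by (apply C3_eq; simpl; replace (RtoC 1) with C1 by reflexivity; ring).
  assert (HR : rder (fun s => RtoC (s ^ S e / s ^ m) *c Kc e m g (RtoC s *v p)) 1
     (RtoC (INR e + 1 - INR m) *c Kc e m g (RtoC 1 *v p) +c RtoC (1 ^ S e / 1 ^ m) *c dot l p)).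
  { apply (rder_mul (fun s => RtoC (s ^ S e / s ^ m))).
    - apply rder_RtoC, is_derive_Reals; auto_derive; [apply pow_nonzero; lra|].
      rewrite !pow1; replace (match e with 0%nat => 1 | S _ => INR e + 1 end) with (INR e + 1) by (destruct e; simpl; ring).
      field.
    - apply rder_ray; rewrite E1p; apply (Kc_Hol e m g r c); auto. }
  rewrite !pow1, E1p in HR.
  replace (RtoC (1 / 1)) with C1 in HR by (unfold Rdiv; rewrite Rinv_1, Rmult_1_r; reflexivity).
  rewrite (rder_unique J 1 (g p) (RtoC (INR e + 1 - INR m) *c Kc e m g p +c C1 *c dot l p)); [ring|auto|].
  apply (rder_ext_loc (fun s => RtoC (s ^ S e / s ^ m) *c Kc e m g (RtoC s *v p)) J 1 (Rmin 1 (b - 1))); auto.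
  - apply Rmin_glb_lt; lra.
  - intros s Hs; symmetry; apply Hscale; pose proof (Rmin_l 1 (b - 1)); pose proof (Rmin_r 1 (b - 1)).
    apply Rabs_lt_between in Hs; lra.
Qed.

(** The constant 6 is 3 for the coordinates times 2 for real and imaginary parts. *)
Lemma good_op_Kop (e m : nat) (r : R) : m = 0%nat \/ m = 2%nat -> good_op (Kop e m) r (6 / (INR e + 1)) m.
Proof.
  intros Hm; pose proof (pos_INR e) as He.
  assert (Hcomp : forall g c, wle r c m g -> forall i q, n3 q < r -> Cnorm (comp i (g q)) <= c * n3 q ^ m).
  { intros g c H i q Hq; eapply Rle_trans; [apply Cnorm_comp_le|apply H; auto]. }
  assert (Hb : forall g c, HolV r g -> wle r c m g -> wle r (6 / (INR e + 1) * c) m (Kop e m g)).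
  { intros g c [H0 [H1 H2]] Hg p Hp; eapply Rle_trans; [apply n3_le_sum|]; simpl.
    pose proof (Kc_bound e m _ r c p Hm H0 (Hcomp g c Hg 0%nat) Hp).
    pose proof (Kc_bound e m _ r c p Hm H1 (Hcomp g c Hg 1%nat) Hp).
    pose proof (Kc_bound e m _ r c p Hm H2 (Hcomp g c Hg 2%nat) Hp).
    replace (6 / (INR e + 1) * c * n3 p ^ m) with (3 * (2 * (c * n3 p ^ m) / (INR e + 1))) by (field; lra). lra. }
  (* [Kc_Hol] wants a nonnegative constant, while [good_op] allows any [c]. *)
  assert (Hc0 : forall g c, wle r c m g -> wle r (Rmax c 0) m g).
  { intros g c H p Hp; eapply Rle_trans; [apply H; auto|]; apply Rmult_le_compat_r; [apply pow_le, n3_ge0|apply Rmax_l]. }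
  constructor.
  - intros g c Hg Hgc; split; [|apply Hb; auto].
    pose proof (Hcomp g _ (Hc0 g c Hgc)) as Hi; pose proof (Rmax_r c 0); destruct Hg as [H0 [H1 H2]].
    repeat split; simpl; apply (Kc_Hol e m _ r (Rmax c 0)); auto; [apply (Hi 0%nat)|apply (Hi 1%nat)|apply (Hi 2%nat)].
  - intros g g' c c' Hg Hg' Hgc Hgc' Hd p Hp.
    replace (Kop e m g p -v Kop e m g' p) with (Kop e m (fun q => g q -v g' q) p).
    + apply Hb; auto.
      destruct Hg as [H0 [H1 H2]]; destruct Hg' as [H0' [H1' H2']]; repeat split; simpl; apply Hol_csub; auto.
    + pose proof (Hcomp g c Hgc) as Hi; pose proof (Hcomp g' c Hgc') as Hi'.
      destruct Hg as [H0 [H1 H2]]; destruct Hg' as [H0' [H1' H2']].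
      apply C3_eq; unfold Kop; simpl; [apply (Kc_sub e m _ _ r c c); auto; [apply (Hi 0%nat)|apply (Hi' 0%nat)]
       |apply (Kc_sub e m _ _ r c c); auto; [apply (Hi 1%nat)|apply (Hi' 1%nat)]
       |apply (Kc_sub e m _ _ r c c); auto; [apply (Hi 2%nat)|apply (Hi' 2%nat)]].
Qed.

Definition euler (W : C3 -> C3) (p : C3) : C3 :=
  mk3 (dot (grad (fun q => p0 (W q)) p) p) (dot (grad (fun q => p1 (W q)) p) p) (dot (grad (fun q => p2 (W q)) p) p).

Lemma Kop_euler (e m : nat) (g : C3 -> C3) (r c : R) (p : C3) : m = 0%nat \/ m = 2%nat -> 0 <= c -> HolV r g ->
  wle r c m g -> n3 p < r -> euler (Kop e m g) p +v RtoC (INR e + 1 - INR m) *v Kop e m g p = g p.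
Proof.
  intros Hm Hc [H0 [H1 H2]] Hg Hp.
  assert (Hcomp : forall i q, n3 q < r -> Cnorm (comp i (g q)) <= c * n3 q ^ m).
  { intros i q Hq; eapply Rle_trans; [apply Cnorm_comp_le|apply Hg; auto]. }
  apply C3_eq;
  [exact (Kc_euler e m (fun q => p0 (g q)) r c p Hm Hc H0 (Hcomp 0%nat) Hp)
  |exact (Kc_euler e m (fun q => p1 (g q)) r c p Hm Hc H1 (Hcomp 1%nat) Hp)
  |exact (Kc_euler e m (fun q => p2 (g q)) r c p Hm Hc H2 (Hcomp 2%nat) Hp)].
Qed.

(** * The equation E w + (e+1-m) w = G(p,w): existence and uniqueness *)

Lemma tdiff_ext_ball (f g : C3 -> Cplx) (r : R) (p l : C3) :
  (forall q, n3 q < r -> f q = g q) -> n3 p < r -> tdiff f p l -> tdiff g p l.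
Proof.
  intros E Hp; apply (tdiff_ext_loc f g p l (r - n3 p)); [lra|].
  intros q Hq; apply E; pose proof (n3_le_sub q p); lra.
Qed.

Lemma grad_ext_ball (f g : C3 -> Cplx) (r : R) (p : C3) :
  Hol r f -> (forall q, n3 q < r -> f q = g q) -> n3 p < r -> grad g p = grad f p.
Proof. intros Hf E Hp; apply tdiff_grad_eq, (tdiff_ext_ball f g r); auto. Qed.

Lemma Hol_ext (r : R) (f g : C3 -> Cplx) : (forall q, n3 q < r -> f q = g q) -> Hol r f -> Hol r g.
Proof. intros E Hf; apply Hol_intro; intros p Hp; exists (grad f p); apply (tdiff_ext_ball f g r); auto. Qed.

Lemma euler_ext (r : R) (W V : C3 -> C3) (p : C3) : HolV r W -> (forall q, n3 q < r -> W q = V q) -> n3 p < r -> euler V p = euler W p.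
Proof.
  intros [H0 [H1 H2]] E Hp; unfold euler; f_equal; f_equal; eapply grad_ext_ball; eauto;
  intros q Hq; cbv beta; rewrite E; auto.
Qed.

(** The frame of three applications: [e = m = 0] for differential equations, [m = 0] and large [e]
    for Briot-Bouquet systems, [e = 0] and [m = 2] for linearisation. With the norm [6 / (e + 1)] of
    [Kop], the condition [ep_contr] says that the contraction factor is at most 1/2. *)
Record euler_problem (G : C3 -> C3 -> C3) (r L delta : R) (e m : nat) : Prop := {
  ep_m : m = 0%nat \/ m = 2%nat;
  ep_r : 0 < r;
  ep_L : 0 <= L;
  ep_delta : 0 <= delta;
  ep_contr : 12 * L <= INR e + 1;
  ep_hol : forall w, HolV r w -> wle r delta m w -> HolV r (fun p => G p (w p));
  ep_lip : forall p w w', n3 p < r -> n3 w <= delta * n3 p ^ m -> n3 w' <= delta * n3 p ^ m ->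
     n3 (G p w -v G p w') <= L * n3 (w -v w') }.

Definition euler_sol (G : C3 -> C3 -> C3) (r : R) (e m : nat) (w : C3 -> C3) : Prop :=
  forall p, n3 p < r -> euler w p +v RtoC (INR e + 1 - INR m) *v w p = G p (w p).

Theorem euler_exists (G : C3 -> C3 -> C3) (r L delta c0 : R) (e m : nat) :
  euler_problem G r L delta e m -> 0 <= c0 -> (forall p, n3 p < r -> n3 (G p O3) <= c0 * n3 p ^ m) ->
  12 * c0 <= (INR e + 1) * delta ->
  exists w, HolV r w /\ wle r delta m w /\ euler_sol G r e m w.
Proof.
  intros [Hm Hr HL Hd Hc Hh Hl] Hc0 H0 Hcd; pose proof (pos_INR e) as He.
  assert (0 < / (INR e + 1)) by (apply Rinv_0_lt_compat; lra).
  assert (/ (INR e + 1) * (INR e + 1) = 1) by (field; lra).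
  destruct (holomorphic_fixed_point (Kop e m) G r (6 / (INR e + 1)) L c0 delta m) as [w [Hw1 [Hw2 Hw3]]]; auto.
  - unfold Rdiv; lra.
  - apply good_op_Kop; auto.
  - unfold Rdiv; nra.
  - unfold Rdiv. set (k := / (INR e + 1)) in *.
    assert (6 * k * c0 <= delta / 2) by nra.
    assert (6 * k * (L * delta) <= delta / 2) by (assert (6 * k * L <= 1 / 2) by nra; nra). nra.
  - exists w; split; [|split]; auto; intros p Hp.
    pose proof (Hh w Hw1 Hw2) as Hg.
    assert (wle r (c0 + L * delta) m (fun p => G p (w p))) as Hgb.
    { intros q Hq; pose proof (Hl q (w q) O3 Hq (Hw2 q Hq)) as K; rewrite n3_O3 in K.
      assert (0 <= n3 q ^ m) by (apply pow_le, n3_ge0).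
      specialize (K ltac:(apply Rmult_le_pos; auto)); replace (w q -v O3) with (w q) in K by (apply C3_eq; simpl; ring).
      pose proof (n3_le_sub (G q (w q)) (G q O3)); specialize (H0 q Hq); specialize (Hw2 q Hq).
      assert (L * n3 (w q) <= L * (delta * n3 q ^ m)) by (apply Rmult_le_compat_l; auto). lra. }
    assert (0 <= c0 + L * delta) as Hpos by (assert (0 <= L * delta) by (apply Rmult_le_pos; auto); lra).
    destruct (good_hol _ _ _ _ (good_op_Kop e m r Hm) _ _ Hg Hgb) as [HK _].
    rewrite (euler_ext r _ w p HK); auto; [|intros q Hq; symmetry; auto].
    pose proof (Kop_euler e m _ r _ p Hm Hpos Hg Hgb Hp) as E; rewrite <- (Hw3 p Hp) in E; exact E.
Qed.

Lemma derivable_pow_quotient (e m : nat) (t : R) : m = 0%nat \/ m = 2%nat -> t <> 0 ->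
  derivable_pt_lim (fun s => s ^ S e / s ^ m) t ((INR e + 1 - INR m) * (t ^ e / t ^ m)).
Proof.
  intros Hm Ht; apply is_derive_Reals; assert (t ^ m <> 0) by (apply pow_nonzero; auto); auto_derive; auto.
  replace (match e with 0%nat => 1 | S _ => INR e + 1 end) with (INR e + 1) by (destruct e; simpl; ring).
  destruct Hm as [-> | ->]; simpl; field; auto.
Qed.

(** Along a ray t^(e+1-m) u(tp) is constant by the equation and O(t^(e+1)) by the growth of [u],
    hence zero. *)
Lemma euler_homogeneous (u : C3 -> Cplx) (r c : R) (e m : nat) (p : C3) : m = 0%nat \/ m = 2%nat -> 0 <= c -> Hol r u ->
  (forall q, n3 q < r -> Cnorm (u q) <= c * n3 q ^ m) ->
  (forall q, n3 q < r -> dot (grad u q) q +c RtoC (INR e + 1 - INR m) *c u q = C0) -> n3 p < r -> u p = C0.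
Proof.
  intros Hm Hc Hu Hb He Hp.
  set (F := fun t => RtoC (t ^ S e / t ^ m) *c u (RtoC t *v p)).
  assert (HF : forall t, 0 < t <= 1 -> rder F t C0).
  { intros t Ht; assert (n3 (RtoC t *v p) < r) as Htp by (apply n3_ray; auto; lra).
    assert (rder F t (RtoC ((INR e + 1 - INR m) * (t ^ e / t ^ m)) *c u (RtoC t *v p) +c RtoC (t ^ S e / t ^ m) *c dot (grad u (RtoC t *v p)) p)) as K.
    { apply (rder_mul (fun s => RtoC (s ^ S e / s ^ m))); [|apply rder_ray, Hu; auto].
      apply rder_RtoC, derivable_pow_quotient; auto; lra. }
    match type of K with rder _ _ ?a => replace a with C0 in K; auto end.
    specialize (He _ Htp).
    replace (RtoC (t ^ S e / t ^ m) *c dot (grad u (RtoC t *v p)) p) with (RtoC (t ^ e / t ^ m) *c dot (grad u (RtoC t *v p)) (RtoC t *v p)).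
    - rewrite RtoC_mul.
      match type of He with ?a +c ?b = _ => replace a with (Copp b) by (replace a with ((a +c b) -c b) by ring; rewrite He; ring) end; ring.
    - replace (t ^ S e / t ^ m) with (t ^ e / t ^ m * t) by (simpl; field; apply pow_nonzero; lra).
      rewrite RtoC_mul; unfold dot; simpl; ring. }
  apply Cnorm_eq0, Rle_antisym; [|apply Cnorm_ge0]; apply le_epsilon; intros eps Heps; rewrite Rplus_0_l.
  assert (0 <= n3 p ^ m) as Hpm by (apply pow_le, n3_ge0).
  set (B := c * n3 p ^ m).
  assert (0 <= B) as HB by (apply Rmult_le_pos; auto).
  set (s := Rmin 1 (eps / (B + 1))).
  assert (0 < eps / (B + 1)) by (apply Rdiv_lt_0_compat; lra).
  assert (eps / (B + 1) * (B + 1) = eps) by (field; lra).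
  assert (0 < s) by (apply Rmin_glb_lt; lra).
  assert (s <= 1) by apply Rmin_l; assert (s <= eps / (B + 1)) by apply Rmin_r.
  pose proof (rder_increment_const F (fun _ => C0) 0 s 1 ltac:(lra) ltac:(intros; apply HF; lra) (fun _ _ => Req_le _ _ Cnorm_C0)) as HI.
  assert (F 1 = u p) as E1.
  { unfold F; rewrite !pow1; replace (RtoC (1 / 1)) with C1 by (unfold Rdiv; rewrite Rinv_1, Rmult_1_r; reflexivity).
    replace (RtoC 1 *v p) with p by (apply C3_eq; simpl; replace (RtoC 1) with C1 by reflexivity; ring); ring. }
  assert (Cnorm (F s) <= s * B) as E2.
  { assert (0 < s ^ m) by (apply pow_lt; auto); assert (0 < s ^ e <= 1) by (split; [apply pow_lt; auto|rewrite <- (pow1 e); apply pow_incr; lra]).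
    pose proof (Hb _ (n3_ray p s r ltac:(lra) Hp)) as K; rewrite n3_scal, Cnorm_RtoC, Rabs_pos_eq, Rpow_mult_distr in K by lra.
    unfold F; rewrite Cnorm_mul, Cnorm_RtoC, Rabs_pos_eq by (left; apply Rdiv_lt_0_compat; auto; apply pow_lt; auto).
    assert (0 <= s ^ S e / s ^ m) by (left; apply Rdiv_lt_0_compat; auto; apply pow_lt; auto).
    apply Rle_trans with (s ^ S e / s ^ m * (c * (s ^ m * n3 p ^ m))); [apply Rmult_le_compat_l; auto|].
    replace (s ^ S e / s ^ m * (c * (s ^ m * n3 p ^ m))) with (s * B * s ^ e) by (unfold B; simpl; field; lra).
    assert (0 <= s * B) by (apply Rmult_le_pos; lra). nra. }
  pose proof (Cnorm_le_sub (F 1) (F s)); rewrite E1 in *. nra.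
Qed.

(** By [euler_homogeneous] the difference of two solutions is [Kop] of the difference of the
    right-hand sides; any bound on it can therefore be halved. *)
Theorem euler_unique (G : C3 -> C3 -> C3) (r L delta : R) (e m : nat) (w w' : C3 -> C3) :
  euler_problem G r L delta e m -> HolV r w -> wle r delta m w -> euler_sol G r e m w ->
  HolV r w' -> wle r delta m w' -> euler_sol G r e m w' -> forall p, n3 p < r -> w p = w' p.
Proof.
  intros [Hm Hr HL Hd Hc Hh Hl] Hw Hwb He Hw' Hwb' He'.
  pose proof (pos_INR e) as Hpe.
  assert (Hpm : forall q, 0 <= n3 q ^ m) by (intros; apply pow_le, n3_ge0).
  set (g := fun p => G p (w p) -v G p (w' p)).
  assert (Hsub : forall A B, HolV r A -> HolV r B -> HolV r (fun p => A p -v B p)).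
  { intros A B [A0 [A1 A2]] [B0 [B1 B2]]; repeat split; simpl; apply Hol_csub; auto. }
  assert (Hg : HolV r g) by (apply Hsub; apply Hh; auto).
  assert (Hgb : forall c, wle r c m (fun p => w p -v w' p) -> wle r (L * c) m g).
  { intros c H q Hq; eapply Rle_trans; [apply Hl; auto|]; rewrite Rmult_assoc; apply Rmult_le_compat_l; auto. }
  assert (Hd0 : wle r (2 * delta) m (fun p => w p -v w' p)).
  { intros q Hq; pose proof (n3_sub (w q) (w' q)); specialize (Hwb q Hq); specialize (Hwb' q Hq); lra. }
  assert (HK : forall p, n3 p < r -> w p -v w' p = Kop e m g p).
  { assert (0 <= L * (2 * delta)) as Hpos by (apply Rmult_le_pos; lra).
    destruct (good_hol _ _ _ _ (good_op_Kop e m r Hm) _ _ Hg (Hgb _ Hd0)) as [HKh HKb].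
    set (C := 2 * delta + 6 / (INR e + 1) * (L * (2 * delta))).
    assert (0 <= C) as HC.
    { assert (0 <= 6 / (INR e + 1)) by (left; apply Rdiv_lt_0_compat; lra).
      assert (0 <= 6 / (INR e + 1) * (L * (2 * delta))) by (apply Rmult_le_pos; auto). unfold C; lra. }
    assert (HU : HolV r (fun p => (w p -v w' p) -v Kop e m g p)) by (apply Hsub; auto).
    assert (HUb : wle r C m (fun p => (w p -v w' p) -v Kop e m g p)).
    { intros q Hq; pose proof (n3_sub (w q -v w' q) (Kop e m g q)); specialize (Hd0 q Hq); specialize (HKb q Hq); unfold C; lra. }
    assert (Heq : forall q, n3 q < r -> euler (fun p => (w p -v w' p) -v Kop e m g p) q +v RtoC (INR e + 1 - INR m) *v ((w q -v w' q) -v Kop e m g q) = O3).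
    { intros q Hq.
      pose proof (Kop_euler e m g r _ q Hm Hpos Hg (Hgb _ Hd0) Hq) as E3.
      pose proof (He q Hq) as E1; pose proof (He' q Hq) as E2.
      assert (forall f1 f2 f3 : C3 -> Cplx, Hol r f1 -> Hol r f2 -> Hol r f3 ->
        dot (grad (fun p => f1 p -c f2 p -c f3 p) q) q = dot (grad f1 q) q -c dot (grad f2 q) q -c dot (grad f3 q) q) as Elin.
      { intros f1 f2 f3 K1 K2 K3.
        rewrite (tdiff_grad_eq (fun p => f1 p -c f2 p -c f3 p) q ((grad f1 q +v Copp C1 *v grad f2 q) +v Copp C1 *v grad f3 q)).
        - unfold dot; simpl; ring.
        - unfold Csub; apply tdiff_add; [apply tdiff_add; [apply K1; auto|apply tdiff_opp, K2; auto]|apply tdiff_opp, K3; auto]. }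
      destruct Hw as [W0 [W1 W2]]; destruct Hw' as [V0 [V1 V2]]; destruct HKh as [K0 [K1 K2]].
      unfold euler; simpl p0; simpl p1; simpl p2.
      rewrite !Elin by auto.
      assert (forall pr : C3 -> Cplx, (forall a b, pr (a +v b) = pr a +c pr b) -> (forall a b, pr (a -v b) = pr a -c pr b) -> (forall a b, pr (a *v b) = a *c pr b) ->
        pr (euler w q) -c pr (euler w' q) -c pr (euler (Kop e m g) q) +c RtoC (INR e + 1 - INR m) *c (pr (w q) -c pr (w' q) -c pr (Kop e m g q)) = C0) as Epr.
      { intros pr Pa Ps Pm; apply (f_equal pr) in E1, E2, E3; rewrite Pa, Pm in E1, E2, E3.
        unfold g in E3 at 3; rewrite Ps, <- E1, <- E2 in E3.
        match type of E3 with ?a = ?b => replace C0 with (b -c a) by (rewrite E3; ring) end; ring. }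
      apply C3_eq; [apply (Epr p0)|apply (Epr p1)|apply (Epr p2)]; reflexivity. }
    intros p Hp; apply n3_eq; destruct HU as [U0 [U1 U2]].
    replace ((w p -v w' p) -v Kop e m g p) with O3; [apply n3_O3|].
    assert (forall i q, n3 q < r -> Cnorm (comp i ((w q -v w' q) -v Kop e m g q)) <= C * n3 q ^ m) as Hi
      by (intros i q Hq; eapply Rle_trans; [apply Cnorm_comp_le|apply HUb; auto]).
    apply C3_eq; symmetry.
    - apply (euler_homogeneous _ r C e m p Hm HC U0 (Hi 0%nat)); auto; intros q Hq; exact (f_equal p0 (Heq q Hq)).
    - apply (euler_homogeneous _ r C e m p Hm HC U1 (Hi 1%nat)); auto; intros q Hq; exact (f_equal p1 (Heq q Hq)).
    - apply (euler_homogeneous _ r C e m p Hm HC U2 (Hi 2%nat)); auto; intros q Hq; exact (f_equal p2 (Heq q Hq)). }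
  assert (Hiter : forall n, wle r (2 * delta * (1 / 2) ^ n) m (fun p => w p -v w' p)).
  { induction n as [|n IH]; [simpl; rewrite Rmult_1_r; auto|].
    destruct (good_hol _ _ _ _ (good_op_Kop e m r Hm) _ _ Hg (Hgb _ IH)) as [_ HKb].
    intros p Hp; rewrite HK by auto; eapply Rle_trans; [apply HKb; auto|]; apply Rmult_le_compat_r; auto.
    assert (0 <= 2 * delta * (1 / 2) ^ n) by (apply Rmult_le_pos; [lra|apply pow_le; lra]).
    assert (0 < / (INR e + 1)) by (apply Rinv_0_lt_compat; lra).
    assert (/ (INR e + 1) * (INR e + 1) = 1) by (field; lra).
    assert (6 / (INR e + 1) * L <= 1 / 2) by (unfold Rdiv; nra). simpl pow; nra. }
  intros p Hp; apply n3_eq, Rle_antisym; [|apply n3_ge0]; apply le_epsilon; intros eps Heps; rewrite Rplus_0_l.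
  set (B := 2 * delta * n3 p ^ m); assert (0 <= B) by (apply Rmult_le_pos; [lra|auto]).
  destruct (pow_lt_1_zero (1 / 2) ltac:(rewrite Rabs_pos_eq; lra) (eps / (B + 1))) as [n Hn]; [apply Rdiv_lt_0_compat; lra|].
  specialize (Hn n (le_n n)); rewrite Rabs_pos_eq in Hn by (apply pow_le; lra).
  assert (eps / (B + 1) * (B + 1) = eps) by (field; lra).
  eapply Rle_trans; [apply (Hiter n p Hp)|].
  replace (2 * delta * (1 / 2) ^ n * n3 p ^ m) with (B * (1 / 2) ^ n) by (unfold B; ring).
  assert (0 < (1 / 2) ^ n) by (apply pow_lt; lra). nra.
Qed.

(** * Local solutions of holomorphic differential equations *)

Lemma HolV_lipschitz_at (X : C3 -> C3) (r : R) (q : C3) : HolV r X -> n3 q < r ->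
  exists d K, 0 < d /\ n3 q + d <= r /\ 0 < K /\
    forall a b, n3 (a -v q) < d -> n3 (b -v q) < d -> n3 (X a -v X b) <= K * n3 (a -v b).
Proof.
  intros [H0 [H1 H2]] Hq.
  assert (forall f, Hol r f -> exists d K, 0 < d /\ 0 < K /\ forall a b, n3 (a -v q) < d -> n3 (b -v q) < d -> Cnorm (f a -c f b) <= K * n3 (a -v b)) as H.
  { intros f Hf; destruct (Hol_sepB r f q Hf Hq) as [d [M [Hd HS]]].
    pose proof (M_nonneg f q d M Hd HS).
    exists (d / 8), (192 * M / d + 1); repeat split; [lra| |].
    - assert (0 <= 192 * M / d) by (apply Rmult_le_pos; [lra|left; apply Rinv_0_lt_compat; auto]); lra.
    - intros a b Ha Hb; pose proof (sepB_lipschitz f q b a d M Hd HS Hb Ha); pose proof (n3_ge0 (a -v b)); lra. }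
  destruct (H _ H0) as [d0 [K0 [A0 [B0 L0]]]]; destruct (H _ H1) as [d1 [K1 [A1 [B1 L1]]]]; destruct (H _ H2) as [d2 [K2 [A2 [B2 L2]]]].
  exists (Rmin (r - n3 q) (Rmin d0 (Rmin d1 d2))), (K0 + K1 + K2).
  pose proof (Rmin_l (r - n3 q) (Rmin d0 (Rmin d1 d2))); pose proof (Rmin_r (r - n3 q) (Rmin d0 (Rmin d1 d2))).
  pose proof (Rmin_l d0 (Rmin d1 d2)); pose proof (Rmin_r d0 (Rmin d1 d2)).
  pose proof (Rmin_l d1 d2); pose proof (Rmin_r d1 d2).
  split; [repeat apply Rmin_glb_lt; lra|split; [lra|split; [lra|]]].
  intros a b Ha Hb; eapply Rle_trans; [apply n3_le_sum|]; simpl.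
  pose proof (L0 a b ltac:(lra) ltac:(lra)); pose proof (L1 a b ltac:(lra) ltac:(lra)); pose proof (L2 a b ltac:(lra) ltac:(lra)); lra.
Qed.

Definition vder (phi : R -> C3) (t : R) (v : C3) : Prop :=
  rder (fun s => p0 (phi s)) t (p0 v) /\ rder (fun s => p1 (phi s)) t (p1 v) /\ rder (fun s => p2 (phi s)) t (p2 v).

Lemma is_sol_vder (X : C3 -> C3) (a b : R) (phi : R -> C3) :
  is_sol X a b phi <-> forall t, a < t < b -> vder phi t (X (phi t)).
Proof.
  split.
  - intros H t Ht; split; [apply (H t Ht 0%nat); lia|split; [apply (H t Ht 1%nat)|apply (H t Ht 2%nat)]; lia].
  - intros H t Ht i Hi; destruct (H t Ht) as [H0 [H1 H2]]; destruct i as [|[|[|i]]]; auto; lia.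
Qed.

Lemma is_global_sol_vder (X : C3 -> C3) (phi : R -> C3) : is_global_sol X phi <-> forall t, vder phi t (X (phi t)).
Proof.
  split.
  - intros H t; split; [apply (H t 0%nat); lia|split; [apply (H t 1%nat)|apply (H t 2%nat)]; lia].
  - intros H t i Hi; destruct (H t) as [H0 [H1 H2]]; destruct i as [|[|[|i]]]; auto; lia.
Qed.

(** With phi(t) = q + t V(t) the equation becomes E V + V = X(q + tV), time being the first
    coordinate of [C3]: an Euler problem with [e = m = 0]. *)
Theorem ode_exists (X : C3 -> C3) (R0 : R) (q : C3) : HolV R0 X -> n3 q < R0 ->
  exists eps phi, 0 < eps /\ is_sol X (- eps) eps phi /\ phi 0 = q.
Proof.
  intros HX Hq.
  destruct (HolV_lipschitz_at X R0 q HX Hq) as [d [K [Hd [Hqd [HK HL]]]]].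
  (* [delta] meets the requirement [12 * c0 <= delta] of [euler_exists], and the second bound on [r]
     keeps [q + t V] inside the Lipschitz ball. *)
  set (c0 := n3 (X q)); set (delta := 12 * c0 + 1).
  assert (0 <= c0) as Hc0 by apply n3_ge0.
  set (r := Rmin (1 / (12 * K)) (d / (2 * delta))).
  assert (0 < delta) as Hdelta by (unfold delta; lra).
  assert (0 < r) as Hr by (apply Rmin_glb_lt; apply Rdiv_lt_0_compat; lra).
  assert (r <= 1 / (12 * K)) as Hr1 by apply Rmin_l; assert (r <= d / (2 * delta)) as Hr2 by apply Rmin_r.
  assert (12 * (K * r) <= 1) as HKr.
  { apply Rle_trans with (12 * (K * (1 / (12 * K)))); [apply Rmult_le_compat_l; [lra|apply Rmult_le_compat_l; lra]|apply Req_le; field; lra]. }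
  assert (r * delta < d) as Hrd.
  { apply Rle_lt_trans with (d / (2 * delta) * delta); [apply Rmult_le_compat_r; lra|].
    replace (d / (2 * delta) * delta) with (d / 2) by (field; lra); lra. }
  assert (Hin : forall p w, n3 p < r -> n3 w <= delta -> n3 ((q +v p0 p *v w) -v q) < d).
  { intros p w Hp Hw; replace ((q +v p0 p *v w) -v q) with (p0 p *v w) by (apply C3_eq; simpl; ring).
    rewrite n3_scal; pose proof (Cnorm_p0 p); pose proof (Cnorm_ge0 (p0 p)); pose proof (n3_ge0 w). nra. }
  assert (HP : euler_problem (fun p w => X (q +v p0 p *v w)) r (K * r) delta 0 0).
  { constructor; auto; try lra.
    - apply Rmult_le_pos; lra.
    - simpl; lra.
    - intros w [W0 [W1 W2]] Hwb; apply (HolV_comp r R0 X (fun p => q +v p0 p *v w p)); auto.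
      + repeat split; simpl; (apply Hol_add; [apply Hol_const|apply Hol_mul; auto; apply Hol_p0]).
      + intros p Hp; specialize (Hwb p Hp); simpl in Hwb; specialize (Hin p (w p) Hp ltac:(lra)).
        pose proof (n3_le_sub (q +v p0 p *v w p) q); lra.
    - intros p w w' Hp Hw Hw'; simpl in Hw, Hw'.
      eapply Rle_trans; [apply HL; apply Hin; auto; lra|].
      replace (q +v p0 p *v w -v (q +v p0 p *v w')) with (p0 p *v (w -v w')) by (apply C3_eq; simpl; ring).
      rewrite n3_scal, Rmult_assoc; apply Rmult_le_compat_l; [lra|]; apply Rmult_le_compat_r; [apply n3_ge0|].
      pose proof (Cnorm_p0 p); lra. }
  destruct (euler_exists _ _ _ _ c0 _ _ HP) as [V [HV [HVb HVe]]]; auto.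
  - intros p Hp; replace (q +v p0 p *v O3) with q by (apply C3_eq; simpl; ring); simpl; unfold c0; lra.
  - simpl; unfold delta; lra.
  - exists r, (fun t => q +v RtoC t *v V (mk3 (RtoC t) C0 C0)); split; auto; split.
    + apply is_sol_vder; intros t Ht.
      assert (n3 (mk3 (RtoC t) C0 C0) < r) as Htr by (rewrite n3_axis0, Cnorm_RtoC; apply Rabs_def1; lra).
      pose proof (HVe _ Htr) as E; cbv beta in E; simpl p0 in E; destruct HV as [V0 [V1 V2]].
      replace (RtoC (INR 0 + 1 - INR 0)) with C1 in E by (apply Cplx_eq; simpl; ring).
      cbv beta; rewrite <- E.
      assert (Hc : forall f, Hol r f -> forall c, rder (fun s => c +c RtoC s *c f (mk3 (RtoC s) C0 C0)) t
         (dot (grad f (mk3 (RtoC t) C0 C0)) (mk3 (RtoC t) C0 C0) +c C1 *c f (mk3 (RtoC t) C0 C0))).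
      { intros f Hf c.
        assert (rder RtoC t C1) as H1 by (apply (rder_RtoC id t 1), derivable_pt_lim_id).
        pose proof (tdiff_comp_rder f (fun s => mk3 (RtoC s) C0 C0) t _ (e3 0) (Hf _ Htr) H1 (rder_const C0 t) (rder_const C0 t)) as H2.
        pose proof (rder_add _ _ _ _ _ (rder_const c t) (rder_mul _ _ _ _ _ H1 H2)) as H3; cbv beta in H3.
        match type of H3 with rder _ _ ?a => match goal with |- rder _ _ ?b => replace b with a; auto end end.
        unfold dot; simpl; ring. }
      split; [|split]; [exact (Hc _ V0 (p0 q))|exact (Hc _ V1 (p1 q))|exact (Hc _ V2 (p2 q))].
    + simpl; replace (RtoC 0) with C0 by reflexivity; apply C3_eq; simpl; ring.
Qed.

Lemma vder_cont (phi : R -> C3) (t : R) (v : C3) : vder phi t v ->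
  forall eps, 0 < eps -> exists d, 0 < d /\ forall s, Rabs (s - t) < d -> n3 (phi s -v phi t) < eps.
Proof.
  intros [H0 [H1 H2]] eps Heps; apply rder_rcont in H0, H1, H2; rewrite rcont_eps in H0, H1, H2.
  destruct (H0 (eps / 3)) as [d0 [A0 K0]]; [lra|]; destruct (H1 (eps / 3)) as [d1 [A1 K1]]; [lra|];
  destruct (H2 (eps / 3)) as [d2 [A2 K2]]; [lra|].
  exists (Rmin d0 (Rmin d1 d2)); split; [repeat apply Rmin_glb_lt; auto|]; intros s Hs.
  pose proof (Rmin_l d0 (Rmin d1 d2)); pose proof (Rmin_r d0 (Rmin d1 d2)).
  pose proof (Rmin_l d1 d2); pose proof (Rmin_r d1 d2).
  eapply Rle_lt_trans; [apply n3_le_sum|]; simpl.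
  specialize (K0 s ltac:(lra)); specialize (K1 s ltac:(lra)); specialize (K2 s ltac:(lra)); lra.
Qed.

Lemma ode_unique_local (X : C3 -> C3) (R0 : R) (phi psi : R -> C3) (a b t0 : R) : HolV R0 X ->
  is_sol X a b phi -> is_sol X a b psi -> a < t0 < b -> n3 (psi t0) < R0 -> phi t0 = psi t0 ->
  exists eta, 0 < eta /\ forall t, Rabs (t - t0) < eta -> phi t = psi t.
Proof.
  rewrite !is_sol_vder; intros HX Hphi Hpsi Ht0 Hq E0.
  destruct (HolV_lipschitz_at X R0 (psi t0) HX Hq) as [d [K [Hd [_ [HK HL]]]]].
  destruct (vder_cont _ _ _ (Hphi t0 Ht0) d Hd) as [e1 [He1 K1]]; rewrite E0 in K1.
  destruct (vder_cont _ _ _ (Hpsi t0 Ht0) d Hd) as [e2 [He2 K2]].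
  (* On this interval both curves stay in the Lipschitz ball. A bound [B] on their distance improves
     to three times [2 * K * B * eta], which is at most [B / 2]. *)
  set (eta := Rmin (Rmin e1 e2) (Rmin (Rmin (t0 - a) (b - t0)) (1 / (12 * K)))).
  pose proof (Rmin_l (Rmin e1 e2) (Rmin (Rmin (t0 - a) (b - t0)) (1 / (12 * K)))).
  pose proof (Rmin_r (Rmin e1 e2) (Rmin (Rmin (t0 - a) (b - t0)) (1 / (12 * K)))).
  pose proof (Rmin_l (Rmin (t0 - a) (b - t0)) (1 / (12 * K))); pose proof (Rmin_r (Rmin (t0 - a) (b - t0)) (1 / (12 * K))).
  pose proof (Rmin_l e1 e2); pose proof (Rmin_r e1 e2); pose proof (Rmin_l (t0 - a) (b - t0)); pose proof (Rmin_r (t0 - a) (b - t0)).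
  assert (0 < eta) as Heta by (repeat apply Rmin_glb_lt; try lra; apply Rdiv_lt_0_compat; lra).
  assert (K * eta <= 1 / 12) as HKe.
  { apply Rle_trans with (K * (1 / (12 * K))); [apply Rmult_le_compat_l; unfold eta; lra|apply Req_le; field; lra]. }
  change (eta <= Rmin e1 e2) in H; change (eta <= Rmin (Rmin (t0 - a) (b - t0)) (1 / (12 * K))) in H0; clearbody eta.
  assert (HB : forall n t, Rabs (t - t0) < eta -> n3 (phi t -v psi t) <= 2 * d * (1 / 2) ^ n).
  { induction n as [|n IH]; intros t Ht.
    - pose proof (n3_sub_tri (phi t) (psi t0) (psi t)) as T; rewrite (n3_sub_sym (psi t0)) in T.
      specialize (K1 t ltac:(lra)); specialize (K2 t ltac:(lra)); simpl; lra.
    - set (B := 2 * d * (1 / 2) ^ n) in *.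
      assert (0 <= B) as HB by (apply Rmult_le_pos; [lra|apply pow_le; lra]).
      assert (Hcomp : forall pr : C3 -> Cplx, (forall x y, pr (x -v y) = pr x -c pr y) -> (forall x, Cnorm (pr x) <= n3 x) ->
         (forall s, a < s < b -> rder (fun s => pr (phi s)) s (pr (X (phi s)))) -> (forall s, a < s < b -> rder (fun s => pr (psi s)) s (pr (X (psi s)))) ->
         Cnorm (pr (phi t -v psi t)) <= 2 * (K * B * eta)).
      { intros pr Psub Pn D1 D2.
        assert (forall u v, u <= v -> (forall s, u <= s <= v -> Rabs (s - t0) < eta) -> v - u <= eta ->
          Cnorm (pr (phi v -v psi v) -c pr (phi u -v psi u)) <= 2 * (K * B * eta)) as HI.
        { intros u v Huv Hin Hlen.
          eapply Rle_trans; [apply (rder_increment_const (fun s => pr (phi s -v psi s)) (fun s => pr (X (phi s) -v X (psi s))) (K * B) u v Huv)|].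
          - intros s Hs; specialize (Hin s Hs); apply Rabs_lt_between in Hin; rewrite Psub.
            replace (fun s => pr (phi s -v psi s)) with (fun s => pr (phi s) +c Copp C1 *c pr (psi s))
              by (apply functional_extensionality; intros; rewrite Psub; ring).
            replace (pr (X (phi s)) -c pr (X (psi s))) with (pr (X (phi s)) +c Copp C1 *c pr (X (psi s))) by ring.
            apply rder_add; [|apply rder_scal]; [apply D1|apply D2]; lra.
          - intros s Hs; specialize (Hin s Hs); eapply Rle_trans; [apply Pn|].
            eapply Rle_trans; [apply HL; [apply K1|apply K2]; lra|]; apply Rmult_le_compat_l; [lra|]; apply IH; auto.
          - apply Rmult_le_compat_l; [lra|]; apply Rmult_le_compat_l; auto; apply Rmult_le_pos; lra. }
        assert (pr (phi t0 -v psi t0) = C0) as Z by (rewrite Psub, E0; ring).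
        apply Rabs_lt_between in Ht; destruct (Rle_dec t0 t).
        - specialize (HI t0 t ltac:(lra) ltac:(intros; apply Rabs_def1; lra) ltac:(lra)); rewrite Z in HI.
          match type of HI with Cnorm (?x -c C0) <= _ => replace (x -c C0) with x in HI by ring end; auto.
        - specialize (HI t t0 ltac:(lra) ltac:(intros; apply Rabs_def1; lra) ltac:(lra)); rewrite Z, Cnorm_sub_sym in HI.
          match type of HI with Cnorm (?x -c C0) <= _ => replace (x -c C0) with x in HI by ring end; auto. }
      eapply Rle_trans; [apply n3_le_sum|].
      pose proof (Hcomp p0 ltac:(reflexivity) Cnorm_p0 (fun s Hs => proj1 (Hphi s Hs)) (fun s Hs => proj1 (Hpsi s Hs))).
      pose proof (Hcomp p1 ltac:(reflexivity) Cnorm_p1 (fun s Hs => proj1 (proj2 (Hphi s Hs))) (fun s Hs => proj1 (proj2 (Hpsi s Hs)))).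
      pose proof (Hcomp p2 ltac:(reflexivity) Cnorm_p2 (fun s Hs => proj2 (proj2 (Hphi s Hs))) (fun s Hs => proj2 (proj2 (Hpsi s Hs)))).
      replace (2 * d * (1 / 2) ^ S n) with (B / 2) by (unfold B; simpl; field).
      assert (K * B * eta <= B / 12) by nra. lra. }
  exists eta; split; auto; intros t Ht; apply n3_eq, Rle_antisym; [|apply n3_ge0].
  apply le_epsilon; intros eps Heps; rewrite Rplus_0_l.
  destruct (pow_lt_1_zero (1 / 2) ltac:(rewrite Rabs_pos_eq; lra) (eps / (2 * d))) as [n Hn]; [apply Rdiv_lt_0_compat; lra|].
  specialize (Hn n (le_n n)); rewrite Rabs_pos_eq in Hn by (apply pow_le; lra).
  eapply Rle_trans; [apply (HB n t Ht)|].
  apply (Rmult_lt_compat_l (2 * d)) in Hn; [|lra]; replace (2 * d * (eps / (2 * d))) with eps in Hn by (field; lra); lra.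
Qed.

(** Connectedness of [0, b): [P] extends to the right of each point where it holds and is closed
    under limits from the left. *)
Lemma interval_induction (P : R -> Prop) (b : R) : P 0 ->
  (forall t, 0 <= t < b -> P t -> exists eta, 0 < eta /\ forall s, t <= s < t + eta -> s < b -> P s) ->
  (forall t, 0 < t < b -> (forall s, 0 <= s < t -> P s) -> P t) -> forall t, 0 <= t < b -> P t.
Proof.
  intros P0 Hopen Hclosed t Ht; apply NNPP; intros HN.
  set (E := fun s => 0 <= s <= t /\ forall u, 0 <= u <= s -> P u).
  destruct (completeness E) as [s [Hs1 Hs2]].
  - exists t; intros s [Hs _]; lra.
  - exists 0; split; [lra|]; intros u Hu; replace u with 0 by lra; auto.
  - assert (0 <= s) as Hs0 by (apply Hs1; split; [lra|]; intros u Hu; replace u with 0 by lra; auto).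
    assert (s <= t) as Hst by (apply Hs2; intros u [Hu _]; lra).
    assert (forall u, 0 <= u < s -> P u) as Hlt.
    { intros u Hu; apply NNPP; intros HNu; apply (Rlt_not_le s u); [lra|]; apply Hs2; intros v [Hv Hv'].
      apply Rnot_lt_le; intros Huv; apply HNu, Hv'; lra. }
    assert (P s) as HPs by (destruct (Req_dec s 0) as [->|]; auto; apply Hclosed; auto; lra).
    destruct (Hopen s ltac:(lra) HPs) as [eta [Heta K]].
    destruct (Rlt_dec s t) as [Hlt'|Hge]; [|apply HN; replace t with s by lra; auto].
    set (s' := Rmin t (s + eta / 2)).
    assert (s' <= t) by apply Rmin_l; assert (s' <= s + eta / 2) by apply Rmin_r.
    assert (s < s') by (apply Rmin_glb_lt; lra).
    assert (E s') as HE.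
    { split; [lra|]; intros u Hu; destruct (Rlt_dec u s); [apply Hlt; lra|apply K; lra]. }
    specialize (Hs1 s' HE); lra.
Qed.

(** Only [psi] is assumed to stay in the ball; [phi] follows it because the set of agreement is open
    and closed. Thus a known periodic orbit can be compared with an arbitrary solution. *)
Theorem ode_unique (X : C3 -> C3) (R0 : R) (phi psi : R -> C3) (a b : R) : HolV R0 X -> a < 0 < b ->
  is_sol X a b phi -> is_sol X a b psi -> (forall t, a < t < b -> n3 (psi t) < R0) -> phi 0 = psi 0 ->
  forall t, a < t < b -> phi t = psi t.
Proof.
  intros HX Hab Hphi Hpsi Hin E0.
  assert (Hcont : forall t, a < t < b -> (forall eta, 0 < eta -> exists s, Rabs (s - t) < eta /\ phi s = psi s) -> phi t = psi t).
  { intros t Ht H; apply n3_eq, Rle_antisym; [|apply n3_ge0]; apply le_epsilon; intros eps Heps; rewrite Rplus_0_l.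
    rewrite is_sol_vder in Hphi, Hpsi.
    destruct (vder_cont _ _ _ (Hphi t Ht) (eps / 2)) as [d1 [Hd1 K1]]; [lra|].
    destruct (vder_cont _ _ _ (Hpsi t Ht) (eps / 2)) as [d2 [Hd2 K2]]; [lra|].
    destruct (H (Rmin d1 d2)) as [s [Hs Es]]; [apply Rmin_glb_lt; auto|].
    pose proof (Rmin_l d1 d2); pose proof (Rmin_r d1 d2); specialize (K1 s ltac:(lra)); specialize (K2 s ltac:(lra)).
    pose proof (n3_sub_tri (phi t) (phi s) (psi t)) as T; rewrite (n3_sub_sym (phi t) (phi s)), Es in T; rewrite Es in K1; lra. }
  assert (Hloc : forall t, a < t < b -> phi t = psi t -> exists eta, 0 < eta /\ forall s, Rabs (s - t) < eta -> phi s = psi s)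
    by (intros t Ht E; apply (ode_unique_local X R0 phi psi a b); auto).
  intros t Ht; destruct (Rle_dec 0 t).
  - apply (interval_induction (fun t => phi t = psi t) b); auto; [| |lra].
    + intros s Hs Es; destruct (Hloc s ltac:(lra) Es) as [eta [Heta K]]; exists eta; split; auto; intros u Hu _; apply K, Rabs_def1; lra.
    + intros s Hs K; apply Hcont; [lra|]; intros eta Heta; exists (Rmax 0 (s - eta / 2)).
      pose proof (Rmax_l 0 (s - eta / 2)); pose proof (Rmax_r 0 (s - eta / 2)).
      assert (Rmax 0 (s - eta / 2) < s) by (apply Rmax_lub_lt; lra).
      split; [apply Rabs_def1; lra|apply K; lra].
  - replace t with (- - t) by ring.
    apply (interval_induction (fun t => phi (- t) = psi (- t)) (- a)); [rewrite Ropp_0; auto| | |lra].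
    + intros s Hs Es; destruct (Hloc (- s) ltac:(lra) Es) as [eta [Heta K]]; exists eta; split; auto; intros u Hu _; apply K, Rabs_def1; lra.
    + intros s Hs K; apply Hcont; [lra|]; intros eta Heta; exists (- Rmax 0 (s - eta / 2)).
      pose proof (Rmax_l 0 (s - eta / 2)); pose proof (Rmax_r 0 (s - eta / 2)).
      assert (Rmax 0 (s - eta / 2) < s) by (apply Rmax_lub_lt; lra).
      split; [apply Rabs_def1; lra|apply K; lra].
Qed.

(** * Linearisation on the plane [y = 0] *)

Definition eul (f : C3 -> Cplx) (p : C3) : Cplx := dot (grad f p) p.

Lemma eul_lin (f g : C3 -> Cplx) (c : Cplx) (p l m : C3) : tdiff f p l -> tdiff g p m ->
  eul (fun q => c *c f q +c g q) p = c *c eul f p +c eul g p.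
Proof.
  intros Hf Hg; unfold eul; rewrite (tdiff_grad_eq f p l Hf), (tdiff_grad_eq g p m Hg).
  rewrite (tdiff_grad_eq _ p _ (tdiff_add _ _ _ _ _ (tdiff_mul _ _ _ _ _ (tdiff_const c p) Hf) Hg)).
  unfold dot; simpl; ring.
Qed.

Lemma eul_p0 (p : C3) : eul p0 p = p0 p.
Proof. unfold eul; rewrite (tdiff_grad_eq _ _ _ (tdiff_p0 p)); unfold dot; simpl; ring. Qed.
Lemma eul_p2 (p : C3) : eul p2 p = p2 p.
Proof. unfold eul; rewrite (tdiff_grad_eq _ _ _ (tdiff_p2 p)); unfold dot; simpl; ring. Qed.

Definition pxz (p : C3) : C3 := mk3 (p0 p) C0 (p2 p).

Lemma n3_pxz (p : C3) : n3 (pxz p) <= n3 p.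
Proof.
  pose proof (n3_sqr p); apply n3_le; [apply n3_ge0|]; rewrite H; simpl p0; simpl p1; simpl p2; rewrite Cnorm_C0.
  pose proof (pow2_ge_0 (Cnorm (p1 p))); lra.
Qed.

Definition yscale (s : R) (p : C3) : C3 := mk3 (p0 p) (RtoC s *c p1 p) (p2 p).

Lemma n3_yscale (s K : R) (p : C3) : 1 <= K -> Rabs s <= K -> n3 (yscale s p) <= K * n3 p.
Proof.
  intros HK Hs; pose proof (n3_ge0 p); pose proof (Rabs_pos s).
  apply n3_le; [nra|]; simpl p0; simpl p1; simpl p2; rewrite Cnorm_mul, Cnorm_RtoC.
  replace ((K * n3 p) ^ 2) with (K ^ 2 * n3 p ^ 2) by ring; rewrite n3_sqr.
  pose proof (pow2_ge_0 (Cnorm (p0 p))); pose proof (pow2_ge_0 (Cnorm (p1 p))); pose proof (pow2_ge_0 (Cnorm (p2 p))).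
  assert (1 <= K ^ 2) by nra. assert (Rabs s ^ 2 <= K ^ 2) by nra.
  replace ((Rabs s * Cnorm (p1 p)) ^ 2) with (Rabs s ^ 2 * Cnorm (p1 p) ^ 2) by ring. nra.
Qed.

Lemma yscale_inv (s : R) (p : C3) : s <> 0 -> yscale s (yscale (/ s) p) = p.
Proof. intros Hs; apply C3_eq; simpl; auto; rewrite RtoC_inv by auto; field; apply RtoC_neq0; auto. Qed.

Definition linG (mu beta : Cplx) (N : C3 -> C3) (s : R) (p W : C3) : C3 :=
  Cinv mu *v (mk3 (beta *c RtoC s *c p1 W) C0 C0 +v yscale (/ s) (N (pxz p +v yscale s W))).

Lemma HolV_yscale (r s : R) (W : C3 -> C3) : HolV r W -> HolV r (fun p => yscale s (W p)).
Proof. intros [H0 [H1 H2]]; repeat split; simpl; auto; apply Hol_mul; auto; apply Hol_const. Qed.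

Lemma HolV_pxz (r : R) : HolV r pxz.
Proof. repeat split; simpl; [apply Hol_p0|apply Hol_const|apply Hol_p2]. Qed.

Lemma HolV_add (r : R) (A B : C3 -> C3) : HolV r A -> HolV r B -> HolV r (fun p => A p +v B p).
Proof. intros [A0 [A1 A2]] [B0 [B1 B2]]; repeat split; simpl; apply Hol_add; auto. Qed.

Lemma HolV_csub (r : R) (A B : C3 -> C3) : HolV r A -> HolV r B -> HolV r (fun p => A p -v B p).
Proof. intros [A0 [A1 A2]] [B0 [B1 B2]]; repeat split; simpl; apply Hol_csub; auto. Qed.

Lemma HolV_sub (r r' : R) (A : C3 -> C3) : r' <= r -> HolV r A -> HolV r' A.
Proof. intros Hr [A0 [A1 A2]]; repeat split; apply (Hol_sub r); auto. Qed.

(** Rescaling [y] makes the nilpotent part small, so that the equation becomes a contraction. *)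
Lemma lin_problem (mu beta : Cplx) (N : C3 -> C3) (R0 : R) : mu <> C0 -> 0 < R0 -> HolV R0 N -> order2V N ->
  exists s c0, 0 < s <= 1 /\ 0 <= c0 /\ forall delta, 0 <= delta -> exists r0, 0 < r0 /\ forall r, 0 < r <= r0 ->
    euler_problem (linG mu beta N s) r (1 / 12) delta 0 2 /\
    (forall p, n3 p < r -> n3 (linG mu beta N s p O3) <= c0 * n3 p ^ 2) /\
    (forall p W, n3 p < r -> n3 W <= delta * n3 p ^ 2 -> n3 (pxz p +v yscale s W) < R0).
Proof.
  intros Hmu HR HN H2.
  destruct (order2V_lipschitz N R0 HR HN H2) as [d [C [Hd [HC HL]]]].
  pose proof (order2V_O3 N H2) as HN0.
  pose proof (Cnorm_gt0 mu Hmu) as Nmu; pose proof (Cnorm_ge0 beta) as Nb.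
  (* The contraction budget is 1/12: with this [s] the nilpotent term takes at most 1/24, and [b]
     below leaves the other 1/24 to [N]. *)
  set (s := Rmin 1 (Cnorm mu / (24 * (1 + Cnorm beta)))).
  assert (0 < Cnorm mu / (24 * (1 + Cnorm beta))) as Hs0 by (apply Rdiv_lt_0_compat; lra).
  assert (0 < s) as Hs by (apply Rmin_glb_lt; lra).
  assert (s <= 1) as Hs1 by apply Rmin_l; assert (s <= Cnorm mu / (24 * (1 + Cnorm beta))) as Hs2 by apply Rmin_r.
  assert (Cnorm beta * s <= Cnorm mu / 24) as Hbs.
  { apply Rle_trans with ((1 + Cnorm beta) * (Cnorm mu / (24 * (1 + Cnorm beta)))); [apply Rmult_le_compat; lra|apply Req_le; field; lra]. }
  assert (1 <= / s) as Hsi by (rewrite <- Rinv_1; apply Rinv_le_contravar; lra).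
  assert (0 < / Cnorm mu) as Nim by (apply Rinv_0_lt_compat; auto).
  assert (HS : forall p, n3 (yscale s p) <= n3 p).
  { intros p; pose proof (n3_yscale s 1 p ltac:(lra) ltac:(rewrite Rabs_pos_eq; lra)); lra. }
  assert (HSi : forall p, n3 (yscale (/ s) p) <= / s * n3 p) by (intros p; apply n3_yscale; [lra|rewrite Rabs_pos_eq; lra]).
  set (A := / Cnorm mu * / s).
  assert (0 < A) as HA by (apply Rmult_lt_0_compat; lra).
  exists s, (A * (2 * C)); split; [lra|]; split; [apply Rmult_le_pos; lra|].
  intros delta Hdelta.
  set (b := Rmin d (1 / (24 * (A * C + 1)))).
  assert (0 <= A * C) as HAC by (apply Rmult_le_pos; lra).
  assert (0 < b) as Hb by (apply Rmin_glb_lt; [lra|apply Rdiv_lt_0_compat; lra]).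
  assert (b <= d) as Hbd by apply Rmin_l; assert (b <= 1 / (24 * (A * C + 1))) as HbA by apply Rmin_r.
  assert (A * C * b <= 1 / 24) as HACb.
  { apply Rle_trans with ((A * C + 1) * (1 / (24 * (A * C + 1)))); [apply Rmult_le_compat; lra|apply Req_le; field; lra]. }
  (* For [n3 p <= 1] the weight [n3 p ^ 2] is at most [n3 p], so the argument of [N] has norm at
     most [(1 + delta) * n3 p], which is less than [b]. *)
  set (r0 := Rmin (Rmin 1 (d / 4)) (b / (2 * (1 + delta)))).
  assert (r0 <= 1) as Hr01 by (eapply Rle_trans; [apply Rmin_l|apply Rmin_l]).
  assert (r0 <= d / 4) as Hr0d by (eapply Rle_trans; [apply Rmin_l|apply Rmin_r]).
  assert (r0 * (1 + delta) <= b / 2) as Hr0b.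
  { apply Rle_trans with (b / (2 * (1 + delta)) * (1 + delta)); [apply Rmult_le_compat_r; [lra|apply Rmin_r]|apply Req_le; field; lra]. }
  exists r0; split; [repeat apply Rmin_glb_lt; try lra; apply Rdiv_lt_0_compat; lra|].
  intros r Hr.
  assert (Hin : forall p W, n3 p < r -> n3 W <= delta * n3 p ^ 2 -> n3 (pxz p +v yscale s W) < b).
  { intros p W Hp HW; pose proof (n3_add (pxz p) (yscale s W)); pose proof (n3_pxz p); pose proof (HS W); pose proof (n3_ge0 p).
    assert (n3 p ^ 2 <= n3 p) by nra. assert (delta * n3 p ^ 2 <= delta * n3 p) by (apply Rmult_le_compat_l; lra). nra. }
  split; [constructor; auto; try lra|split].
  - simpl; lra.
  - intros W HW HWb.
    assert (HolV r (fun p => yscale (/ s) (N (pxz p +v yscale s (W p))))) as HNh.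
    { apply HolV_yscale, (HolV_comp r R0 N (fun p => pxz p +v yscale s (W p))); auto.
      - apply HolV_add; [apply HolV_pxz|apply HolV_yscale; auto].
      - intros p Hp; pose proof (Hin p (W p) Hp (HWb p Hp)); lra. }
    destruct HNh as [A0 [A1 A2]]; destruct HW as [W0 [W1 W2]].
    repeat split; unfold linG; simpl; apply Hol_mul; try apply Hol_const; apply Hol_add; auto; try apply Hol_const.
    apply Hol_mul; auto; apply Hol_const.
  - intros p W W' Hp HW HW'; unfold linG.
    set (u := pxz p +v yscale s W); set (u' := pxz p +v yscale s W').
    replace (Cinv mu *v (mk3 (beta *c RtoC s *c p1 W) C0 C0 +v yscale (/ s) (N u)) -v Cinv mu *v (mk3 (beta *c RtoC s *c p1 W') C0 C0 +v yscale (/ s) (N u')))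
      with (Cinv mu *v ((beta *c RtoC s *c p1 (W -v W')) *v e3 0 +v yscale (/ s) (N u -v N u'))) by (apply C3_eq; simpl; ring).
    rewrite n3_scal, Cnorm_inv by auto.
    eapply Rle_trans; [apply Rmult_le_compat_l; [lra|apply n3_add]|].
    rewrite n3_scal_e3, !Cnorm_mul, Cnorm_RtoC, (Rabs_pos_eq s) by lra.
    pose proof (HL b Hbd u u' (Hin p W Hp HW) (Hin p W' Hp HW')) as HLu.
    replace (u -v u') with (yscale s (W -v W')) in HLu by (unfold u, u'; apply C3_eq; simpl; ring).
    pose proof (HS (W -v W')); pose proof (HSi (N u -v N u')); pose proof (Cnorm_p1 (W -v W')); pose proof (n3_ge0 (W -v W')).
    set (D := n3 (W -v W')) in *.
    assert (C * b * n3 (yscale s (W -v W')) <= C * b * D) by (apply Rmult_le_compat_l; auto; apply Rmult_le_pos; lra).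
    assert (Cnorm beta * s * Cnorm (p1 (W -v W')) <= Cnorm mu / 24 * D) by (apply Rmult_le_compat; auto; try apply Cnorm_ge0; apply Rmult_le_pos; lra).
    assert (n3 (yscale (/ s) (N u -v N u')) <= / s * (C * b * D)).
    { eapply Rle_trans; [eassumption|]; apply Rmult_le_compat_l; lra. }
    apply Rle_trans with (/ Cnorm mu * (Cnorm mu / 24 * D + / s * (C * b * D))); [apply Rmult_le_compat_l; lra|].
    replace (/ Cnorm mu * (Cnorm mu / 24 * D + / s * (C * b * D))) with (D / 24 + A * C * b * D) by (unfold A; field; lra). nra.
  - intros p Hp; unfold linG.
    replace (pxz p +v yscale s O3) with (pxz p) by (apply C3_eq; simpl; ring).
    replace (mk3 (beta *c RtoC s *c p1 O3) C0 C0 +v yscale (/ s) (N (pxz p))) with (yscale (/ s) (N (pxz p))) by (apply C3_eq; simpl; ring).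
    rewrite n3_scal, Cnorm_inv by auto.
    pose proof (n3_pxz p); pose proof (n3_ge0 p); pose proof (HSi (N (pxz p))).
    assert (n3 (N (pxz p)) <= 2 * C * n3 p ^ 2) as HNp.
    { destruct (Req_dec (n3 p) 0) as [E|E].
      - rewrite (n3_eq0 p E); replace (pxz O3) with O3 by reflexivity; rewrite HN0, n3_O3; simpl; lra.
      - pose proof (HL (2 * n3 p) ltac:(lra) (pxz p) O3 ltac:(lra) ltac:(rewrite n3_O3; lra)) as HLp; rewrite HN0 in HLp.
        replace (N (pxz p) -v O3) with (N (pxz p)) in HLp by (apply C3_eq; simpl; ring).
        replace (pxz p -v O3) with (pxz p) in HLp by (apply C3_eq; simpl; ring).
        assert (C * (2 * n3 p) * n3 (pxz p) <= C * (2 * n3 p) * n3 p) by (apply Rmult_le_compat_l; auto; apply Rmult_le_pos; lra). lra. }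
    apply Rle_trans with (/ Cnorm mu * (/ s * (2 * C * n3 p ^ 2))); [|apply Req_le; unfold A; ring].
    apply Rmult_le_compat_l; [lra|]; eapply Rle_trans; [eassumption|]; apply Rmult_le_compat_l; lra.
  - intros p W Hp HW; pose proof (Hin p W Hp HW); lra.
Qed.

(** With [beta = C1] and equal frequencies this is the system of the theorem; [beta = C0] serves its
    restrictions to invariant curves and surfaces. *)
Definition lin_field (mu beta : Cplx) (N : C3 -> C3) (p : C3) : C3 := mu *v p +v ((beta *c p1 p) *v e3 0 +v N p).

Lemma yscale_euler (s : R) (r : R) (W : C3 -> C3) (p : C3) : HolV r W -> n3 p < r ->
  euler (fun q => pxz q +v yscale s (W q)) p = pxz p +v yscale s (euler W p).
Proof.
  intros [H0 [H1 H2]] Hp; apply C3_eq; simpl.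
  - change (eul (fun q => p0 q +c p0 (W q)) p = p0 p +c eul (fun q => p0 (W q)) p).
    replace (fun q => p0 q +c p0 (W q)) with (fun q => C1 *c p0 q +c p0 (W q)) by (apply functional_extensionality; intros; ring).
    rewrite (eul_lin p0 (fun q => p0 (W q)) C1 p _ _ (tdiff_p0 p) (H0 p Hp)), eul_p0; ring.
  - change (eul (fun q => C0 +c RtoC s *c p1 (W q)) p = C0 +c RtoC s *c eul (fun q => p1 (W q)) p).
    replace (fun q => C0 +c RtoC s *c p1 (W q)) with (fun q => RtoC s *c p1 (W q) +c (fun _ => C0) q) by (apply functional_extensionality; intros; ring).
    rewrite (eul_lin (fun q => p1 (W q)) (fun _ => C0) (RtoC s) p _ _ (H1 p Hp) (tdiff_const C0 p)).
    unfold eul at 2; rewrite (tdiff_grad_eq _ _ _ (tdiff_const C0 p)); unfold dot; simpl; ring.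
  - change (eul (fun q => p2 q +c p2 (W q)) p = p2 p +c eul (fun q => p2 (W q)) p).
    replace (fun q => p2 q +c p2 (W q)) with (fun q => C1 *c p2 q +c p2 (W q)) by (apply functional_extensionality; intros; ring).
    rewrite (eul_lin p2 (fun q => p2 (W q)) C1 p _ _ (tdiff_p2 p) (H2 p Hp)), eul_p2; ring.
Qed.

(** [euler_sol (linG ...) r 0 2 W] says that [Gamma = pxz + yscale s W] conjugates the Euler flow to the field. *)
Lemma lin_equation (mu beta : Cplx) (N : C3 -> C3) (s : R) (p V W : C3) : mu <> C0 -> s <> 0 ->
  (V +v RtoC (INR 0 + 1 - INR 2) *v W = linG mu beta N s p W <->
   mu *v (pxz p +v yscale s V) = lin_field mu beta N (pxz p +v yscale s W)).
Proof.
  intros Hmu Hs.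
  replace (RtoC (INR 0 + 1 - INR 2)) with (Copp C1) by (apply Cplx_eq; simpl; ring).
  unfold linG, lin_field; set (n := N (pxz p +v yscale s W)).
  assert (RtoC s <> C0) by (apply RtoC_neq0; auto).
  split; intros E.
  - replace V with (W +v Cinv mu *v (mk3 (beta *c RtoC s *c p1 W) C0 C0 +v yscale (/ s) n))
      by (rewrite <- E; apply C3_eq; simpl; ring).
    apply C3_eq; simpl; rewrite ?RtoC_inv by auto; field; auto.
  - pose proof (f_equal p0 E) as E0; pose proof (f_equal p1 E) as E1; pose proof (f_equal p2 E) as E2; simpl in E0, E1, E2.
    apply C3_eq; simpl; rewrite ?RtoC_inv by auto.
    + transitivity (Cinv mu *c (mu *c (p0 p +c p0 V)) -c p0 p -c p0 W); [field; auto|rewrite E0; field; auto].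
    + transitivity (Cinv mu *c Cinv (RtoC s) *c (mu *c (C0 +c RtoC s *c p1 V)) -c p1 W); [field; auto|rewrite E1; field; auto].
    + transitivity (Cinv mu *c (mu *c (p2 p +c p2 V)) -c p2 p -c p2 W); [field; auto|rewrite E2; field; auto].
Qed.

(** Such a [Gam] maps the orbits [t -> exp(mu t) p] of the linear flow to orbits of [X]. *)
Definition lin_sol (X : C3 -> C3) (mu : Cplx) (rho : R) (Gam : C3 -> C3) : Prop :=
  HolV rho Gam /\ order2V (fun p => Gam p -v pxz p) /\ forall p, n3 p < rho -> mu *v euler Gam p = X (Gam p).

Lemma wle2_order2V (r c : R) (W : C3 -> C3) : 0 < r -> wle r c 2 W -> order2V W.
Proof.
  intros Hr H; split; [|split]; apply (order2_of_square _ r c); auto; intros p Hp; eapply Rle_trans; [|apply (H p Hp)| |apply (H p Hp)| |apply (H p Hp)];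
  [apply Cnorm_p0|apply Cnorm_p1|apply Cnorm_p2].
Qed.

Lemma order2V_wle2 (r : R) (W : C3 -> C3) : 0 < r -> HolV r W -> order2V W -> exists d c, 0 < d <= r /\ 0 <= c /\ wle d c 2 W.
Proof.
  intros Hr [H0 [H1 H2]] [O0 [O1 O2]].
  destruct (order2_square _ r Hr H0 O0) as [d0 [c0 [A0 [B0 L0]]]]; destruct (order2_square _ r Hr H1 O1) as [d1 [c1 [A1 [B1 L1]]]];
  destruct (order2_square _ r Hr H2 O2) as [d2 [c2 [A2 [B2 L2]]]].
  exists (Rmin d0 (Rmin d1 d2)), (c0 + c1 + c2).
  pose proof (Rmin_l d0 (Rmin d1 d2)); pose proof (Rmin_r d0 (Rmin d1 d2)); pose proof (Rmin_l d1 d2); pose proof (Rmin_r d1 d2).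
  split; [split; [repeat apply Rmin_glb_lt; lra|lra]|split; [lra|]].
  intros p Hp; eapply Rle_trans; [apply n3_le_sum|].
  pose proof (L0 p ltac:(lra)); pose proof (L1 p ltac:(lra)); pose proof (L2 p ltac:(lra)); cbv beta in *; lra.
Qed.

Theorem lin_exists (mu beta : Cplx) (N : C3 -> C3) (R0 : R) : mu <> C0 -> 0 < R0 -> HolV R0 N -> order2V N ->
  exists rho Gam, 0 < rho /\ lin_sol (lin_field mu beta N) mu rho Gam.
Proof.
  intros Hmu HR HN H2.
  destruct (lin_problem mu beta N R0 Hmu HR HN H2) as [s [c0 [Hs [Hc0 K]]]].
  (* The smallest [delta] allowed by [euler_exists] for [e = 0]. *)
  destruct (K (12 * c0)) as [r0 [Hr0 K']]; [lra|]; destruct (K' r0) as [HP [HG0 _]]; [lra|].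
  destruct (euler_exists _ _ _ _ c0 _ _ HP Hc0 HG0) as [W [HW [HWb HWe]]]; [simpl; lra|].
  exists r0, (fun p => pxz p +v yscale s (W p)); split; auto; split; [|split].
  - apply HolV_add; [apply HolV_pxz|apply HolV_yscale; auto].
  - apply (wle2_order2V r0 (12 * c0)); auto; intros p Hp.
    replace (pxz p +v yscale s (W p) -v pxz p) with (yscale s (W p)) by (apply C3_eq; simpl; ring).
    pose proof (n3_yscale s 1 (W p) ltac:(lra) ltac:(rewrite Rabs_pos_eq; lra)); specialize (HWb p Hp); lra.
  - intros p Hp; rewrite (yscale_euler s r0) by auto; apply lin_equation; [auto|lra|]; apply HWe; auto.
Qed.

(** The linear part of Gam is prescribed to be [pxz], so Gam - pxz vanishes to order two and, after
    rescaling, solves the Euler problem of weight 2, where solutions are unique. *)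
Theorem lin_unique (mu beta : Cplx) (N : C3 -> C3) (R0 rho rho' : R) (Gam Gam' : C3 -> C3) : mu <> C0 -> 0 < R0 ->
  HolV R0 N -> order2V N -> 0 < rho -> 0 < rho' ->
  lin_sol (lin_field mu beta N) mu rho Gam -> lin_sol (lin_field mu beta N) mu rho' Gam' ->
  exists r, 0 < r /\ forall p, n3 p < r -> Gam p = Gam' p.
Proof.
  intros Hmu HR HN H2 Hrho Hrho' HG HG'.
  destruct (lin_problem mu beta N R0 Hmu HR HN H2) as [s [c0 [Hs [_ K]]]].
  assert (Hgen : forall rho Gam, 0 < rho -> lin_sol (lin_field mu beta N) mu rho Gam ->
    exists d c, 0 < d /\ 0 <= c /\ forall r, r <= d -> HolV r (fun p => yscale (/ s) (Gam p -v pxz p)) /\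
      wle r c 2 (fun p => yscale (/ s) (Gam p -v pxz p)) /\ euler_sol (linG mu beta N s) r 0 2 (fun p => yscale (/ s) (Gam p -v pxz p))).
  { clear rho rho' Gam Gam' Hrho Hrho' HG HG'; intros rho Gam Hrho [H1 [H3 H4]].
    assert (HolV rho (fun p => Gam p -v pxz p)) as H5 by (apply HolV_csub; auto; apply HolV_pxz).
    destruct (order2V_wle2 rho _ Hrho H5 H3) as [d [c [Hd [Hc Hw]]]].
    assert (1 <= / s) as Hsi by (rewrite <- Rinv_1; apply Rinv_le_contravar; lra).
    exists d, (/ s * c); split; [lra|]; split; [apply Rmult_le_pos; lra|]; intros r Hr.
    assert (HolV rho (fun p => yscale (/ s) (Gam p -v pxz p))) as H6 by (apply HolV_yscale; auto).
    split; [apply (HolV_sub rho); auto; lra|]; split.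
    - intros p Hp; pose proof (n3_yscale (/ s) (/ s) (Gam p -v pxz p) Hsi ltac:(rewrite Rabs_pos_eq; lra)).
      pose proof (Hw p ltac:(lra)); cbv beta in *.
      eapply Rle_trans; [eassumption|]; rewrite Rmult_assoc; apply Rmult_le_compat_l; lra.
    - intros p Hp; apply lin_equation; auto; [lra|].
      rewrite <- (yscale_euler s rho) by (auto; lra).
      assert (forall q, pxz q +v yscale s (yscale (/ s) (Gam q -v pxz q)) = Gam q) as E
        by (intros q; rewrite yscale_inv by lra; apply C3_eq; simpl; ring).
      rewrite E; rewrite <- H4 by lra; f_equal; apply (euler_ext rho); auto; lra. }
  destruct (Hgen rho Gam Hrho HG) as [d [c [Hd [Hc L]]]]; destruct (Hgen rho' Gam' Hrho' HG') as [d' [c' [Hd' [Hc' L']]]].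
  (* The constants of both solutions are known first; [lin_problem] then supplies a radius for this
     common bound. *)
  set (delta := Rmax c c').
  assert (c <= delta) by apply Rmax_l; assert (c' <= delta) by apply Rmax_r.
  destruct (K delta ltac:(lra)) as [r0 [Hr0 K']].
  set (r := Rmin r0 (Rmin d d')).
  assert (r <= r0) by apply Rmin_l.
  assert (r <= d) by (eapply Rle_trans; [apply Rmin_r|apply Rmin_l]).
  assert (r <= d') by (eapply Rle_trans; [apply Rmin_r|apply Rmin_r]).
  assert (0 < r) by (repeat apply Rmin_glb_lt; auto).
  destruct (K' r) as [HP _]; [lra|].
  destruct (L r) as [A1 [A2 A3]]; auto; destruct (L' r) as [B1 [B2 B3]]; auto.
  assert (forall a W, a <= delta -> wle r a 2 W -> wle r delta 2 W) as Hmono.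
  { intros a W Ha HW p Hp; eapply Rle_trans; [apply HW; auto|]; apply Rmult_le_compat_r; auto; apply pow_le, n3_ge0. }
  exists r; split; auto; intros p Hp.
  pose proof (euler_unique _ _ _ _ _ _ _ _ HP A1 (Hmono _ _ H A2) A3 B1 (Hmono _ _ H0 B2) B3 p Hp) as E; cbv beta in E.
  apply (f_equal (yscale s)) in E; rewrite !yscale_inv in E by lra.
  apply C3_eq; [pose proof (f_equal p0 E) as E'|pose proof (f_equal p1 E) as E'|pose proof (f_equal p2 E) as E']; simpl in E';
  [apply (f_equal (fun z => z +c p0 p)) in E'|apply (f_equal (fun z => z +c C0)) in E'|apply (f_equal (fun z => z +c p2 p)) in E'];
  match type of E' with ?a = ?b => match goal with |- ?x = ?y => replace x with a by ring; replace y with b by ring; auto end end.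
Qed.

(** * Families of periodic orbits *)

Lemma cis_add (a b : R) : cis (a + b) = cis a *c cis b.
Proof. unfold cis; rewrite <- cexp_add; f_equal; apply Cplx_eq; simpl; ring. Qed.

Lemma cis_0 : cis 0 = C1.
Proof. apply Cplx_eq; unfold cis, cexp; simpl; rewrite exp_0, ?cos_0, ?sin_0; ring. Qed.

Lemma cis_period (t : R) : cis (t + 2 * PI) = cis t.
Proof. rewrite cis_add; replace (cis (2 * PI)) with C1; [ring|]; apply Cplx_eq; unfold cis, cexp; simpl; rewrite exp_0, ?cos_2PI, ?sin_2PI; ring. Qed.

Lemma cis_eq1 (t : R) : 0 < t < 2 * PI -> cis t <> C1.
Proof.
  intros Ht E; apply (f_equal Re) in E; unfold cis, cexp in E; simpl in E; rewrite exp_0 in E.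
  assert (0 < sin (t / 2)) by (apply sin_gt_0; lra).
  replace t with (2 * (t / 2)) in E by field; rewrite cos_2a_sin in E. nra.
Qed.

Lemma n3_cis (t : R) (p : C3) : n3 (cis t *v p) = n3 p.
Proof. rewrite n3_scal, Cnorm_cis; ring. Qed.

Lemma rder_cis_scaled (w t : R) : rder (fun t => cis (w * t)) t (Ci *c RtoC w *c cis (w * t)).
Proof.
  unfold cis; replace (Ci *c RtoC w *c cexp (mkC 0 (w * t))) with (cexp (mkC 0 (w * t)) *c (Ci *c RtoC w)) by ring.
  apply (rder_comp cexp (fun t => mkC 0 (w * t))); [apply cder_cexp|].
  split; simpl; [replace (0 * w - 1 * 0) with 0 by ring; apply derivable_pt_lim_const|].
  apply is_derive_Reals; auto_derive; auto; ring.
Qed.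

(** The derivative of Gam(exp(iwt) p) in [t] is i w times the Euler derivative. As rotation
    preserves the norm, the equation is needed on one sphere only. *)
Lemma orbit_solution (X Gam : C3 -> C3) (w rho : R) (p : C3) : HolV rho Gam ->
  (forall q, n3 q = n3 p -> (Ci *c RtoC w) *v euler Gam q = X (Gam q)) -> n3 p < rho ->
  is_global_sol X (fun t => Gam (cis (w * t) *v p)).
Proof.
  intros [H0 [H1 H2]] He Hp; apply is_global_sol_vder; intros t.
  assert (n3 (cis (w * t) *v p) < rho) as Hin by (rewrite n3_cis; auto).
  rewrite <- He by (rewrite ?n3_cis; auto).
  assert (forall f, Hol rho f -> rder (fun t => f (cis (w * t) *v p)) t (Ci *c RtoC w *c dot (grad f (cis (w * t) *v p)) (cis (w * t) *v p))) as H.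
  { intros f Hf.
    assert (forall c, rder (fun t => cis (w * t) *c c) t (Ci *c RtoC w *c cis (w * t) *c c)) as Hc.
    { intros c; pose proof (rder_mul _ _ _ _ _ (rder_cis_scaled w t) (rder_const c t)) as K; cbv beta in K.
      match type of K with rder _ _ (?a +c ?b *c C0) => replace (a +c b *c C0) with a in K by ring end; exact K. }
    replace (Ci *c RtoC w *c dot (grad f (cis (w * t) *v p)) (cis (w * t) *v p)) with
      (dot (grad f (cis (w * t) *v p)) ((Ci *c RtoC w *c cis (w * t)) *v p)) by (unfold dot; simpl; ring).
    apply (tdiff_comp_rder f (fun t => cis (w * t) *v p)); [apply Hf; auto| | |]; apply Hc. }
  split; [|split]; [exact (H _ H0)|exact (H _ H1)|exact (H _ H2)].
Qed.

(** Isochrony and invariance are both reduced to a parametrisation of [S] by rotations. [ode_unique]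
    identifies every solution starting on [S] with such an orbit, and the last condition,
    injectivity along it, excludes a shorter period. *)
Lemma isochronous_of_orbits (X Gam : C3 -> C3) (S : C3 -> Prop) (R0 d w : R) : w <> 0 -> 0 < d -> HolV R0 X ->
  (forall q, S q -> n3 q < d -> exists p, Gam p = q /\ is_global_sol X (fun t => Gam (cis (w * t) *v p)) /\
     (forall t, S (Gam (cis t *v p)) /\ n3 (Gam (cis t *v p)) < R0) /\
     (q <> O3 -> forall t, Gam (cis t *v p) = q -> cis t = C1)) ->
  isochronous X S (2 * PI / Rabs w) /\ invariant X S.
Proof.
  intros Hw Hd HX H; pose proof PI_RGT_0 as HPI; pose proof (Rabs_pos_lt w Hw) as Haw.
  assert (Estart : forall p, cis (w * 0) *v p = p) by (intros p; rewrite Rmult_0_r, cis_0; apply C3_eq; simpl; ring).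
  assert (Hglob : forall phi a b, is_global_sol X phi -> is_sol X a b phi) by (intros phi a b Hphi t Ht i Hi; apply Hphi; auto).
  split.
  - exists d; split; auto; intros q HS Hq.
    destruct (H q HS ltac:(lra)) as [p [Ep [Hsol [Hin Hper]]]].
    split; [exists (fun t => Gam (cis (w * t) *v p)); split; auto; rewrite Estart; auto|].
    intros phi Hphi E0.
    assert (Heq : forall t, phi t = Gam (cis (w * t) *v p)).
    { intros t; pose proof (Rabs_pos t).
      apply (ode_unique X R0 phi (fun t => Gam (cis (w * t) *v p)) (- (Rabs t + 1)) (Rabs t + 1)); auto; try lra.
      - intros s _; apply Hin.
      - rewrite Estart, Ep; auto.
      - pose proof (Rle_abs t); pose proof (Rle_abs (- t)); rewrite Rabs_Ropp in *; lra. }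
    split.
    + intros t; rewrite !Heq; do 2 f_equal.
      (* For negative [w] the orbit runs backwards and the period closes it after -2 pi. *)
      destruct (Rle_dec 0 w) as [Hw0|Hw0].
      * rewrite Rabs_pos_eq by lra; replace (w * (t + 2 * PI / w)) with (w * t + 2 * PI) by (field; auto); apply cis_period.
      * rewrite Rabs_left by lra; rewrite <- (cis_period (w * (t + 2 * PI / - w))); f_equal; field; lra.
    + intros t Ht E; rewrite Heq in E.
      assert (q <> O3) as Hq0 by (intros ->; rewrite n3_O3 in Hq; lra).
      apply (Hper Hq0 (w * t)) in E.
      assert (0 < Rabs w * t < 2 * PI) as Hwt.
      { split; [apply Rmult_lt_0_compat; lra|]; destruct Ht as [_ Ht]; apply (Rmult_lt_compat_l (Rabs w)) in Ht; auto.
        replace (Rabs w * (2 * PI / Rabs w)) with (2 * PI) in Ht by (field; lra); auto. }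
      destruct (Rle_dec 0 w) as [Hw0|Hw0].
      * rewrite Rabs_pos_eq in Hwt by lra; apply (cis_eq1 _ Hwt); auto.
      * rewrite Rabs_left in Hwt by lra; apply (cis_eq1 _ Hwt).
        replace (- w * t) with (0 + (- w * t)) by ring; assert (cis 0 = cis (w * t) *c cis (- w * t)) as Em by (rewrite <- cis_add; f_equal; ring).
        rewrite E, cis_0 in Em; rewrite cis_add, cis_0; auto.
  - exists d; split; auto; intros q Hq HS eps phi Heps Hphi E0.
    destruct (H q HS Hq) as [p [Ep [Hsol [Hin _]]]].
    exists eps; split; auto; intros t Ht.
    rewrite (ode_unique X R0 phi (fun t => Gam (cis (w * t) *v p)) (- eps) eps); auto; [apply Hin|lra|intros s _; apply Hin|].
    rewrite Estart, Ep; auto.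
Qed.

(** * Removable singularities along [x = 0] *)

Lemma clim0_unique (H : Cplx -> Cplx) (L L' : Cplx) : clim0 H L -> clim0 H L' -> L = L'.
Proof.
  intros K K'; apply Csub_eq0, Cnorm_eq0, Rle_antisym; [|apply Cnorm_ge0].
  apply le_epsilon; intros eps Heps; rewrite Rplus_0_l.
  destruct (K (eps / 2)) as [d [Hd D]]; [lra|]; destruct (K' (eps / 2)) as [d' [Hd' D']]; [lra|].
  assert (0 < Rmin d d') by (apply Rmin_glb_lt; auto).
  pose proof (Rmin_l d d'); pose proof (Rmin_r d d').
  set (s := RtoC (Rmin d d' / 2)).
  assert (Cnorm s = Rmin d d' / 2) as Es by (unfold s; rewrite Cnorm_RtoC, Rabs_pos_eq; lra).
  specialize (D s ltac:(lra)); specialize (D' s ltac:(lra)).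
  pose proof (Cnorm_sub_tri L (H s) L'); rewrite (Cnorm_sub_sym L (H s)) in *; lra.
Qed.

Lemma remov_off (H : C3 -> Cplx) (p : C3) : p0 p <> C0 -> remov H p = H p.
Proof. intros Hp; unfold remov; destruct excluded_middle_informative; [contradiction|reflexivity]. Qed.

Lemma remov_on (H : C3 -> Cplx) (p : C3) (L : Cplx) : p0 p = C0 ->
  clim0 (fun s => H (mk3 s (p1 p) (p2 p))) L -> remov H p = L.
Proof.
  intros Hp HL; unfold remov; destruct excluded_middle_informative; [|contradiction].
  apply (clim0_unique _ _ _ (epsilon_spec (inhabits C0) _ (ex_intro _ L HL)) HL).
Qed.

(** [H0] is the limit on the hyperplane {x = 0}. Partial derivatives exist there in the direction of
    [x] by the one-variable theorem and in the others by hypothesis on [H0], and the bound [M]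
    completes Osgood's criterion. *)
Lemma remov_Hol (H H0 : C3 -> Cplx) (r M : R) : 0 < r ->
  (forall p, n3 p < r -> p0 p <> C0 -> (exists l, tdiff H p l) /\ Cnorm (H p) <= M) ->
  (forall p, n3 p < r -> p0 p = C0 -> clim0 (fun s => H (mk3 s (p1 p) (p2 p))) (H0 p)) ->
  (forall p i, n3 p < r -> p0 p = C0 -> (1 <= i < 3)%nat -> exists L, has_pd i H0 p L) ->
  Hol r (remov H) /\ forall p, n3 p < r -> p0 p = C0 -> remov H p = H0 p.
Proof.
  intros Hr Hoff Hlim Hpd.
  assert (Hon : forall p, n3 p < r -> p0 p = C0 -> remov H p = H0 p) by (intros p Hp E; apply remov_on; auto).
  split; auto.
  apply (Hol_of_sep r M); intros p Hp.
  destruct (excluded_middle_informative (p0 p = C0)) as [E|E].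
  - split.
    + intros i Hi.
      destruct i as [|i].
      (* The slice in the direction of [x] is differentiable off 0 and has the right limit at 0. *)
      * destruct (removable (fun z => remov H (p +v z *v e3 0)) (r - n3 p) M) as [L HL].
        -- lra.
        -- intros z Hz; set (q := p +v z *v e3 0).
           assert (n3 q < r) as Hq by (unfold q; pose proof (n3_add p (z *v e3 0)); rewrite n3_scal_e3 in *; lra).
           assert (p0 q = z) as Eq by (unfold q; simpl; rewrite E; ring).
           assert (p0 q <> C0) as Hq0 by (rewrite Eq; apply Cnorm_neq0; lra).
           destruct (Hoff q Hq Hq0) as [[l Hl] _]; exists (comp 0 l).
           apply has_pd_cder, tdiff_has_pd; fold q.
           apply (tdiff_ext_loc H (remov H) q l (Cnorm z)); auto; [lra|].
           intros q' Hq'; symmetry; apply remov_off; intros E'.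
           pose proof (Cnorm_p0 (q' -v q)) as T; change (p0 (q' -v q)) with (p0 q' -c p0 q) in T; rewrite E', Eq in T.
           replace (C0 -c z) with (Copp z) in T by ring; rewrite Cnorm_opp in T; lra.
        -- rewrite add3_C0_e3, Hon by auto.
           intros eps Heps; destruct (Hlim p Hp E eps Heps) as [d [Hd K]]; exists d; split; auto; intros s Hs.
           specialize (K s Hs); rewrite remov_off.
           ++ replace (p +v s *v e3 0) with (mk3 s (p1 p) (p2 p)) by (apply C3_eq; simpl; rewrite ?E; ring); auto.
           ++ simpl; rewrite E; replace (C0 +c s *c C1) with s by ring; apply Cnorm_neq0; lra.
        -- exists L; apply has_pd_cder0; auto.
      (* The other directions stay in the hyperplane, where the extension is [H0]. *)
      * destruct (Hpd p (S i) Hp E ltac:(lia)) as [L HL]; exists L; apply has_pd_cder0.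
        apply has_pd_cder0 in HL; apply (cder_ext_loc (fun z => H0 (p +v z *v e3 (S i))) _ C0 L (r - n3 p)); auto; [lra|].
        intros z Hz; replace (z -c C0) with z in Hz by ring; symmetry; apply Hon.
        -- pose proof (n3_add p (z *v e3 (S i))); rewrite n3_scal_e3 in *; lra.
        -- destruct i as [|i]; simpl; rewrite E; ring.
    + rewrite Hon by auto; apply le_epsilon; intros eps Heps.
      destruct (Hlim p Hp E eps Heps) as [d [Hd K]].
      set (e := Rmin d (r - n3 p) / 2).
      assert (0 < Rmin d (r - n3 p)) by (apply Rmin_glb_lt; lra).
      pose proof (Rmin_l d (r - n3 p)); pose proof (Rmin_r d (r - n3 p)).
      assert (Cnorm (RtoC e) = e) as Ee by (rewrite Cnorm_RtoC, Rabs_pos_eq; unfold e; lra).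
      specialize (K (RtoC e) ltac:(rewrite Ee; unfold e; lra)).
      destruct (Hoff (mk3 (RtoC e) (p1 p) (p2 p))) as [_ HM].
      * replace (mk3 (RtoC e) (p1 p) (p2 p)) with (p +v RtoC e *v e3 0) by (apply C3_eq; simpl; rewrite ?E; ring).
        pose proof (n3_add p (RtoC e *v e3 0)); rewrite n3_scal_e3, Ee in *; unfold e in *; lra.
      * simpl; apply Cnorm_neq0; rewrite Ee; unfold e; lra.
      * pose proof (Cnorm_le_sub (H0 p) (H (mk3 (RtoC e) (p1 p) (p2 p)))) as T; rewrite Cnorm_sub_sym in T; lra.
  - rewrite remov_off by auto; destruct (Hoff p Hp E) as [[l Hl] HM]; split; auto.
    intros i Hi; exists (comp i l); apply tdiff_has_pd.
    pose proof (Cnorm_gt0 _ E).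
    apply (tdiff_ext_loc H (remov H) p l (Cnorm (p0 p))); auto.
    intros q Hq; symmetry; apply remov_off; intros Eq.
    pose proof (Cnorm_p0 (q -v p)) as T; change (p0 (q -v p)) with (p0 q -c p0 p) in T; rewrite Eq in T.
    replace (C0 -c p0 p) with (Copp (p0 p)) in T by ring; rewrite Cnorm_opp in T; lra.
Qed.

(** * Briot-Bouquet systems and the reduction step *)

Definition good_F (F : C3 -> Cplx) : Prop := order_ge2 F /\ exists r, 0 < r /\ Hol r F.
Definition good_bb (s : BB) : Prop := good_F (bb_F1 s) /\ good_F (bb_F2 s).

Definition bbsol (s : BB) (r : R) (u v : Cplx -> Cplx) : Prop :=
  0 < r /\ u C0 = C0 /\ v C0 = C0 /\ forall x, Cnorm x < r -> exists L1 L2, cder u x L1 /\ cder v x L2 /\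
    x *c L1 = x *c bb_a1 s +c (bb_m11 s *c u x +c bb_m12 s *c v x) +c bb_F1 s (mk3 x (u x) (v x)) /\
    x *c L2 = x *c bb_a2 s +c (bb_m21 s *c u x +c bb_m22 s *c v x) +c bb_F2 s (mk3 x (u x) (v x)).

Definition agree (u v u' v' : Cplx -> Cplx) : Prop :=
  exists d, 0 < d /\ forall x, Cnorm x < d -> u x = u' x /\ v x = v' x.

Definition reduced_F (F : C3 -> Cplx) (c1 c2 : Cplx) : C3 -> Cplx :=
  remov (fun p => F (mk3 (p0 p) (p0 p *c (p1 p +c c1)) (p0 p *c (p2 p +c c2))) /c p0 p -c p0 p *c quad F (mk3 C1 c1 c2)).

(** [reduce] with Cramer's solution replaced by an arbitrary solution [c] of [(I - M) c = a]: at a resonance [c] is not unique. *)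
Definition redc (c1 c2 : Cplx) (s : BB) : BB :=
  mkBB (quad (bb_F1 s) (mk3 C1 c1 c2)) (quad (bb_F2 s) (mk3 C1 c1 c2))
    (bb_m11 s -c C1) (bb_m12 s) (bb_m21 s) (bb_m22 s -c C1) (reduced_F (bb_F1 s) c1 c2) (reduced_F (bb_F2 s) c1 c2).

(** The characteristic polynomial of the linear matrix; a positive integer root is a resonance. *)
Definition bb_det (s : BB) (n : Cplx) : Cplx := (n -c bb_m11 s) *c (n -c bb_m22 s) -c bb_m12 s *c bb_m21 s.
Definition cramer1 (s : BB) : Cplx := ((C1 -c bb_m22 s) *c bb_a1 s +c bb_m12 s *c bb_a2 s) /c bb_det s C1.
Definition cramer2 (s : BB) : Cplx := (bb_m21 s *c bb_a1 s +c (C1 -c bb_m11 s) *c bb_a2 s) /c bb_det s C1.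

Lemma reduce_redc (s : BB) : reduce s = redc (cramer1 s) (cramer2 s) s.
Proof. reflexivity. Qed.

Definition shift_eq (s : BB) (c1 c2 : Cplx) : Prop :=
  c1 = bb_a1 s +c (bb_m11 s *c c1 +c bb_m12 s *c c2) /\ c2 = bb_a2 s +c (bb_m21 s *c c1 +c bb_m22 s *c c2).

Lemma shift_eq_a (s : BB) (c1 c2 : Cplx) : shift_eq s c1 c2 ->
  bb_a1 s = c1 -c (bb_m11 s *c c1 +c bb_m12 s *c c2) /\ bb_a2 s = c2 -c (bb_m21 s *c c1 +c bb_m22 s *c c2).
Proof. intros [E1 E2]; split; [rewrite E1 at 1|rewrite E2 at 1]; ring. Qed.

Lemma cramer_shift (s : BB) (c1 c2 : Cplx) : bb_det s C1 <> C0 -> (shift_eq s c1 c2 <-> c1 = cramer1 s /\ c2 = cramer2 s).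
Proof.
  intros Hd; unfold cramer1, cramer2; split.
  - intros E; destruct (shift_eq_a s c1 c2 E) as [A1 A2].
    rewrite A1, A2; unfold bb_det in *; split; field; auto.
  - intros [-> ->]; unfold shift_eq, bb_det in *; split; field; auto.
Qed.

(** F(x, x(w+c)) is O(x^2) uniformly in small [w], so after division by [x] the extension vanishes
    identically on {x = 0}. Its remaining first-order term at 0 is [x] times [quad F (1,c)], and
    this is what the definition subtracts. *)
Lemma reduced_F_good (F : C3 -> Cplx) (c1 c2 : Cplx) : good_F F -> good_F (reduced_F F c1 c2).
Proof.
  intros [H2 [R0 [HR HF]]].
  destruct (order2_square F R0 HR HF H2) as [d [C [Hd [HC HFb]]]].
  set (Q := quad F (mk3 C1 c1 c2)).
  set (sub := fun p => mk3 (p0 p) (p0 p *c (p1 p +c c1)) (p0 p *c (p2 p +c c2))).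
  set (H := fun p => F (sub p) /c p0 p -c p0 p *c Q).
  set (A := 3 + Cnorm c1 + Cnorm c2).
  pose proof (Cnorm_ge0 c1); pose proof (Cnorm_ge0 c2).
  assert (0 < A) as HA by (unfold A; lra).
  assert (Hsub : forall p, Cnorm (p1 p) <= 1 -> Cnorm (p2 p) <= 1 -> n3 (sub p) <= A * Cnorm (p0 p)).
  { intros p Hp1 Hp2; eapply Rle_trans; [apply n3_le_sum|]; unfold sub; simpl; rewrite !Cnorm_mul.
    pose proof (Cnorm_add (p1 p) c1); pose proof (Cnorm_add (p2 p) c2); pose proof (Cnorm_ge0 (p0 p)).
    unfold A; nra. }
  set (r := Rmin 1 (d / (2 * A))).
  assert (0 < r) as Hr by (apply Rmin_glb_lt; [lra|apply Rdiv_lt_0_compat; lra]).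
  assert (r <= 1) as Hr1 by apply Rmin_l.
  assert (A * r < d) as HAr.
  { apply Rle_lt_trans with (A * (d / (2 * A))); [apply Rmult_le_compat_l; [lra|apply Rmin_r]|].
    replace (A * (d / (2 * A))) with (d / 2) by (field; lra); lra. }
  (* The substituted point has norm at most [A] times that of [x], which gives [C * A ^ 2] for the
     quotient; the rest is the subtracted term. *)
  set (K := C * A ^ 2 + Cnorm Q).
  assert (0 <= K) as HK by (unfold K; pose proof (Cnorm_ge0 Q); assert (0 <= C * A ^ 2) by (apply Rmult_le_pos; nra); lra).
  assert (Hbd : forall p, Cnorm (p0 p) < r -> Cnorm (p1 p) <= 1 -> Cnorm (p2 p) <= 1 -> p0 p <> C0 -> Cnorm (H p) <= K * Cnorm (p0 p)).
  { intros p Hp0 Hp1 Hp2 Hp; pose proof (Cnorm_gt0 _ Hp).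
    specialize (Hsub p Hp1 Hp2); pose proof (n3_ge0 (sub p)).
    specialize (HFb (sub p) ltac:(nra)).
    unfold H; eapply Rle_trans; [apply Cnorm_sub|]; rewrite Cnorm_mul, Cnorm_div by auto.
    assert (Cnorm (F (sub p)) / Cnorm (p0 p) <= C * A ^ 2 * Cnorm (p0 p)).
    { apply (Rmult_le_reg_r (Cnorm (p0 p))); auto; unfold Rdiv; rewrite Rmult_assoc, Rinv_l, Rmult_1_r by lra.
      eapply Rle_trans; [exact HFb|].
      replace (C * A ^ 2 * Cnorm (p0 p) * Cnorm (p0 p)) with (C * (A * Cnorm (p0 p)) ^ 2) by ring.
      apply Rmult_le_compat_l; auto; nra. }
    unfold K; lra. }
  destruct (remov_Hol H (fun _ => C0) r (K * r)) as [HH Hon]; auto.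
  - intros p Hp Hp0.
    pose proof (Cnorm_p0 p); pose proof (Cnorm_p1 p); pose proof (Cnorm_p2 p).
    split; [|eapply Rle_trans; [apply Hbd; auto; lra|apply Rmult_le_compat_l; lra]].
    pose proof (Hsub p ltac:(lra) ltac:(lra)) as Hs.
    eexists; unfold H, Csub, Cdiv; apply tdiff_add; [apply tdiff_mul|apply tdiff_opp, tdiff_mul; [apply tdiff_p0|apply tdiff_const]].
    + apply (tdiff_comp F sub); [apply HF; nra|apply tdiff_p0| |]; simpl;
      (apply tdiff_mul; [apply tdiff_p0|apply tdiff_add; [|apply tdiff_const]]); [apply tdiff_p1|apply tdiff_p2].
    + apply (tdiff_cder Cinv); [apply cder_inv; auto|apply tdiff_p0].
  - intros p Hp Hp0 eps Heps.
    pose proof (Cnorm_p1 p); pose proof (Cnorm_p2 p).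
    exists (Rmin r (eps / (K + 1))); split; [apply Rmin_glb_lt; auto; apply Rdiv_lt_0_compat; lra|]; intros s Hs.
    pose proof (Rmin_l r (eps / (K + 1))); pose proof (Rmin_r r (eps / (K + 1))).
    assert (eps / (K + 1) * (K + 1) = eps) by (field; lra).
    replace (H (mk3 s (p1 p) (p2 p)) -c C0) with (H (mk3 s (p1 p) (p2 p))) by ring.
    eapply Rle_lt_trans; [apply Hbd; simpl; try lra; apply Cnorm_neq0; lra|]; simpl; nra.
  - intros p i _ _ _; exists C0; apply has_pd_cder0, cder_const.
  - assert (remov H O3 = C0) as HH0 by (apply Hon; auto; rewrite n3_O3; auto).
    split; [|exists r; split; auto]; split; auto.
    intros i Hi; apply pd_eq; destruct i as [|i].
    + intros eps Heps.
      destruct (quad_limit F R0 (mk3 C1 c1 c2) HR HF H2 eps Heps) as [e [He HQ]].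
      exists e; split; auto; intros h Hh.
      change (reduced_F F c1 c2) with (remov H).
      replace (O3 +v h *v e3 0) with (mk3 h C0 C0) by (apply C3_eq; simpl; ring); rewrite HH0.
      destruct (excluded_middle_informative (h = C0)) as [->|Hn].
      * change (mk3 C0 C0 C0) with O3; rewrite HH0; replace (C0 -c C0 -c C0 *c C0) with C0 by ring; rewrite Cnorm_C0; lra.
      * rewrite remov_off by auto; pose proof (Cnorm_gt0 h Hn); specialize (HQ h Hh).
        apply (Rmult_le_reg_r (Cnorm h)); auto; rewrite <- Cnorm_mul.
        replace ((H (mk3 h C0 C0) -c C0 -c C0 *c h) *c h) with (F (h *v mk3 C1 c1 c2) -c h *c h *c Q); [unfold Q; nra|].
        unfold H; simpl p0.
        replace (h *v mk3 C1 c1 c2) with (sub (mk3 h C0 C0)) by (unfold sub; apply C3_eq; simpl; ring).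
        field; auto.
    + apply has_pd_cder0; apply (cder_ext_loc (fun _ => C0) _ C0 C0 r); auto; [|apply cder_const].
      intros z Hz; replace (z -c C0) with z in Hz by ring; symmetry; apply Hon.
      * replace (O3 +v z *v e3 (S i)) with (z *v e3 (S i)) by (apply C3_eq; simpl; ring); rewrite n3_scal_e3; auto.
      * destruct i; simpl; ring.
Qed.

Lemma redc_good (c1 c2 : Cplx) (s : BB) : good_bb s -> good_bb (redc c1 c2 s).
Proof. intros [H1 H2]; split; apply reduced_F_good; auto. Qed.

Definition unshift (u : Cplx -> Cplx) (c x : Cplx) : Cplx := x *c (u x +c c).
(** The inverse of [unshift], with the value 0 at 0 that [bbsol] requires. *)
Definition shift (u : Cplx -> Cplx) (c x : Cplx) : Cplx :=
  if excluded_middle_informative (x = C0) then C0 else u x /c x -c c.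

Lemma cder_unshift (u : Cplx -> Cplx) (c x L : Cplx) : cder u x L -> cder (unshift u c) x ((u x +c c) +c x *c L).
Proof.
  intros H; pose proof (cder_mul _ _ _ _ _ (cder_id x) (cder_add _ _ _ _ _ H (cder_const c x))) as K.
  unfold unshift; cbv beta in K; match type of K with cder _ _ ?a => replace a with (u x +c c +c x *c L) in K by ring end; exact K.
Qed.

Lemma redc_up (c1 c2 : Cplx) (s : BB) (r : R) (u v : Cplx -> Cplx) : good_bb s -> shift_eq s c1 c2 ->
  bbsol (redc c1 c2 s) r u v -> bbsol s r (unshift u c1) (unshift v c2).
Proof.
  intros [[[HF1 _] _] [[HF2 _] _]] E [Hr [Hu0 [Hv0 H]]].
  split; auto; split; [unfold unshift; ring|]; split; [unfold unshift; ring|]; intros x Hx.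
  destruct (H x Hx) as [L1 [L2 [D1 [D2 [Q1 Q2]]]]].
  exists (u x +c c1 +c x *c L1), (v x +c c2 +c x *c L2); split; [apply cder_unshift; auto|]; split; [apply cder_unshift; auto|].
  destruct (excluded_middle_informative (x = C0)) as [->|Hn].
  - rewrite Hu0, Hv0 in *; unfold unshift; rewrite Hu0, Hv0.
    replace (C0 *c (C0 +c c1)) with C0 by ring; replace (C0 *c (C0 +c c2)) with C0 by ring.
    change (mk3 C0 C0 C0) with O3; rewrite HF1, HF2; split; ring.
  - simpl in Q1, Q2; unfold reduced_F in Q1, Q2; rewrite remov_off in Q1, Q2 by auto; simpl in Q1, Q2; unfold unshift.
    destruct (shift_eq_a s c1 c2 E) as [A1 A2]; rewrite Q1, Q2, A1, A2; split; field; auto.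
Qed.

Lemma bbsol_curve_cder (F : C3 -> Cplx) (u v : Cplx -> Cplx) (x L1 L2 : Cplx) (l : C3) :
  cder u x L1 -> cder v x L2 -> tdiff F (mk3 x (u x) (v x)) l ->
  cder (fun x => F (mk3 x (u x) (v x))) x (dot l (mk3 C1 L1 L2)).
Proof. intros H1 H2 HF; apply (tdiff_comp_cder F (fun x => mk3 x (u x) (v x))); auto; apply cder_id. Qed.

Lemma bbsol_hol1 (s : BB) (r : R) (u v : Cplx -> Cplx) : bbsol s r u v -> hol1 u C0 r /\ hol1 v C0 r.
Proof.
  intros [_ [_ [_ H]]]; split; intros z Hz; replace (z -c C0) with z in Hz by ring;
  destruct (H z Hz) as [L1 [L2 [D1 [D2 _]]]]; eauto.
Qed.

(** Differentiate the system at 0. On the left, [x u'] has derivative [u'(0)] because [u'] is itself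
    differentiable; on the right, [F] does not contribute. An unsolvable equation for [c] thus
    excludes every solution. *)
Lemma bbsol_derivative (s : BB) (r : R) (u v : Cplx -> Cplx) : good_bb s -> bbsol s r u v ->
  exists c1 c2, cder u C0 c1 /\ cder v C0 c2 /\ shift_eq s c1 c2.
Proof.
  intros [[HF1 [R1 [HR1 G1]]] [HF2 [R2 [HR2 G2]]]] Hs; destruct (bbsol_hol1 s r u v Hs) as [Hu Hv].
  destruct (hol1_choose u C0 r Hu) as [du Du]; destruct (hol1_choose v C0 r Hv) as [dv Dv].
  destruct Hs as [Hr [Hu0 [Hv0 H]]].
  destruct (hol1_derivative u du C0 r Hr Du) as [B1 HB1]; destruct (hol1_derivative v dv C0 r Hr Dv) as [B2 HB2].
  assert (HO : Cnorm (C0 -c C0) < r) by (rewrite Cnorm_self; auto).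
  exists (du C0), (dv C0); split; [apply Du; auto|]; split; [apply Dv; auto|].
  assert (Hgen : forall (F : C3 -> Cplx) (dw : Cplx -> Cplx) a m m' B, tdiff F O3 O3 -> cder dw C0 B ->
    (forall x, Cnorm x < r -> x *c dw x = x *c a +c (m *c u x +c m' *c v x) +c F (mk3 x (u x) (v x))) ->
    dw C0 = a +c (m *c du C0 +c m' *c dv C0)).
  { intros F dw a m m' B HF HB E.
    apply (cder_unique (fun x => x *c dw x) C0).
    - pose proof (cder_mul _ _ _ _ _ (cder_id C0) HB) as K; cbv beta in K.
      replace (C1 *c dw C0 +c C0 *c B) with (dw C0) in K by ring; exact K.
    - apply (cder_ext_loc (fun x => x *c a +c (m *c u x +c m' *c v x) +c F (mk3 x (u x) (v x))) _ C0 _ r); auto.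
      + intros x Hx; replace (x -c C0) with x in Hx by ring; rewrite E; auto.
      + pose proof (Du C0 HO) as D1; pose proof (Dv C0 HO) as D2.
        assert (tdiff F (mk3 C0 (u C0) (v C0)) O3) as HF' by (rewrite Hu0, Hv0; exact HF).
        pose proof (cder_add _ _ _ _ _ (cder_add _ _ _ _ _ (cder_mul _ _ _ _ _ (cder_id C0) (cder_const a C0))
          (cder_add _ _ _ _ _ (cder_mul _ _ _ _ _ (cder_const m C0) D1) (cder_mul _ _ _ _ _ (cder_const m' C0) D2)))
          (bbsol_curve_cder F u v C0 _ _ _ D1 D2 HF')) as K; cbv beta in K.
        match type of K with cder _ _ ?b => replace b with (a +c (m *c du C0 +c m' *c dv C0)) in K by (unfold dot; simpl; ring) end; exact K. }
  split.
  - apply (Hgen (bb_F1 s) du _ _ _ B1); auto; [apply (order2_tdiff _ R1); auto|].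
    intros x Hx; destruct (H x Hx) as [L1 [L2 [D1 [D2 [Q1 Q2]]]]].
    rewrite (cder_unique u x _ L1 (Du x ltac:(replace (x -c C0) with x by ring; auto)) D1); auto.
  - apply (Hgen (bb_F2 s) dv _ _ _ B2); auto; [apply (order2_tdiff _ R2); auto|].
    intros x Hx; destruct (H x Hx) as [L1 [L2 [D1 [D2 [Q1 Q2]]]]].
    rewrite (cder_unique v x _ L2 (Dv x ltac:(replace (x -c C0) with x by ring; auto)) D2); auto.
Qed.

Lemma shift_off (u : Cplx -> Cplx) (c x : Cplx) : x <> C0 -> shift u c x = u x /c x -c c.
Proof. intros H; unfold shift; destruct excluded_middle_informative; [contradiction|reflexivity]. Qed.

Lemma shift_on (u : Cplx -> Cplx) (c : Cplx) : shift u c C0 = C0.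
Proof. unfold shift; destruct excluded_middle_informative; congruence. Qed.

Lemma cder_quotient (u : Cplx -> Cplx) (c x L : Cplx) : x <> C0 -> cder u x L ->
  cder (shift u c) x (L /c x -c u x /c (x *c x)).
Proof.
  intros Hx H.
  apply (cder_ext_loc (fun x => u x *c Cinv x +c Copp c) _ x _ (Cnorm x)); [apply Cnorm_gt0; auto| |].
  - intros w Hw; rewrite shift_off; [reflexivity|]; intros ->.
    replace (C0 -c x) with (Copp x) in Hw by ring; rewrite Cnorm_opp in Hw; lra.
  - pose proof (cder_add _ _ _ _ _ (cder_mul _ _ _ _ _ H (cder_inv x Hx)) (cder_const (Copp c) x)) as K.
    match type of K with cder _ _ ?b => replace b with (L /c x -c u x /c (x *c x)) in K by (field; auto) end; exact K.
Qed.

(** The derivative of [u(x)/x - c] at 0 is half the second derivative of [u], by [taylor2]. *)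
Lemma cder_shift0 (u : Cplx -> Cplx) (c : Cplx) (r : R) : 0 < r -> hol1 u C0 r -> u C0 = C0 -> cder u C0 c ->
  exists L, cder (shift u c) C0 L.
Proof.
  intros Hr Hu Hu0 Hc; destruct (hol1_choose u C0 r Hu) as [du Du].
  destruct (hol1_derivative u du C0 r Hr Du) as [B HB].
  assert (du C0 = c) as Ec by (apply (cder_unique u C0); auto; apply Du; rewrite Cnorm_self; auto).
  exists (RtoC (1 / 2) *c B); intros eps Heps.
  destruct (taylor2 u du C0 B r Hr Du HB eps Heps) as [d [Hd K]]; exists d; split; auto; intros h Hh; specialize (K h Hh).
  replace (C0 +c h) with h in * by ring; rewrite shift_on.
  destruct (excluded_middle_informative (h = C0)) as [->|Hn].
  - rewrite shift_on; replace (C0 -c C0 -c RtoC (1 / 2) *c B *c C0) with C0 by ring; rewrite Cnorm_C0; lra.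
  - rewrite shift_off by auto; pose proof (Cnorm_gt0 h Hn).
    apply (Rmult_le_reg_r (Cnorm h)); auto; rewrite <- Cnorm_mul.
    replace ((u h /c h -c c -c C0 -c RtoC (1 / 2) *c B *c h) *c h) with (u h -c u C0 -c du C0 *c h -c RtoC (1 / 2) *c B *c (h *c h))
      by (rewrite Hu0, Ec; field; auto).
    eapply Rle_trans; [exact K|apply Req_le; ring].
Qed.

Lemma redc_down (c1 c2 : Cplx) (s : BB) (r : R) (u v : Cplx -> Cplx) : good_bb s ->
  bbsol s r u v -> cder u C0 c1 -> cder v C0 c2 -> bbsol (redc c1 c2 s) r (shift u c1) (shift v c2).
Proof.
  intros Hg Hs Hc1 Hc2; pose proof (redc_good c1 c2 s Hg) as [[[HG1 _] _] [[HG2 _] _]].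
  destruct (bbsol_hol1 s r u v Hs) as [Hu Hv].
  assert (shift_eq s c1 c2) as E.
  { destruct (bbsol_derivative s r u v Hg Hs) as [e1 [e2 [D1 [D2 E]]]].
    rewrite (cder_unique u C0 _ _ Hc1 D1), (cder_unique v C0 _ _ Hc2 D2); auto. }
  destruct Hs as [Hr [Hu0 [Hv0 H]]].
  split; auto; split; [apply shift_on|]; split; [apply shift_on|]; intros x Hx.
  destruct (excluded_middle_informative (x = C0)) as [->|Hn].
  - destruct (cder_shift0 u c1 r Hr Hu Hu0 Hc1) as [L1 D1]; destruct (cder_shift0 v c2 r Hr Hv Hv0 Hc2) as [L2 D2].
    exists L1, L2; split; auto; split; auto; rewrite !shift_on; change (mk3 C0 C0 C0) with O3.
    rewrite HG1, HG2; split; ring.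
  - destruct (H x Hx) as [L1 [L2 [D1 [D2 [Q1 Q2]]]]].
    eexists; eexists; split; [apply cder_quotient; eauto|]; split; [apply cder_quotient; eauto|].
    rewrite !shift_off by auto; simpl; unfold reduced_F; rewrite !remov_off by auto; simpl.
    replace (x *c (u x /c x -c c1 +c c1)) with (u x) by (field; auto).
    replace (x *c (v x /c x -c c2 +c c2)) with (v x) by (field; auto).
    destruct (shift_eq_a s c1 c2 E) as [A1 A2]; rewrite A1 in Q1; rewrite A2 in Q2.
    set (f1 := bb_F1 s (mk3 x (u x) (v x))) in *; set (f2 := bb_F2 s (mk3 x (u x) (v x))) in *.
    split.
    + transitivity ((x *c L1) /c x -c u x /c x); [field; auto|rewrite Q1; field; auto].
    + transitivity ((x *c L2) /c x -c v x /c x); [field; auto|rewrite Q2; field; auto].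
Qed.

Lemma agree_shift (u v u' v' : Cplx -> Cplx) (c1 c2 : Cplx) : u C0 = C0 -> v C0 = C0 -> u' C0 = C0 -> v' C0 = C0 ->
  agree (shift u c1) (shift v c2) (shift u' c1) (shift v' c2) -> agree u v u' v'.
Proof.
  intros Hu Hv Hu' Hv' [d [Hd H]]; exists d; split; auto; intros x Hx; destruct (H x Hx) as [E1 E2].
  destruct (excluded_middle_informative (x = C0)) as [->|Hn]; [rewrite Hu, Hu', Hv, Hv'; auto|].
  rewrite !shift_off in E1, E2 by auto.
  split.
  - replace (u x) with (x *c (u x /c x -c c1) +c x *c c1) by (field; auto); rewrite E1; field; auto.
  - replace (v x) with (x *c (v x /c x -c c2) +c x *c c2) by (field; auto); rewrite E2; field; auto.
Qed.

Definition bb_unique_sol (s : BB) : Prop := (exists r u v, bbsol s r u v) /\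
  forall r u v r' u' v', bbsol s r u v -> bbsol s r' u' v' -> agree u v u' v'.

(** Every solution has the derivative at 0 given by Cramer's rule, so all solutions pass to one and
    the same reduced system. *)
Lemma bb_unique_reduce (s : BB) : good_bb s -> bb_det s C1 <> C0 -> bb_unique_sol (reduce s) -> bb_unique_sol s.
Proof.
  intros Hg Hd [[r [u [v Hs]]] HU]; rewrite reduce_redc in *; split.
  - eexists; eexists; eexists; eapply redc_up; eauto; apply cramer_shift; auto.
  - intros r1 u1 v1 r2 u2 v2 H1 H2.
    assert (forall r u v, bbsol s r u v -> bbsol (redc (cramer1 s) (cramer2 s) s) r (shift u (cramer1 s)) (shift v (cramer2 s))) as Hdown.
    { intros r' u' v' Hs'; destruct (bbsol_derivative s r' u' v' Hg Hs') as [c1 [c2 [D1 [D2 E]]]].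
      apply (cramer_shift s c1 c2 Hd) in E; destruct E as [-> ->]; apply redc_down; auto. }
    pose proof (HU _ _ _ _ _ _ (Hdown _ _ _ H1) (Hdown _ _ _ H2)) as HA.
    apply (agree_shift _ _ _ _ (cramer1 s) (cramer2 s)); auto; try apply H1; try apply H2.
Qed.

(** When [M + N] is small compared with [N], the equation is a contraction. *)
Definition bbG (s : BB) (N : R) (p W : C3) : C3 :=
  mk3 C0 (p0 p *c bb_a1 s +c ((bb_m11 s +c RtoC N) *c p1 W +c bb_m12 s *c p2 W) +c bb_F1 s (mk3 (p0 p) (p1 W) (p2 W)))
    (p0 p *c bb_a2 s +c (bb_m21 s *c p1 W +c (bb_m22 s +c RtoC N) *c p2 W) +c bb_F2 s (mk3 (p0 p) (p1 W) (p2 W))).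

(** With N = e + 1 the system reads x w' + N w = x a + (M + N) w + F. Four entries bounded by [B]
    and a Lipschitz constant 1/12 for [F] give L = 4B + 1/12, and [48 * B + 1 <= INR e + 1] is the
    contraction condition. [delta] depends on [F] only; [r0] is then taken small enough for [a]. *)
Lemma bb_problem (s : BB) (e : nat) (B : R) : good_bb s ->
  Cnorm (bb_m11 s +c RtoC (INR e + 1)) <= B -> Cnorm (bb_m12 s) <= B -> Cnorm (bb_m21 s) <= B ->
  Cnorm (bb_m22 s +c RtoC (INR e + 1)) <= B -> 48 * B + 1 <= INR e + 1 ->
  exists delta r0 L, 0 < delta /\ 0 < r0 /\ forall r, 0 < r <= r0 -> euler_problem (bbG s (INR e + 1)) r L delta e 0 /\
  exists c0, 0 <= c0 /\ (forall p, n3 p < r -> n3 (bbG s (INR e + 1) p O3) <= c0 * n3 p ^ 0) /\ 12 * c0 <= (INR e + 1) * delta.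
Proof.
  intros [[HO1 [R1 [HR1 HF1]]] [HO2 [R2 [HR2 HF2]]]] M11 M12 M21 M22 HB.
  set (N := INR e + 1) in *.
  destruct (order2_lipschitz _ R1 HR1 HF1 HO1) as [d1 [K1 [Hd1 [HK1 L1]]]]; destruct (order2_lipschitz _ R2 HR2 HF2 HO2) as [d2 [K2 [Hd2 [HK2 L2]]]].
  assert (0 <= B) as HB0 by (eapply Rle_trans; [apply Cnorm_ge0|exact M12]).
  set (K := K1 + K2).
  set (b := Rmin (Rmin d1 d2) (1 / (12 * (K + 1)))).
  assert (0 < b) as Hb by (repeat apply Rmin_glb_lt; try lra; apply Rdiv_lt_0_compat; unfold K; lra).
  assert (b <= d1) as Hb1 by (eapply Rle_trans; [apply Rmin_l|apply Rmin_l]).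
  assert (b <= d2) as Hb2 by (eapply Rle_trans; [apply Rmin_l|apply Rmin_r]).
  assert (K * b <= 1 / 12) as HKb.
  { apply Rle_trans with ((K + 1) * (1 / (12 * (K + 1)))); [apply Rmult_le_compat; try (unfold K; lra); apply Rmin_r|apply Req_le; field; unfold K; lra]. }
  set (delta := b / 4).
  set (A := Cnorm (bb_a1 s) + Cnorm (bb_a2 s) + K * b).
  pose proof (Cnorm_ge0 (bb_a1 s)); pose proof (Cnorm_ge0 (bb_a2 s)).
  assert (0 <= K * b) by (apply Rmult_le_pos; unfold K; lra).
  set (r0 := Rmin (b / 4) (delta / (12 * (A + 1)))).
  assert (r0 <= b / 4) as Hr0b by apply Rmin_l.
  assert (A * r0 <= delta / 12) as HAr.
  { apply Rle_trans with ((A + 1) * (delta / (12 * (A + 1)))).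
    - apply Rmult_le_compat; try (unfold A; lra); [|apply Rmin_r]. unfold r0; apply Rmin_glb; [lra|]. left; apply Rdiv_lt_0_compat; unfold delta, A; lra.
    - apply Req_le; field; unfold A; lra. }
  exists delta, r0, (4 * B + 1 / 12); split; [unfold delta; lra|]; split.
  { apply Rmin_glb_lt; [lra|apply Rdiv_lt_0_compat; unfold delta, A; lra]. }
  intros r Hr.
  assert (Hin : forall p W, n3 p < r -> n3 W <= delta -> n3 (mk3 (p0 p) (p1 W) (p2 W)) < b).
  { intros p W Hp HW; eapply Rle_lt_trans; [apply n3_le_sum|]; simpl.
    pose proof (Cnorm_p0 p); pose proof (Cnorm_p1 W); pose proof (Cnorm_p2 W); unfold delta in *; lra. }
  split.
  - constructor; auto; try (unfold delta; lra); try (fold N; lra).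
    + intros W [W0 [W1 W2]] HWb.
      assert (HV : HolV r (fun p => mk3 (p0 p) (p1 (W p)) (p2 (W p)))) by (repeat split; simpl; auto; apply Hol_p0).
      assert (forall F R, R >= b -> Hol R F -> Hol r (fun p => F (mk3 (p0 p) (p1 (W p)) (p2 (W p))))) as HC.
      { intros F R HR HF; apply (Hol_comp r R F (fun p => mk3 (p0 p) (p1 (W p)) (p2 (W p)))); auto.
        intros p Hp; specialize (HWb p Hp); simpl in HWb; specialize (Hin p (W p) Hp ltac:(lra)); lra. }
      repeat split; unfold bbG; simpl; [apply Hol_const| |];
      (apply Hol_add; [apply Hol_add; [apply Hol_mul; [apply Hol_p0|apply Hol_const]|apply Hol_add; apply Hol_mul; auto; apply Hol_const]|]).
      * apply (HC _ R1); auto; lra.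
      * apply (HC _ R2); auto; lra.
    + intros p W W' Hp HW HW'; simpl in HW, HW'; rewrite Rmult_1_r in HW, HW'.
      pose proof (Hin p W Hp HW) as HI; pose proof (Hin p W' Hp HW') as HI'.
      pose proof (L1 b Hb1 _ _ HI HI') as G1; pose proof (L2 b Hb2 _ _ HI HI') as G2.
      set (D := n3 (W -v W')).
      assert (n3 (mk3 (p0 p) (p1 W) (p2 W) -v mk3 (p0 p) (p1 W') (p2 W')) <= D) as HD.
      { apply n3_le; [apply n3_ge0|]; unfold D; rewrite n3_sqr; simpl p0; simpl p1; simpl p2; rewrite Cnorm_self.
        pose proof (pow2_ge_0 (Cnorm (p0 W -c p0 W'))); lra. }
      assert (0 <= D) as HD0 by apply n3_ge0.
      eapply Rle_trans; [apply n3_le_sum|]; unfold bbG; simpl; rewrite Cnorm_self.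
      pose proof (Cnorm_p1 (W -v W')) as P1; pose proof (Cnorm_p2 (W -v W')) as P2; simpl in P1, P2; fold D in P1, P2.
      set (f1 := bb_F1 s (mk3 (p0 p) (p1 W) (p2 W))) in *; set (f1' := bb_F1 s (mk3 (p0 p) (p1 W') (p2 W'))) in *.
      set (f2 := bb_F2 s (mk3 (p0 p) (p1 W) (p2 W))) in *; set (f2' := bb_F2 s (mk3 (p0 p) (p1 W') (p2 W'))) in *.
      assert (forall a m m' f f' k, Cnorm m <= B -> Cnorm m' <= B -> Cnorm (f -c f') <= k * b * n3 (mk3 (p0 p) (p1 W) (p2 W) -v mk3 (p0 p) (p1 W') (p2 W')) -> 0 <= k ->
        Cnorm (a +c (m *c p1 W +c m' *c p2 W) +c f -c (a +c (m *c p1 W' +c m' *c p2 W') +c f')) <= 2 * (B * D) + k * b * D) as HG.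
      { intros a m m' f f' k Hm Hm' Hf Hk.
        replace (a +c (m *c p1 W +c m' *c p2 W) +c f -c (a +c (m *c p1 W' +c m' *c p2 W') +c f')) with
          ((m *c (p1 W -c p1 W') +c m' *c (p2 W -c p2 W')) +c (f -c f')) by ring.
        eapply Rle_trans; [apply Cnorm_add|]; eapply Rle_trans; [apply Rplus_le_compat_r, Cnorm_add|]; rewrite !Cnorm_mul.
        assert (Cnorm m * Cnorm (p1 W -c p1 W') <= B * D) by (apply Rmult_le_compat; auto; apply Cnorm_ge0).
        assert (Cnorm m' * Cnorm (p2 W -c p2 W') <= B * D) by (apply Rmult_le_compat; auto; apply Cnorm_ge0).
        assert (k * b * n3 (mk3 (p0 p) (p1 W) (p2 W) -v mk3 (p0 p) (p1 W') (p2 W')) <= k * b * D) by (apply Rmult_le_compat_l; auto; apply Rmult_le_pos; lra). lra. }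
      pose proof (HG (p0 p *c bb_a1 s) _ _ f1 f1' K1 M11 M12 G1 HK1) as E1; pose proof (HG (p0 p *c bb_a2 s) _ _ f2 f2' K2 M21 M22 G2 HK2) as E2.
      unfold K in HKb. nra.
  - exists (A * r); split; [apply Rmult_le_pos; unfold A; lra|]; split.
    + intros p Hp; simpl pow; rewrite Rmult_1_r; eapply Rle_trans; [apply n3_le_sum|]; unfold bbG; simpl; rewrite Cnorm_C0.
      pose proof (Cnorm_p0 p) as Hp0; pose proof (Cnorm_ge0 (p0 p)).
      assert (n3 (mk3 (p0 p) C0 C0) < b) as HI by (rewrite n3_axis0; lra).
      pose proof (L1 b Hb1 _ O3 HI ltac:(rewrite n3_O3; auto)) as G1; pose proof (L2 b Hb2 _ O3 HI ltac:(rewrite n3_O3; auto)) as G2.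
      destruct HO1 as [Z1 _]; destruct HO2 as [Z2 _]; rewrite Z1 in G1; rewrite Z2 in G2.
      replace (mk3 (p0 p) C0 C0 -v O3) with (mk3 (p0 p) C0 C0) in * by (apply C3_eq; simpl; ring); rewrite n3_axis0 in *.
      assert (forall a m m' f k, Cnorm (f -c C0) <= k * b * Cnorm (p0 p) -> Cnorm (p0 p *c a +c (m *c C0 +c m' *c C0) +c f) <= (Cnorm a + k * b) * Cnorm (p0 p)) as HG.
      { intros a m m' f k Hf; replace (p0 p *c a +c (m *c C0 +c m' *c C0) +c f) with (p0 p *c a +c (f -c C0)) by ring.
        eapply Rle_trans; [apply Cnorm_add|]; rewrite Cnorm_mul; lra. }
      pose proof (HG (bb_a1 s) (bb_m11 s +c RtoC N) (bb_m12 s) _ K1 G1); pose proof (HG (bb_a2 s) (bb_m21 s) (bb_m22 s +c RtoC N) _ K2 G2).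
      apply Rle_trans with (A * Cnorm (p0 p)); [unfold A, K; lra|]; apply Rmult_le_compat_l; unfold A; lra.
    + assert (A * r <= A * r0) by (apply Rmult_le_compat_l; unfold A; lra).
      assert (1 * delta <= N * delta) by (apply Rmult_le_compat_r; unfold delta; lra). lra.
Qed.

(** Solutions in one variable and solutions of the Euler problem on [C3] correspond: restrict the
    latter to the first axis, or let the former depend on the first coordinate only. *)
Lemma bb_unique_large (s : BB) (e : nat) (B : R) : good_bb s ->
  Cnorm (bb_m11 s +c RtoC (INR e + 1)) <= B -> Cnorm (bb_m12 s) <= B -> Cnorm (bb_m21 s) <= B ->
  Cnorm (bb_m22 s +c RtoC (INR e + 1)) <= B -> 48 * B + 1 <= INR e + 1 -> bb_unique_sol s.
Proof.
  intros Hg M11 M12 M21 M22 HB.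
  destruct (bb_problem s e B Hg M11 M12 M21 M22 HB) as [delta [r0 [L [Hdelta [Hr0 HP]]]]].
  assert (HN : RtoC (INR e + 1 - INR 0) = RtoC (INR e + 1)) by (f_equal; simpl; ring).
  split.
  - destruct (HP r0) as [P [c0 [Hc0 [HG Hc]]]]; [lra|].
    destruct (euler_exists _ _ _ _ c0 _ _ P Hc0 HG Hc) as [W [[_ [W1 W2]] [HWb HWe]]].
    set (ax := fun x => mk3 x C0 C0).
    (* Weight 0 does not force [W] to vanish at the origin. There the Euler term drops out, leaving
       (e+1) W = G(0,W), and the contraction condition admits only 0. *)
    assert (HW0 : W O3 = O3).
    { assert (n3 O3 < r0) as HO by (rewrite n3_O3; auto).
      pose proof (HWe O3 HO) as E; unfold euler in E; rewrite !dot_O3, HN in E.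
      assert (0 <= 48 * B) by (pose proof (Cnorm_ge0 (bb_m12 s)); lra).
      pose proof (ep_lip _ _ _ _ _ _ P O3 (W O3) O3 HO (HWb O3 HO) ltac:(rewrite n3_O3; simpl; lra)) as HL.
      assert (bbG s (INR e + 1) O3 O3 = O3) as HG0.
      { destruct Hg as [[[Z1 _] _] [[Z2 _] _]]; unfold bbG; apply C3_eq; simpl; change (mk3 C0 C0 C0) with O3; rewrite ?Z1, ?Z2; ring. }
      rewrite HG0, <- E in HL.
      match type of HL with n3 ?a <= _ => replace a with (RtoC (INR e + 1) *v W O3) in HL by (apply C3_eq; simpl; ring) end.
      rewrite n3_scal, Cnorm_RtoC, Rabs_pos_eq in HL by lra.
      replace (W O3 -v O3) with (W O3) in HL by (apply C3_eq; simpl; ring).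
      pose proof (ep_contr _ _ _ _ _ _ P); pose proof (n3_ge0 (W O3)); pose proof (pos_INR e).
      apply n3_eq0; nra. }
    exists r0, (fun x => p1 (W (ax x))), (fun x => p2 (W (ax x))); split; auto; change (ax C0) with O3; rewrite HW0; split; [reflexivity|split; [reflexivity|]].
    intros x Hx; assert (n3 (ax x) < r0) as Hax by (unfold ax; rewrite n3_axis0; auto).
    assert (Hder : forall f, Hol r0 f -> cder (fun x => f (ax x)) x (p0 (grad f (ax x)))).
    { intros f Hf; replace (p0 (grad f (ax x))) with (dot (grad f (ax x)) (e3 0)) by (unfold dot; simpl; ring).
      apply (tdiff_comp_cder f ax); [apply Hf; auto|exact (cder_id x)|exact (cder_const C0 x)|exact (cder_const C0 x)]. }
    eexists; eexists; split; [exact (Hder _ W1)|]; split; [exact (Hder _ W2)|].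
    pose proof (HWe _ Hax) as E; rewrite HN in E.
    pose proof (f_equal p1 E) as E1; pose proof (f_equal p2 E) as E2; unfold euler, dot in E1, E2; simpl in E1, E2.
    split; [match goal with |- ?l = ?r => transitivity (r +c RtoC (INR e + 1) *c p1 (W (ax x)) -c RtoC (INR e + 1) *c p1 (W (ax x))); [|ring] end
           |match goal with |- ?l = ?r => transitivity (r +c RtoC (INR e + 1) *c p2 (W (ax x)) -c RtoC (INR e + 1) *c p2 (W (ax x))); [|ring] end].
    + transitivity ((p0 (grad (fun p => p1 (W p)) (ax x)) *c x +c (p1 (grad (fun p => p1 (W p)) (ax x)) *c C0 +c p2 (grad (fun p => p1 (W p)) (ax x)) *c C0)
        +c RtoC (INR e + 1) *c p1 (W (ax x))) -c RtoC (INR e + 1) *c p1 (W (ax x))); [ring|].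
      f_equal; etransitivity; [exact E1|]; simpl; ring.
    + transitivity ((p0 (grad (fun p => p2 (W p)) (ax x)) *c x +c (p1 (grad (fun p => p2 (W p)) (ax x)) *c C0 +c p2 (grad (fun p => p2 (W p)) (ax x)) *c C0)
        +c RtoC (INR e + 1) *c p2 (W (ax x))) -c RtoC (INR e + 1) *c p2 (W (ax x))); [ring|].
      f_equal; etransitivity; [exact E2|]; simpl; ring.
  - intros r u v r' u' v' Hs Hs'.
    (* For a map that depends on [x] alone, the Euler operator is x d/dx. *)
    assert (Hgen : forall r u v, bbsol s r u v -> exists d, 0 < d /\ forall q, 0 < q <= d -> let W := fun p => mk3 C0 (u (p0 p)) (v (p0 p)) in
      HolV q W /\ wle q delta 0 W /\ euler_sol (bbG s (INR e + 1)) q e 0 W).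
    { clear r u v r' u' v' Hs Hs'; intros r u v [Hr [Hu0 [Hv0 H]]].
      destruct (H C0 ltac:(rewrite Cnorm_C0; auto)) as [L1 [L2 [D1 [D2 _]]]].
      destruct (cder_ccont1 _ _ _ D1 (delta / 2)) as [d1 [Hd1 K1]]; [lra|]; destruct (cder_ccont1 _ _ _ D2 (delta / 2)) as [d2 [Hd2 K2]]; [lra|].
      exists (Rmin r (Rmin d1 d2)); split; [repeat apply Rmin_glb_lt; auto|]; intros q Hq W.
      pose proof (Rmin_l r (Rmin d1 d2)); pose proof (Rmin_r r (Rmin d1 d2)); pose proof (Rmin_l d1 d2); pose proof (Rmin_r d1 d2).
      assert (Htd : forall f p l, cder f (p0 p) l -> tdiff (fun p => f (p0 p)) p (l *v e3 0)) by (intros f p l Hf; apply (tdiff_cder f p0); auto; apply tdiff_p0).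
      split; [|split].
      - split; [exact (Hol_const q C0)|]; split; apply Hol_intro; intros p Hp; pose proof (Cnorm_p0 p);
        destruct (H (p0 p) ltac:(lra)) as [M1 [M2 [E1 [E2 _]]]]; eexists; [exact (Htd u p _ E1)|exact (Htd v p _ E2)].
      - intros p Hp; pose proof (Cnorm_p0 p); unfold W; simpl pow; rewrite Rmult_1_r.
        eapply Rle_trans; [apply n3_le_sum|]; simpl; rewrite Cnorm_C0.
        specialize (K1 (p0 p)); specialize (K2 (p0 p)); rewrite Hu0 in K1; rewrite Hv0 in K2.
        replace (p0 p -c C0) with (p0 p) in * by ring; replace (u (p0 p) -c C0) with (u (p0 p)) in * by ring; replace (v (p0 p) -c C0) with (v (p0 p)) in * by ring.
        specialize (K1 ltac:(lra)); specialize (K2 ltac:(lra)); lra.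
      - intros p Hp; pose proof (Cnorm_p0 p); destruct (H (p0 p) ltac:(lra)) as [M1 [M2 [E1 [E2 [Q1 Q2]]]]].
        rewrite HN; unfold euler, W, bbG; simpl.
        rewrite (tdiff_grad_eq _ _ _ (tdiff_const C0 p)), (tdiff_grad_eq _ _ _ (Htd u p _ E1)), (tdiff_grad_eq _ _ _ (Htd v p _ E2)).
        apply C3_eq; simpl; unfold dot; simpl; [ring| |].
        + transitivity (p0 p *c M1 +c RtoC (INR e + 1) *c u (p0 p)); [ring|rewrite Q1; ring].
        + transitivity (p0 p *c M2 +c RtoC (INR e + 1) *c v (p0 p)); [ring|rewrite Q2; ring]. }
    destruct (Hgen r u v Hs) as [d [Hd K]]; destruct (Hgen r' u' v' Hs') as [d' [Hd' K']].
    set (q := Rmin r0 (Rmin d d')).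
    assert (0 < q) as Hq by (repeat apply Rmin_glb_lt; auto).
    assert (q <= r0) by apply Rmin_l.
    assert (q <= d) by (eapply Rle_trans; [apply Rmin_r|apply Rmin_l]); assert (q <= d') by (eapply Rle_trans; [apply Rmin_r|apply Rmin_r]).
    destruct (K q ltac:(lra)) as [A1 [A2 A3]]; destruct (K' q ltac:(lra)) as [A1' [A2' A3']]; destruct (HP q ltac:(lra)) as [P _].
    exists q; split; auto; intros x Hx.
    pose proof (euler_unique _ _ _ _ _ _ _ _ P A1 A2 A3 A1' A2' A3' (mk3 x C0 C0) ltac:(rewrite n3_axis0; auto)) as E; simpl in E.
    injection E; auto.
Qed.

(** * Nonresonant systems have exactly one solution *)

Definition nonresonant (s : BB) : Prop := forall n : nat, (1 <= n)%nat -> bb_det s (RtoC (INR n)) <> C0.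

Lemma bb_det_redc (c1 c2 : Cplx) (s : BB) (n : Cplx) : bb_det (redc c1 c2 s) n = bb_det s (n +c C1).
Proof. unfold bb_det; simpl; ring. Qed.

Lemma RtoC_INR_S (n : nat) : RtoC (INR (S n)) = RtoC (INR n) +c C1.
Proof. rewrite S_INR, RtoC_add; reflexivity. Qed.

Lemma nonresonant_redc (c1 c2 : Cplx) (s : BB) : nonresonant s -> nonresonant (redc c1 c2 s).
Proof. intros H n Hn; rewrite bb_det_redc, <- RtoC_INR_S; apply H; lia. Qed.

(** After e + 1 reductions the linear matrix is M - (e+1) I, so adding N = e + 1 restores [M]
    itself: the bound [B] does not grow with [e], while [N] can be made as large as wanted. *)
Theorem bb_unique_nonresonant (s : BB) : good_bb s -> nonresonant s -> bb_unique_sol s.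
Proof.
  intros Hg Hn.
  set (B := Cnorm (bb_m11 s) + Cnorm (bb_m12 s) + Cnorm (bb_m21 s) + Cnorm (bb_m22 s)).
  destruct (INR_unbounded (48 * B + 1)) as [e He].
  assert (Hiter : forall n t, good_bb t -> nonresonant t ->
    (forall t', good_bb t' -> bb_m11 t' = bb_m11 t -c RtoC (INR n) -> bb_m12 t' = bb_m12 t -> bb_m21 t' = bb_m21 t ->
       bb_m22 t' = bb_m22 t -c RtoC (INR n) -> bb_unique_sol t') -> bb_unique_sol t).
  { induction n as [|n IH]; intros t Ht Hnt H.
    - apply H; auto; simpl; replace (RtoC 0) with C0 by reflexivity; ring.
    - apply bb_unique_reduce; auto.
      + pose proof (Hnt 1%nat (le_n 1)) as K; simpl in K; exact K.
      + rewrite reduce_redc; apply IH; [apply redc_good; auto|apply nonresonant_redc; auto|].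
        intros t' Ht' E1 E2 E3 E4; apply H; auto; [rewrite E1|rewrite E4]; rewrite RtoC_INR_S; simpl; ring. }
  apply (Hiter (S e) s Hg Hn); intros t Ht E1 E2 E3 E4.
  pose proof (Cnorm_ge0 (bb_m11 s)); pose proof (Cnorm_ge0 (bb_m12 s)); pose proof (Cnorm_ge0 (bb_m21 s)); pose proof (Cnorm_ge0 (bb_m22 s)).
  apply (bb_unique_large t e B); auto; [| | | |lra].
  - rewrite E1, <- S_INR; replace (bb_m11 s -c RtoC (INR (S e)) +c RtoC (INR (S e))) with (bb_m11 s) by ring; unfold B; lra.
  - rewrite E2; unfold B; lra.
  - rewrite E3; unfold B; lra.
  - rewrite E4, <- S_INR; replace (bb_m22 s -c RtoC (INR (S e)) +c RtoC (INR (S e))) with (bb_m22 s) by ring; unfold B; lra.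
Qed.

(** * The Briot-Bouquet system in the direction of the first coordinate *)

Definition blow (p : C3) : C3 := mk3 (p0 p) (p0 p *c p1 p) (p0 p *c p2 p).

Definition lin_form (b0 b1 b2 : Cplx) (f : C3 -> Cplx) (p : C3) : Cplx := (b0 *c p0 p +c (b1 *c p1 p +c b2 *c p2 p)) +c f p.

Lemma good_F_square (f : C3 -> Cplx) : good_F f -> exists d C, 0 < d /\ 0 <= C /\ Hol d f /\ forall p, n3 p < d -> Cnorm (f p) <= C * n3 p ^ 2.
Proof.
  intros [H [r [Hr Hf]]]; destruct (order2_square f r Hr Hf H) as [d [C [Hd [HC K]]]].
  exists d, C; repeat split; auto; [lra|apply (Hol_sub r); auto; lra].
Qed.

Lemma n3_blow (p : C3) : n3 p <= 1 -> n3 (blow p) <= 3 * Cnorm (p0 p).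
Proof.
  intros Hp; pose proof (Cnorm_p1 p); pose proof (Cnorm_p2 p); pose proof (Cnorm_ge0 (p0 p)).
  eapply Rle_trans; [apply n3_le_sum|]; unfold blow; simpl; rewrite !Cnorm_mul. nra.
Qed.

(** In blown-up coordinates the first component is [x] times mu + l1 u + l2 v + O(x), hence
    comparable to [x]; this justifies division by it off {x = 0}. *)
Lemma blow_lower_bound (mu l1 l2 : Cplx) (f : C3 -> Cplx) : mu <> C0 -> good_F f ->
  exists r, 0 < r <= 1 /\ forall p, n3 p < r -> Cnorm mu / 2 <= Cnorm (mu +c (l1 *c p1 p +c l2 *c p2 p)) /\
    Cnorm mu / 2 * Cnorm (p0 p) <= Cnorm (lin_form mu l1 l2 f (blow p)).
Proof.
  intros Hmu Hf; destruct (good_F_square f Hf) as [d [C [Hd [HC [_ K]]]]].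
  pose proof (Cnorm_gt0 mu Hmu) as Nmu; pose proof (Cnorm_ge0 l1); pose proof (Cnorm_ge0 l2).
  set (A := Cnorm l1 + Cnorm l2 + 9 * C + 1).
  assert (0 < Cnorm mu / (2 * A)) by (apply Rdiv_lt_0_compat; unfold A; lra).
  exists (Rmin (Rmin 1 (d / 3)) (Cnorm mu / (2 * A))).
  pose proof (Rmin_l (Rmin 1 (d / 3)) (Cnorm mu / (2 * A))); pose proof (Rmin_r (Rmin 1 (d / 3)) (Cnorm mu / (2 * A))).
  pose proof (Rmin_l 1 (d / 3)); pose proof (Rmin_r 1 (d / 3)).
  split; [split; [repeat apply Rmin_glb_lt; lra|lra]|].
  intros p Hp; pose proof (Cnorm_p0 p) as P0; pose proof (Cnorm_p1 p) as P1; pose proof (Cnorm_p2 p) as P2; pose proof (Cnorm_ge0 (p0 p)) as P3.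
  assert (A * n3 p <= Cnorm mu / 2) as HA.
  { apply Rle_trans with (A * (Cnorm mu / (2 * A))); [apply Rmult_le_compat_l; unfold A in *; lra|apply Req_le; field; unfold A; lra]. }
  pose proof (n3_ge0 p) as Np.
  set (e := l1 *c p1 p +c l2 *c p2 p).
  assert (Cnorm e <= (Cnorm l1 + Cnorm l2) * n3 p) as He.
  { unfold e; eapply Rle_trans; [apply Cnorm_add|]; rewrite !Cnorm_mul; nra. }
  assert (0 <= 9 * C * n3 p) by (apply Rmult_le_pos; lra).
  unfold A in HA. split.
  - pose proof (Cnorm_le_sub mu (mu +c e)) as T; replace (mu -c (mu +c e)) with (Copp e) in T by ring; rewrite Cnorm_opp in T. lra.
  - pose proof (n3_blow p ltac:(lra)) as Hb; pose proof (n3_ge0 (blow p)).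
    specialize (K (blow p) ltac:(lra)).
    assert (Cnorm (f (blow p)) <= 9 * C * n3 p * Cnorm (p0 p)).
    { eapply Rle_trans; [exact K|].
      apply Rle_trans with (C * (3 * Cnorm (p0 p)) ^ 2); [apply Rmult_le_compat_l; auto; nra|].
      replace (C * (3 * Cnorm (p0 p)) ^ 2) with (9 * C * Cnorm (p0 p) * Cnorm (p0 p)) by ring.
      apply Rmult_le_compat_r; auto; apply Rmult_le_compat_l; lra. }
    replace (lin_form mu l1 l2 f (blow p)) with (p0 p *c (mu +c e) +c f (blow p)) by (unfold lin_form, blow, e; simpl; ring).
    pose proof (Cnorm_le_sub (p0 p *c mu) (p0 p *c (mu +c e) +c f (blow p))) as T.
    replace (p0 p *c mu -c (p0 p *c (mu +c e) +c f (blow p))) with (Copp (p0 p *c e +c f (blow p))) in T by ring.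
    rewrite Cnorm_opp in T; pose proof (Cnorm_add (p0 p *c e) (f (blow p))) as T2; rewrite !Cnorm_mul in *.
    assert (Cnorm (p0 p) * Cnorm e <= Cnorm (p0 p) * ((Cnorm l1 + Cnorm l2) * n3 p)) by (apply Rmult_le_compat_l; auto).
    nra.
Qed.

Definition bb_quot (P Q : C3 -> Cplx) (j : nat) : C3 -> Cplx := remov (fun p => Q (blow p) /c P (blow p) -c comp j p).

Lemma tdiff_comp_coord (j : nat) (p : C3) : tdiff (comp j) p (e3 j).
Proof. destruct j as [|[|j]]; [apply tdiff_p0|apply tdiff_p1|apply tdiff_p2]. Qed.

Lemma tdiff_lin_form (b0 b1 b2 : Cplx) (f : C3 -> Cplx) (p l : C3) : tdiff f p l -> tdiff (lin_form b0 b1 b2 f) p (mk3 b0 b1 b2 +v l).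
Proof.
  intros H; unfold lin_form; apply tdiff_add; auto; apply tdiff_of_exact; intros h; unfold dot; simpl; ring.
Qed.

Lemma tdiff_blow (F : C3 -> Cplx) (p l : C3) : tdiff F (blow p) l -> exists m, tdiff (fun p => F (blow p)) p m.
Proof.
  intros H; eexists; apply (tdiff_comp F blow); [exact H|apply tdiff_p0| |]; simpl;
  (apply tdiff_mul; [apply tdiff_p0|]); [apply tdiff_p1|apply tdiff_p2].
Qed.

(** A common factor [x] cancels, and the limit on {x = 0} is the quotient of the linear parts, [H0];
    the distance from it is O(x). As [H0] is explicit, the linear matrix is read off from its
    gradient at 0. *)
Lemma bb_quot_Hol (mu l1 l2 b1 b2 : Cplx) (f g P Q : C3 -> Cplx) (j : nat) : mu <> C0 -> good_F f -> good_F g ->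
  (forall p, P p = lin_form mu l1 l2 f p) -> (forall p, Q p = lin_form C0 b1 b2 g p) -> (1 <= j < 3)%nat ->
  exists r, 0 < r /\ Hol r (bb_quot P Q j) /\ bb_quot P Q j O3 = C0 /\
    forall i, (1 <= i < 3)%nat -> pd i (bb_quot P Q j) O3 = comp i (Cinv mu *v mk3 C0 b1 b2 -v e3 j).
Proof.
  intros Hmu Hf Hg HP HQ Hj.
  destruct (blow_lower_bound mu l1 l2 f Hmu Hf) as [r0 [Hr0 HL]].
  destruct (good_F_square f Hf) as [df [Cf [Hdf [HCf [HfH Kf]]]]]; destruct (good_F_square g Hg) as [dg [Cg [Hdg [HCg [HgH Kg]]]]].
  pose proof (Cnorm_gt0 mu Hmu) as Nmu; set (m := Cnorm mu / 2) in *; assert (0 < m) as Hm by (unfold m; lra).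
  set (r := Rmin r0 (Rmin (df / 4) (dg / 4))).
  assert (0 < r) as Hr by (repeat apply Rmin_glb_lt; lra).
  assert (r <= r0) as R1 by apply Rmin_l.
  assert (r <= df / 4) as R2 by (eapply Rle_trans; [apply Rmin_r|apply Rmin_l]).
  assert (r <= dg / 4) as R3 by (eapply Rle_trans; [apply Rmin_r|apply Rmin_r]).
  set (D := fun p => mu +c (l1 *c p1 p +c l2 *c p2 p)); set (E := fun p => b1 *c p1 p +c b2 *c p2 p).
  set (H := fun p => Q (blow p) /c P (blow p) -c comp j p).
  set (H0 := fun p => E p /c D p -c comp j p).
  assert (Hcoord : forall s p, comp j (mk3 s (p1 p) (p2 p)) = comp j p) by (destruct j as [|[|j]]; intros; auto; lia).
  assert (HPeq : forall p, P (blow p) = p0 p *c D p +c f (blow p)) by (intros p; rewrite HP; unfold lin_form, D, blow; simpl; ring).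
  assert (HQeq : forall p, Q (blow p) = p0 p *c E p +c g (blow p)) by (intros p; rewrite HQ; unfold lin_form, E, blow; simpl; ring).
  assert (HD : forall p, n3 p < r -> m <= Cnorm (D p)) by (intros p Hp; apply HL; lra).
  assert (HPn : forall p, n3 p < r -> m * Cnorm (p0 p) <= Cnorm (P (blow p))) by (intros p Hp; rewrite HP; apply HL; lra).
  assert (HE : forall p, n3 p < r -> Cnorm (E p) <= Cnorm b1 + Cnorm b2).
  { intros p Hp; unfold E; eapply Rle_trans; [apply Cnorm_add|]; rewrite !Cnorm_mul.
    pose proof (Cnorm_p1 p); pose proof (Cnorm_p2 p); pose proof (Cnorm_ge0 b1); pose proof (Cnorm_ge0 b2). nra. }
  set (BE := Cnorm b1 + Cnorm b2) in *.
  assert (HDu : forall p, n3 p < r -> Cnorm (D p) <= Cnorm mu + (Cnorm l1 + Cnorm l2)).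
  { intros p Hp; unfold D; eapply Rle_trans; [apply Cnorm_add|]; apply Rplus_le_compat_l; eapply Rle_trans; [apply Cnorm_add|]; rewrite !Cnorm_mul.
    pose proof (Cnorm_p1 p); pose proof (Cnorm_p2 p); pose proof (Cnorm_ge0 l1); pose proof (Cnorm_ge0 l2). nra. }
  set (BD := Cnorm mu + (Cnorm l1 + Cnorm l2)) in *.
  assert (0 <= BE) as HBE by (unfold BE; pose proof (Cnorm_ge0 b1); pose proof (Cnorm_ge0 b2); lra).
  assert (0 <= BD) as HBD by (unfold BD; pose proof (Cnorm_ge0 l1); pose proof (Cnorm_ge0 l2); lra).
  assert (Hblow : forall p, n3 p < r -> n3 (blow p) < df /\ n3 (blow p) < dg /\ n3 (blow p) <= 3 * Cnorm (p0 p)).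
  { intros p Hp; pose proof (n3_blow p ltac:(lra)); pose proof (Cnorm_p0 p); lra. }
  assert (Hsq : forall (k : C3 -> Cplx) C d p, 0 <= C -> (forall q, n3 q < d -> Cnorm (k q) <= C * n3 q ^ 2) -> n3 p < r -> n3 (blow p) < d ->
    Cnorm (k (blow p)) <= 9 * C * Cnorm (p0 p) ^ 2).
  { intros k C d p HC Hk Hp Hb; eapply Rle_trans; [apply Hk; auto|]; destruct (Hblow p Hp) as [_ [_ B]]; pose proof (n3_ge0 (blow p)).
    replace (9 * C * Cnorm (p0 p) ^ 2) with (C * (3 * Cnorm (p0 p)) ^ 2) by ring; apply Rmult_le_compat_l; auto; nra. }
  (* The difference of the quotients has numerator g D - f E, with [f] and [g] of order x^2, over P
     D, of order [x]. *)
  set (K := 9 * (Cg * BD + Cf * BE) / (m * m)).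
  assert (0 <= K) as HK by (unfold K, Rdiv; apply Rmult_le_pos; [|left; apply Rinv_0_lt_compat; nra]; assert (0 <= Cg * BD) by (apply Rmult_le_pos; auto); assert (0 <= Cf * BE) by (apply Rmult_le_pos; auto); lra).
  assert (Hclose : forall p, n3 p < r -> p0 p <> C0 -> Cnorm (H p -c H0 p) <= K * Cnorm (p0 p)).
  { intros p Hp Hn; pose proof (Cnorm_gt0 _ Hn) as N0; destruct (Hblow p Hp) as [B1 [B2 _]].
    pose proof (Hsq f Cf df p HCf Kf Hp B1) as Gf; pose proof (Hsq g Cg dg p HCg Kg Hp B2) as Gg.
    specialize (HD p Hp); specialize (HPn p Hp); specialize (HE p Hp); specialize (HDu p Hp).
    assert (D p <> C0) as HD0 by (apply Cnorm_neq0; lra).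
    assert (P (blow p) <> C0) as HP0 by (apply Cnorm_neq0; nra).
    replace (H p -c H0 p) with ((g (blow p) *c D p -c f (blow p) *c E p) /c (P (blow p) *c D p)).
    2:{ unfold H, H0; rewrite HQeq; rewrite HPeq in *; field; auto. }
    rewrite Cnorm_div by (apply Cmul_neq0; auto); rewrite Cnorm_mul.
    apply (Rmult_le_reg_r (Cnorm (P (blow p)) * Cnorm (D p))); [apply Rmult_lt_0_compat; nra|].
    unfold Rdiv; rewrite Rmult_assoc, Rinv_l, Rmult_1_r by (apply Rgt_not_eq, Rmult_lt_0_compat; nra).
    eapply Rle_trans; [apply Cnorm_sub|]; rewrite !Cnorm_mul.
    assert (Cnorm (g (blow p)) * Cnorm (D p) <= 9 * Cg * Cnorm (p0 p) ^ 2 * BD) by (apply Rmult_le_compat; auto; apply Cnorm_ge0).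
    assert (Cnorm (f (blow p)) * Cnorm (E p) <= 9 * Cf * Cnorm (p0 p) ^ 2 * BE) by (apply Rmult_le_compat; auto; apply Cnorm_ge0).
    apply Rle_trans with (K * Cnorm (p0 p) * (m * Cnorm (p0 p) * m)).
    - replace (K * Cnorm (p0 p) * (m * Cnorm (p0 p) * m)) with (9 * Cg * Cnorm (p0 p) ^ 2 * BD + 9 * Cf * Cnorm (p0 p) ^ 2 * BE) by (unfold K; field; lra). lra.
    - apply Rmult_le_compat_l; [apply Rmult_le_pos; lra|]; apply Rmult_le_compat; try lra; apply Rmult_le_pos; lra. }
  assert (HH0b : forall p, n3 p < r -> Cnorm (H0 p) <= BE / m + r).
  { intros p Hp; specialize (HD p Hp); specialize (HE p Hp); unfold H0; eapply Rle_trans; [apply Cnorm_sub|].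
    apply Rplus_le_compat; [|pose proof (Cnorm_comp_le j p); lra].
    rewrite Cnorm_div by (apply Cnorm_neq0; lra); unfold Rdiv; apply Rmult_le_compat; auto; try apply Cnorm_ge0.
    - left; apply Rinv_0_lt_compat; lra.
    - apply Rinv_le_contravar; auto. }
  assert (HH0d : forall p, n3 p < r -> tdiff H0 p ((Cinv (D p) *v mk3 C0 b1 b2 +v E p *v (Copp (Cinv (D p *c D p)) *v mk3 C0 l1 l2)) +v Copp C1 *v e3 j)).
  { intros p Hp; specialize (HD p Hp); unfold H0, Csub, Cdiv; apply tdiff_add; [|apply tdiff_opp, tdiff_comp_coord].
    apply tdiff_mul; [apply tdiff_of_exact; intros h; unfold E, dot; simpl; ring|].
    apply (tdiff_cder Cinv); [apply cder_inv, Cnorm_neq0; lra|]; apply tdiff_of_exact; intros h; unfold D, dot; simpl; ring. }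
  destruct (remov_Hol H H0 r (K * r + (BE / m + r)) Hr) as [HH Hon].
  - intros p Hp Hn; pose proof (Cnorm_gt0 _ Hn) as N0; destruct (Hblow p Hp) as [B1 [B2 _]]; split.
    + destruct (tdiff_blow Q p (mk3 C0 b1 b2 +v grad g (blow p))) as [lq Hq].
      { replace Q with (lin_form C0 b1 b2 g) by (apply functional_extensionality; auto); apply tdiff_lin_form, HgH; auto. }
      destruct (tdiff_blow P p (mk3 mu l1 l2 +v grad f (blow p))) as [lp Hlp].
      { replace P with (lin_form mu l1 l2 f) by (apply functional_extensionality; auto); apply tdiff_lin_form, HfH; auto. }
      eexists; unfold H, Csub, Cdiv; apply tdiff_add; [|apply tdiff_opp, tdiff_comp_coord].
      apply tdiff_mul; [exact Hq|]; apply (tdiff_cder Cinv _ _ _ _ (cder_inv (P (blow p)) ltac:(apply Cnorm_neq0; specialize (HPn p Hp); nra)) Hlp).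
    + pose proof (Hclose p Hp Hn); pose proof (Cnorm_p0 p); specialize (HH0b p Hp); pose proof (Cnorm_le_sub (H p) (H0 p)).
      assert (K * Cnorm (p0 p) <= K * r) by (apply Rmult_le_compat_l; lra). lra.
  - intros p Hp Hn eps Heps.
    exists (Rmin (r - n3 p) (eps / (K + 1))); split; [apply Rmin_glb_lt; [lra|apply Rdiv_lt_0_compat; lra]|]; intros s Hs.
    pose proof (Rmin_l (r - n3 p) (eps / (K + 1))); pose proof (Rmin_r (r - n3 p) (eps / (K + 1))).
    assert (eps / (K + 1) * (K + 1) = eps) by (field; lra).
    assert (n3 (mk3 s (p1 p) (p2 p)) < r) as Hin.
    { replace (mk3 s (p1 p) (p2 p)) with (p +v s *v e3 0) by (apply C3_eq; simpl; rewrite ?Hn; ring).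
      pose proof (n3_add p (s *v e3 0)); rewrite n3_scal_e3 in *; lra. }
    replace (H0 p) with (H0 (mk3 s (p1 p) (p2 p))) by (unfold H0; rewrite Hcoord; reflexivity).
    eapply Rle_lt_trans; [apply Hclose; auto; simpl; apply Cnorm_neq0; lra|]; simpl; nra.
  - intros p i Hp _ _; eexists; apply tdiff_has_pd, HH0d; auto.
  - assert (n3 O3 < r) as HO by (rewrite n3_O3; auto).
    exists r; split; auto; split; [exact HH|]; split.
    + change (remov H O3 = C0); rewrite Hon by auto; unfold H0, E, D; simpl.
      replace (comp j O3) with C0 by (destruct j as [|[|j]]; reflexivity).
      field. intros Z; apply Hmu; rewrite <- Z; ring.
    + intros i Hi; apply pd_eq.
      pose proof (tdiff_has_pd _ _ _ i (HH0d O3 HO)) as HT.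
      match type of HT with has_pd _ _ _ ?a => replace a with (comp i (Cinv mu *v mk3 C0 b1 b2 -v e3 j)) in HT end.
      2:{ replace (D O3) with mu by (unfold D; simpl; ring); replace (E O3) with C0 by (unfold E; simpl; ring).
          f_equal; apply C3_eq; simpl; ring. }
      apply has_pd_cder0 in HT; apply has_pd_cder0.
      apply (cder_ext_loc (fun z => H0 (O3 +v z *v e3 i)) _ C0 _ r); auto.
      intros z Hz; replace (z -c C0) with z in Hz by ring; symmetry; apply (Hon (O3 +v z *v e3 i)).
      * replace (O3 +v z *v e3 i) with (z *v e3 i) by (apply C3_eq; simpl; ring); rewrite n3_scal_e3; auto.
      * destruct i as [|[|i]]; [lia| |]; simpl; ring.
Qed.

Lemma bb_rhs_good (G : C3 -> Cplx) (r : R) : 0 < r -> Hol r G -> G O3 = C0 ->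
  good_F (fun p => G p -c (p0 p *c pd 0 G O3 +c (pd 1 G O3 *c p1 p +c pd 2 G O3 *c p2 p))).
Proof.
  intros Hr HG H0.
  assert (Hlin : forall p, tdiff (fun p => p0 p *c pd 0 G O3 +c (pd 1 G O3 *c p1 p +c pd 2 G O3 *c p2 p)) p (grad G O3))
    by (intros p; apply tdiff_of_exact; intros h; unfold dot, grad; simpl; ring).
  split.
  - apply order2_intro; [rewrite H0; simpl; ring|].
    assert (n3 O3 < r) as HO by (rewrite n3_O3; auto).
    pose proof (tdiff_add _ _ _ _ _ (HG O3 HO) (tdiff_opp _ _ _ (Hlin O3))) as K.
    replace (grad G O3 +v Copp C1 *v grad G O3) with O3 in K by (apply C3_eq; simpl; ring); exact K.
  - exists r; split; auto; apply Hol_csub; auto; apply Hol_intro; intros p _; eexists; apply Hlin.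
Qed.

(** The second and third equations have no linear term in the first coordinate: the first axis is an
    eigenspace, with eigenvalue [mu]. The x-direction has this form, and so has the z-direction
    after a permutation. *)
Record axis_system (mu l1 l2 b11 b12 b21 b22 : Cplx) (f g h P Q Rf : C3 -> Cplx) : Prop := {
  as_mu : mu <> C0;
  as_f : good_F f; as_g : good_F g; as_h : good_F h;
  as_P : forall p, P p = lin_form mu l1 l2 f p;
  as_Q : forall p, Q p = lin_form C0 b11 b12 g p;
  as_R : forall p, Rf p = lin_form C0 b21 b22 h p }.

Lemma bb_x_quot (P Q Rf : C3 -> Cplx) : bb_x P Q Rf = bb_of_rhs (bb_quot P Q 1) (bb_quot P Rf 2).
Proof. reflexivity. Qed.

Lemma bb_x_good (mu l1 l2 b11 b12 b21 b22 : Cplx) (f g h P Q Rf : C3 -> Cplx) :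
  axis_system mu l1 l2 b11 b12 b21 b22 f g h P Q Rf ->
  good_bb (bb_x P Q Rf) /\ bb_m11 (bb_x P Q Rf) = b11 /c mu -c C1 /\ bb_m12 (bb_x P Q Rf) = b12 /c mu /\
    bb_m21 (bb_x P Q Rf) = b21 /c mu /\ bb_m22 (bb_x P Q Rf) = b22 /c mu -c C1.
Proof.
  intros [Hmu Hf Hg Hh HP HQ HR].
  destruct (bb_quot_Hol mu l1 l2 b11 b12 f g P Q 1 Hmu Hf Hg HP HQ ltac:(lia)) as [r1 [Hr1 [H1 [Z1 D1]]]].
  destruct (bb_quot_Hol mu l1 l2 b21 b22 f h P Rf 2 Hmu Hf Hh HP HR ltac:(lia)) as [r2 [Hr2 [H2 [Z2 D2]]]].
  rewrite bb_x_quot; split; [split; [apply (bb_rhs_good _ r1)|apply (bb_rhs_good _ r2)]; auto|].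
  simpl; rewrite !D1, !D2 by lia; simpl; repeat split; field; auto.
Qed.

(** At [x = 0] both sides of the system vanish, so that only the honest quotients off 0 have to be
    compared. *)
Lemma bbsol_bb_x (P Q Rf : C3 -> Cplx) (r : R) (u v : Cplx -> Cplx) : bb_quot P Q 1 O3 = C0 -> bb_quot P Rf 2 O3 = C0 ->
  (bbsol (bb_x P Q Rf) r u v <->
   0 < r /\ u C0 = C0 /\ v C0 = C0 /\ forall x, Cnorm x < r -> exists L1 L2, cder u x L1 /\ cder v x L2 /\
     (x <> C0 -> let c := mk3 x (x *c u x) (x *c v x) in
       x *c L1 = Q c /c P c -c u x /\ x *c L2 = Rf c /c P c -c v x)).
Proof.
  intros Z1 Z2; rewrite bb_x_quot; split; intros [Hr [Hu [Hv H]]]; split; auto; split; auto; split; auto; intros x Hx;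
  destruct (H x Hx) as [L1 [L2 [D1 [D2 E]]]]; exists L1, L2; split; auto; split; auto.
  - intros Hn; destruct E as [E1 E2]; simpl in E1, E2; rewrite E1, E2.
    unfold bb_quot; rewrite !remov_off by auto; unfold blow; simpl; split; ring.
  - simpl; destruct (excluded_middle_informative (x = C0)) as [->|Hn].
    + rewrite Hu, Hv; change (mk3 C0 C0 C0) with O3; rewrite Z1, Z2; split; ring.
    + destruct (E Hn) as [E1 E2]; rewrite E1, E2.
      assert (forall K j, bb_quot P K j (mk3 x (u x) (v x)) = K (mk3 x (x *c u x) (x *c v x)) /c P (mk3 x (x *c u x) (x *c v x)) -c comp j (mk3 x (u x) (v x))) as Hq
        by (intros K j; unfold bb_quot; rewrite remov_off by auto; reflexivity).
      rewrite !Hq; simpl; split; ring.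
Qed.

(** * Tangency of invariant manifolds *)

(** Invariance speaks of real trajectories. [ode_exists] supplies one through each point, and
    differentiating [F] along it gives tangency of the field. *)
Lemma invariant_tangent (X : C3 -> C3) (S : C3 -> Prop) (R0 rho : R) (F : C3 -> Cplx) : 0 < R0 -> 0 < rho -> HolV R0 X ->
  invariant X S -> (forall q, n3 q < rho -> S q -> F q = C0) ->
  exists r, 0 < r /\ forall q l, n3 q < r -> S q -> tdiff F q l -> dot l (X q) = C0.
Proof.
  intros HR Hrho HX [ri [Hri HI]] HF.
  exists (Rmin ri (Rmin R0 rho)); split; [repeat apply Rmin_glb_lt; auto|]; intros q l Hq HS Hl.
  pose proof (Rmin_l ri (Rmin R0 rho)); pose proof (Rmin_r ri (Rmin R0 rho)); pose proof (Rmin_l R0 rho); pose proof (Rmin_r R0 rho).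
  destruct (ode_exists X R0 q HX ltac:(lra)) as [eps [phi [Heps [Hphi E0]]]].
  destruct (HI q ltac:(lra) HS eps phi Heps Hphi E0) as [eps' [Heps' HS']].
  rewrite is_sol_vder in Hphi; pose proof (Hphi 0 ltac:(lra)) as HV; rewrite E0 in HV.
  destruct (vder_cont _ _ _ HV (rho - n3 q)) as [d [Hd K]]; [lra|]; rewrite E0 in K.
  destruct HV as [A0 [A1 A2]].
  assert (tdiff F (phi 0) l) as Hl' by (rewrite E0; auto).
  pose proof (tdiff_comp_rder F phi 0 l (X q) Hl' A0 A1 A2) as HD.
  apply (rder_unique (fun s => F (phi s)) 0); auto.
  apply (rder_ext_loc (fun _ => C0) _ 0 (Rmin eps' d)); [apply Rmin_glb_lt; auto| |apply rder_const].
  intros s Hs; pose proof (Rmin_l eps' d); pose proof (Rmin_r eps' d); symmetry; apply HF.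
  - specialize (K s ltac:(lra)); pose proof (n3_le_sub (phi s) q); lra.
  - apply HS'; replace (s - 0) with s in Hs by ring; apply Rabs_lt_between; lra.
Qed.

(** The implicit function theorem: a linear change of the defining functions makes their
    differentials at 0 those of the last two coordinates, so [inverse_near_identity] yields a graph
    over the first axis. Invariance then becomes the two tangency equations. *)
Theorem axis_manifold_curve (X : C3 -> C3) (S : C3 -> Prop) (R0 : R) : 0 < R0 -> HolV R0 X -> cm_axis 0 X S ->
  exists rho al be, 0 < rho /\ al C0 = C0 /\ be C0 = C0 /\ cder al C0 C0 /\ cder be C0 C0 /\
    (forall q, n3 q < rho -> (S q <-> p1 q = al (p0 q) /\ p2 q = be (p0 q))) /\
    (forall x, Cnorm x < rho -> exists A B, cder al x A /\ cder be x B /\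
       let c := mk3 x (al x) (be x) in p1 (X c) = A *c p0 (X c) /\ p2 (X c) = B *c p0 (X c)).
Proof.
  intros HR HX [[r [f1 [f2 [Hr [Hf1 [Hf2 [Z1 [Z2 [_ [Hker HS]]]]]]]]]] HI].
  apply holo_ball_Hol in Hf1, Hf2.
  assert (n3 O3 < r) as HO by (rewrite n3_O3; auto).
  change (forall v, (dot (grad f1 O3) v = C0 /\ dot (grad f2 O3) v = C0) <-> exists lam, v = lam *v e3 0) in Hker.
  destruct (grad f1 O3) as [a0 a1 a2] eqn:G1; destruct (grad f2 O3) as [b0 b1 b2] eqn:G2.
  assert (a0 = C0 /\ b0 = C0) as [-> ->].
  { assert (exists lam, e3 0 = lam *v e3 0) as He by (exists C1; apply C3_eq; simpl; ring).
    destruct (proj2 (Hker (e3 0)) He) as [E1 E2]; unfold dot in E1, E2; simpl in E1, E2.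
    split; [rewrite <- E1|rewrite <- E2]; ring. }
  set (D := a1 *c b2 -c a2 *c b1).
  (* If [D] were 0, the kernel of the two differentials would contain a vector off the axis. *)
  assert (HD : D <> C0).
  { intros HD.
    assert (forall x y, a1 *c x +c a2 *c y = C0 -> b1 *c x +c b2 *c y = C0 -> x = C0 /\ y = C0) as Hk.
    { intros x y E1 E2; destruct (proj1 (Hker (mk3 C0 x y))) as [lam El].
      - unfold dot; simpl; split; [transitivity (a1 *c x +c a2 *c y)|transitivity (b1 *c x +c b2 *c y)]; auto; ring.
      - pose proof (f_equal p1 El) as F1; pose proof (f_equal p2 El) as F2; simpl in F1, F2; rewrite F1, F2; split; ring. }
    destruct (Hk a2 (Copp a1)) as [K1 K2]; [ring|transitivity (Copp D); [unfold D; ring|rewrite HD; ring]|].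
    destruct (Hk b2 (Copp b1)) as [K3 K4]; [transitivity D; [unfold D; ring|auto]|ring|].
    assert (a1 = C0) as -> by (replace a1 with (Copp (Copp a1)) by ring; rewrite K2; ring).
    assert (b1 = C0) as -> by (replace b1 with (Copp (Copp b1)) by ring; rewrite K4; ring).
    rewrite K1, K3 in Hk; destruct (Hk C1 C0) as [K5 _]; [ring|ring|]; exact (C1_neq_C0 K5). }
  (* The inverse of the 2 by 2 block is applied to the defining functions; their common zeros do not
     change. *)
  set (psi1 := fun p => Cinv D *c (b2 *c f1 p -c a2 *c f2 p)); set (psi2 := fun p => Cinv D *c (a1 *c f2 p -c b1 *c f1 p)).
  assert (Hpsi1 : Hol r psi1) by (unfold psi1; apply Hol_mul; [apply Hol_const|apply Hol_csub; apply Hol_mul; auto; apply Hol_const]).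
  assert (Hpsi2 : Hol r psi2) by (unfold psi2; apply Hol_mul; [apply Hol_const|apply Hol_csub; apply Hol_mul; auto; apply Hol_const]).
  assert (Hzero : forall p, psi1 p = C0 /\ psi2 p = C0 <-> f1 p = C0 /\ f2 p = C0).
  { intros p; unfold psi1, psi2; split; [intros [E1 E2]|intros [-> ->]; split; ring].
    split.
    - transitivity (a1 *c (Cinv D *c (b2 *c f1 p -c a2 *c f2 p)) +c a2 *c (Cinv D *c (a1 *c f2 p -c b1 *c f1 p))); [unfold D in *; field; auto|rewrite E1, E2; ring].
    - transitivity (b1 *c (Cinv D *c (b2 *c f1 p -c a2 *c f2 p)) +c b2 *c (Cinv D *c (a1 *c f2 p -c b1 *c f1 p))); [unfold D in *; field; auto|rewrite E1, E2; ring]. }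
  assert (Hlin : forall c1 c2, tdiff (fun p => Cinv D *c (c1 *c f1 p -c c2 *c f2 p)) O3 (Cinv D *v (c1 *v mk3 C0 a1 a2 -v c2 *v mk3 C0 b1 b2))).
  { intros c1 c2; pose proof (Hf1 O3 HO) as T1; pose proof (Hf2 O3 HO) as T2; rewrite G1 in T1; rewrite G2 in T2.
    pose proof (tdiff_mul _ _ _ _ _ (tdiff_const (Cinv D) O3) (tdiff_add _ _ _ _ _ (tdiff_mul _ _ _ _ _ (tdiff_const c1 O3) T1) (tdiff_opp _ _ _ (tdiff_mul _ _ _ _ _ (tdiff_const c2 O3) T2)))) as K.
    cbv beta in K; match type of K with tdiff _ _ ?l => replace l with (Cinv D *v (c1 *v mk3 C0 a1 a2 -v c2 *v mk3 C0 b1 b2)) in K by (apply C3_eq; simpl; ring) end; exact K. }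
  (* [id + N] is the chart (x, psi1, psi2). Its inverse on the first axis traces the manifold. *)
  set (N := fun p => mk3 C0 (psi1 p -c p1 p) (psi2 p -c p2 p)).
  assert (HN : HolV r N) by (repeat split; unfold N; simpl; [apply Hol_const|apply Hol_csub; auto; apply Hol_p1|apply Hol_csub; auto; apply Hol_p2]).
  assert (HN2 : order2V N).
  { split; [|split]; unfold N; simpl; apply order2_intro.
    - reflexivity.
    - exact (tdiff_const C0 O3).
    - unfold psi1; rewrite Z1, Z2; simpl; ring.
    - pose proof (tdiff_add _ _ _ _ _ (Hlin b2 a2) (tdiff_opp _ _ _ (tdiff_p1 O3))) as K.
      cbv beta in K; match type of K with tdiff _ _ ?l => replace l with O3 in K by (unfold D in *; apply C3_eq; simpl; field; auto) end; exact K.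
    - unfold psi2; rewrite Z1, Z2; simpl; ring.
    - pose proof (tdiff_add _ _ _ _ _ (Hlin (Copp b1) (Copp a1)) (tdiff_opp _ _ _ (tdiff_p2 O3))) as K.
      cbv beta in K; match type of K with tdiff _ _ ?l => replace l with O3 in K by (unfold D in *; apply C3_eq; simpl; field; auto) end.
      replace (fun p => psi2 p -c p2 p) with (fun q => Cinv D *c (Copp b1 *c f1 q -c Copp a1 *c f2 q) +c Copp (p2 q)); auto.
      apply functional_extensionality; intros p; unfold psi2; ring. }
  destruct (inverse_near_identity N r Hr HN HN2) as [d [Psi [Hd [Hdr [HP [HP1 [HP2 [_ [HP4 HP5]]]]]]]]].
  set (ax := fun x => mk3 x C0 C0).
  set (al := fun x => p1 (Psi (ax x))); set (be := fun x => p2 (Psi (ax x))).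
  assert (Hax : forall x, Cnorm x < d -> n3 (ax x) < d) by (intros x Hx; unfold ax; rewrite n3_axis0; auto).
  assert (HPax : forall x, Cnorm x < d -> Psi (ax x) = mk3 x (al x) (be x) /\ n3 (mk3 x (al x) (be x)) <= 2 * Cnorm x).
  { intros x Hx; destruct (HP1 _ (Hax x Hx)) as [E1 E2].
    assert (Psi (ax x) = mk3 x (al x) (be x)) as E; [|rewrite <- E; split; auto; rewrite <- (n3_axis0 x); auto].
    apply C3_eq; auto; apply (f_equal p0) in E2; unfold N in E2; simpl in E2; simpl.
    transitivity (p0 (Psi (ax x)) +c C0); [ring|exact E2]. }
  assert (Hder : forall f x, Hol d f -> Cnorm x < d -> cder (fun x => f (ax x)) x (p0 (grad f (ax x)))).
  { intros f x Hf Hx; replace (p0 (grad f (ax x))) with (dot (grad f (ax x)) (e3 0)) by (unfold dot; simpl; ring).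
    apply (tdiff_comp_cder f ax); [apply Hf, Hax; auto|exact (cder_id x)|exact (cder_const C0 x)|exact (cder_const C0 x)]. }
  destruct HP as [Q0 [Q1 Q2]].
  assert (Hchar : forall q, n3 q < d / 2 -> (S q <-> p1 q = al (p0 q) /\ p2 q = be (p0 q))).
  { intros q Hq; rewrite HS by lra; rewrite <- Hzero.
    pose proof (Cnorm_p0 q); destruct (HPax (p0 q) ltac:(lra)) as [E1 _].
    assert (q +v N q = mk3 (p0 q) (psi1 q) (psi2 q)) as EN by (apply C3_eq; unfold N; simpl; ring).
    split.
    - intros [F1 F2]; rewrite F1, F2 in EN.
      pose proof (HP2 q ltac:(lra)) as E; rewrite EN in E; specialize (E (Hax (p0 q) ltac:(lra))); fold (ax (p0 q)) in E; rewrite E in E1.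
      split; [exact (f_equal p1 E1)|exact (f_equal p2 E1)].
    - intros [F1 F2]; assert (Psi (ax (p0 q)) = q) as E by (rewrite E1; apply C3_eq; auto).
      destruct (HP1 (ax (p0 q)) (Hax (p0 q) ltac:(lra))) as [_ E2]; rewrite E, EN in E2.
      split; [exact (f_equal p1 E2)|exact (f_equal p2 E2)]. }
  (* For a coordinate [pr] equal to a function [k] of [x] on [S], tangency reads d pr(X) = k'(x)
     times the first component of X. *)
  assert (Hset : forall (k : Cplx -> Cplx) (pr : C3 -> Cplx), (forall q, n3 q < d / 2 -> S q -> pr q = k (p0 q)) ->
     exists e, 0 < e /\ forall q A l, n3 q < e -> S q -> cder k (p0 q) A -> tdiff pr q l -> dot l (X q) = A *c p0 (X q)).
  { intros k pr Hpr.
    destruct (invariant_tangent X S R0 (d / 2) (fun q => pr q -c k (p0 q)) HR ltac:(lra) HX HI) as [e [He K]].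
    - intros q Hq HSq; rewrite (Hpr q Hq HSq); ring.
    - exists e; split; auto; intros q A l Hq HSq HA Hl.
      specialize (K q (l +v Copp C1 *v (A *v e3 0)) Hq HSq).
      specialize (K (tdiff_add _ _ _ _ _ Hl (tdiff_opp _ _ _ (tdiff_cder k p0 q _ A HA (tdiff_p0 q))))).
      apply Csub_eq0; rewrite <- K; unfold dot; simpl; ring. }
  destruct (Hset al p1) as [e1 [He1 K1]]; [intros q Hq HSq; apply Hchar; auto|].
  destruct (Hset be p2) as [e2 [He2 K2]]; [intros q Hq HSq; apply Hchar; auto|].
  set (rho := Rmin (d / 4) (Rmin (e1 / 2) (e2 / 2))).
  assert (rho <= d / 4) as R1 by apply Rmin_l.
  assert (rho <= e1 / 2) as R2 by (eapply Rle_trans; [apply Rmin_r|apply Rmin_l]).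
  assert (rho <= e2 / 2) as R3 by (eapply Rle_trans; [apply Rmin_r|apply Rmin_r]).
  assert (al C0 = C0 /\ be C0 = C0) as [A0 B0].
  { destruct (HPax C0 ltac:(rewrite Cnorm_C0; auto)) as [E1 E2]; rewrite Cnorm_C0 in E2.
    assert (mk3 C0 (al C0) (be C0) = O3) as E3 by (apply n3_eq0, Rle_antisym; [lra|apply n3_ge0]).
    split; [exact (f_equal p1 E3)|exact (f_equal p2 E3)]. }
  exists rho, al, be; split; [repeat apply Rmin_glb_lt; lra|]; split; auto; split; auto; split; [|split; [|split]].
  - pose proof (Hder _ C0 Q1 ltac:(rewrite Cnorm_C0; auto)) as K; change (ax C0) with O3 in K; rewrite (tdiff_grad_eq _ _ _ HP4) in K; exact K.
  - pose proof (Hder _ C0 Q2 ltac:(rewrite Cnorm_C0; auto)) as K; change (ax C0) with O3 in K; rewrite (tdiff_grad_eq _ _ _ HP5) in K; exact K.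
  - intros q Hq; apply Hchar; lra.
  - intros x Hx; destruct (HPax x ltac:(lra)) as [_ E2].
    eexists; eexists; split; [exact (Hder _ x Q1 ltac:(lra))|]; split; [exact (Hder _ x Q2 ltac:(lra))|]; intros c.
    assert (S c) as HSc by (apply Hchar; [unfold c; lra|simpl; auto]).
    pose proof (K1 c _ (e3 1) ltac:(unfold c; lra) HSc (Hder _ x Q1 ltac:(lra)) (tdiff_p1 c)) as T1.
    pose proof (K2 c _ (e3 2) ltac:(unfold c; lra) HSc (Hder _ x Q2 ltac:(lra)) (tdiff_p2 c)) as T2.
    split; [rewrite <- T1|rewrite <- T2]; unfold dot; simpl; ring.
Qed.

(** * Invariant curves and solutions of the Briot-Bouquet system *)

Definition field3 (P Q Rf : C3 -> Cplx) (p : C3) : C3 := mk3 (P p) (Q p) (Rf p).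

Lemma lin_form_Hol (b0 b1 b2 : Cplx) (f : C3 -> Cplx) (r : R) : Hol r f -> Hol r (lin_form b0 b1 b2 f).
Proof. intros Hf; apply Hol_intro; intros p Hp; eexists; apply tdiff_lin_form, Hf; auto. Qed.

Lemma axis_field_HolV (mu l1 l2 b11 b12 b21 b22 : Cplx) (f g h P Q Rf : C3 -> Cplx) :
  axis_system mu l1 l2 b11 b12 b21 b22 f g h P Q Rf -> exists R0, 0 < R0 /\ HolV R0 (field3 P Q Rf).
Proof.
  intros [_ [_ [rf [Hrf Hf]]] [_ [rg [Hrg Hg]]] [_ [rh [Hrh Hh]]] HP HQ HR].
  pose proof (Rmin_l rf (Rmin rg rh)); pose proof (Rmin_r rf (Rmin rg rh)); pose proof (Rmin_l rg rh); pose proof (Rmin_r rg rh).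
  exists (Rmin rf (Rmin rg rh)); split; [repeat apply Rmin_glb_lt; auto|].
  unfold field3; repeat split; simpl.
  - apply (Hol_ext _ (lin_form mu l1 l2 f)); [intros; auto|apply lin_form_Hol, (Hol_sub rf); auto; lra].
  - apply (Hol_ext _ (lin_form C0 b11 b12 g)); [intros; auto|apply lin_form_Hol, (Hol_sub rg); auto; lra].
  - apply (Hol_ext _ (lin_form C0 b21 b22 h)); [intros; auto|apply lin_form_Hol, (Hol_sub rh); auto; lra].
Qed.

Lemma bb_quot_O3 (mu l1 l2 b11 b12 b21 b22 : Cplx) (f g h P Q Rf : C3 -> Cplx) :
  axis_system mu l1 l2 b11 b12 b21 b22 f g h P Q Rf -> bb_quot P Q 1 O3 = C0 /\ bb_quot P Rf 2 O3 = C0.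
Proof.
  intros [Hmu Hf Hg Hh HP HQ HR].
  destruct (bb_quot_Hol mu l1 l2 b11 b12 f g P Q 1 Hmu Hf Hg HP HQ ltac:(lia)) as [r1 [_ [_ [Z1 _]]]].
  destruct (bb_quot_Hol mu l1 l2 b21 b22 f h P Rf 2 Hmu Hf Hh HP HR ltac:(lia)) as [r2 [_ [_ [Z2 _]]]]; auto.
Qed.

Lemma small_triple (u v : Cplx -> Cplx) (L1 L2 : Cplx) (e : R) : 0 < e -> u C0 = C0 -> v C0 = C0 -> cder u C0 L1 -> cder v C0 L2 ->
  exists d, 0 < d /\ forall x, Cnorm x < d -> n3 (mk3 x (u x) (v x)) < e.
Proof.
  intros He Hu Hv D1 D2.
  destruct (cder_ccont1 _ _ _ D1 (e / 3)) as [d1 [Hd1 K1]]; [lra|]; destruct (cder_ccont1 _ _ _ D2 (e / 3)) as [d2 [Hd2 K2]]; [lra|].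
  exists (Rmin (e / 3) (Rmin d1 d2)); split; [repeat apply Rmin_glb_lt; lra|]; intros x Hx.
  pose proof (Rmin_l (e / 3) (Rmin d1 d2)); pose proof (Rmin_r (e / 3) (Rmin d1 d2)); pose proof (Rmin_l d1 d2); pose proof (Rmin_r d1 d2).
  specialize (K1 x); specialize (K2 x); rewrite Hu in K1; rewrite Hv in K2.
  replace (x -c C0) with x in * by ring; replace (u x -c C0) with (u x) in * by ring; replace (v x -c C0) with (v x) in * by ring.
  eapply Rle_lt_trans; [apply n3_le_sum|]; simpl; specialize (K1 ltac:(lra)); specialize (K2 ltac:(lra)); lra.
Qed.

(** The graph functions vanish at 0 with their derivatives, so their quotients by [x] are
    holomorphic and vanish at 0. Dividing the tangency relation Q = al' P by [P] gives the
    system. *)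
Theorem axis_manifold_bbsol (mu l1 l2 b11 b12 b21 b22 : Cplx) (f g h P Q Rf : C3 -> Cplx) (S : C3 -> Prop) :
  axis_system mu l1 l2 b11 b12 b21 b22 f g h P Q Rf -> cm_axis 0 (field3 P Q Rf) S ->
  exists r u v rho, bbsol (bb_x P Q Rf) r u v /\ 0 < rho /\
    forall q, n3 q < rho -> (S q <-> p1 q = p0 q *c u (p0 q) /\ p2 q = p0 q *c v (p0 q)).
Proof.
  intros HA HS; destruct (axis_field_HolV _ _ _ _ _ _ _ _ _ _ _ _ _ HA) as [R0 [HR HX]].
  destruct (bb_quot_O3 _ _ _ _ _ _ _ _ _ _ _ _ _ HA) as [Z1 Z2].
  destruct (axis_manifold_curve _ S R0 HR HX HS) as [rho [al [be [Hrho [A0 [B0 [DA [DB [Hchar HT]]]]]]]]].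
  destruct HA as [Hmu Hf _ _ HP _ _].
  destruct (blow_lower_bound mu l1 l2 f Hmu Hf) as [r0 [Hr0 HL]].
  set (u := shift al C0); set (v := shift be C0).
  assert (Hhol : hol1 al C0 rho /\ hol1 be C0 rho).
  { split; intros z Hz; replace (z -c C0) with z in Hz by ring; destruct (HT z Hz) as [A [B [E1 [E2 _]]]]; eauto. }
  assert (Hal : forall x, al x = x *c u x /\ be x = x *c v x).
  { intros x; unfold u, v; destruct (excluded_middle_informative (x = C0)) as [->|Hn].
    - rewrite !shift_on, A0, B0; split; ring.
    - rewrite !shift_off by auto; split; field; auto. }
  destruct (cder_shift0 al C0 rho Hrho (proj1 Hhol) A0 DA) as [Lu Du]; destruct (cder_shift0 be C0 rho Hrho (proj2 Hhol) B0 DB) as [Lv Dv].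
  destruct (small_triple u v Lu Lv r0 ltac:(lra) (shift_on _ _) (shift_on _ _) Du Dv) as [d [Hd Hsmall]].
  exists (Rmin rho d), u, v, rho; split; [|split; auto].
  - pose proof (Rmin_l rho d); pose proof (Rmin_r rho d).
    apply bbsol_bb_x; auto; split; [apply Rmin_glb_lt; auto|]; split; [apply shift_on|]; split; [apply shift_on|]; intros x Hx.
    destruct (excluded_middle_informative (x = C0)) as [->|Hn].
    + exists Lu, Lv; split; auto; split; auto; intros Hn; contradiction.
    + destruct (HT x ltac:(lra)) as [A [B [E1 [E2 [T1 T2]]]]]; simpl in T1, T2.
      eexists; eexists; split; [apply cder_quotient; eauto|]; split; [apply cder_quotient; eauto|]; intros _ c.
      destruct (Hal x) as [F1 F2].
      assert (mk3 x (al x) (be x) = c) as Ec by (unfold c; rewrite <- F1, <- F2; reflexivity).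
      rewrite Ec in T1, T2.
      destruct (HL _ (Hsmall x ltac:(lra))) as [_ HPn]; simpl in HPn.
      pose proof (Cnorm_gt0 x Hn); pose proof (Cnorm_gt0 mu Hmu).
      assert (P c <> C0) as HPc by (apply Cnorm_neq0; rewrite HP; unfold c; change (mk3 x (x *c u x) (x *c v x)) with (blow (mk3 x (u x) (v x))); nra).
      rewrite T1, T2; rewrite F1, F2; split; field; auto.
  - intros q Hq; rewrite Hchar by auto; destruct (Hal (p0 q)) as [<- <-]; reflexivity.
Qed.

(** The flow on an invariant curve [c] is conjugate to a rotation; the conjugacy is the linearisation of [x' = P (c x)]. *)
Theorem bbsol_axis_manifold (w : R) (l1 l2 b11 b12 b21 b22 : Cplx) (f g h P Q Rf : C3 -> Cplx) (r : R) (u v : Cplx -> Cplx) :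
  w <> 0 -> axis_system (Ci *c RtoC w) l1 l2 b11 b12 b21 b22 f g h P Q Rf -> bbsol (bb_x P Q Rf) r u v ->
  exists rho, 0 < rho /\ let S := fun q => n3 q < rho /\ p1 q = p0 q *c u (p0 q) /\ p2 q = p0 q *c v (p0 q) in
    cm_axis 0 (field3 P Q Rf) S /\ isochronous (field3 P Q Rf) S (2 * PI / Rabs w).
Proof.
  intros Hw HA Hs; destruct (axis_field_HolV _ _ _ _ _ _ _ _ _ _ _ _ _ HA) as [R0 [HR HX]].
  destruct (bb_quot_O3 _ _ _ _ _ _ _ _ _ _ _ _ _ HA) as [Z1 Z2].
  apply bbsol_bb_x in Hs; auto; destruct Hs as [Hr [Hu0 [Hv0 H]]].
  destruct HA as [Hmu Hf Hg Hh HP HQ HRf].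
  set (mu := Ci *c RtoC w) in *.
  destruct (blow_lower_bound mu l1 l2 f Hmu Hf) as [r0 [Hr0 HL]].
  destruct (H C0 ltac:(rewrite Cnorm_C0; auto)) as [Lu [Lv [Du [Dv _]]]].
  destruct Hf as [Hf2 [rf [Hrf Hf]]].
  set (emin := Rmin (Rmin r0 1) (Rmin R0 (rf / 4))).
  assert (emin <= r0) as M1 by (eapply Rle_trans; [apply Rmin_l|apply Rmin_l]).
  assert (emin <= 1) as M2 by (eapply Rle_trans; [apply Rmin_l|apply Rmin_r]).
  assert (emin <= R0) as M3 by (eapply Rle_trans; [apply Rmin_r|apply Rmin_l]).
  assert (emin <= rf / 4) as M4 by (eapply Rle_trans; [apply Rmin_r|apply Rmin_r]).
  assert (0 < emin) as M0 by (repeat apply Rmin_glb_lt; lra).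
  destruct (small_triple u v Lu Lv emin M0 Hu0 Hv0 Du Dv) as [d0 [Hd0 Hsmall]].
  set (d := Rmin r d0).
  assert (0 < d) as Hd by (apply Rmin_glb_lt; auto).
  assert (d <= r) as Hdr by apply Rmin_l; assert (d <= d0) as Hdd by apply Rmin_r.
  set (c := fun x => mk3 x (x *c u x) (x *c v x)).
  assert (Hcb : forall x, c x = blow (mk3 x (u x) (v x))) by reflexivity.
  assert (Hc3 : forall x, Cnorm x < d -> n3 (c x) <= 3 * Cnorm x).
  { intros x Hx; rewrite Hcb; apply n3_blow; pose proof (Hsmall x ltac:(lra)); lra. }
  assert (Hcx : forall x, Cnorm x < d -> Cnorm x < emin).
  { intros x Hx; pose proof (Hsmall x ltac:(lra)); pose proof (Cnorm_p0 (mk3 x (u x) (v x))) as T; simpl in T; lra. }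
  assert (Htd : forall k q l, cder k (p0 q) l -> tdiff (fun q => k (p0 q)) q (l *v e3 0)) by (intros k q l Hk; apply (tdiff_cder k p0); auto; apply tdiff_p0).
  assert (Hw1 : forall k x L, cder k x L -> cder (fun x => x *c k x) x (k x +c x *c L)).
  { intros k x L HK; pose proof (cder_mul _ _ _ _ _ (cder_id x) HK) as K; cbv beta in K; replace (k x +c x *c L) with (C1 *c k x +c x *c L) by ring; exact K. }
  (* The velocity of the curve times [P] is the field along it; at [x = 0] both sides vanish. *)
  assert (Huv : forall x, Cnorm x < d -> exists U V, cder (fun x => x *c u x) x U /\ cder (fun x => x *c v x) x V /\
     U *c P (c x) = Q (c x) /\ V *c P (c x) = Rf (c x)).
  { intros x Hx; destruct (H x ltac:(lra)) as [L1 [L2 [E1 [E2 E]]]].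
    exists (u x +c x *c L1), (v x +c x *c L2); split; [auto|]; split; [auto|].
    destruct (excluded_middle_informative (x = C0)) as [->|Hn].
    - assert (c C0 = O3) as -> by (unfold c; apply C3_eq; simpl; ring).
      destruct Hg as [[G0 _] _]; destruct Hh as [[H0 _] _]; destruct Hf2 as [F0 _].
      rewrite HP, HQ, HRf; unfold lin_form; simpl; rewrite F0, G0, H0; split; ring.
    - destruct (E Hn) as [E3 E4]; fold (c x) in E3, E4; rewrite E3, E4.
      destruct (HL _ (Rlt_le_trans _ _ _ (Hsmall x ltac:(lra)) M1)) as [_ HPn]; simpl in HPn.
      pose proof (Cnorm_gt0 x Hn); pose proof (Cnorm_gt0 mu Hmu).
      assert (P (c x) <> C0) as HPc by (apply Cnorm_neq0; rewrite HP, Hcb; nra).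
      split; field; auto. }
  (* The nonlinear part of x' = P(c(x)), regarded as a function on [C3] of the first coordinate so
     that [lin_exists] applies with [beta = C0]. *)
  set (n := fun q => P (c (p0 q)) -c mu *c p0 q).
  assert (HcV : HolV d (fun q => c (p0 q))).
  { unfold c; repeat split; simpl; [apply Hol_p0| |]; apply Hol_intro; intros q Hq; pose proof (Cnorm_p0 q);
    destruct (Huv (p0 q) ltac:(lra)) as [U [V [E1 [E2 _]]]]; eexists; [exact (Htd _ q _ E1)|exact (Htd _ q _ E2)]. }
  assert (HPH : Hol rf P) by (apply (Hol_ext _ (lin_form mu l1 l2 f)); [intros; auto|apply lin_form_Hol; auto]).
  assert (Hn : Hol d n).
  { unfold n; apply Hol_csub; [apply (Hol_comp d rf P (fun q => c (p0 q))); auto|apply Hol_mul; [apply Hol_const|apply Hol_p0]].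
    intros q Hq; pose proof (Cnorm_p0 q); pose proof (Hc3 (p0 q) ltac:(lra)); pose proof (Hcx (p0 q) ltac:(lra)); lra. }
  assert (Hc0 : c C0 = O3) by (unfold c; apply C3_eq; simpl; ring).
  assert (HP0 : P O3 = C0) by (rewrite HP; unfold lin_form; destruct Hf2 as [F0 _]; rewrite F0; simpl; ring).
  assert (Hn2 : order_ge2 n).
  { apply order2_intro; [unfold n; simpl; rewrite Hc0, HP0; ring|].
    assert (tdiff P (c (p0 O3)) (mk3 mu l1 l2)) as T.
    { simpl; rewrite Hc0; replace P with (lin_form mu l1 l2 f) by (apply functional_extensionality; auto).
      replace (mk3 mu l1 l2) with (mk3 mu l1 l2 +v O3) by (apply C3_eq; simpl; ring).
      apply tdiff_lin_form, (order2_tdiff f rf); auto. }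
    pose proof (Hw1 u C0 Lu Du) as W1; pose proof (Hw1 v C0 Lv Dv) as W2; rewrite Hu0 in W1; rewrite Hv0 in W2.
    pose proof (tdiff_comp P (fun q => c (p0 q)) O3 _ _ _ _ T (tdiff_p0 O3) (Htd _ O3 _ W1) (Htd _ O3 _ W2)) as K.
    pose proof (tdiff_add _ _ _ _ _ K (tdiff_opp _ _ _ (tdiff_mul _ _ _ _ _ (tdiff_const mu O3) (tdiff_p0 O3)))) as K2; cbv beta in K2.
    match type of K2 with tdiff _ _ ?l => replace l with O3 in K2 by (apply C3_eq; unfold scomb; simpl; ring) end; exact K2. }
  set (N := fun q => mk3 (n q) C0 C0).
  assert (HN : HolV d N) by (repeat split; unfold N; simpl; auto; apply Hol_const).
  assert (Hzero2 : order_ge2 (fun _ => C0)) by (apply order2_intro; [reflexivity|apply tdiff_const]).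
  assert (HN2 : order2V N) by (split; [exact Hn2|split; exact Hzero2]).
  destruct (lin_exists mu C0 N d Hmu Hd HN HN2) as [rho1 [G1 [Hrho1 [HG1 [HG12 HG1e]]]]].
  (* The linearising coordinate change restricted to the first axis: mu x k'(x) = P(c(k(x))).
     Composed with the curve it gives [Gam] below. *)
  set (k := fun q => p0 (G1 (mk3 (p0 q) C0 C0))).
  assert (Hax : forall q, n3 (mk3 (p0 q) C0 C0) <= n3 q) by (intros q; rewrite n3_axis0; apply Cnorm_p0).
  assert (HaxV : forall s, HolV s (fun q => mk3 (p0 q) C0 C0)) by (intros s; repeat split; simpl; [apply Hol_p0|apply Hol_const|apply Hol_const]).
  destruct HG1 as [HG10 _]; destruct HG12 as [HG120 _].
  assert (Hk : Hol rho1 k).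
  { apply (Hol_comp rho1 rho1 (fun p => p0 (G1 p)) (fun q => mk3 (p0 q) C0 C0)); auto; intros q Hq; pose proof (Hax q); lra. }
  set (N1 := fun q => mk3 (k q -c p0 q) C0 C0).
  assert (HN1 : HolV rho1 N1) by (repeat split; unfold N1; simpl; [apply Hol_csub; auto; apply Hol_p0|apply Hol_const|apply Hol_const]).
  assert (HN12 : order2V N1).
  { split; [|split; exact Hzero2]; unfold N1; simpl.
    destruct HG120 as [GZ GD]; apply order2_intro.
    - unfold k; simpl; exact GZ.
    - assert (tdiff (fun p => p0 (G1 p -v pxz p)) (mk3 (p0 O3) C0 C0) O3) as T.
      { apply (order2_tdiff _ rho1); [auto| |split; auto]; apply Hol_csub; auto; apply Hol_p0. }
      pose proof (tdiff_comp _ (fun q => mk3 (p0 q) C0 C0) O3 O3 _ _ _ T (tdiff_p0 O3) (tdiff_const C0 O3) (tdiff_const C0 O3)) as K.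
      match type of K with tdiff _ _ ?l => replace l with O3 in K by (apply C3_eq; unfold scomb; simpl; ring) end; exact K. }
  (* [k] is close to the identity; its inverse finds the parameter of a given point of the curve and
     later shows that it is unique. *)
  destruct (inverse_near_identity N1 rho1 Hrho1 HN1 HN12) as [d1 [Psi [Hd1 [Hd1r [_ [HI1 [HI2 _]]]]]]].
  assert (Hkq : forall q, n3 q < rho1 -> dot (grad k q) q *c mu = P (c (k q))).
  { intros q Hq; set (a := mk3 (p0 q) C0 C0); assert (n3 a < rho1) as Ha by (pose proof (Hax q); unfold a; lra).
    pose proof (f_equal p0 (HG1e a Ha)) as E; unfold lin_field, N, n in E; simpl in E.
    assert (p0 (G1 a) = k q) as Ek by reflexivity; rewrite Ek in E.
    replace (P (c (k q))) with (mu *c k q +c (C0 *c p1 (G1 a) *c C1 +c (P (c (k q)) -c mu *c k q))) by ring; rewrite <- E.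
    pose proof (tdiff_comp (fun p => p0 (G1 p)) (fun q => mk3 (p0 q) C0 C0) q _ _ _ _ (HG10 a Ha) (tdiff_p0 q) (tdiff_const C0 q) (tdiff_const C0 q)) as K.
    rewrite (tdiff_grad_eq k q _ K); unfold dot, scomb, a; simpl; ring. }
  assert (Hksmall : forall e, 0 < e -> exists t, 0 < t /\ forall q, n3 q < t -> Cnorm (k q) < e).
  { intros e He; assert (n3 O3 < rho1) as HO by (rewrite n3_O3; auto).
    destruct (tdiff_ccont k O3 _ (Hk O3 HO) e He) as [t [Ht K]]; exists t; split; auto; intros q Hq.
    assert (k O3 = C0) as K0.
    { destruct HG120 as [GZ _]; transitivity (p0 (G1 O3) -c p0 (pxz O3)); [change (k O3) with (p0 (G1 O3)); simpl; ring|exact GZ]. }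
    specialize (K q); rewrite K0 in K; replace (q -v O3) with q in K by (apply C3_eq; simpl; ring).
    replace (k q -c C0) with (k q) in K by ring; auto. }
  destruct (Hksmall d Hd) as [t1 [Ht1 Hk1]].
  set (rs := Rmin emin d).
  assert (0 < rs) as Hrs by (apply Rmin_glb_lt; auto).
  assert (rs <= emin) as Hrs1 by apply Rmin_l; assert (rs <= d) as Hrs2 by apply Rmin_r.
  destruct (Hksmall (Rmin d (Rmin (rs / 3) (d1 / 2)))) as [t2 [Ht2 Hk2]]; [repeat apply Rmin_glb_lt; lra|].
  exists rs; split; auto; intros S.
  set (Gam := fun q => c (k q)).
  set (rg := Rmin rho1 t1).
  assert (0 < rg) as Hrg by (apply Rmin_glb_lt; auto).
  assert (rg <= rho1) as Hrg1 by apply Rmin_l; assert (rg <= t1) as Hrg2 by apply Rmin_r.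
  assert (HGam : HolV rg Gam /\ forall q, n3 q < rg -> mu *v euler Gam q = field3 P Q Rf (Gam q)).
  { assert (forall q, n3 q < rg -> exists U V, tdiff (fun q => p0 (Gam q)) q (grad k q) /\ tdiff (fun q => p1 (Gam q)) q (U *v grad k q) /\
      tdiff (fun q => p2 (Gam q)) q (V *v grad k q) /\ U *c P (c (k q)) = Q (c (k q)) /\ V *c P (c (k q)) = Rf (c (k q))) as HG.
    { intros q Hq; destruct (Huv (k q) (Hk1 q ltac:(lra))) as [U [V [E1 [E2 [E3 E4]]]]]; exists U, V.
      pose proof (Hk q ltac:(lra)) as Tk.
      split; [exact Tk|]; split; [exact (tdiff_cder _ k q _ U E1 Tk)|]; split; [exact (tdiff_cder _ k q _ V E2 Tk)|auto]. }
    split.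
    - repeat split; apply Hol_intro; intros q Hq; destruct (HG q Hq) as [U [V [E1 [E2 [E3 _]]]]]; eauto.
    - intros q Hq; destruct (HG q Hq) as [U [V [E1 [E2 [E3 [E4 E5]]]]]]; pose proof (Hkq q ltac:(lra)) as Ek.
      unfold euler; rewrite (tdiff_grad_eq _ _ _ E1), (tdiff_grad_eq _ _ _ E2), (tdiff_grad_eq _ _ _ E3).
      unfold field3, Gam; rewrite <- E4, <- E5, <- Ek; apply C3_eq; unfold dot; simpl; ring. }
  destruct HGam as [HGamH HGame].
  assert (Hker : forall q, n3 q < rs -> S q <-> p1 q = p0 q *c u (p0 q) /\ p2 q = p0 q *c v (p0 q)) by (intros q Hq; unfold S; intuition).
  set (dl := Rmin rs (Rmin (d1 / 2) (Rmin (rg / 2) (t2 / 2)))).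
  assert (dl <= rs) as D1 by apply Rmin_l.
  assert (dl <= d1 / 2) as D2 by (eapply Rle_trans; [apply Rmin_r|apply Rmin_l]).
  assert (dl <= rg / 2) as D3 by (eapply Rle_trans; [apply Rmin_r|]; eapply Rle_trans; [apply Rmin_r|apply Rmin_l]).
  assert (dl <= t2 / 2) as D4 by (eapply Rle_trans; [apply Rmin_r|]; eapply Rle_trans; [apply Rmin_r|apply Rmin_r]).
  assert (Hpsi : forall a, n3 a < d1 -> n3 (a +v N1 a) < d1 -> Psi (a +v N1 a) = a) by auto.
  assert (Hiso : isochronous (field3 P Q Rf) S (2 * PI / Rabs w) /\ invariant (field3 P Q Rf) S).
  { apply (isochronous_of_orbits (field3 P Q Rf) Gam S R0 dl w); auto; [repeat apply Rmin_glb_lt; lra|].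
    intros q [Hq1 [Hq2 Hq3]] Hq; pose proof (Cnorm_p0 q) as Hq0.
    set (a := mk3 (p0 q) C0 C0); assert (n3 a < d1) as Ha by (pose proof (Hax q); unfold a; lra).
    destruct (HI1 a Ha) as [I1 I2]; set (p := Psi a) in *.
    assert (n3 a <= n3 q) as Haq by apply Hax.
    assert (k p = p0 q) as Ekp by (apply (f_equal p0) in I2; unfold N1, a in I2; simpl in I2; transitivity (p0 p +c (k p -c p0 p)); [ring|exact I2]).
    exists p; split; [|split; [|split]].
    - unfold Gam; rewrite Ekp; unfold c; apply C3_eq; auto.
    - apply (orbit_solution _ Gam w rg); auto; [|lra]; intros q' Hq'; apply HGame; lra.
    - intros t; assert (n3 (cis t *v p) < t2) as Hc by (rewrite n3_cis; lra).
      pose proof (Hk2 _ Hc) as Hkk; pose proof (Rmin_l d (Rmin (rs / 3) (d1 / 2))); pose proof (Rmin_r d (Rmin (rs / 3) (d1 / 2))); pose proof (Rmin_l (rs / 3) (d1 / 2)).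
      pose proof (Hc3 (k (cis t *v p)) ltac:(lra)) as T.
      unfold Gam; split; [|lra]; split; [lra|split; reflexivity].
    - intros Hq0' t E; apply (f_equal p0) in E; unfold Gam, c in E; simpl in E.
      (* Injectivity of [k] turns a return to [q] into cis(t) p = p in the first coordinate, which
         is nonzero because [q] is not the origin. *)
      set (b := fun s => mk3 (p0 (cis s *v p)) C0 C0).
      assert (forall s, n3 (b s) < d1) as Hb by (intros s; unfold b; pose proof (Hax (cis s *v p)); rewrite n3_cis in *; lra).
      assert (forall s, b s +v N1 (b s) = mk3 (k (cis s *v p)) C0 C0) as Eb by (intros s; unfold N1, b, k; apply C3_eq; simpl; ring).
      assert (k (cis 0 *v p) = p0 q) as E0 by (rewrite cis_0; replace (C1 *v p) with p by (apply C3_eq; simpl; ring); auto).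
      pose proof (Hpsi (b t) (Hb t)) as F1; pose proof (Hpsi (b 0) (Hb 0)) as F2; rewrite Eb in F1, F2; rewrite E in F1; rewrite E0 in F2.
      fold a in F1, F2; rewrite F1 in F2 by auto; specialize (F2 Ha).
      apply (f_equal p0) in F2; unfold b in F2; simpl in F2; rewrite cis_0 in F2.
      assert (p0 p <> C0) as Hp0.
      { intros Z; apply Hq0'.
        assert (p0 q = C0) as Zq.
        { rewrite <- Ekp; unfold k; rewrite Z; destruct HG120 as [GZ _]; transitivity (p0 (G1 O3) -c p0 (pxz O3)); [simpl; change (mk3 C0 C0 C0) with O3; ring|exact GZ]. }
        apply C3_eq; [auto|rewrite Hq2, Zq; simpl; ring|rewrite Hq3, Zq; simpl; ring]. }
      replace (cis t) with (cis t *c p0 p /c p0 p) by (field; auto); rewrite F2; field; auto. }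
  split; [split|]; try apply Hiso.
  set (phi1 := fun q => p1 q -c p0 q *c u (p0 q)); set (phi2 := fun q => p2 q -c p0 q *c v (p0 q)).
  assert (Hphi1 : forall q, n3 q < rs -> exists U, tdiff phi1 q (e3 1 +v Copp C1 *v (U *v e3 0)) /\ (q = O3 -> U = C0)).
  { intros q Hq; destruct (excluded_middle_informative (q = O3)) as [->|Hn0].
    - exists C0; split; auto; pose proof (Hw1 u C0 Lu Du) as W1; rewrite Hu0 in W1; replace (C0 +c C0 *c Lu) with C0 in W1 by ring.
      exact (tdiff_add _ _ _ _ _ (tdiff_p1 O3) (tdiff_opp _ _ _ (Htd _ O3 _ W1))).
    - pose proof (Cnorm_p0 q); destruct (Huv (p0 q) ltac:(lra)) as [U [V [E1 _]]]; exists U; split; [|contradiction].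
      exact (tdiff_add _ _ _ _ _ (tdiff_p1 q) (tdiff_opp _ _ _ (Htd _ q _ E1))). }
  assert (Hphi2 : forall q, n3 q < rs -> exists U, tdiff phi2 q (e3 2 +v Copp C1 *v (U *v e3 0)) /\ (q = O3 -> U = C0)).
  { intros q Hq; destruct (excluded_middle_informative (q = O3)) as [->|Hn0].
    - exists C0; split; auto; pose proof (Hw1 v C0 Lv Dv) as W1; rewrite Hv0 in W1; replace (C0 +c C0 *c Lv) with C0 in W1 by ring.
      exact (tdiff_add _ _ _ _ _ (tdiff_p2 O3) (tdiff_opp _ _ _ (Htd _ O3 _ W1))).
    - pose proof (Cnorm_p0 q); destruct (Huv (p0 q) ltac:(lra)) as [U [V [_ [E1 _]]]]; exists V; split; [|contradiction].
      exact (tdiff_add _ _ _ _ _ (tdiff_p2 q) (tdiff_opp _ _ _ (Htd _ q _ E1))). }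
  assert (n3 O3 < rs) as HO by (rewrite n3_O3; auto).
  assert (grad phi1 O3 = e3 1) as Gr1.
  { destruct (Hphi1 O3 HO) as [U [E EU]]; rewrite (EU eq_refl) in E; rewrite (tdiff_grad_eq _ _ _ E); apply C3_eq; simpl; ring. }
  assert (grad phi2 O3 = e3 2) as Gr2.
  { destruct (Hphi2 O3 HO) as [U [E EU]]; rewrite (EU eq_refl) in E; rewrite (tdiff_grad_eq _ _ _ E); apply C3_eq; simpl; ring. }
  exists rs, phi1, phi2; split; auto; split; [apply holo_ball_Hol, Hol_intro; intros q Hq; destruct (Hphi1 q Hq) as [U [E _]]; eauto|].
  split; [apply holo_ball_Hol, Hol_intro; intros q Hq; destruct (Hphi2 q Hq) as [U [E _]]; eauto|].
  split; [unfold phi1; simpl; ring|]; split; [unfold phi2; simpl; ring|]; split; [|split].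
  - exists 1%nat, 2%nat; split; [lia|]; split; [lia|].
    rewrite <- !comp_grad by lia; rewrite Gr1, Gr2; simpl; intros Z; apply C1_neq_C0; rewrite <- Z; ring.
  - intros q; change (Defs.d0 phi1 q) with (dot (grad phi1 O3) q); change (Defs.d0 phi2 q) with (dot (grad phi2 O3) q); rewrite Gr1, Gr2; unfold dot; simpl; split.
    + intros [E1 E2]; exists (p0 q); apply C3_eq; simpl.
      * ring.
      * replace (p1 q) with (C0 *c p0 q +c (C1 *c p1 q +c C0 *c p2 q)) by ring; rewrite E1; ring.
      * replace (p2 q) with (C0 *c p0 q +c (C0 *c p1 q +c C1 *c p2 q)) by ring; rewrite E2; ring.
    + intros [lam ->]; simpl; split; ring.
  - intros q Hq; rewrite Hker by auto; unfold phi1, phi2; split.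
    + intros [-> ->]; split; ring.
    + intros [E1 E2]; split; apply Csub_eq0; auto.
Qed.

(** * Resonant Briot-Bouquet systems *)

Definition bb_many (s : BB) : Prop := exists U V : nat -> Cplx -> Cplx,
  (forall n, exists r, bbsol s r (U n) (V n)) /\ forall m n, m <> n -> ~ agree (U m) (V m) (U n) (V n).

Lemma agree_of_unshift (u v u' v' : Cplx -> Cplx) (c1 c2 : Cplx) : u C0 = C0 -> v C0 = C0 -> u' C0 = C0 -> v' C0 = C0 ->
  agree (unshift u c1) (unshift v c2) (unshift u' c1) (unshift v' c2) -> agree u v u' v'.
Proof.
  intros Hu Hv Hu' Hv' [d [Hd H]]; exists d; split; auto; intros x Hx; destruct (H x Hx) as [E1 E2].
  destruct (excluded_middle_informative (x = C0)) as [->|Hn]; [rewrite Hu, Hu', Hv, Hv'; auto|].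
  unfold unshift in E1, E2.
  assert (forall f f' : Cplx -> Cplx, forall c, x *c (f x +c c) = x *c (f' x +c c) -> f x = f' x) as K.
  { intros f f' c E; replace (f x) with (x *c (f x +c c) /c x -c c) by (field; auto); rewrite E; field; auto. }
  split; eapply K; eauto.
Qed.

Lemma bb_many_reduce (s : BB) : good_bb s -> bb_det s C1 <> C0 -> bb_many (reduce s) -> bb_many s.
Proof.
  intros Hg Hd [U [V [HS HD]]]; rewrite reduce_redc in HS.
  exists (fun n => unshift (U n) (cramer1 s)), (fun n => unshift (V n) (cramer2 s)); split.
  - intros n; destruct (HS n) as [r Hr]; exists r; apply redc_up; auto; apply cramer_shift; auto.
  - intros m n Hmn K; apply (HD m n Hmn); revert K.
    destruct (HS m) as [r [_ [A1 [A2 _]]]]; destruct (HS n) as [r' [_ [A3 [A4 _]]]]; apply agree_of_unshift; auto.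
Qed.

Lemma bbsol_reduce (s : BB) (r : R) (u v : Cplx -> Cplx) : good_bb s -> bb_det s C1 <> C0 -> bbsol s r u v ->
  exists u' v', bbsol (reduce s) r u' v'.
Proof.
  intros Hg Hd Hs; destruct (bbsol_derivative s r u v Hg Hs) as [c1 [c2 [D1 [D2 E]]]].
  apply cramer_shift in E; auto; destruct E as [-> ->]; rewrite reduce_redc.
  eexists; eexists; eapply redc_down; eauto.
Qed.

(** Families of solutions are carried up from the reduced system and single solutions down to it;
    the two directions serve existence and nonexistence. *)
Lemma bb_iter_reduce (n : nat) (s : BB) : good_bb s -> (forall j, (1 <= j <= n)%nat -> bb_det s (RtoC (INR j)) <> C0) ->
  let s' := Nat.iter n reduce s in
  good_bb s' /\ bb_m11 s' = bb_m11 s -c RtoC (INR n) /\ bb_m12 s' = bb_m12 s /\ bb_m21 s' = bb_m21 s /\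
  bb_m22 s' = bb_m22 s -c RtoC (INR n) /\ (bb_many s' -> bb_many s) /\
  forall r u v, bbsol s r u v -> exists u' v', bbsol s' r u' v'.
Proof.
  revert s; induction n as [|n IH]; intros s Hg Hd s'; unfold s'.
  - simpl; change (RtoC 0) with C0; repeat split; try apply Hg; try ring; eauto.
  - rewrite Nat.iter_succ_r.
    assert (bb_det s C1 <> C0) as Hd1 by (apply (Hd 1%nat); lia).
    destruct (IH (reduce s)) as [A [A1 [A2 [A3 [A4 [A5 A6]]]]]].
    + rewrite reduce_redc; apply redc_good; auto.
    + intros j Hj; rewrite reduce_redc, bb_det_redc, <- RtoC_INR_S; apply Hd; lia.
    + split; [exact A|]; rewrite A1, A2, A3, A4, RtoC_INR_S; simpl.
      repeat split; try ring.
      * intros HM; apply bb_many_reduce; auto.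
      * intros r u v Hs; destruct (bbsol_reduce s r u v Hg Hd1 Hs) as [u' [v' Hs']]; eauto.
Qed.

(** Each admissible [c] leads to a reduced system whose eigenvalues have passed the resonance, hence
    to a solution. Solutions for different [c] have different derivatives at 0. *)
Lemma bb_many_shift (s : BB) (c1 c2 : nat -> Cplx) : good_bb s ->
  (forall j, (2 <= j)%nat -> bb_det s (RtoC (INR j)) <> C0) ->
  (forall n, shift_eq s (c1 n) (c2 n)) -> (forall m n, m <> n -> c1 m <> c1 n \/ c2 m <> c2 n) -> bb_many s.
Proof.
  intros Hg Hd Hc Hinj.
  assert (forall n, exists uv : (Cplx -> Cplx) * (Cplx -> Cplx), exists r, bbsol (redc (c1 n) (c2 n) s) r (fst uv) (snd uv)) as HE.
  { intros n; destruct (bb_unique_nonresonant (redc (c1 n) (c2 n) s)) as [[r [u [v Hs]]] _].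
    - apply redc_good; auto.
    - intros j Hj; rewrite bb_det_redc, <- RtoC_INR_S; apply Hd; lia.
    - exists (u, v), r; auto. }
  set (W := fun n => proj1_sig (constructive_indefinite_description _ (HE n))).
  assert (HW : forall n, exists r, bbsol (redc (c1 n) (c2 n) s) r (fst (W n)) (snd (W n))) by (intros n; exact (proj2_sig (constructive_indefinite_description _ (HE n)))).
  clearbody W.
  exists (fun n => unshift (fst (W n)) (c1 n)), (fun n => unshift (snd (W n)) (c2 n)); split.
  - intros n; destruct (HW n) as [r Hr]; exists r; apply redc_up; auto.
  - intros m n Hmn [d [Hd0 HK]].
    assert (forall k, cder (unshift (fst (W k)) (c1 k)) C0 (c1 k) /\ cder (unshift (snd (W k)) (c2 k)) C0 (c2 k)) as HD.
    { intros k; destruct (HW k) as [r [Hr [A1 [A2 A3]]]]; destruct (A3 C0) as [L1 [L2 [D1 [D2 _]]]]; [rewrite Cnorm_C0; auto|].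
      pose proof (cder_unshift _ (c1 k) _ _ D1) as K1; pose proof (cder_unshift _ (c2 k) _ _ D2) as K2; rewrite A1 in K1; rewrite A2 in K2.
      replace (C0 +c c1 k +c C0 *c L1) with (c1 k) in K1 by ring; replace (C0 +c c2 k +c C0 *c L2) with (c2 k) in K2 by ring; auto. }
    destruct (HD m) as [M1 M2]; destruct (HD n) as [N1 N2].
    destruct (Hinj m n Hmn) as [E|E]; apply E; [apply (cder_unique (unshift (fst (W n)) (c1 n)) C0)|apply (cder_unique (unshift (snd (W n)) (c2 n)) C0)]; auto.
    + apply (cder_ext_loc (unshift (fst (W m)) (c1 m)) _ _ _ d); auto; intros w Hw; apply HK; replace (w -c C0) with w in Hw by ring; auto.
    + apply (cder_ext_loc (unshift (snd (W m)) (c2 m)) _ _ _ d); auto; intros w Hw; apply HK; replace (w -c C0) with w in Hw by ring; auto.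
Qed.

Lemma RtoC_INR_inj (m n : nat) : RtoC (INR m) = RtoC (INR n) -> m = n.
Proof. intros E; apply INR_eq; exact (f_equal Re E). Qed.

Lemma RtoC_INR_sub_neq0 (m n : nat) : m <> n -> RtoC (INR m) -c RtoC (INR n) <> C0.
Proof. intros H E; apply H, RtoC_INR_inj, Csub_eq0; auto. Qed.

(** The two alternatives are the x-direction, with exponents 0 and n + 1, and the z-direction, with
    a Jordan block at n + 1. After [n] reductions the second row of the matrix is (0, 1), so the
    second equation for [c] says just that the second constant is 0. *)
Theorem bb_resonant (s : BB) (n a : nat) : good_bb s -> bb_m21 s = C0 -> bb_m22 s = RtoC (INR (S n)) ->
  bb_m11 s = RtoC (INR a) -> a = 0%nat \/ a = S n /\ bb_m12 s <> C0 ->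
  let s' := Nat.iter n reduce s in
  (bb_a2 s' = C0 -> bb_many s) /\ (bb_a2 s' <> C0 -> forall r u v, ~ bbsol s r u v).
Proof.
  intros Hg M21 M22 M11 Ha s'.
  assert (Hdet : forall j, (1 <= j)%nat -> j <> S n -> bb_det s (RtoC (INR j)) <> C0).
  { intros j Hj Hjn; unfold bb_det; rewrite M21, M22, M11.
    replace (bb_m12 s *c C0) with C0 by ring; intros E; apply Csub_eq0 in E; revert E.
    apply Cmul_neq0; apply RtoC_INR_sub_neq0; lia. }
  destruct (bb_iter_reduce n s Hg) as [G' [N11 [N12 [N21 [N22 [Hm Hs]]]]]]; [intros j Hj; apply Hdet; lia|]; fold s' in G', N11, N12, N21, N22, Hm, Hs.
  rewrite M21 in N21; rewrite M22, RtoC_INR_S in N22; replace (RtoC (INR n) +c C1 -c RtoC (INR n)) with C1 in N22 by ring.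
  split; intros Ha2.
  - apply Hm; assert (forall j, (2 <= j)%nat -> bb_det s' (RtoC (INR j)) <> C0) as Hd'.
    { intros j Hj; specialize (Hdet (j + n)%nat ltac:(lia) ltac:(lia)); rewrite plus_INR, RtoC_add in Hdet.
      unfold bb_det in *; rewrite N11, N12, N21, N22; rewrite M21, M22, RtoC_INR_S in Hdet; intros E; apply Hdet; etransitivity; [|exact E]; ring. }
    destruct Ha as [->|[-> Hb]].
    (* The first diagonal entry is now -n, different from 1: [c2] is free and determines [c1]. *)
    + assert (C1 -c bb_m11 s' <> C0) as Hne.
      { rewrite N11, M11; change (RtoC (INR 0)) with C0; intros E; apply (RtoC_neq0 (INR (S n)) ltac:(apply not_0_INR; lia)).
        rewrite RtoC_INR_S; etransitivity; [|exact E]; ring. }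
      apply (bb_many_shift s' (fun j => (bb_a1 s' +c bb_m12 s' *c RtoC (INR j)) /c (C1 -c bb_m11 s')) (fun j => RtoC (INR j))); auto.
      * intros j; unfold shift_eq; rewrite Ha2, N21, N22; split; [field; auto|ring].
      * intros i j Hij; right; contradict Hij; apply RtoC_INR_inj; auto.
    (* Both diagonal entries are now 1: the nonzero [bb_m12] determines [c2], and [c1] is free. *)
    + rewrite M11, RtoC_INR_S in N11; replace (RtoC (INR n) +c C1 -c RtoC (INR n)) with C1 in N11 by ring.
      apply (bb_many_shift s' (fun j => RtoC (INR j)) (fun j => Copp (bb_a1 s') /c bb_m12 s')); auto.
      * intros j; unfold shift_eq; rewrite Ha2, N21, N22, N11, N12; split; [field; auto|ring].
      * intros i j Hij; left; contradict Hij; apply RtoC_INR_inj; auto.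
  - intros r u v H; destruct (Hs r u v H) as [u' [v' H']].
    destruct (bbsol_derivative s' r u' v' G' H') as [c1 [c2 [_ [_ [_ E]]]]]; rewrite N21, N22 in E.
    apply Ha2; transitivity (bb_a2 s' +c (C0 *c c1 +c C1 *c c2) -c c2); [ring|rewrite <- E; ring].
Qed.

(** * Center manifolds tangent to an axis *)

Lemma agree_of_graphs (r r' rho : R) (s : BB) (u v u' v' : Cplx -> Cplx) : bbsol s r u v -> bbsol s r' u' v' -> 0 < rho ->
  (forall q, n3 q < rho -> p1 q = p0 q *c u (p0 q) /\ p2 q = p0 q *c v (p0 q) -> p1 q = p0 q *c u' (p0 q) /\ p2 q = p0 q *c v' (p0 q)) ->
  agree u v u' v'.
Proof.
  intros [Hr [Hu [Hv H]]] [_ [Hu' [Hv' _]]] Hrho HK.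
  destruct (H C0) as [L1 [L2 [D1 [D2 _]]]]; [rewrite Cnorm_C0; auto|].
  destruct (small_triple (fun x => x *c u x) (fun x => x *c v x) _ _ rho Hrho ltac:(cbv beta; ring) ltac:(cbv beta; ring)
    (cder_mul _ _ _ _ _ (cder_id C0) D1) (cder_mul _ _ _ _ _ (cder_id C0) D2)) as [d [Hd Hs]].
  exists d; split; auto; intros x Hx.
  destruct (excluded_middle_informative (x = C0)) as [->|Hn]; [rewrite Hu, Hu', Hv, Hv'; auto|].
  destruct (HK _ (Hs x Hx)) as [E1 E2]; [simpl; auto|]; simpl in E1, E2.
  split; [replace (u x) with (x *c u x /c x) by (field; auto); rewrite E1|replace (v x) with (x *c v x /c x) by (field; auto); rewrite E2]; field; auto.
Qed.

(** Existence comes from the unique solution of the Briot-Bouquet system; any other manifold also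
    gives a solution, whose germ must be the same. *)
Theorem axis_manifold_unique (w : R) (l1 l2 b11 b12 b21 b22 : Cplx) (f g h P Q Rf : C3 -> Cplx) :
  w <> 0 -> axis_system (Ci *c RtoC w) l1 l2 b11 b12 b21 b22 f g h P Q Rf -> nonresonant (bb_x P Q Rf) ->
  exists S, cm_axis 0 (field3 P Q Rf) S /\ isochronous (field3 P Q Rf) S (2 * PI / Rabs w) /\
    forall S', cm_axis 0 (field3 P Q Rf) S' -> germ_eq S S'.
Proof.
  intros Hw HA HN; destruct (bb_unique_nonresonant _ (proj1 (bb_x_good _ _ _ _ _ _ _ _ _ _ _ _ _ HA)) HN) as [[r [u [v Hs]]] HU].
  destruct (bbsol_axis_manifold w _ _ _ _ _ _ _ _ _ _ _ _ r u v Hw HA Hs) as [rho [Hrho [K1 K2]]].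
  eexists; split; [exact K1|]; split; [exact K2|]; intros S' HS'.
  destruct (axis_manifold_bbsol _ _ _ _ _ _ _ _ _ _ _ _ _ S' HA HS') as [r' [u' [v' [rho' [Hs' [Hrho' HC]]]]]].
  destruct (HU _ _ _ _ _ _ Hs Hs') as [d [Hd E]].
  exists (Rmin d (Rmin rho rho')); split; [repeat apply Rmin_glb_lt; auto|]; intros q Hq.
  pose proof (Rmin_l d (Rmin rho rho')); pose proof (Rmin_r d (Rmin rho rho')); pose proof (Rmin_l rho rho'); pose proof (Rmin_r rho rho').
  pose proof (Cnorm_p0 q); rewrite HC by lra; destruct (E (p0 q) ltac:(lra)) as [-> ->]; intuition lra.
Qed.

Theorem axis_manifold_many (w : R) (l1 l2 b11 b12 b21 b22 : Cplx) (f g h P Q Rf : C3 -> Cplx) :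
  w <> 0 -> axis_system (Ci *c RtoC w) l1 l2 b11 b12 b21 b22 f g h P Q Rf -> bb_many (bb_x P Q Rf) ->
  infinitely_many (fun S => cm_axis 0 (field3 P Q Rf) S /\ isochronous (field3 P Q Rf) S (2 * PI / Rabs w)).
Proof.
  intros Hw HA [U [V [HS HD]]].
  assert (forall n, exists rho, 0 < rho /\ let S := fun q => n3 q < rho /\ p1 q = p0 q *c U n (p0 q) /\ p2 q = p0 q *c V n (p0 q) in
    cm_axis 0 (field3 P Q Rf) S /\ isochronous (field3 P Q Rf) S (2 * PI / Rabs w)) as HE.
  { intros n; destruct (HS n) as [r Hs]; exact (bbsol_axis_manifold w _ _ _ _ _ _ _ _ _ _ _ _ r (U n) (V n) Hw HA Hs). }
  set (rho := fun n => proj1_sig (constructive_indefinite_description _ (HE n))).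
  assert (Hrho := fun n => proj2_sig (constructive_indefinite_description _ (HE n))); change (forall n, 0 < rho n /\ let S := fun q => n3 q < rho n /\ p1 q = p0 q *c U n (p0 q) /\ p2 q = p0 q *c V n (p0 q) in
    cm_axis 0 (field3 P Q Rf) S /\ isochronous (field3 P Q Rf) S (2 * PI / Rabs w)) in Hrho; clearbody rho.
  exists (fun n q => n3 q < rho n /\ p1 q = p0 q *c U n (p0 q) /\ p2 q = p0 q *c V n (p0 q)); split; [intros n; apply Hrho|].
  intros m n Hmn [d [Hd K]]; apply (HD m n Hmn).
  destruct (HS m) as [r Hm]; destruct (HS n) as [r' Hn].
  pose proof (Rmin_l d (rho m)); pose proof (Rmin_r d (rho m)).
  apply (agree_of_graphs r r' (Rmin d (rho m)) _ _ _ _ _ Hm Hn); [apply Rmin_glb_lt; auto; apply Hrho|].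
  intros q Hq E; apply (K q ltac:(lra)); split; [lra|auto].
Qed.

Lemma axis_manifold_none (mu l1 l2 b11 b12 b21 b22 : Cplx) (f g h P Q Rf : C3 -> Cplx) :
  axis_system mu l1 l2 b11 b12 b21 b22 f g h P Q Rf -> (forall r u v, ~ bbsol (bb_x P Q Rf) r u v) ->
  ~ exists S, cm_axis 0 (field3 P Q Rf) S.
Proof.
  intros HA HN [S HS]; destruct (axis_manifold_bbsol _ _ _ _ _ _ _ _ _ _ _ _ _ S HA HS) as [r [u [v [rho [Hs _]]]]].
  apply (HN _ _ _ Hs).
Qed.

(** * Cyclic permutation of the coordinates *)

Definition rot (p : C3) : C3 := mk3 (p1 p) (p2 p) (p0 p).
(** The pullback of the field by [rot]: [rot (Rot X p) = X (rot p)]. Coordinate [j] of [rot q] is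
    coordinate [next_axis j] of [q]. *)
Definition Rot (X : C3 -> C3) (p : C3) : C3 := let q := X (rot p) in mk3 (p2 q) (p0 q) (p1 q).
Definition next_axis (t : nat) : nat := match t with 0%nat => 1%nat | 1%nat => 2%nat | _ => 0%nat end.

Lemma rot3 (p : C3) : rot (rot (rot p)) = p.
Proof. destruct p; reflexivity. Qed.

(** Since the permutation has order three, its inverse is its square; transfer lemmas in one
    direction suffice. *)
Lemma Rot3 (X : C3 -> C3) : Rot (Rot (Rot X)) = X.
Proof. apply functional_extensionality; intros p; unfold Rot; rewrite rot3; simpl; destruct (X p); reflexivity. Qed.

Lemma n3_rot (p : C3) : n3 (rot p) = n3 p.
Proof. unfold n3; simpl; f_equal; ring. Qed.

Lemma is_global_sol_rot (X : C3 -> C3) (phi : R -> C3) : is_global_sol (Rot X) phi -> is_global_sol X (fun t => rot (phi t)).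
Proof.
  intros H t i Hi; pose proof (H t (next_axis i) ltac:(destruct i as [|[|]]; simpl; lia)) as K.
  destruct i as [|[|]]; exact K.
Qed.

Lemma is_sol_rot (X : C3 -> C3) (a b : R) (phi : R -> C3) : is_sol (Rot X) a b phi -> is_sol X a b (fun t => rot (phi t)).
Proof.
  intros H t Ht i Hi; pose proof (H t Ht (next_axis i) ltac:(destruct i as [|[|]]; simpl; lia)) as K.
  destruct i as [|[|]]; exact K.
Qed.

Lemma holo_ball_rot (r : R) (f : C3 -> Cplx) : holo_ball r f -> holo_ball r (fun q => f (rot q)).
Proof.
  intros H q Hq; rewrite <- n3_rot in Hq; destruct (H _ Hq) as [K1 K2]; split.
  - intros eps Heps; destruct (K1 eps Heps) as [d [Hd K]]; exists d; split; auto; intros q' Hq'.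
    apply K; rewrite <- n3_rot in Hq'; exact Hq'.
  - intros i Hi; destruct i as [|[|[|i]]]; [exact (K2 2%nat ltac:(lia))|exact (K2 0%nat ltac:(lia))|exact (K2 1%nat ltac:(lia))|lia].
Qed.

Lemma holo_near0_rot (f : C3 -> Cplx) : holo_near0 f -> holo_near0 (fun q => f (rot q)).
Proof. intros [r [Hr H]]; exists r; split; auto; apply holo_ball_rot; auto. Qed.

Lemma pd_rot (j : nat) (f : C3 -> Cplx) : (j < 3)%nat -> pd (next_axis j) (fun q => f (rot q)) O3 = pd j f O3.
Proof. intros Hj; destruct j as [|[|[|j]]]; [reflexivity|reflexivity|reflexivity|lia]. Qed.

Lemma order_ge2_rot (f : C3 -> Cplx) : order_ge2 f -> order_ge2 (fun q => f (rot q)).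
Proof.
  intros [H K]; split; [exact H|]; intros i Hi.
  destruct i as [|[|[|i]]]; [exact (K 2%nat ltac:(lia))|exact (K 0%nat ltac:(lia))|exact (K 1%nat ltac:(lia))|lia].
Qed.

Lemma d0_rot (f : C3 -> Cplx) (v : C3) : d0 (fun q => f (rot q)) v = d0 f (rot v).
Proof.
  unfold d0; rewrite <- (pd_rot 0 f), <- (pd_rot 1 f), <- (pd_rot 2 f) by lia; simpl; ring.
Qed.

Lemma rot_axis (t : nat) (v : C3) : (exists lam, rot v = lam *v e3 t) <-> exists lam, v = lam *v e3 (next_axis t).
Proof.
  destruct v as [a b c]; split; intros [lam E]; exists lam; unfold rot in *; simpl in *;
  destruct t as [|[|]]; simpl in *; injection E; intros -> -> ->; reflexivity.
Qed.

Lemma invariant_rot (X : C3 -> C3) (S : C3 -> Prop) : invariant X S -> invariant (Rot X) (fun q => S (rot q)).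
Proof.
  intros [r [Hr H]]; exists r; split; auto; intros q Hq HS eps phi Heps Hphi E.
  rewrite <- n3_rot in Hq; apply (H (rot q) Hq HS eps (fun t => rot (phi t)) Heps); [apply is_sol_rot; auto|rewrite E; auto].
Qed.

Lemma cm_axis_rot (t : nat) (X : C3 -> C3) (S : C3 -> Prop) : cm_axis t X S -> cm_axis (next_axis t) (Rot X) (fun q => S (rot q)).
Proof.
  intros [[r [f1 [f2 [Hr [H1 [H2 [Z1 [Z2 [[j [k [Hj [Hk Hjk]]]] [HT HS]]]]]]]]]] HI]; split; [|apply invariant_rot; auto].
  exists r, (fun q => f1 (rot q)), (fun q => f2 (rot q)); split; auto; split; [apply holo_ball_rot; auto|]; split; [apply holo_ball_rot; auto|].
  split; [exact Z1|]; split; [exact Z2|]; split; [|split].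
  - exists (next_axis j), (next_axis k); rewrite !pd_rot by auto; split; [destruct j as [|[|]]; simpl; lia|]; split; [destruct k as [|[|]]; simpl; lia|auto].
  - intros v; rewrite !d0_rot, HT; apply rot_axis.
  - intros q Hq; apply HS; rewrite n3_rot; auto.
Qed.

Lemma germ_eq_rot (S S' : C3 -> Prop) : germ_eq S S' -> germ_eq (fun q => S (rot q)) (fun q => S' (rot q)).
Proof. intros [r [Hr H]]; exists r; split; auto; intros q Hq; apply H; rewrite n3_rot; auto. Qed.

Lemma isochronous_rot (X : C3 -> C3) (S : C3 -> Prop) (T : R) : isochronous X S T -> isochronous (Rot X) (fun q => S (rot q)) T.
Proof.
  intros [d [Hd H]]; exists d; split; auto; intros q HS Hq; rewrite <- n3_rot in Hq.
  destruct (H _ HS Hq) as [[phi [H1 H2]] H3]; split.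
  - exists (fun t => rot (rot (phi t))); split; [|rewrite H2; apply rot3].
    apply (is_global_sol_rot (Rot X) (fun t => rot (phi t))), is_global_sol_rot; rewrite Rot3; auto.
  - intros psi K1 K2; destruct (H3 (fun t => rot (psi t))) as [K3 K4]; [apply is_global_sol_rot; auto|rewrite K2; auto|].
    split; intros t; [rewrite <- (rot3 (psi (t + T))), K3; apply rot3|].
    intros Ht E; apply (K4 t Ht); rewrite E; auto.
Qed.

Definition unique_axis_family (t : nat) (X : C3 -> C3) (T : R) : Prop :=
  exists S, cm_axis t X S /\ isochronous X S T /\ forall S', cm_axis t X S' -> germ_eq S S'.
Definition many_axis_families (t : nat) (X : C3 -> C3) (T : R) : Prop :=
  infinitely_many (fun S => cm_axis t X S /\ isochronous X S T).

Lemma rot3_set (S : C3 -> Prop) : (fun q => S (rot (rot (rot q)))) = S.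
Proof. apply functional_extensionality; intros q; rewrite rot3; auto. Qed.

Lemma unique_axis_family_rot (t : nat) (X : C3 -> C3) (T : R) : (t < 3)%nat ->
  unique_axis_family t X T -> unique_axis_family (next_axis t) (Rot X) T.
Proof.
  intros Ht [S [H1 [H2 H3]]]; exists (fun q => S (rot q)); split; [apply cm_axis_rot; auto|]; split; [apply isochronous_rot; auto|].
  intros S' H'; do 2 apply cm_axis_rot in H'; rewrite Rot3 in H'.
  replace (next_axis (next_axis (next_axis t))) with t in H' by (destruct t as [|[|[|]]]; simpl; lia).
  pose proof (germ_eq_rot _ _ (H3 _ H')) as K; cbv beta in K; rewrite (rot3_set S') in K; auto.
Qed.

Lemma many_axis_families_rot (t : nat) (X : C3 -> C3) (T : R) :
  many_axis_families t X T -> many_axis_families (next_axis t) (Rot X) T.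
Proof.
  intros [Sf [H1 H2]]; exists (fun n q => Sf n (rot q)); split.
  - intros n; destruct (H1 n); split; [apply cm_axis_rot; auto|apply isochronous_rot; auto].
  - intros m n Hmn K; apply (H2 m n Hmn); do 2 apply germ_eq_rot in K; cbv beta in K.
    rewrite (rot3_set (Sf m)), (rot3_set (Sf n)) in K; auto.
Qed.

(** * No manifold along the axis that feeds the nilpotent part *)

(** The coordinates are (y, z, x). On a curve x = be(y) with be'(0) = 0, the tangency equation
    equates x' = y + mu x + f, whose derivative at y = 0 is 1, with be'(y) y', whose derivative
    there is 0. *)
Lemma no_shear_axis_manifold (mu nu : Cplx) (f g h : C3 -> Cplx) (S : C3 -> Prop) :
  good_F f -> good_F g -> good_F h ->
  ~ cm_axis 0 (field3 (lin_form mu C0 C0 g) (lin_form C0 nu C0 h) (lin_form C1 C0 mu f)) S.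
Proof.
  intros [Of [rf [Hrf Hf]]] [Og [rg [Hrg Hg]]] [Oh [rh [Hrh Hh]]]; set (Y := field3 _ _ _); intros HS.
  assert (HolV (Rmin rf (Rmin rg rh)) Y) as HY.
  { pose proof (Rmin_l rf (Rmin rg rh)); pose proof (Rmin_r rf (Rmin rg rh)); pose proof (Rmin_l rg rh); pose proof (Rmin_r rg rh).
    repeat split; unfold Y; simpl; apply lin_form_Hol; [apply (Hol_sub rg)|apply (Hol_sub rh)|apply (Hol_sub rf)]; auto; lra. }
  destruct (axis_manifold_curve Y S _ (Rmin_glb_lt _ _ _ Hrf (Rmin_glb_lt _ _ _ Hrg Hrh)) HY HS)
    as [rho [al [be [Hrho [A0 [B0 [DA [DB [_ HT]]]]]]]]].
  assert (hol1 be C0 rho) as Hbe.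
  { intros z Hz; replace (z -c C0) with z in Hz by ring; destruct (HT z Hz) as [A [B [_ [K _]]]]; eauto. }
  destruct (hol1_choose be C0 rho Hbe) as [db Db]; destruct (hol1_derivative be db C0 rho Hrho Db) as [L DL].
  assert (db C0 = C0) as Edb by (apply (cder_unique be C0); auto; apply Db; rewrite Cnorm_self; auto).
  set (c := fun x => mk3 x (al x) (be x)).
  assert (c C0 = O3) as Ec by (unfold c; rewrite A0, B0; reflexivity).
  assert (forall F l, tdiff F O3 l -> cder (fun x => F (c x)) C0 (p0 l)) as Hc.
  { intros F l HF; replace (p0 l) with (dot l (e3 0)) by (unfold dot; simpl; ring).
    apply (tdiff_comp_cder F c C0); [rewrite Ec; exact HF|exact (cder_id C0)|exact DA|exact DB]. }
  pose proof (Hc (lin_form C1 C0 mu f) _ (tdiff_lin_form _ _ _ _ _ _ (order2_tdiff f rf Hrf Hf Of))) as K2.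
  pose proof (Hc (lin_form mu C0 C0 g) _ (tdiff_lin_form _ _ _ _ _ _ (order2_tdiff g rg Hrg Hg Og))) as K0.
  pose proof (cder_mul _ _ _ _ _ DL K0) as K; cbv beta in K; rewrite Ec, Edb in K.
  assert (lin_form mu C0 C0 g O3 = C0) as E0 by (unfold lin_form; rewrite (proj1 Og); simpl; ring).
  rewrite E0 in K; simpl in K, K2.
  apply C1_neq_C0; transitivity (C1 +c C0); [ring|].
  transitivity (L *c C0 +c C0 *c (mu +c C0)); [|ring].
  eapply cder_unique; [exact K2|].
  apply (cder_ext_loc (fun x => db x *c lin_form mu C0 C0 g (c x)) _ _ _ rho Hrho); [|exact K].
  intros x Hx; pose proof (Db x Hx) as D; replace (x -c C0) with x in Hx by ring; destruct (HT x Hx) as [A [B [_ [E2 [_ E3]]]]].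
  rewrite (cder_unique _ _ _ _ D E2); symmetry; exact E3.
Qed.

(** * Center manifolds tangent to the [(x,z)]-plane *)

(** The implicit function theorem once more, with the chart (x, psi, z). The graph function [al]
    does not depend on y; [ga] and [gb] are its derivatives in x and z, evaluated on the plane. *)
Lemma xz_manifold_graph (X : C3 -> C3) (S : C3 -> Prop) (R0 : R) : 0 < R0 -> HolV R0 X -> cm_xz X S ->
  exists d al ga gb, 0 < d /\ order_ge2 al /\ (forall q, al (pxz q) = al q) /\
    (forall q, n3 q < d -> tdiff al q (mk3 (ga (pxz q)) C0 (gb (pxz q)))) /\
    (forall q, n3 q < d -> (S q <-> p1 q = al q)) /\
    (forall q, n3 q < d -> S q -> p1 (X q) = ga (pxz q) *c p0 (X q) +c gb (pxz q) *c p2 (X q)).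
Proof.
  intros HR HX [[r [f [Hr [Hf [Z [[j [Hj Hne]] [Hker HS]]]]]]] HI].
  apply holo_ball_Hol in Hf.
  assert (n3 O3 < r) as HO by (rewrite n3_O3; auto).
  rewrite <- comp_grad in Hne by auto.
  change (forall v, dot (grad f O3) v = C0 <-> exists lam mu, v = lam *v e3 0 +v mu *v e3 2) in Hker.
  destruct (grad f O3) as [a0 a1 a2] eqn:G.
  assert (a0 = C0 /\ a2 = C0) as [-> ->].
  { assert (dot (mk3 a0 a1 a2) (e3 0) = C0) as E1 by (apply Hker; exists C1, C0; apply C3_eq; simpl; ring).
    assert (dot (mk3 a0 a1 a2) (e3 2) = C0) as E2 by (apply Hker; exists C0, C1; apply C3_eq; simpl; ring).
    unfold dot in E1, E2; simpl in E1, E2; split; etransitivity; [|exact E1| |exact E2]; ring. }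
  assert (a1 <> C0) as Ha by (intros ->; apply Hne; destruct j as [|[|]]; reflexivity).
  set (psi := fun p => Cinv a1 *c f p).
  assert (Hpsi : Hol r psi) by (apply Hol_mul; [apply Hol_const|auto]).
  assert (Hzero : forall p, f p = C0 <-> psi p = C0).
  { intros p; unfold psi; split; [intros ->; ring|intros E; transitivity (a1 *c (Cinv a1 *c f p)); [field; auto|rewrite E; ring]]. }
  set (N := fun p => mk3 C0 (psi p -c p1 p) C0).
  assert (HN : HolV r N) by (repeat split; unfold N; simpl; [apply Hol_const|apply Hol_csub; auto; apply Hol_p1|apply Hol_const]).
  assert (Hzero2 : order_ge2 (fun _ => C0)) by (apply order2_intro; [reflexivity|exact (tdiff_const C0 O3)]).
  assert (HN2 : order2V N).
  { split; [exact Hzero2|split; [|exact Hzero2]]; unfold N; simpl; apply order2_intro; [unfold psi; rewrite Z; simpl; ring|].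
    pose proof (Hf O3 HO) as T; rewrite G in T.
    pose proof (tdiff_add _ _ _ _ _ (tdiff_mul _ _ _ _ _ (tdiff_const (Cinv a1) O3) T) (tdiff_opp _ _ _ (tdiff_p1 O3))) as K.
    cbv beta in K; match type of K with tdiff _ _ ?l => replace l with O3 in K by (apply C3_eq; simpl; field; auto) end; exact K. }
  destruct (inverse_near_identity N r Hr HN HN2) as [d [Psi [Hd [Hdr [[Q0 [Q1 Q2]] [HP1 [HP2 [_ [HP4 _]]]]]]]]].
  set (al := fun q => p1 (Psi (pxz q))).
  set (ga := fun q => p0 (grad (fun q => p1 (Psi q)) q)); set (gb := fun q => p2 (grad (fun q => p1 (Psi q)) q)).
  assert (Hal : forall q l, tdiff (fun q => p1 (Psi q)) (pxz q) l -> tdiff al q (mk3 (p0 l) C0 (p2 l))).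
  { intros q l Hl; pose proof (tdiff_comp _ pxz q l _ _ _ Hl (tdiff_p0 q) (tdiff_const C0 q) (tdiff_p2 q)) as K.
    match type of K with tdiff _ _ ?m => replace m with (mk3 (p0 l) C0 (p2 l)) in K by (apply C3_eq; unfold scomb; simpl; ring) end; exact K. }
  assert (HPxz : forall q, n3 q < d -> Psi (pxz q) = mk3 (p0 q) (al q) (p2 q)).
  { intros q Hq; pose proof (n3_pxz q); destruct (HP1 (pxz q) ltac:(lra)) as [_ E]; apply C3_eq; [|reflexivity|];
    [apply (f_equal p0) in E|apply (f_equal p2) in E]; simpl in E |- *; etransitivity; [|exact E| |exact E]; ring. }
  assert (HSal : forall q, n3 q < d -> (S q <-> p1 q = al q)).
  { intros q Hq; rewrite HS, Hzero by lra; pose proof (n3_pxz q).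
    assert (q +v N q = mk3 (p0 q) (psi q) (p2 q)) as EN by (apply C3_eq; unfold N; simpl; ring).
    split; intros E.
    - rewrite E in EN; pose proof (HP2 q Hq) as K; rewrite EN in K; fold (pxz q) in K; unfold al; rewrite K by lra; auto.
    - assert (Psi (pxz q) = q) as K by (rewrite HPxz by auto; apply C3_eq; auto).
      destruct (HP1 (pxz q) ltac:(lra)) as [_ E2]; rewrite K, EN in E2; exact (f_equal p1 E2). }
  destruct (invariant_tangent X S R0 d (fun q => p1 q -c al q) HR Hd HX HI) as [e [He K]].
  { intros q Hq HSq; rewrite (proj1 (HSal q Hq) HSq); ring. }
  assert (Halt : forall q, n3 q < d -> tdiff al q (mk3 (ga (pxz q)) C0 (gb (pxz q)))) by (intros q Hq; pose proof (n3_pxz q); apply Hal, Q1; lra).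
  pose proof (Rmin_l d e); pose proof (Rmin_r d e).
  exists (Rmin d e), al, ga, gb; split; [apply Rmin_glb_lt; auto|]; split; [|split; [reflexivity|]; split; [|split]].
  - assert (tdiff al O3 O3) as T by (exact (Hal O3 _ HP4)).
    apply order2_intro; auto; unfold al; change (pxz O3) with O3.
    destruct (HP1 O3 ltac:(rewrite n3_O3; auto)) as [E _]; rewrite n3_O3 in E.
    assert (Psi O3 = O3) as -> by (apply n3_eq0, Rle_antisym; [lra|apply n3_ge0]); reflexivity.
  - intros q Hq; apply Halt; lra.
  - intros q Hq; apply HSal; lra.
  - intros q Hq HSq; specialize (K q _ ltac:(lra) HSq (tdiff_add _ _ _ _ _ (tdiff_p1 q) (tdiff_opp _ _ _ (Halt q ltac:(lra))))).
    apply Csub_eq0; etransitivity; [|exact K]; unfold dot; simpl; ring.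
Qed.

Lemma near_pxz_small (rho e : R) (Gam : C3 -> C3) : 0 < rho -> 0 < e -> HolV rho Gam -> order2V (fun p => Gam p -v pxz p) ->
  exists d, 0 < d <= rho /\ forall p, n3 p < d -> n3 (Gam p) < e.
Proof.
  intros Hrho He HG H2; destruct (order2V_wle2 rho (fun p => Gam p -v pxz p) Hrho) as [d [c [Hd [Hc K]]]]; auto.
  { apply HolV_csub; auto; apply HolV_pxz. }
  pose proof (Rmin_l d (Rmin 1 (e / (1 + c)))); pose proof (Rmin_r d (Rmin 1 (e / (1 + c)))); pose proof (Rmin_l 1 (e / (1 + c))); pose proof (Rmin_r 1 (e / (1 + c))).
  exists (Rmin d (Rmin 1 (e / (1 + c)))); split.
  { split; [repeat apply Rmin_glb_lt; [lra|lra|apply Rdiv_lt_0_compat; lra]|lra]. }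
  intros p Hp; pose proof (K p ltac:(lra)) as E; cbv beta in E; pose proof (n3_le_sub (Gam p) (pxz p)); pose proof (n3_pxz p); pose proof (n3_ge0 p).
  assert (n3 p * (1 + c) < e) by (apply Rlt_div_r; lra).
  assert (n3 p ^ 2 <= n3 p) by nra; nra.
Qed.

Lemma order2_comp (k : C3 -> Cplx) (W : C3 -> C3) (r r' : R) : 0 < r -> 0 < r' -> Hol r k -> order_ge2 k -> W O3 = O3 -> HolV r' W ->
  order_ge2 (fun p => k (W p)).
Proof.
  intros Hr Hr' Hk Ok E [W0 [W1 W2]]; assert (n3 O3 < r') as HO by (rewrite n3_O3; auto).
  apply order2_intro; [rewrite E; apply Ok|].
  pose proof (order2_tdiff k r Hr Hk Ok) as T; rewrite <- E in T at 1.
  pose proof (tdiff_comp k W O3 O3 _ _ _ T (W0 O3 HO) (W1 O3 HO) (W2 O3 HO)) as K.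
  match type of K with tdiff _ _ ?m => replace m with O3 in K by (apply C3_eq; unfold scomb; simpl; ring) end; exact K.
Qed.

(** Gam itself need not be invertible near 0, its linear part being the projection [pxz]. The map p
    + Gam(pxz p) - pxz p is near the identity and agrees with Gam on the plane y = 0. *)
Lemma near_pxz_perturbation (rho : R) (Gam : C3 -> C3) : 0 < rho -> HolV rho Gam -> order2V (fun p => Gam p -v pxz p) ->
  HolV rho (fun p => Gam (pxz p) -v pxz p) /\ order2V (fun p => Gam (pxz p) -v pxz p).
Proof.
  intros Hrho HG [O0 [O1 O2]].
  assert (HolV rho (fun p => Gam p -v pxz p)) as HK by (apply HolV_csub; auto; apply HolV_pxz).
  split; [apply (HolV_comp rho rho (fun p => Gam p -v pxz p) pxz); auto; [apply HolV_pxz|intros p Hp; pose proof (n3_pxz p); lra]|].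
  destruct HK as [K0 [K1 K2]]; split; [|split];
  [exact (order2_comp _ pxz rho 1 Hrho Rlt_0_1 K0 O0 eq_refl (HolV_pxz 1))
  |exact (order2_comp _ pxz rho 1 Hrho Rlt_0_1 K1 O1 eq_refl (HolV_pxz 1))
  |exact (order2_comp _ pxz rho 1 Hrho Rlt_0_1 K2 O2 eq_refl (HolV_pxz 1))].
Qed.

Lemma near_pxz_O3 (Gam : C3 -> C3) : order2V (fun p => Gam p -v pxz p) -> Gam O3 = O3.
Proof. intros H; apply n3_eq; change O3 with (pxz O3) at 2; rewrite (order2V_O3 _ H), n3_O3; auto. Qed.

(** The manifold is the image of the plane y = 0 under Gam. The last conclusion, that its points
    near 0 have small parameters, serves the comparison with other manifolds. *)
Theorem xz_manifold_exists (w R0 rho : R) (X Gam : C3 -> C3) : w <> 0 -> 0 < R0 -> HolV R0 X -> 0 < rho ->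
  lin_sol X (Ci *c RtoC w) rho Gam ->
  exists S, cm_xz X S /\ isochronous X S (2 * PI / Rabs w) /\
    forall e, 0 < e -> exists d, 0 < d /\ forall q, n3 q < d -> S q -> exists p, n3 p < e /\ Gam p = q.
Proof.
  intros Hw HR HX Hrho [HG [HG2 HGe]].
  destruct (near_pxz_perturbation rho Gam Hrho HG HG2) as [HN HN2]; set (N := fun p => Gam (pxz p) -v pxz p) in *.
  destruct (inverse_near_identity N rho Hrho HN HN2) as [d1 [Psi [Hd1 [Hd1r [[Q0 [Q1 Q2]] [HP1 [HP2 [_ [HP4 _]]]]]]]]].
  (* The image of the plane under [id + N], described through the inverse so that it is a zero
     set. *)
  set (S := fun q => n3 q < d1 /\ p1 (Psi q) = C0).
  pose proof (Rmin_l d1 R0); pose proof (Rmin_r d1 R0).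
  destruct (near_pxz_small rho (Rmin d1 R0) Gam Hrho ltac:(apply Rmin_glb_lt; auto) HG HG2) as [t2 [Ht2 Hsm]].
  assert (Hsmall : forall p, n3 p < t2 -> n3 (Gam p) < d1 /\ n3 (Gam p) < R0) by (intros p Hp; specialize (Hsm p Hp); lra).
  assert (Hflat : forall p, p1 p = C0 -> p +v N p = Gam p).
  { intros p Hp; unfold N; replace (pxz p) with p by (apply C3_eq; auto); apply C3_eq; simpl; ring. }
  assert (HS : forall q, S q -> n3 (Psi q) <= 2 * n3 q /\ p1 (Psi q) = C0 /\ Gam (Psi q) = q).
  { intros q [Hq E]; destruct (HP1 q Hq) as [E1 E2]; rewrite Hflat in E2; auto. }
  set (dl := Rmin (d1 / 2) (t2 / 2)).
  assert (Hdl : 0 < dl) by (apply Rmin_glb_lt; lra).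
  assert (dl <= d1 / 2) as D1 by apply Rmin_l; assert (dl <= t2 / 2) as D2 by apply Rmin_r.
  assert (Hcis : forall t p, p1 p = C0 -> p1 (cis t *v p) = C0) by (intros t p E; simpl; rewrite E; ring).
  assert (isochronous X S (2 * PI / Rabs w) /\ invariant X S) as [HI1 HI2].
  { apply (isochronous_of_orbits X Gam S R0 dl w); auto; intros q Hq Hqd.
    destruct (HS q Hq) as [E1 [E2 E3]]; exists (Psi q); set (p := Psi q) in *; clearbody p.
    assert (forall t, n3 (Gam (cis t *v p)) < d1 /\ n3 (Gam (cis t *v p)) < R0) as Hb by (intros t; apply Hsmall; rewrite n3_cis; lra).
    assert (forall t, Psi (Gam (cis t *v p)) = cis t *v p) as Hinv.
    { intros t; rewrite <- (Hflat (cis t *v p)) by auto; apply HP2; [rewrite n3_cis; lra|rewrite Hflat by auto; apply Hb]. }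
    split; auto; split; [|split].
    - apply (orbit_solution X Gam w rho); auto; [intros q' Hq'; apply HGe; lra|lra].
    - intros t; split; [split; [apply Hb|rewrite Hinv; auto]|apply Hb].
    - intros Hne t E; pose proof (Hinv t) as K1; pose proof (Hinv 0) as K2; rewrite E in K1; rewrite cis_0 in K2.
      replace (C1 *v p) with p in K2 by (apply C3_eq; simpl; ring); rewrite E3 in K2; rewrite K2 in K1.
      assert (forall z, z = cis t *c z -> z <> C0 -> cis t = C1) as Hz.
      { intros z Ez Hz; replace (cis t) with (cis t *c z /c z) by (field; auto); rewrite <- Ez; field; auto. }
      destruct (excluded_middle_informative (p0 p = C0)) as [Z0|Z0]; [|exact (Hz _ (f_equal p0 K1) Z0)].
      destruct (excluded_middle_informative (p2 p = C0)) as [Z2|Z2]; [|exact (Hz _ (f_equal p2 K1) Z2)].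
      exfalso; apply Hne; assert (p = O3) as Ep by (apply C3_eq; auto).
      rewrite <- E3, Ep; apply near_pxz_O3; auto. }
  exists S; split; [split; auto|]; [|split; auto].
  - exists d1, (fun q => p1 (Psi q)); split; auto; split; [apply holo_ball_Hol; exact Q1|].
    assert (Psi O3 = O3) as EO.
    { destruct (HP1 O3 ltac:(rewrite n3_O3; auto)) as [E _]; rewrite n3_O3 in E; apply n3_eq0, Rle_antisym; [lra|apply n3_ge0]. }
    split; [rewrite EO; reflexivity|]; split; [|split].
    + exists 1%nat; split; [lia|]; rewrite <- comp_grad by lia; rewrite (tdiff_grad_eq _ _ _ HP4); exact C1_neq_C0.
    + intros v; change (Defs.d0 (fun q => p1 (Psi q)) v) with (dot (grad (fun q => p1 (Psi q)) O3) v); rewrite (tdiff_grad_eq _ _ _ HP4); split.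
      * intros E; exists (p0 v), (p2 v); apply C3_eq; simpl; try ring; etransitivity; [|etransitivity; [exact E|]]; unfold dot; simpl; ring.
      * intros [a [b ->]]; unfold dot; simpl; ring.
    + intros q Hq; unfold S; tauto.
  - intros e He; exists (e / 2); split; [lra|]; intros q Hq HSq; destruct (HS q HSq) as [E1 [_ E3]]; exists (Psi q); split; auto; lra.
Qed.

(** Restrict the field to the given manifold, linearise the restriction and lift the result to the
    graph. The lift solves the same conjugacy equation as Gam, so [lin_unique] identifies the two,
    and Gam takes values in the manifold. *)
Theorem xz_manifold_contains (mu : Cplx) (R0 rho : R) (N Gam : C3 -> C3) (S : C3 -> Prop) : mu <> C0 -> 0 < R0 -> HolV R0 N -> order2V N ->
  cm_xz (lin_field mu C1 N) S -> 0 < rho -> lin_sol (lin_field mu C1 N) mu rho Gam ->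
  exists e, 0 < e /\ forall p, n3 p < e -> S (Gam p).
Proof.
  intros Hmu HR HN HN2 HS Hrho HGam.
  assert (HX : HolV R0 (lin_field mu C1 N)).
  { destruct HN as [N0 [N1 N2]]; repeat split; unfold lin_field; simpl; repeat apply Hol_add; auto; repeat apply Hol_mul;
    try apply Hol_const; try apply Hol_p0; try apply Hol_p1; try apply Hol_p2. }
  destruct (xz_manifold_graph _ S R0 HR HX HS) as [d [al [ga [gb [Hd [Hal2 [Halxz [Halt [HSal Htan]]]]]]]]].
  assert (Hal : Hol d al) by (apply Hol_intro; intros q Hq; eexists; apply Halt; auto).
  set (sg := fun p => mk3 (p0 p) (al p) (p2 p)).
  assert (Hsg : HolV d sg) by (repeat split; [apply Hol_p0|exact Hal|apply Hol_p2]).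
  assert (Hzero2 : order_ge2 (fun _ => C0)) by (apply order2_intro; [reflexivity|exact (tdiff_const C0 O3)]).
  assert (Hcan : forall k : C3 -> Cplx, order_ge2 (fun p => k p -c k p)).
  { intros k; replace (fun p => k p -c k p) with (fun _ : C3 => C0) by (apply functional_extensionality; intros p; ring); auto. }
  assert (Hsg2 : order2V (fun p => sg p -v pxz p)).
  { split; [|split]; [exact (Hcan p0)| |exact (Hcan p2)]; simpl.
    replace (fun p => al p -c C0) with al by (apply functional_extensionality; intros p; ring); auto. }
  pose proof (near_pxz_O3 sg Hsg2) as Hsg0.
  pose proof (Rmin_l R0 d); pose proof (Rmin_r R0 d).
  destruct (near_pxz_small d (Rmin R0 d) sg Hd ltac:(apply Rmin_glb_lt; auto) Hsg Hsg2) as [r2 [[Hr2 Hr2d] Hsgs]].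
  (* The field on the manifold in the coordinates x, z. There y = al(x,z) has order two, so the
     nilpotent term joins the nonlinear part. *)
  set (N2 := fun p => mk3 (al p +c p0 (N (sg p))) C0 (p2 (N (sg p)))).
  assert (HNs : HolV r2 (fun p => N (sg p))) by (apply (HolV_comp r2 R0); auto; [apply (HolV_sub d); auto|intros p Hp; specialize (Hsgs p Hp); lra]).
  assert (HN2H : HolV r2 N2).
  { destruct HNs as [A0 [_ A2]]; repeat split; [apply Hol_add; [apply (Hol_sub d); auto|exact A0]|exact (Hol_const r2 C0)|exact A2]. }
  assert (HN22 : order2V N2).
  { destruct HN as [A0 [_ A2]]; destruct HN2 as [B0 [_ B2]].
    pose proof (order2_comp _ sg R0 d HR Hd A0 B0 Hsg0 Hsg) as K0; pose proof (order2_comp _ sg R0 d HR Hd A2 B2 Hsg0 Hsg) as K2.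
    split; [|split; [exact Hzero2|exact K2]]; apply order2_intro; [unfold N2; simpl; rewrite (proj1 Hal2), (proj1 K0); ring|].
    pose proof (tdiff_add _ _ _ _ _ (order2_tdiff _ d Hd Hal Hal2) (order2_tdiff _ r2 Hr2 (proj1 HNs) K0)) as K.
    replace (O3 +v O3) with O3 in K by (apply C3_eq; simpl; ring); exact K. }
  destruct (lin_exists mu C0 N2 r2 Hmu Hr2 HN2H HN22) as [rho' [G' [Hrho' [HG' [HG2' HGe']]]]].
  destruct (near_pxz_small rho' r2 G' Hrho' Hr2 HG' HG2') as [r3 [[Hr3 Hr3r] HG's]].
  assert (HSs : forall p, n3 p < r3 -> S (sg (G' p))).
  { intros p Hp; specialize (HG's p Hp); specialize (Hsgs _ HG's); apply HSal; [lra|].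
    rewrite <- (Halxz (sg (G' p))); change (pxz (sg (G' p))) with (pxz (G' p)); rewrite Halxz; reflexivity. }
  (* The x and z components hold by the choice of [G'], the y component by tangency of the field to
     the graph. *)
  assert (Hsol : lin_sol (lin_field mu C1 N) mu r3 (fun p => sg (G' p))).
  { assert (HolV r3 G') as HG'3 by (apply (HolV_sub rho'); auto).
    split; [apply (HolV_comp r3 d); auto; intros p Hp; specialize (HG's p Hp); lra|]; split.
    - pose proof (near_pxz_O3 G' HG2') as HG'0; destruct HG2' as [B0 [_ B2]]; split; [exact B0|split; [|exact B2]]; simpl.
      replace (fun p => al (G' p) -c C0) with (fun p => al (G' p)) by (apply functional_extensionality; intros p; ring).
      apply (order2_comp al G' d r3); auto.
    - intros p Hp; pose proof (HG's p Hp) as Hp2; pose proof (Hsgs _ Hp2) as Hp3.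
      pose proof (HGe' p ltac:(lra)) as E; pose proof (Htan (sg (G' p)) ltac:(lra) (HSs p Hp)) as T.
      pose proof (f_equal p0 E) as E0; pose proof (f_equal p2 E) as E2; clear E.
      destruct HG'3 as [D0 [D1 D2]].
      pose proof (tdiff_comp al G' p _ _ _ _ (Halt (G' p) ltac:(lra)) (D0 p Hp) (D1 p Hp) (D2 p Hp)) as K.
      change (pxz (sg (G' p))) with (pxz (G' p)) in T.
      set (q := sg (G' p)) in *; set (A := ga (pxz (G' p))) in *; set (B := gb (pxz (G' p))) in *.
      assert (mu *c eul (fun q => p0 (G' q)) p = p0 (lin_field mu C1 N q)) as F0 by (etransitivity; [exact E0|]; unfold q; simpl; ring).
      assert (mu *c eul (fun q => p2 (G' q)) p = p2 (lin_field mu C1 N q)) as F2 by (etransitivity; [exact E2|]; unfold q; simpl; ring).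
      apply C3_eq; [exact F0| |exact F2]; rewrite T, <- F0, <- F2.
      change (p1 (mu *v euler (fun p => sg (G' p)) p)) with (mu *c dot (grad (fun p => al (G' p)) p) p).
      rewrite (tdiff_grad_eq _ _ _ K); unfold eul, scomb, dot; simpl; ring. }
  destruct (lin_unique mu C1 N R0 rho r3 Gam _ Hmu HR HN HN2 Hrho Hr3 HGam Hsol) as [r [Hr E]].
  pose proof (Rmin_l r r3); pose proof (Rmin_r r r3).
  exists (Rmin r r3); split; [apply Rmin_glb_lt; auto|]; intros p Hp; rewrite E by lra; apply HSs; lra.
Qed.

(** Both germs are graphs over the same plane, so inclusion of one in the other is equality. *)
Lemma xz_manifold_germ_eq (X : C3 -> C3) (R0 d : R) (S S' : C3 -> Prop) : 0 < R0 -> HolV R0 X -> cm_xz X S -> cm_xz X S' ->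
  0 < d -> (forall q, n3 q < d -> S q -> S' q) -> germ_eq S S'.
Proof.
  intros HR HX HS HS' Hd Hsub.
  destruct (xz_manifold_graph X S R0 HR HX HS) as [d1 [al [ga [gb [Hd1 [A1 [A2 [A3 [A4 _]]]]]]]]].
  destruct (xz_manifold_graph X S' R0 HR HX HS') as [d2 [be [ga' [gb' [Hd2 [B1 [B2 [B3 [B4 _]]]]]]]]].
  set (e := Rmin d (Rmin d1 d2)).
  assert (0 < e) as He by (repeat apply Rmin_glb_lt; auto).
  assert (e <= d) as E1 by apply Rmin_l.
  assert (e <= d1) as E2 by (eapply Rle_trans; [apply Rmin_r|apply Rmin_l]).
  assert (e <= d2) as E3 by (eapply Rle_trans; [apply Rmin_r|apply Rmin_r]).
  destruct (tdiff_ccont al O3 _ (A3 O3 ltac:(rewrite n3_O3; auto)) (e / 2) ltac:(lra)) as [t' [Ht' K']].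
  rewrite (proj1 A1) in K'.
  pose proof (Rmin_l t' (e / 2)); pose proof (Rmin_r t' (e / 2)).
  exists (Rmin t' (e / 2)); split; [apply Rmin_glb_lt; lra|]; intros q Hq; split; [apply Hsub; lra|]; intros HSq.
  apply B4 in HSq; [|lra]; rewrite A4 by lra.
  specialize (K' q); replace (q -v O3) with q in K' by (apply C3_eq; simpl; ring); replace (al q -c C0) with (al q) in K' by ring; specialize (K' ltac:(lra)).
  (* The point of [S] above the same (x, z). It also lies in [S'], which has a single point
     there. *)
  set (s := mk3 (p0 q) (al q) (p2 q)).
  assert (n3 s < e) as Hs.
  { replace s with (pxz q +v al q *v e3 1) by (apply C3_eq; unfold s; simpl; ring).
    pose proof (n3_add (pxz q) (al q *v e3 1)); pose proof (n3_pxz q); rewrite n3_scal_e3 in *; lra. }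
  assert (S' s) as HS's.
  { apply Hsub; [lra|]; apply A4; [lra|]; rewrite <- (A2 s); change (pxz s) with (pxz q); rewrite A2; reflexivity. }
  apply B4 in HS's; [|lra]; rewrite HSq, <- (B2 q); change (pxz q) with (pxz s); rewrite B2; symmetry; exact HS's.
Qed.

Theorem xz_manifold_unique (w R0 : R) (N : C3 -> C3) : w <> 0 -> 0 < R0 -> HolV R0 N -> order2V N ->
  let X := lin_field (Ci *c RtoC w) C1 N in
  exists S, cm_xz X S /\ isochronous X S (2 * PI / Rabs w) /\ forall S', cm_xz X S' -> germ_eq S S'.
Proof.
  intros Hw HR HN HN2 X.
  assert (Hmu : Ci *c RtoC w <> C0) by (intros E; apply Hw; apply (f_equal Im) in E; simpl in E; lra).
  assert (HX : HolV R0 X).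
  { destruct HN as [N0 [N1 N2]]; repeat split; unfold X, lin_field; simpl; repeat apply Hol_add; auto; repeat apply Hol_mul;
    try apply Hol_const; try apply Hol_p0; try apply Hol_p1; try apply Hol_p2. }
  destruct (lin_exists _ C1 N R0 Hmu HR HN HN2) as [rho [Gam [Hrho HGam]]].
  destruct (xz_manifold_exists w R0 rho X Gam Hw HR HX Hrho HGam) as [S [HS [HI HE]]].
  exists S; split; auto; split; auto; intros S' HS'.
  destruct (xz_manifold_contains _ R0 rho N Gam S' Hmu HR HN HN2 HS' Hrho HGam) as [e [He K]].
  destruct (HE e He) as [d [Hd K2]].
  apply (xz_manifold_germ_eq X R0 d S S' HR HX HS HS' Hd); intros q Hq HSq.
  destruct (K2 q Hq HSq) as [p [Hp <-]]; auto.
Qed.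

(** * The system of the theorem *)

Lemma holo_near0_good_F (f : C3 -> Cplx) : holo_near0 f -> order_ge2 f -> good_F f.
Proof. intros [r [Hr H]] H2; split; auto; exists r; split; auto; apply holo_ball_Hol; auto. Qed.

Lemma Ci_RtoC_neq0 (w : R) : w <> 0 -> Ci *c RtoC w <> C0.
Proof. intros Hw E; apply Hw; apply (f_equal Im) in E; simpl in E; lra. Qed.

Lemma exponent_RtoC (a b : R) : b <> 0 -> (Ci *c RtoC a) /c (Ci *c RtoC b) -c C1 = RtoC (a / b - 1).
Proof.
  intros Hb; unfold Rdiv; rewrite RtoC_sub, RtoC_mul, RtoC_inv by auto; change (RtoC 1) with C1.
  assert (Ci <> C0) by (intros E; apply (f_equal Im) in E; simpl in E; lra).
  pose proof (RtoC_neq0 b Hb); field; auto.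
Qed.

Lemma nonresonant_triangular (s : BB) (a b : R) : bb_m21 s = C0 -> bb_m11 s = RtoC a -> bb_m22 s = RtoC b ->
  (forall n, (1 <= n)%nat -> INR n <> a /\ INR n <> b) -> nonresonant s.
Proof.
  intros M21 M11 M22 H n Hn; unfold bb_det; rewrite M21, M11, M22; destruct (H n Hn) as [Ha Hb].
  replace (bb_m12 s *c C0) with C0 by ring; intros E; apply Csub_eq0 in E; revert E.
  rewrite <- !RtoC_sub; apply Cmul_neq0; apply RtoC_neq0; lra.
Qed.

Lemma not_ratio_in_N (a b : R) (n : nat) : b <> 0 -> ~ ratio_in_N a b -> INR n <> a / b - 1.
Proof.
  intros Hb H E; apply H; exists (S n); split; [lia|]; rewrite S_INR, E; field; auto.
Qed.

Lemma x_axis_system (w1 w2 : R) (f g h : C3 -> Cplx) : w1 <> 0 -> good_F f -> good_F g -> good_F h ->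
  axis_system (Ci *c RtoC w1) C1 C0 (Ci *c RtoC w1) C0 C0 (Ci *c RtoC w2) f g h (Psys w1 f) (Qsys w1 g) (Rsys w2 h).
Proof.
  intros Hw Hf Hg Hh; split; auto; [apply Ci_RtoC_neq0; auto|..]; intros p; unfold lin_form, Psys, Qsys, Rsys; ring.
Qed.

Lemma good_F_rot (f : C3 -> Cplx) : holo_near0 f -> order_ge2 f -> good_F (fun q => f (rot q)).
Proof. intros Hf H2; apply holo_near0_good_F; [apply holo_near0_rot; auto|apply order_ge2_rot; auto]. Qed.

Lemma z_axis_system (w1 w2 : R) (f g h : C3 -> Cplx) : w2 <> 0 ->
  good_F (fun q => f (rot q)) -> good_F (fun q => g (rot q)) -> good_F (fun q => h (rot q)) ->
  axis_system (Ci *c RtoC w2) C0 C0 (Ci *c RtoC w1) C1 C0 (Ci *c RtoC w1) (fun q => h (rot q)) (fun q => f (rot q)) (fun q => g (rot q))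
    (fun q => Rsys w2 h (rot q)) (fun q => Psys w1 f (rot q)) (fun q => Qsys w1 g (rot q)).
Proof.
  intros Hw Hf Hg Hh; split; auto; [apply Ci_RtoC_neq0; auto|..]; intros p; unfold lin_form, Psys, Qsys, Rsys, rot; simpl; ring.
Qed.

(** True by computation: [rot] sends the chart (z, zu, zv) of the first direction to (zu, zv, z). *)
Lemma bb_z_rot (P Q Rf : C3 -> Cplx) : bb_z P Q Rf = bb_x (fun q => Rf (rot q)) (fun q => P (rot q)) (fun q => Q (rot q)).
Proof. reflexivity. Qed.

Lemma x_exponents (w1 w2 : R) (f g h : C3 -> Cplx) : w1 <> 0 -> good_F f -> good_F g -> good_F h ->
  let s := bb_x (Psys w1 f) (Qsys w1 g) (Rsys w2 h) in
  good_bb s /\ bb_m11 s = RtoC 0 /\ bb_m21 s = C0 /\ bb_m22 s = RtoC (w2 / w1 - 1).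
Proof.
  intros Hw Hf Hg Hh s; destruct (bb_x_good _ _ _ _ _ _ _ _ _ _ _ _ _ (x_axis_system w1 w2 f g h Hw Hf Hg Hh)) as [G [M11 [M12 [M21 M22]]]].
  fold s in G, M11, M12, M21, M22; split; auto; rewrite M11, M21, M22, !exponent_RtoC by auto.
  split; [f_equal; field; auto|]; split; [unfold Cdiv; ring|reflexivity].
Qed.

Lemma z_exponents (w1 w2 : R) (f g h : C3 -> Cplx) : w2 <> 0 ->
  good_F (fun q => f (rot q)) -> good_F (fun q => g (rot q)) -> good_F (fun q => h (rot q)) ->
  let s := bb_z (Psys w1 f) (Qsys w1 g) (Rsys w2 h) in
  good_bb s /\ bb_m11 s = RtoC (w1 / w2 - 1) /\ bb_m12 s <> C0 /\ bb_m21 s = C0 /\ bb_m22 s = RtoC (w1 / w2 - 1).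
Proof.
  intros Hw Hf Hg Hh s; unfold s; rewrite bb_z_rot; clear s.
  destruct (bb_x_good _ _ _ _ _ _ _ _ _ _ _ _ _ (z_axis_system w1 w2 f g h Hw Hf Hg Hh)) as [G [M11 [M12 [M21 M22]]]].
  split; auto; rewrite M11, M12, M21, M22, !exponent_RtoC by auto; pose proof (Ci_RtoC_neq0 w2 Hw) as Hmu.
  split; auto; split; [|split; [unfold Cdiv; ring|auto]].
  revert Hmu; generalize (Ci *c RtoC w2); intros mu Hmu E.
  apply C1_neq_C0; transitivity (C1 /c mu *c mu); [field; auto|rewrite E; ring].
Qed.

Theorem theorem3p9 (w1 w2 : R) (f g h : C3 -> Cplx) :
  w1 <> 0 -> w2 <> 0 ->
  holo_near0 f -> holo_near0 g -> holo_near0 h ->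
  order_ge2 f -> order_ge2 g -> order_ge2 h ->
  let X := Xsys w1 w2 f g h in
  let P := Psys w1 f in let Q := Qsys w1 g in let Rf := Rsys w2 h in
  (* 1) *)
  (~ exists S, cm_axis 1 X S) /\
  (* 2) *)
  (~ ratio_in_N w2 w1 ->
     exists S, cm_axis 0 X S /\ isochronous X S (2 * PI / Rabs w1) /\
       forall S', cm_axis 0 X S' -> germ_eq S S') /\
  (* 3) *)
  (~ ratio_in_N w1 w2 ->
     exists S, cm_axis 2 X S /\ isochronous X S (2 * PI / Rabs w2) /\
       forall S', cm_axis 2 X S' -> germ_eq S S') /\
  (* 4) *)
  (w1 = w2 ->
     exists S, cm_xz X S /\ isochronous X S (2 * PI / Rabs w1) /\
       forall S', cm_xz X S' -> germ_eq S S') /\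
  (* 5) *)
  (forall k : nat, (2 <= k)%nat -> w2 = INR k * w1 ->
     let rx := bb_a2 (Nat.iter (k - 2) reduce (bb_x P Q Rf)) in
     (rx = C0 ->
        infinitely_many (fun S => cm_axis 0 X S /\ isochronous X S (2 * PI / Rabs w1))) /\
     (rx <> C0 -> ~ exists S, cm_axis 0 X S)) /\
  (* 6) *)
  (forall k : nat, (2 <= k)%nat -> w1 = INR k * w2 ->
     let rz := bb_a2 (Nat.iter (k - 2) reduce (bb_z P Q Rf)) in
     (rz = C0 ->
        infinitely_many (fun S => cm_axis 2 X S /\ isochronous X S (2 * PI / Rabs w2))) /\
     (rz <> C0 -> ~ exists S, cm_axis 2 X S)).
Proof.
  intros Hw1 Hw2 Hf Hg Hh Of Og Oh X P Q Rf.
  pose proof (holo_near0_good_F f Hf Of) as Gf; pose proof (holo_near0_good_F g Hg Og) as Gg; pose proof (holo_near0_good_F h Hh Oh) as Gh.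
  pose proof (good_F_rot f Hf Of) as Rfr; pose proof (good_F_rot g Hg Og) as Rg; pose proof (good_F_rot h Hh Oh) as Rh.
  pose proof (x_axis_system w1 w2 f g h Hw1 Gf Gg Gh) as Ax; pose proof (z_axis_system w1 w2 f g h Hw2 Rfr Rg Rh) as Az.
  destruct (x_exponents w1 w2 f g h Hw1 Gf Gg Gh) as [Gx [X11 [X21 X22]]].
  destruct (z_exponents w1 w2 f g h Hw2 Rfr Rg Rh) as [Gz [Z11 [Z12 [Z21 Z22]]]].
  (* The resonant exponent is k - 1, so that k - 2 reductions bring it to 1; this is the form
     [INR (S n)] of [bb_resonant]. *)
  assert (forall (k : nat) a b, (2 <= k)%nat -> b <> 0 -> a = INR k * b -> a / b - 1 = INR (S (k - 2))) as Hk.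
  { intros k a b Hk Hb ->; replace k with (S (S (k - 2))) at 1 by lia; rewrite (S_INR (S _)); field; auto. }
  split; [|split; [|split; [|split; [|split]]]].
  (* Two permutations move the y-axis to the first place and order the coordinates as (y, z, x). *)
  - intros [S HS]; do 2 apply cm_axis_rot in HS; simpl next_axis in HS.
    apply (no_shear_axis_manifold (Ci *c RtoC w1) (Ci *c RtoC w2) (fun q => f (rot (rot q))) (fun q => g (rot (rot q))) (fun q => h (rot (rot q))) (fun q => S (rot (rot q)))).
    + apply (good_F_rot (fun q => f (rot q))); [apply holo_near0_rot; auto|apply order_ge2_rot; auto].
    + apply (good_F_rot (fun q => g (rot q))); [apply holo_near0_rot; auto|apply order_ge2_rot; auto].
    + apply (good_F_rot (fun q => h (rot q))); [apply holo_near0_rot; auto|apply order_ge2_rot; auto].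
    + match goal with |- cm_axis 0 ?Y _ => replace Y with (Rot (Rot X)) end; [exact HS|].
      apply functional_extensionality; intros p; unfold X, Rot, Xsys, field3, lin_form, Psys, Qsys, Rsys, rot; apply C3_eq; simpl; ring.
  - intros HN; apply (axis_manifold_unique w1 _ _ _ _ _ _ _ _ _ _ _ _ Hw1 Ax).
    apply (nonresonant_triangular _ _ _ X21 X11 X22); intros n Hn; split; [apply not_0_INR; lia|apply not_ratio_in_N; auto].
  (* [X] is obtained by applying [Rot] twice to the field of [z_axis_system], which takes the first
     axis to the third. *)
  - intros HN; change (unique_axis_family 2 X (2 * PI / Rabs w2)); rewrite <- (Rot3 X).
    apply (unique_axis_family_rot 1), (unique_axis_family_rot 0); [lia|lia|].
    apply (axis_manifold_unique w2 _ _ _ _ _ _ _ _ _ _ _ _ Hw2 Az).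
    apply (nonresonant_triangular _ _ _ Z21 Z11 Z22); intros n Hn; split; apply not_ratio_in_N; auto.
  - intros E; destruct Gf as [_ [rf [Hrf Ff]]]; destruct Gg as [_ [rg [Hrg Fg]]]; destruct Gh as [_ [rh [Hrh Fh]]].
    pose proof (Rmin_l rf (Rmin rg rh)); pose proof (Rmin_r rf (Rmin rg rh)); pose proof (Rmin_l rg rh); pose proof (Rmin_r rg rh).
    pose proof (xz_manifold_unique w1 (Rmin rf (Rmin rg rh)) (fun p => mk3 (f p) (g p) (h p)) Hw1) as K.
    replace (lin_field (Ci *c RtoC w1) C1 (fun p => mk3 (f p) (g p) (h p))) with X in K.
    + apply K; [repeat apply Rmin_glb_lt; auto| |split; auto].
      split; [apply (Hol_sub rf)|split; [apply (Hol_sub rg)|apply (Hol_sub rh)]]; auto; lra.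
    + apply functional_extensionality; intros p; unfold X, Xsys, lin_field, Psys, Qsys, Rsys; rewrite <- E; apply C3_eq; simpl; ring.
  (* Exponents 0 and k - 1: the first alternative of [bb_resonant]. *)
  - intros k H2 E rx; destruct (bb_resonant _ (k - 2) 0 Gx X21) as [K1 K2]; auto; [rewrite X22, (Hk k); auto|].
    split; intros Hr.
    + apply (axis_manifold_many w1 _ _ _ _ _ _ _ _ _ _ _ _ Hw1 Ax); auto.
    + apply (axis_manifold_none _ _ _ _ _ _ _ _ _ _ _ _ _ Ax); auto.
  (* The double exponent k - 1 with nonzero [bb_m12]: the second alternative. *)
  - intros k H2 E rz; rewrite (Hk k) in Z11, Z22 by auto; destruct (bb_resonant _ (k - 2) (S (k - 2)) Gz Z21 Z22 Z11) as [K1 K2]; auto.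
    split; intros Hr.
    + change (many_axis_families 2 X (2 * PI / Rabs w2)); rewrite <- (Rot3 X).
      apply (many_axis_families_rot 1), (many_axis_families_rot 0), (axis_manifold_many w2 _ _ _ _ _ _ _ _ _ _ _ _ Hw2 Az); auto.
    + intros [S HS]; apply cm_axis_rot in HS; apply (axis_manifold_none _ _ _ _ _ _ _ _ _ _ _ _ _ Az (K2 Hr)); eauto.
Qed.
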